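(* Let $n\in\mathbb N$, $s\in(0,1)$, and let $\Omega, W_1, W_2\subset\mathbb R^n$ be bounded open sets with $W_1,W_2$ non-empty and $W_1,W_2\subset\Omega_e:=\mathbb R^n\setminus\overline\Omega$. Let $A_1,A_2\in L^\infty(\mathbb R^{2n},\mathbb R^{n\times n})$ both satisfy assumptions (A1), (A2), (A3), (A4) stated in the context. Then the two conditions (i) $A_1\sim A_2$ (that is, $A_1$ and $A_2$ are in gauge), and (ii) $\Lambda_{A_1}f|_{W_2}=\Lambda_{A_2}f|_{W_2}$ for all $f\in C^\infty_c(W_1)$ both hold if and only if $A_{1,s}=A_{2,s}$, where $A_{j,s}$ denotes the symmetric part of $A_j$ defined in the context.
   Context: Function spaces. $H^r(\mathbb R^n)$ is the $L^2$-based Bessel potential space. For $\Omega\subset\mathbb R^n$ open, $\widetilde H^s(\Omega)$ is the closure of $C_c^\infty(\Omega)$ in $H^s(\mathbb R^n)$. $\langle\cdot,\cdot\rangle$ denotes the bilinear (no conjugation) duality pairing extending $\int fg$. For $r\in[0,1)$ and $k\in\{0,1,2,\dots\}$, $C^{k+r}(\mathbb R^n)$ is the space of functions with bounded continuous derivatives up to order $k$ whose derivatives of order $k$ are $r$-Hölder, with norm $\max_{|\beta|\le k}\|D^\beta u\|_{L^\infty}+\max_{|\beta|=k}\sup_{x\ne y}|D^\beta u(x)-D^\beta u(y)|/|x-y|^r$. A sequence of matrix functions $\Phi=\{\Phi_k\}_{k\in\mathbb N}$ belongs to $C^t(\mathbb R^n)$ if $\|\Phi\|_{C^t}:=\sum_{k}\sum_{i,j=1}^n\|\Phi_{k,ij}\|_{C^t(\mathbb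 R^n)}<\infty$. Operations. $\odot$ is the entrywise (Hadamard) product of matrices, $A\cdot v$ is matrix-vector multiplication, and $A:B=\sum_{i,j}A_{ij}B_{ij}$. No summation convention is used. Operator. For $u\in C^\infty_c(\mathbb R^n)$ the fractional gradient is $\nabla^su(x,y):=(u(y)-u(x))\,\zeta(x,y)$, with $\zeta(x,y):=\frac{C_{n,s}^{1/2}}{\sqrt2}\frac{x-y}{|x-y|^{n/2+s+1}}$ and $C_{n,s}=\frac{4^s\Gamma(n/2+s)}{\pi^{n/2}|\Gamma(-s)|}$; it extends to a bounded operator $H^s(\mathbb R^n)\to L^2(\mathbb R^{2n})$. Its adjoint is the fractional divergence $(\nabla\cdot)^s:L^2(\mathbb R^{2n})\to H^{-s}(\mathbb R^n)$. For $A\in L^\infty(\mathbb R^{2n},\mathbb R^{n\times n})$ define $\mathbf C^s_A:H^s(\mathbb R^n)\to H^{-s}(\mathbb R^n)$ by $\mathbf C^s_Au:=(\nabla\cdot)^s(A(x,y)\cdot\nabla^su)$, and $B^s_A(u,v):=\langle A\cdot\nabla^su,\nabla^sv\rangle$. Symmetric part. $A_s(x,y):=\frac14\left(A(x,y)+A(y,x)+A^T(x,y)+A^T(y,x)\right)$; here the subscript $s$ stands for ''symmetric'' and is not the exponent. ''Matrix-wise symmetric'' means $M=M^T$. Assumptions on a coefficient $A$ (relative to $s$ and $\Omega$): (A1) There exist two families of matrix-wise symmetric functions $\{\beta_k\}_{k\in\mathbb N}\subset L^\infty(\mathbb R^n,\mathbb R^{n\times n})$, each constant in $\Omega_e$,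 and $\{\phi_k\}_{k\in\mathbb N}\subset L^2(\Omega,\mathbb C^{n\times n})$, each compactly supported in $\Omega$ (and extended by $0$ to $\mathbb R^n$), such that for a.e. $(x,y)\in\mathbb R^{2n}$ one has $A_s(x,y)=\tilde a(x,y)+\sum_{k}\phi_k(x)\odot\phi_k(y)$, where $\tilde a(x,y):=\sum_k\beta_k(x)\odot\beta_k(y)$ coincides with $A_s(x,y)$ whenever $(x,y)\notin\Omega^2$. Let $\Phi=\{\Phi_k\}$ be the sequence given by $\Phi_{2k}:=\beta_k$, $\Phi_{2k+1}:=\phi_k$ for $k\in\mathbb N$ (and $\Phi_1:=0$), so that $A_s(x,y)=\sum_k\Phi_k(x)\odot\Phi_k(y)$. (A2) There exists $\nu>0$ such that $A_s(x,y):(\xi\otimes\xi)\ge\nu|\xi|^2$ for all $\xi\in\mathbb R^n$ and $x,y\in\mathbb R^n$. (A3) There exists $\varepsilon>0$ such that $\Phi\in C^{2s+\varepsilon}(\mathbb R^n)$. (A4) There exist scalar functions $b_k$ such that $\beta_k=b_k\,\mathrm{Id}$ for all $k\in\mathbb N$. Gauge. $A_1\sim A_2$ means: there exists $\rho\in C_c^\infty(\Omega)$ such that $A_{2,s}(x,y)=(1+\rho(x))(1+\rho(y))A_{1,s}(x,y)$ for all $x,y\in\mathbb R^n$. DN map. Under (A1)–(A3), for each $f\in H^s(\mathbb R^n)$ there is a unique $u_f\in H^s(\mathbb R^n)$ with $u_f-f\in\widetilde H^s(\Omega)$ and $B^s_A(u_f,v)=0$ for all $v\in\widetilde H^s(\Omega)$;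 it depends only on the class $[f]\in X:=H^s(\mathbb R^n)/\widetilde H^s(\Omega)$. The Dirichlet-to-Neumann map $\Lambda_A:X\to X^*$ is $\langle\Lambda_A[f],[g]\rangle:=B^s_A(u_f,g)$. The condition $\Lambda_{A_1}f|_{W_2}=\Lambda_{A_2}f|_{W_2}$ means $\langle\Lambda_{A_1}[f],[g]\rangle=\langle\Lambda_{A_2}[f],[g]\rangle$ for all $g\in C^\infty_c(W_2)$, i.e. $\mathbf C^s_{A_1}u^{(1)}_f=\mathbf C^s_{A_2}u^{(2)}_f$ as distributions in $W_2$, where $u^{(j)}_f$ is the solution for $A_j$. *)

(* Defs.v *)
From HB Require Import structures.
From mathcomp Require Import all_boot all_order all_algebra.
From mathcomp Require Import all_classical all_reals all_analysis.
From mathcomp.real_closed Require Export complex.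

Set Implicit Arguments.
Unset Strict Implicit.
Unset Printing Implicit Defensive.

Import Order.TTheory GRing.Theory Num.Def Num.Theory.
Import numFieldNormedType.Exports.

Local Open Scope classical_set_scope.
Local Open Scope ring_scope.

Definition rV_display : measure_display.
Proof. exact: default_measure_display. Qed.

Section measurable_rV.
Context {R : realType} (n : nat).

Let coord (i : 'I_n) (x : 'rV[R]_n) : measurableTypeR R := x ord0 i.

Let rV_set0 : g_sigma_preimage coord set0.
Proof. exact: sigma_algebra0. Qed.

Let rV_setC A : g_sigma_preimage coord A -> g_sigma_preimage coord (~` A).
Proof. exact: sigma_algebraC. Qed.

Let rV_bigcup (F : _^nat) : (forall i, g_sigma_preimage coord (F i)) ->
  g_sigma_preimage coord (\bigcup_i (F i)).
Proof. exact: sigma_algebra_bigcup. Qed.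

(* the sigma-algebra generated by the coordinates, i.e. the Borel sets of R^n *)
HB.instance Definition _ := @isMeasurable.Build rV_display
  'rV[R]_n (g_sigma_preimage coord) rV_set0 rV_setC rV_bigcup.

End measurable_rV.

Section lebesgue_rV.
Context {R : realType}.

Lemma measurable_coord n (i : 'I_n) :
  measurable_fun [set: 'rV[R]_n] (fun x => x ord0 i).
Proof.
move=> _ Y mY; rewrite setTI; apply: sub_sigma_algebra => /=.
rewrite -bigcup_seq/=; exists i => /=; first by rewrite mem_index_enum.
by exists Y => //; rewrite setTI.
Qed.

Lemma measurable_fun_rVP d (T : measurableType d) n (f : T -> 'rV[R]_n) :
  measurable_fun [set: T] f <->
  forall i, measurable_fun [set: T] (fun t => f t ord0 i).
Proof.
split=> [mf i|mf]; first exact: (measurableT_comp (@measurable_coord n i) mf).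
set G := image_set_system setT f (@measurable _ T).
have sG : sigma_algebra setT G.
  exact: (sigma_algebra_image f (@sigma_algebra_measurable _ T)).
have mG (A : set 'rV[R]_n) : measurable A -> G A.
  apply: smallest_sub => // B.
  rewrite -bigcup_seq => -[i _ [C mC <-]].
  have := mf i measurableT C mC.
  by rewrite /G /image_set_system /= !setTI.
by move=> _ Y mY; exact: (mG Y mY).
Qed.

Lemma sigma_finite_product d1 d2 (T1 : measurableType d1)
    (T2 : measurableType d2) (m1 : {sigma_finite_measure set T1 -> \bar R})
    (m2 : {sigma_finite_measure set T2 -> \bar R}) :
  sigma_finite setT (m1 \x m2)%E.
Proof.
have /sigma_finiteP[F [TF ndF Foo]] := sigma_finiteT m1.
have /sigma_finiteP[G [TG ndG Goo]] := sigma_finiteT m2.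
exists (fun k => F k `*` G k).
  rewrite -setXTT TF TG predeqE => -[x y]; split.
    move=> [/= [k _ Fkx] [l _ Gly]]; exists (maxn k l) => //; split.
    - by move: x Fkx; exact/subsetPset/ndF/leq_maxl.
    - by move: y Gly; exact/subsetPset/ndG/leq_maxr.
  by move=> [k _ []/= ? ?]; split; exists k.
move=> k; have [? ?] := Foo k; have [? ?] := Goo k.
split; first exact: measurableX.
by rewrite product_measure1E// lte_mul_pinfty// ge0_fin_numE.
Qed.

Definition row_cons n (p : measurableTypeR R * 'rV[R]_n) : 'rV[R]_n.+1 :=
  \row_i oapp (p.2 ord0) p.1 (unlift ord0 i).

Definition row_uncons n (x : 'rV[R]_n.+1) : measurableTypeR R * 'rV[R]_n :=
  (x ord0 ord0, \row_j x ord0 (lift ord0 j)).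

Lemma row_consK n : cancel (@row_cons n) (@row_uncons n).
Proof.
move=> [a v]; rewrite /row_uncons mxE unlift_none; congr pair.
by apply/rowP => j; rewrite !mxE liftK.
Qed.

Lemma measurable_row_cons n : measurable_fun setT (@row_cons n).
Proof.
apply/measurable_fun_rVP => i; case: (unliftP ord0 i) => [j ->|->].
- apply: (eq_measurable_fun (fun p : _ * 'rV[R]_n => p.2 ord0 j)) => [p _|].
    by rewrite mxE liftK.
  exact: (measurableT_comp (@measurable_coord n j) measurable_snd).
- apply: (eq_measurable_fun (fun p : measurableTypeR R * 'rV[R]_n => p.1)) => [p _|].
    by rewrite mxE unlift_none.
  exact: measurable_fst.
Qed.

Lemma measurable_row_uncons n : measurable_fun setT (@row_uncons n).
Proof.
apply/measurable_fun_pairP; split; first exact: measurable_coord.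
apply/measurable_fun_rVP => i.
apply: (eq_measurable_fun (fun x : 'rV[R]_n.+1 => x ord0 (lift ord0 i))) => [p _|].
  by rewrite /= mxE.
exact: measurable_coord.
Qed.

Lemma sigma_finite_pushforward d1 d2 (T1 : measurableType d1)
    (T2 : measurableType d2) (m : set T1 -> \bar R)
    (f : T1 -> T2) (g : T2 -> T1) :
  measurable_fun setT g -> cancel f g -> sigma_finite setT m ->
  sigma_finite setT (pushforward m f).
Proof.
move=> mg fK [F UF mF].
exists (fun k => g @^-1` F k); first by rewrite -preimage_bigcup -UF.
move=> k; have [mFk Fk_fin] := mF k; split.
  by rewrite -[X in measurable X]setTI; exact: mg.
rewrite /pushforward -comp_preimage (_ : g \o f = id)//.
by apply/funext => x /=; rewrite fK.
Qed.

(* the image of [lebesgue_measure \x m] under R * R^n -> R^(n+1) *)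
Definition lebesgue_step n (m : {sigma_finite_measure set 'rV[R]_n -> \bar R}) :
    set 'rV[R]_n.+1 -> \bar R :=
  pushforward (@lebesgue_measure R \x m)%E (@row_cons n).

Section lebesgue_step_measure.
Variables (n : nat) (m : {sigma_finite_measure set 'rV[R]_n -> \bar R}).

Let lebesgue_step_measure : {measure set 'rV[R]_n.+1 -> \bar R} :=
  measure_function_pushforward__canonical__measure_function_Measure
    (@lebesgue_measure R \x m)%E (@measurable_row_cons n).

HB.instance Definition _ := isMeasure.Build _ _ _ (lebesgue_step m)
  (measure0 lebesgue_step_measure) (measure_ge0 lebesgue_step_measure)
  (@measure_semi_sigma_additive _ _ _ lebesgue_step_measure).

Let lebesgue_step_sigma_finite : sigma_finite setT (lebesgue_step m).
Proof.
apply: sigma_finite_pushforward (@measurable_row_uncons n) (@row_consK n) _.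
exact: sigma_finite_product.
Qed.

HB.instance Definition _ := Measure_isSigmaFinite.Build _ _ _ (lebesgue_step m)
  lebesgue_step_sigma_finite.

End lebesgue_step_measure.

Fixpoint leb n : {sigma_finite_measure set 'rV[R]_n -> \bar R} :=
  match n with
  | 0 => dirac (0 : 'rV[R]_0)
  | k.+1 => lebesgue_step (leb k)
  end.

End lebesgue_rV.

Notation normc := ComplexField.Normc.normc.

Section euclidean.
Context {R : realType}.

Definition edot n (x y : 'rV[R]_n) : R := \sum_i x ord0 i * y ord0 i.

(* the library norm on row vectors is the sup norm *)
Definition enorm n (x : 'rV[R]_n) : R := Num.sqrt (edot x x).

Definition expi (t : R) : R[i] := Complex (cos t) (sin t).

Definition cvec_norm n (v : 'cV[R[i]]_n) : R :=
  Num.sqrt (\sum_i normc (v i ord0) ^+ 2).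

Definition cmx m n (A : 'M[R]_(m, n)) : 'M[R[i]]_(m, n) := map_mx (real_complex R) A.

End euclidean.

Section complex_lebesgue.
Context d (T : measurableType d) {R : realType} (mu : {measure set T -> \bar R}).

Definition cmeasurable (f : T -> R[i]) : Prop :=
  measurable_fun setT (fun x => complex.Re (f x)) /\
  measurable_fun setT (fun x => complex.Im (f x)).

Definition cintegral (f : T -> R[i]) : R[i] :=
  Complex (\int[mu]_(x in setT) complex.Re (f x))
          (\int[mu]_(x in setT) complex.Im (f x)).

Definition cL2norm (f : T -> R[i]) : \bar R :=
  Lnorm mu 2%:E (fun x => (normc (f x))%:E).

Definition cL2 (f : T -> R[i]) : Prop := cmeasurable f /\ (cL2norm f < +oo)%E.

Definition vecL2norm n (F : T -> 'cV[R[i]]_n) : \bar R :=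
  Lnorm mu 2%:E (fun x => (cvec_norm (F x))%:E).

Definition vecL2 n (F : T -> 'cV[R[i]]_n) : Prop :=
  (forall i, cmeasurable (fun x => F x i ord0)) /\ (vecL2norm F < +oo)%E.

Definition Linfty (f : T -> R) : Prop :=
  measurable_fun setT f /\ (Lnorm mu +oo%E (fun x => (f x)%:E) < +oo)%E.

Definition mxLinfty m n (A : T -> 'M[R]_(m, n)) : Prop :=
  forall i j, Linfty (fun x => A x i j).

Definition mxL2 m n (A : T -> 'M[R[i]]_(m, n)) : Prop :=
  forall i j, cL2 (fun x => A x i j).

End complex_lebesgue.

Section smoothness.
Context {R : realType} {n : nat}.
Local Notation V := 'rV[R]_n.

Definition partial (i : 'I_n) (f : V -> R) : V -> R :=
  fun x => 'D_(delta_mx ord0 i) f x.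

Definition partials (l : seq 'I_n) (f : V -> R) : V -> R := foldr partial f l.

Definition class_C (k : nat) (f : V -> R) : Prop := forall l : seq 'I_n,
  ((size l <= k)%N -> continuous (partials l f)) /\
  ((size l < k)%N -> forall i x, derivable (partials l f) x (delta_mx ord0 i)).

Definition cclass_C (k : nat) (f : V -> R[i]) : Prop :=
  class_C k (fun x => complex.Re (f x)) /\ class_C k (fun x => complex.Im (f x)).

Definition csmooth (f : V -> R[i]) : Prop := forall k, cclass_C k f.

Definition mdeg (b : {ffun 'I_n -> nat}) : nat := (\sum_i b i)%N.

Definition mderiv (b : {ffun 'I_n -> nat}) (f : V -> R[i]) : V -> R[i] :=
  let Db := partials (flatten [seq nseq (b i) i | i <- enum 'I_n]) in
  fun x => Complex (Db (fun y => complex.Re (f y)) x)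
                   (Db (fun y => complex.Im (f y)) x).

Definition Cc_infty (U : set V) (f : V -> R[i]) : Prop :=
  csmooth f /\ exists K, [/\ compact K, K `<=` U & forall x, ~ K x -> f x = 0].

Definition schwartz (f : V -> R[i]) : Prop :=
  csmooth f /\ forall (m : nat) (b : {ffun 'I_n -> nat}),
    exists M : R, forall x, (1 + enorm x) ^+ m * normc (mderiv b f x) <= M.

(* [t] is k + r with k = truncn t and r in [0, 1) *)
Definition holder_norm (t : R) (f : V -> R[i]) : \bar R :=
  let k := truncn t in
  (ereal_sup [set y | exists b x,
     (mdeg b <= k)%N /\ y = (normc (mderiv b f x))%:E] +
   ereal_sup [set y | exists b x x', [/\ mdeg b = k, x != x' &
     y = (normc (mderiv b f x - mderiv b f x') / enorm (x - x') `^ (t - k%:R))%:E]])%E.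

Definition holder_seq (t : R) (Phi : nat -> V -> 'M[R[i]]_n) : Prop :=
  (forall k i j, cclass_C (truncn t) (fun x => Phi k x i j)) /\
  (\sum_(0 <= k <oo) \sum_i \sum_j holder_norm t (fun x => Phi k x i j) < +oo)%E.

End smoothness.

Section bessel.
Context {R : realType} {n : nat}.
Local Notation V := 'rV[R]_n.
Local Notation C := R[i].

Definition fourier (f : V -> C) (xi : V) : C :=
  cintegral (leb n) (fun x => expi (- edot x xi) * f x).

(* the L^2 function representing the Fourier transform of [u] as a tempered
   distribution; it is unique up to a null set and exists for u in L^2 *)
Definition fourierL2 (u : V -> C) : V -> C :=
  xget (fun=> 0) [set w | cL2 (leb n) w /\ forall phi, schwartz phi ->
    cintegral (leb n) (fun x => u x * fourier phi x) =
    cintegral (leb n) (fun xi => w xi * phi xi)].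

Definition bessel (s : R) (u : V -> C) (xi : V) : C :=
  ((Num.sqrt (1 + edot xi xi)) `^ s)%:C%C * fourierL2 u xi.

Definition Hs_norm (s : R) (u : V -> C) : \bar R := cL2norm (leb n) (bessel s u).

(* for s >= 0 only, where H^s is contained in L^2 *)
Definition Hs (s : R) (u : V -> C) : Prop :=
  cL2 (leb n) u /\ cL2 (leb n) (bessel s u).

Definition Hs_cvg (s : R) (u_ : nat -> V -> C) (u : V -> C) : Prop :=
  Hs_norm s (fun x => u_ k x - u x) @[k --> \oo] --> 0%E.

Definition tildeHs (s : R) (Omega : set V) (u : V -> C) : Prop :=
  Hs s u /\ exists phi_, (forall k, Cc_infty Omega (phi_ k)) /\ Hs_cvg s phi_ u.

End bessel.

Section gamma.
Context {R : realType}.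

Definition Gamma_integral (x : R) : R :=
  \int[lebesgue_measure]_(t in `]0, +oo[) (t `^ (x - 1) * expR (- t)).

(* extended to negative non-integers by Gamma (x + 1) = x * Gamma x *)
Definition Gamma (x : R) : R :=
  if 0 < x then Gamma_integral x
  else let m := (truncn (- x)).+1 in
       Gamma_integral (x + m%:R) / \prod_(i < m) (x + i%:R).

End gamma.

Section fractional.
Context {R : realType} {n : nat}.
Local Notation V := 'rV[R]_n.
Local Notation C := R[i].
Local Notation leb2 := (leb n \x leb n)%E.

Definition C_ns (s : R) : R :=
  4 `^ s * Gamma (n%:R / 2 + s) / (pi `^ (n%:R / 2) * `|Gamma (- s)|).

Definition zeta (s : R) (x y : V) : 'cV[R]_n :=
  (Num.sqrt (C_ns s) / Num.sqrt 2 / enorm (x - y) `^ (n%:R / 2 + s + 1))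
    *: (x - y)^T.

Definition fgrad_smooth (s : R) (u : V -> C) (z : V * V) : 'cV[C]_n :=
  (u z.2 - u z.1) *: cmx (zeta s z.1 z.2).

(* the extension by continuity of [fgrad_smooth s] from C_c^oo(R^n) to
   H^s(R^n) -> L^2(R^2n), unique up to a null set *)
Definition fgrad (s : R) (u : V -> C) : V * V -> 'cV[C]_n :=
  xget (fun=> 0) [set F | vecL2 leb2 F /\
    exists phi_, [/\ forall k, Cc_infty setT (phi_ k), Hs_cvg s phi_ u &
      vecL2norm leb2 (fun z => fgrad_smooth s (phi_ k) z - F z)
        @[k --> \oo] --> 0%E]].

Implicit Types A : V -> V -> 'M[R]_n.

Definition B_form (s : R) A (u v : V -> C) : C :=
  cintegral leb2 (fun z =>
    \sum_i (cmx (A z.1 z.2) *m fgrad s u z) i ord0 * fgrad s v z i ord0).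

Definition solution (s : R) (Omega : set V) A (f u : V -> C) : Prop :=
  [/\ Hs s u, tildeHs s Omega (fun x => u x - f x) &
      forall v, tildeHs s Omega v -> B_form s A u v = 0].

Definition u_sol (s : R) (Omega : set V) A (f : V -> C) : V -> C :=
  xget (fun=> 0) [set u | solution s Omega A f u].

(* the pairing of Lambda_A [f] with [g], on representatives of the classes
   [f], [g] in H^s(R^n) / tildeHs(Omega) *)
Definition DN (s : R) (Omega : set V) A (f g : V -> C) : C :=
  B_form s A (u_sol s Omega A f) g.

End fractional.

Section coefficients.
Context {R : realType} {n : nat}.
Local Notation V := 'rV[R]_n.
Local Notation C := R[i].
Local Notation leb2 := (leb n \x leb n)%E.
Implicit Types (A : V -> V -> 'M[R]_n) (Omega : set V).
Implicit Types (beta : nat -> V -> 'M[R]_n) (phi : nat -> V -> 'M[C]_n).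

Definition exterior Omega : set V := ~` closure Omega.

Definition hadamard (K : pzRingType) (M N : 'M[K]_n) : 'M[K]_n := map2_mx *%R M N.

Definition contraction (M N : 'M[R]_n) : R := \sum_i \sum_j M i j * N i j.

Definition tensor (x y : V) : 'M[R]_n := x^T *m y.

Definition sympart A (x y : V) : 'M[R]_n :=
  4^-1 *: (A x y + A y x + (A x y)^T + (A y x)^T).

Definition mx_series (M_ : nat -> 'M[C]_n) (M : 'M[C]_n) : Prop := forall i j,
  (series (fun k => complex.Re (M_ k i j)) @ \oo --> complex.Re (M i j)) /\
  (series (fun k => complex.Im (M_ k i j)) @ \oo --> complex.Im (M i j)).

Definition assumption_A1 Omega A beta phi : Prop :=
  [/\ forall k, [/\ forall x, (beta k x)^T = beta k x, mxLinfty (leb n) (beta k) &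
        exists M, forall x, exterior Omega x -> beta k x = M],
      forall k, [/\ forall x, (phi k x)^T = phi k x, mxL2 (leb n) (phi k) &
        exists K, [/\ compact K, K `<=` Omega & forall x, ~ K x -> phi k x = 0]] &
      exists a : V -> V -> 'M[R]_n, \forall z \ae leb2,
        [/\ mx_series (fun k => cmx (hadamard (beta k z.1) (beta k z.2)))
              (cmx (a z.1 z.2)),
            mx_series (fun k => hadamard (phi k z.1) (phi k z.2))
              (cmx (sympart A z.1 z.2) - cmx (a z.1 z.2)) &
            ~ (Omega `*` Omega) z -> a z.1 z.2 = sympart A z.1 z.2]].

Definition assumption_A2 A : Prop :=
  exists2 nu : R, 0 < nu & forall x y xi : V,
    nu * enorm xi ^+ 2 <= contraction (sympart A x y) (tensor xi xi).

(* Families over {1, 2, ...} are shifted to start at 0, so this is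
   Phi_1 = 0, Phi_2 = beta_1, Phi_3 = phi_1, Phi_4 = beta_2, ... *)
Definition interleave beta phi (m : nat) (x : V) : 'M[C]_n :=
  if m == 0%N then 0
  else if odd m then cmx (beta m./2 x) else phi (m./2).-1 x.

Definition assumption_A3 (s : R) beta phi : Prop :=
  exists2 eps : R, 0 < eps & holder_seq (2 * s + eps) (interleave beta phi).

Definition assumption_A4 beta : Prop :=
  forall k, exists b : V -> R, forall x, beta k x = (b x)%:M.

Definition admissible (s : R) Omega A : Prop :=
  assumption_A2 A /\ exists beta phi,
    [/\ assumption_A1 Omega A beta phi, assumption_A3 s beta phi &
        assumption_A4 beta].

Definition gauge Omega A1 A2 : Prop :=
  exists2 rho : V -> C, Cc_infty Omega rho & forall x y,
    cmx (sympart A2 x y) =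
    ((1 + rho x) * (1 + rho y)) *: cmx (sympart A1 x y).

End coefficients.

(* Main.v *)
From HB Require Import structures.
From mathcomp Require Import all_boot all_order all_algebra.
From mathcomp Require Import all_classical all_reals all_analysis.
From mathcomp Require Import measurable_realfun lebesgue_integral_under ess_sup_inf.
From mathcomp Require Import ring lra.
Require Import Defs.
Set Implicit Arguments.
Unset Strict Implicit.
Unset Printing Implicit Defensive.
Import Order.TTheory GRing.Theory Num.Def Num.Theory.
Import numFieldNormedType.Exports.
Local Open Scope classical_set_scope.
Local Open Scope ring_scope.

(* The form B_A depends only on A_s, through the kernel K(x,y) = zeta . (A_s zeta), so
   A_{1,s} = A_{2,s} gives the same solutions and the same DN map, and rho = 0 is a gauge.

   Conversely let g = 1 + rho be the gauge, so that K_2(x,y) = g(x) g(y) K_1(x,y); by (A2) and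
   rho = 0 outside Omega, g is real and positive.  Let f be real, smooth and supported in a small
   cube of W1, with solutions u_1, u_2, which exist by the Dirichlet principle.  Testing the DN
   maps on a disjoint small cube W of W2 shows that the integral of K_1(x,y) h(y) over y vanishes
   for x in W, where h = u_1 - g u_2 is supported in Omega.  By (A1) and (A4), for x outside Omega
   K_1(x,y) is a positive function of y times |x-y|^(-n-2s).  If the integral of
   w(y) |x-y|^(2b) vanishes for x in an open set away from the support of w, so does, applying
   Laplacians, that with any exponent b - p; power series in 1/|x-y|^2 and the Gamma integral then
   give the integral of w(y) exp(-|x-y|^2), and its x-derivatives all moments of
   w(y) exp(-|x-y|^2), so that the Fourier transform of the latter, and hence w, is zero.
   Therefore u_1 = g u_2.  The identity
     (u_1(y)-u_1(x)) (g phi(y) - g phi(x)) - g(x) g(y) (u_2(y)-u_2(x)) (phi(y)-phi(x))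
       = (rho(y)-rho(x)) (u_1 phi(y) - u_1 phi(x))
   shows that B_1(rho, u_1 phi) = 0 for all phi in C_c^oo(Omega), while B_1(rho, u_1) = 0.  Letting
   phi increase to the indicator function of Omega, with phi = 1 near the support of rho, the
   integral of K_1(x,y) rho(y) f(x) vanishes for every f, and unique continuation gives rho = 0. *)

(** * Integrals of real-valued functions *)

(** Solutions, the fractional gradient and the L^2 Fourier transform are given by choice, hence at
    best up to null sets, and H^s is measured on the Fourier side, whereas the argument runs on
    double integrals of K(x,y) times differences. The bridge is [HU]: limits of real test functions
    in L^2 and in Gagliardo energy at once. [tildeHsP] identifies it with [tildeHs]; real and
    imaginary parts decouple because K is real.

    Subtracting B_1(rho, u_1) = 0 leaves the factor 1 - phi, and this is where the datum enters: u_1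
    (1 - phi) is f off Omega and tends to 0 inside.

    Unique continuation is used twice, from W2 for u_1 - g u_2 and from W1 for rho. W1 and W2 may
    coincide, so the data and the tests are confined to disjoint cubes; then u_1, u_2 and rho all
    vanish where the tests live, and only interactions between separated points survive. *)

Section L1.
Context d (T : measurableType d) (R : realType).
Variable mu : {measure set T -> \bar R}.
Implicit Types f g h : T -> R.

Definition L1 f := mu.-integrable [set: T] (EFin \o f).
(** Measurability is asked separately, since that of the square does not give that of [f]. *)
Definition L2 f := measurable_fun [set: T] f /\ L1 (fun x => f x ^+ 2).
Definition I f : R := \int[mu]_x f x.

Lemma L1_measurable f : L1 f -> measurable_fun [set: T] f.
Proof. by move=> /measurable_int /measurable_EFinP. Qed.

Lemma L1_le f g : measurable_fun [set: T] f -> L1 g ->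
  (forall x, `|f x| <= g x) -> L1 f.
Proof.
move=> mf ig fg; apply: (le_integrable _ _ _ ig) => //; first exact/measurable_EFinP.
by move=> x _ /=; rewrite lee_fin (le_trans (fg x))// ler_norm.
Qed.

Lemma L1D f g : L1 f -> L1 g -> L1 (fun x => f x + g x).
Proof. by move=> i j; have := integrableD measurableT i j. Qed.

Lemma L1B f g : L1 f -> L1 g -> L1 (fun x => f x - g x).
Proof. by move=> i j; have := integrableB measurableT i j. Qed.

Lemma L1Z (k : R) f : L1 f -> L1 (fun x => k * f x).
Proof. by move=> i; have := integrableZl measurableT k i. Qed.

Lemma L1N f : L1 f -> L1 (fun x => - f x).
Proof. by move=> i; have := integrableN i. Qed.

Lemma L10 : L1 (fun=> 0).
Proof. exact: integrable0. Qed.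

Lemma L1_norm f : L1 f -> L1 (fun x => `|f x|).
Proof. by move=> i; exact: (integrable_norm i). Qed.

Lemma L1_sum (J : Type) (s : seq J) (F : J -> T -> R) :
  (forall j, L1 (F j)) -> L1 (fun x => \sum_(j <- s) F j x).
Proof.
move=> iF; elim: s => [|j s ih].
  by under eq_fun do rewrite big_nil; exact: L10.
by under eq_fun do rewrite big_cons; exact: L1D.
Qed.

Lemma I_D f g : L1 f -> L1 g -> I (fun x => f x + g x) = I f + I g.
Proof. by move=> *; rewrite /I RintegralD. Qed.

Lemma I_B f g : L1 f -> L1 g -> I (fun x => f x - g x) = I f - I g.
Proof. by move=> *; rewrite /I RintegralB. Qed.

Lemma I_Z k f : L1 f -> I (fun x => k * f x) = k * I f.
Proof. by move=> *; rewrite /I RintegralZl. Qed.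

Lemma I_N f : L1 f -> I (fun x => - f x) = - I f.
Proof.
move=> i; rewrite -[RHS]mulN1r -I_Z//; congr I.
by apply/funext => x; rewrite mulN1r.
Qed.

Lemma I_0 : I (fun=> 0) = 0.
Proof. by rewrite /I/= /Rintegral integral0. Qed.

Lemma I_sum (J : Type) (s : seq J) (F : J -> T -> R) :
  (forall j, L1 (F j)) -> I (fun x => \sum_(j <- s) F j x) = \sum_(j <- s) I (F j).
Proof.
move=> iF; elim: s => [|j s ih].
  by under eq_fun do rewrite big_nil; rewrite big_nil I_0.
under eq_fun do rewrite big_cons; rewrite big_cons I_D ?ih//.
exact: L1_sum.
Qed.

Lemma I_ge0 f : (forall x, 0 <= f x) -> 0 <= I f.
Proof. by move=> f0; exact: Rintegral_ge0. Qed.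

Lemma I_le f g : L1 f -> L1 g -> (forall x, f x <= g x) -> I f <= I g.
Proof. by move=> i j fg; apply: le_Rintegral => // x _; exact: fg. Qed.

Lemma I_norm f : L1 f -> `|I f| <= I (fun x => `|f x|).
Proof. by move=> i; exact: le_normr_Rintegral. Qed.

Lemma EFin_I f : L1 f -> (I f)%:E = (\int[mu]_x (f x)%:E)%E.
Proof. by move=> i; rewrite /I /Rintegral fineK//; exact: integrable_fin_num. Qed.

Lemma L1_ge0P f : measurable_fun [set: T] f -> (forall x, 0 <= f x) ->
  L1 f <-> (\int[mu]_x (f x)%:E < +oo)%E.
Proof.
move=> mf f0; have E : (\int[mu]_x `|(EFin \o f) x| = \int[mu]_x (f x)%:E)%E.
  by apply: eq_integral => x _; rewrite /= ger0_norm.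
split=> [/integrableP[_]|h]; first by rewrite E.
by apply/integrableP; split; [exact/measurable_EFinP|rewrite E].
Qed.

Lemma L1_lty f : L1 f -> (forall x, 0 <= f x) -> (\int[mu]_x (f x)%:E < +oo)%E.
Proof. by move=> lf f0; apply/(L1_ge0P _ f0) => //; exact: L1_measurable. Qed.

Lemma I_ae_eq f g : measurable_fun [set: T] f -> measurable_fun [set: T] g ->
  {ae mu, forall x, f x = g x} -> I f = I g.
Proof.
move=> mf mg fg; rewrite /I /Rintegral; congr fine.
apply: ae_eq_integral => //; try exact/measurable_EFinP.
by apply: filterS fg => x /= -> _.
Qed.

(** [g] is assumed measurable because [mu] need not be complete: on the null set where the two
    functions differ, [g] could be arbitrary. *)
Lemma L1_ae_eq f g : measurable_fun [set: T] g ->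
  {ae mu, forall x, f x = g x} -> L1 f -> L1 g.
Proof.
move=> mg fg lf; have mf := L1_measurable lf.
have : L1 (fun x => `|g x|).
  apply/L1_ge0P => //; first exact: measurableT_comp.
  have mnf : measurable_fun [set: T] (fun x => `|f x|) by exact: measurableT_comp.
  have [+ _] := L1_ge0P mnf (fun x => normr_ge0 (f x)).
  move=> /(_ (L1_norm lf)) /=.
  rewrite (ae_eq_integral (fun x => `|g x|%:E))//.
  - by apply/measurable_EFinP; exact: measurableT_comp.
  - by apply/measurable_EFinP; exact: measurableT_comp.
  - by apply: filterS fg => x /= -> _.
by move=> /L1_le; apply.
Qed.

Lemma L1_le_ae f g : measurable_fun [set: T] f -> L1 g ->
  {ae mu, forall x, `|f x| <= g x} -> L1 f.
Proof.
move=> mf lg fg; have mg := L1_measurable lg.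
(* Cutting [|f|] at [g] gives a function that is dominated everywhere and equals [|f|] almost
   everywhere. *)
have mm : measurable_fun [set: T] (fun x => Num.min `|f x| (g x)).
  by apply: measurable_minr => //; exact: measurableT_comp.
have lm : L1 (fun x => Num.min `|f x| (g x)).
  apply: (L1_le mm (L1_norm lg)) => x.
  rewrite /Num.min; case: ifPn => h; rewrite ?normr_id//.
  by rewrite (le_trans (ltW h))// ler_norm.
have : L1 (fun x => `|f x|).
  apply: L1_ae_eq lm; first exact: measurableT_comp.
  by apply: filterS fg => x h; rewrite min_l.
by move=> /L1_le; apply.
Qed.

Lemma dct (f_ : nat -> T -> R) f g : (forall n, measurable_fun [set: T] (f_ n)) ->
  measurable_fun [set: T] f -> {ae mu, forall x, f_ n x @[n --> \oo] --> f x} ->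
  L1 g -> (forall n, {ae mu, forall x, `|f_ n x| <= g x}) ->
  L1 f /\ I (f_ n) @[n --> \oo] --> I f.
Proof.
move=> mf_ mf ff lg fg.
have lf_ n : L1 (f_ n) by exact: (L1_le_ae (mf_ n) lg (fg n)).
have [] := @dominated_convergence _ _ _ mu _ measurableT (fun n => EFin \o f_ n)
  (EFin \o f) (EFin \o g).
- by move=> n; exact/measurable_EFinP.
- exact/measurable_EFinP.
- apply: filterS ff => x h _; exact: (cvg_EFin (nearW _ _) h).
- exact: lg.
- have : {ae mu, forall x, forall n, `|f_ n x| <= g x} by apply/ae_foralln.
  by apply: filterS => x h n _ /=; rewrite lee_fin.
move=> lf _ h; split; first exact: lf.
have : (I (f_ n))%:E @[n --> \oo] --> (I f)%:E.
  by rewrite EFin_I//; under eq_fun do rewrite EFin_I//.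
by move/fine_cvg.
Qed.

Lemma L2M f g : L2 f -> L2 g -> L1 (fun x => f x * g x).
Proof.
move=> [mf lf] [mg lg]; apply: (L1_le _ (L1D lf lg)); first exact: measurable_funM.
by move=> x; rewrite ler_norml; apply/andP; split; nra.
Qed.

Lemma L2Z k f : L2 f -> L2 (fun x => k * f x).
Proof.
move=> [mf lf]; split; first exact: measurable_funM.
by under eq_fun do rewrite exprMn; exact: L1Z.
Qed.

Lemma L2D f g : L2 f -> L2 g -> L2 (fun x => f x + g x).
Proof.
move=> [mf lf] [mg lg]; split; first exact: measurable_funD.
apply: (L1_le _ (L1Z 2 (L1D lf lg))).
  by apply: measurable_funX; exact: measurable_funD.
by move=> x; rewrite ger0_norm ?sqr_ge0//; have := sqr_ge0 (f x - g x); nra.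
Qed.

Lemma L2N f : L2 f -> L2 (fun x => - f x).
Proof. by move=> /(L2Z (-1)); under eq_fun do rewrite mulN1r. Qed.

Lemma L2B f g : L2 f -> L2 g -> L2 (fun x => f x - g x).
Proof. by move=> lf lg; exact: L2D lf (L2N lg). Qed.

Lemma L2_le f g : measurable_fun [set: T] f -> L2 g ->
  (forall x, `|f x| <= `|g x|) -> L2 f.
Proof.
move=> mf [mg lg] fg; split=> //; apply: (L1_le _ lg); first exact: measurable_funX.
move=> x; rewrite ger0_norm ?sqr_ge0// -[leLHS]real_normK ?num_real//.
by rewrite -[leRHS]real_normK ?num_real// lerXn2r ?nnegrE.
Qed.

(** The square of the L^2 norm, kept squared so that all estimates stay polynomial. *)
Definition sqI f : R := I (fun x => f x ^+ 2).

Lemma sqI_ge0 f : 0 <= sqI f.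
Proof. by apply: I_ge0 => x; exact: sqr_ge0. Qed.

Lemma sqI_D f g : L2 f -> L2 g ->
  sqI (fun x => f x + g x) = sqI f + 2 * I (fun x => f x * g x) + sqI g.
Proof.
move=> lf lg; have lfg := L2M lf lg; case: (lf) (lg) => _ lf2 [_ lg2].
rewrite /sqI -I_Z// -I_D//; last exact: L1Z.
rewrite -I_D//; last by apply: L1D => //; exact: L1Z.
by congr I; apply/funext => x; ring.
Qed.

Lemma sqI_Z k f : L2 f -> sqI (fun x => k * f x) = k ^+ 2 * sqI f.
Proof.
move=> [_ lf]; rewrite /sqI -I_Z//; congr I.
by apply/funext => x; ring.
Qed.

Lemma sqI_le2 f g : L2 f -> L2 g ->
  sqI (fun x => f x + g x) <= 2 * (sqI f + sqI g).
Proof.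
(* Parallelogram law: what is discarded is the nonnegative [sqI] of the difference. *)
move=> lf lg; have := sqI_ge0 (fun x => f x + (-1) * g x).
rewrite sqI_D//; last exact: L2Z.
rewrite sqI_Z// sqI_D//.
have -> : I (fun x => f x * (-1 * g x)) = - I (fun x => f x * g x).
  rewrite -I_N; last exact: L2M.
  by congr I; apply/funext => x; ring.
lra.
Qed.

(** The quadratic [t |-> sqI (f + t g)] is nonnegative, hence so is its value at the vertex. *)
Lemma cauchy_schwarz f g : L2 f -> L2 g ->
  I (fun x => f x * g x) ^+ 2 <= sqI f * sqI g.
Proof.
move=> lf lg; set b := I _.
have key t : 0 <= sqI f + 2 * t * b + t ^+ 2 * sqI g.
  have := sqI_ge0 (fun x => f x + t * g x).
  rewrite sqI_D//; last exact: L2Z.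
  rewrite sqI_Z//.
  have -> : I (fun x => f x * (t * g x)) = t * b.
    rewrite -I_Z; last exact: L2M.
    by congr I; apply/funext => x; ring.
  lra.
have := sqI_ge0 g; rewrite le_eqVlt => /orP[/eqP g0|g0].
  rewrite -g0 mulr0; have [->|b0] := eqVneq b 0; first by rewrite expr0n.
  (* With [sqI g = 0] the quadratic is affine in [t], and this [t] would give it the value -1. *)
  have := key (- (sqI f + 1) / (2 * b)); rewrite -g0 mulr0 addr0.
  have -> : 2 * (- (sqI f + 1) / (2 * b)) * b = - (sqI f + 1) by field.
  lra.
have := key (- b / sqI g).
have -> : sqI f + 2 * (- b / sqI g) * b + (- b / sqI g) ^+ 2 * sqI g =
  (sqI f * sqI g - b ^+ 2) / sqI g by field; rewrite gt_eqF.
by rewrite pmulr_lge0 ?invr_gt0// subr_ge0.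
Qed.

Definition L2cvg (f_ : nat -> T -> R) f :=
  sqI (fun x => f_ n x - f x) @[n --> \oo] --> 0.

Lemma L2cvgM (f_ g_ : nat -> T -> R) f g : (forall n, L2 (f_ n)) -> L2 f ->
  (forall n, L2 (g_ n)) -> L2 g -> L2cvg f_ f -> L2cvg g_ g ->
  I (fun x => f_ n x * g_ n x) @[n --> \oo] --> I (fun x => f x * g x).
Proof.
move=> lf_ lf lg_ lg ff gg; apply/cvgrPdist_le => e e0.
have sf := sqI_ge0 f; have sg := sqI_ge0 g.
(* By Cauchy-Schwarz the squares of the two error terms are at most [e1 * (2 * (e1 + sqI g))] and
   [e1 * sqI f]. As [e1 <= 1], both are at most [e1 * K], which is made smaller than
   [(e / 2) ^+ 2]. *)
pose K := 2 * sqI g + 2 + sqI f; have K0 : 0 < K by rewrite /K; lra.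
pose e1 := Num.min 1 (e ^+ 2 / (4 * K)).
have e10 : 0 < e1 by rewrite /e1 lt_min ltr01/= divr_gt0 ?exprn_gt0 ?mulr_gt0.
have e11 : e1 <= 1 by rewrite /e1 ge_min lexx.
have e1K : e1 * K <= (e / 2) ^+ 2.
  have : e1 <= e ^+ 2 / (4 * K) by rewrite /e1 ge_min lexx orbT.
  rewrite ler_pdivlMr ?mulr_gt0//; lra.
move/cvgrPdist_le : ff => /(_ _ e10); move/cvgrPdist_le : gg => /(_ _ e10).
apply: filterS2 => n; rewrite !sub0r !normrN.
rewrite ger0_norm ?sqI_ge0// => hg; rewrite ger0_norm ?sqI_ge0// => hf.
have E : I (fun x => f x * g x) - I (fun x => f_ n x * g_ n x) =
   - (I (fun x => (f_ n x - f x) * g_ n x) + I (fun x => (g_ n x - g x) * f x)).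
  have la := L2M lf lg; have lb := L2M (lf_ n) (lg_ n).
  have lc := L2M (L2B (lf_ n) lf) (lg_ n); have ld := L2M (L2B (lg_ n) lg) lf.
  rewrite -I_B// -I_D// -I_N; last exact: L1D.
  by congr I; apply/funext => x; ring.
have h1 := cauchy_schwarz (L2B (lf_ n) lf) (lg_ n).
have h2 := cauchy_schwarz (L2B (lg_ n) lg) lf.
have h3 : sqI (g_ n) <= 2 * (e1 + sqI g).
  have := sqI_le2 (L2B (lg_ n) lg) lg.
  have -> : (fun x => g_ n x - g x + g x) = g_ n by apply/funext => x; ring.
  lra.
have hn := sqI_ge0 (g_ n).
have a1 : `|I (fun x => (f_ n x - f x) * g_ n x)| <= e / 2.
  rewrite -(@ler_pXn2r _ 2) ?nnegrE//; last lra.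
  rewrite real_normK ?num_real//; apply: (le_trans h1); apply: le_trans e1K.
  by have := sqI_ge0 (fun x => f_ n x - f x); rewrite /K; nra.
have a2 : `|I (fun x => (g_ n x - g x) * f x)| <= e / 2.
  rewrite -(@ler_pXn2r _ 2) ?nnegrE//; last lra.
  rewrite real_normK ?num_real//; apply: (le_trans h2); apply: le_trans e1K.
  by have := sqI_ge0 (fun x => g_ n x - g x); rewrite /K; nra.
by rewrite E normrN (le_trans (ler_normD _ _))//; lra.
Qed.

Lemma L2cvg_cst f : L2cvg (fun=> f) f.
Proof.
rewrite /L2cvg (_ : (fun=> _) = fun=> 0); first exact: cvg_cst.
apply/funext => n; rewrite /sqI -[RHS]I_0; congr I.
by apply/funext => x; rewrite subrr expr0n.
Qed.

Lemma L2cvg_sqI (f_ : nat -> T -> R) f : (forall n, L2 (f_ n)) -> L2 f -> L2cvg f_ f ->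
  sqI (f_ n) @[n --> \oo] --> sqI f.
Proof. by move=> lf_ lf ff; exact: L2cvgM. Qed.

Lemma L2cvgD (f_ g_ : nat -> T -> R) f g : (forall n, L2 (f_ n)) -> L2 f ->
  (forall n, L2 (g_ n)) -> L2 g -> L2cvg f_ f -> L2cvg g_ g ->
  L2cvg (fun n x => f_ n x + g_ n x) (fun x => f x + g x).
Proof.
move=> lf_ lf lg_ lg ff gg; rewrite /L2cvg.
have h : 2 * (sqI (fun x => f_ n x - f x) + sqI (fun x => g_ n x - g x))
    @[n --> \oo] --> (2 * (0 + 0) : R).
  by apply: cvgMr; apply: cvgD.
rewrite addr0 mulr0 in h.
apply: (squeeze_cvgr _ (cvg_cst 0) h).
apply: nearW => n; rewrite sqI_ge0/=.
rewrite (_ : (fun x => _) = fun x => (f_ n x - f x) + (g_ n x - g x)).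
  by apply: sqI_le2; exact: L2B.
by apply/funext => x; ring.
Qed.

(* Borel-Cantelli in L^1 form; the summability is only used through the bound 2. *)
Lemma ae_cvg0_summable (e_ : nat -> T -> R) : (forall n, L1 (e_ n)) ->
  (forall n x, 0 <= e_ n x) -> (forall n, I (e_ n) <= 2^-1 ^+ n) ->
  {ae mu, forall x, e_ n x @[n --> \oo] --> 0}.
Proof.
move=> le_ e0 eb.
have me n : measurable_fun [set: T] (EFin \o e_ n).
  by apply/measurable_EFinP; exact: L1_measurable.
pose S x := (\sum_(0 <= n <oo) (e_ n x)%:E)%E.
have mS : measurable_fun [set: T] S.
  apply: (@ge0_emeasurable_sum _ _ _ setT (fun n x => (e_ n x)%:E) xpredT).
    by move=> k x _ _; rewrite lee_fin.
  by move=> k _; exact: me.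
have S0 x : (0 <= S x)%E by apply: nneseries_ge0 => n _ _; rewrite lee_fin.
have iS : (\int[mu]_x S x < +oo)%E.
  rewrite /S integral_nneseries//; last by move=> n x _; rewrite lee_fin.
  apply: (@le_lt_trans _ _ 2%:E); last exact: ltry.
  apply: lime_le.
    by apply: is_cvg_nneseries => n _ _; apply: integral_ge0 => x _; rewrite lee_fin.
  apply: nearW => N; under eq_bigr do rewrite -EFin_I//.
  rewrite sumEFin lee_fin; apply: (@le_trans _ _ (\sum_(0 <= i < N) 2^-1 ^+ i)).
    by apply: ler_sum => i _; exact: eb.
  have := @geometric_le_lim R N 1 2^-1; rewrite /series/= ler01 invr_gt0 ltr0n.
  rewrite ger0_norm ?invr_ge0// invf_lt1// ltr1n => /(_ isT isT isT).
  under eq_bigr do rewrite mul1r.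
  by move/le_trans; apply; rewrite div1r (_ : (1 - 2^-1)^-1 = 2 :> R)//; field.
have : mu.-integrable [set: T] S.
  by apply/integrableP; split=> //; under eq_integral do rewrite gee0_abs//.
move/(integrable_ae measurableT); apply: filterS => x /(_ Logic.I) Sfin.
apply: (@cvg_series_cvg_0 _ R); apply: nondecreasing_is_cvgn.
  by apply/nondecreasing_seqP => n; rewrite seriesSr lerDl.
exists (fine (S x)) => _ [n _ <-]; rewrite -lee_fin fineK// /series/= -sumEFin.
by apply: nneseries_lim_ge => k _ _; rewrite lee_fin.
Qed.

Lemma ae_cvgn (f_ : nat -> T -> R) : (forall n, measurable_fun [set: T] (f_ n)) ->
  {ae mu, forall x, cvgn (f_ ^~ x)} ->
  exists2 f : T -> R, measurable_fun [set: T] f & {ae mu, forall x, f_ n x @[n --> \oo] --> f x}.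
Proof.
move=> mf_ [N [mN N0 subN]].
pose g_ n x := f_ n x * \1_(~` N) x.
have mg_ n : measurable_fun [set: T] (g_ n).
  by apply: measurable_funM => //; apply: measurable_indic; exact: measurableC.
have cg x : g_ n x @[n --> \oo] --> limn (g_ ^~ x).
  rewrite /g_ indicE; have [xN|xN] := boolP (x \in ~` N) => /=.
    under eq_fun do rewrite mulr1; move/set_mem: xN => xN.
    by apply: contrapT => h; apply: xN; apply: subN.
  by under eq_fun do rewrite mulr0; exact: is_cvg_cst.
exists (fun x => limn (g_ ^~ x)).
  by apply: measurable_fun_cvg mg_ _ => x _; exact: cg.
exists N; split => // x /= nx; apply: contrapT => xN; apply: nx.
have := cg x; rewrite {1}/g_ indicE mem_set//=.
by under eq_fun do rewrite mulr1.
Qed.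

Lemma fatou_sqI (f_ : nat -> T -> R) f (c : R) : (forall n, L2 (f_ n)) ->
  measurable_fun [set: T] f -> {ae mu, forall x, f_ n x @[n --> \oo] --> f x} ->
  (\forall n \near \oo, sqI (f_ n) <= c) -> L2 f /\ sqI f <= c.
Proof.
move=> lf_ mf ff [N _ Nc].
case: ff => A [mA A0 subA].
(* The shift by [N] makes the bound hold for all indices, and the cut-off outside [A] makes the
   convergence hold at all points. *)
pose g_ n x := f_ (n + N)%N x * \1_(~` A) x; pose g x := f x * \1_(~` A) x.
have mi : measurable_fun [set: T] (\1_(~` A) : T -> R).
  by apply: measurable_indic; exact: measurableC.
have mg_ n : measurable_fun [set: T] (fun x => (g_ n x ^+ 2)%:E).
  apply/measurable_EFinP; apply: measurable_funX; apply: measurable_funM => //.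
  by have [] := lf_ (n + N)%N.
have gg x : (g_ n x ^+ 2)%:E @[n --> \oo] --> (g x ^+ 2)%:E.
  apply: cvg_EFin; first exact: nearW.
  rewrite /= /g_ /g indicE; have [xN|xN] := boolP (x \in ~` A) => /=.
    under eq_fun do rewrite mulr1; rewrite mulr1; move/set_mem: xN => xN.
    have h : f_ n x @[n --> \oo] --> f x.
      by apply: contrapT => h; apply: xN; apply: subA.
    have h' : f_ (n + N)%N x @[n --> \oo] --> f x.
      by rewrite (cvg_shiftn N (fun n => f_ n x)).
    exact: (cvgM h' h').
  by rewrite mulr0; under eq_fun do rewrite mulr0; exact: cvg_cst.
have mg : measurable_fun [set: T] (fun x => g x ^+ 2).
  by apply: measurable_funX; exact: measurable_funM.
have fg : {ae mu, forall x, g x ^+ 2 = f x ^+ 2}.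
  exists A; split => // x /= nx; apply: contrapT => xA; apply: nx.
  by rewrite /g indicE mem_set//= mulr1.
have h : (\int[mu]_x (g x ^+ 2)%:E <= c%:E)%E.
  rewrite (eq_integral (fun x => limn_einf (fun n => (g_ n x ^+ 2)%:E))); last first.
    by move=> x _; rewrite (cvg_limn_einf_sup (gg x)).1.
  apply: le_trans (fatou _ _ _ _) _ => //.
    by move=> n x _; rewrite lee_fin sqr_ge0.
  rewrite limn_einf_lim; apply: lime_le; first exact: is_cvg_einfs.
  apply: nearW => n; apply: (@le_trans _ _ (\int[mu]_x (g_ n x ^+ 2)%:E)%E).
    by apply: ereal_inf_lbound; exists n => //=.
  apply: (@le_trans _ _ (sqI (f_ (n + N)%N))%:E); last first.
    by rewrite lee_fin; apply: Nc => /=; exact: leq_addl.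
  rewrite /sqI EFin_I; last by have [] := lf_ (n + N)%N.
  apply: ge0_le_integral => //.
  - by move=> x _; rewrite lee_fin sqr_ge0.
  - by apply/measurable_EFinP; apply: measurable_funX; have [] := lf_ (n + N)%N.
  - move=> x _; rewrite lee_fin /g_ exprMn indicE; case: (x \in ~` A) => /=.
      by rewrite expr1n mulr1.
    by rewrite expr0n mulr0 sqr_ge0.
have lg : L1 (fun x => g x ^+ 2).
  apply/L1_ge0P => //; first by move=> x; exact: sqr_ge0.
  exact: le_lt_trans h (ltry _).
have mf2 : measurable_fun [set: T] (fun x => f x ^+ 2) by exact: measurable_funX.
split; first by split => //; exact: (L1_ae_eq mf2 fg lg).
by rewrite /sqI -(I_ae_eq mg mf2 fg) -lee_fin EFin_I.
Qed.

Lemma pow2_large (e : R) : 0 < e -> exists n, 2^-1 ^+ n <= e.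
Proof.
move=> e0; have := @cvg_geometric R 1 2^-1.
rewrite ger0_norm ?invr_ge0// invf_lt1// ltr1n => /(_ isT) /cvgrPdist_le /(_ e e0).
case=> n _ /(_ n (leqnn n)); rewrite sub0r normrN /= mul1r ger0_norm; first by exists n.
by rewrite exprn_ge0// invr_ge0.
Qed.

Lemma L2cvg_subseq (f_ : nat -> T -> R) f : (forall n, L2 (f_ n)) -> L2 f ->
  L2cvg f_ f -> exists s : nat -> nat, (forall n, (n <= s n)%N) /\
    {ae mu, forall x, f_ (s n) x @[n --> \oo] --> f x}.
Proof.
move=> lf_ lf ff.
(* Squared distances below [2^-1 ^+ n] are summable, so [ae_cvg0_summable] applies. The selection
   only ensures [n <= s n], which is enough to carry limits over. *)
have /choice[s hs] n : exists m, (n <= m)%N /\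
    sqI (fun x => f_ m x - f x) <= 2^-1 ^+ n.
  have e0 : 0 < 2^-1 ^+ n :> R by rewrite exprn_gt0// invr_gt0.
  move/cvgrPdist_le : ff => /(_ _ e0) [N _ hN].
  exists (maxn n N); split; first exact: leq_maxl.
  have := hN (maxn n N) (leq_maxr _ _).
  by rewrite sub0r normrN ger0_norm// sqI_ge0.
exists s; split; first by move=> n; have [] := hs n.
have := @ae_cvg0_summable (fun n x => (f_ (s n) x - f x) ^+ 2).
have h1 n : L1 (fun x => (f_ (s n) x - f x) ^+ 2) by have [] := L2B (lf_ (s n)) lf.
have h2 n x : 0 <= (f_ (s n) x - f x) ^+ 2 by exact: sqr_ge0.
move=> /(_ h1 h2 (fun n => (hs n).2)); apply: filterS => x h.
have h' : (f_ (s n) x - f x) @[n --> \oo] --> 0.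
  apply: norm_cvg0; under eq_fun do rewrite -sqrtr_sqr.
  by rewrite -[0]sqrtr0; exact: (continuous_cvg _ (@sqrt_continuous R 0)).
have -> : (fun n => f_ (s n) x) = (fun n => (f_ (s n) x - f x) + f x).
  by apply/funext => n; rewrite subrK.
by rewrite -[X in _ --> X]add0r; apply: cvgD => //; exact: cvg_cst.
Qed.

Lemma L2_complete (f_ : nat -> T -> R) : (forall n, L2 (f_ n)) ->
  (forall e, 0 < e -> exists N, forall m n, (N <= m)%N -> (N <= n)%N ->
    sqI (fun x => f_ m x - f_ n x) <= e) ->
  exists f, L2 f /\ L2cvg f_ f.
Proof.
move=> lf_ cf.
(* The rate 8^-n leaves room for the weight 4^n in [e_]: the weighted squares have integrals at most
   2^-n, and boundedness of [e_ n x] in [n] then makes the increments O(2^-n). *)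
have /choice[N hN] n : exists N, forall m p, (N <= m)%N -> (N <= p)%N ->
    sqI (fun x => f_ m x - f_ p x) <= 2^-1 ^+ (n + n + n).
  by apply: cf; rewrite exprn_gt0// invr_gt0.
(* Partial sums of [(N i).+1] increase, dominate [N n] and are at least [n]. *)
pose s n := (\sum_(i < n.+1) (N i).+1)%N.
have sS n : s n.+1 = (s n + (N n.+1).+1)%N by rewrite /s big_ord_recr.
have sN n : (N n <= s n)%N.
  by case: n => [|n]; rewrite ?sS /s ?big_ord1// (leq_trans (leqnSn _))// leq_addl.
have sle n : (n <= s n)%N.
  by elim: n => // n ih; rewrite sS -addn1 leq_add.
pose e_ n x := 2 ^+ (n + n) * (f_ (s n.+1) x - f_ (s n) x) ^+ 2.
have le_ n : L1 (e_ n) by apply: L1Z; have [] := L2B (lf_ (s n.+1)) (lf_ (s n)).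
have e_0 n x : 0 <= e_ n x by apply: mulr_ge0; [exact: exprn_ge0|exact: sqr_ge0].
have eb n : I (e_ n) <= 2^-1 ^+ n.
  have := hN n (s n.+1) (s n); rewrite sN => /(_ _ isT) h.
  have {}h : sqI (fun x => f_ (s n.+1) x - f_ (s n) x) <= 2^-1 ^+ (n + n + n).
    by apply: h; rewrite sS (leq_trans (sN n))// leq_addr.
  rewrite /e_ I_Z; last by have [] := L2B (lf_ (s n.+1)) (lf_ (s n)).
  apply: le_trans (ler_wpM2l _ h) _; first by rewrite exprn_ge0.
  by rewrite [X in _ * X]exprD mulrA -exprMn divff// expr1n mul1r.
have fc : {ae mu, forall x, cvgn (fun n => f_ (s n) x)}.
  apply: filterS (ae_cvg0_summable le_ e_0 eb) => x ex.
  pose u n := f_ (s n.+1) x - f_ (s n) x.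
  have cu : cvgn (series u).
    apply: normed_cvg.
    have /cvg_seq_bounded[M [_ hM]] : cvgn (e_ ^~ x) by apply/cvg_ex; exists 0.
    have {hM} hM n : `|e_ n x| <= `|M| + 1.
      by apply: (hM (`|M| + 1)) => //; rewrite (le_lt_trans (ler_norm _))// ltrDl.
    set K := `|M| + 2.
    have K0 : 0 <= K by rewrite /K addr_ge0.
    apply: (@series_le_cvg _ _ (geometric K 2^-1)) => [n|n|n|] /=.
    - exact: normr_ge0.
    - by rewrite mulr_ge0// exprn_ge0// invr_ge0.
    - rewrite -(@ler_pXn2r _ 2) ?nnegrE ?mulr_ge0 ?exprn_ge0 ?invr_ge0//.
      rewrite real_normK ?num_real// exprMn -exprM exprVn ler_pdivlMr ?exprn_gt0//.
      rewrite mulrC muln2 -addnn; apply: le_trans (ler_norm _) _.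
      by apply: le_trans (hM n) _; rewrite /K; have := normr_ge0 M; nra.
    - apply: is_cvg_geometric_series.
      by rewrite ger0_norm ?invr_ge0// invf_lt1// ltr1n.
  have -> : (fun n => f_ (s n) x) = (fun n => series u n + f_ (s 0%N) x).
    apply/funext => n; rewrite /series /= /u.
    by rewrite (telescope_sumr (fun n => f_ (s n) x))// subrK.
  by apply: is_cvgD => //; exact: is_cvg_cst.
have [f mf ff] := ae_cvgn (fun n => (lf_ (s n)).1) fc.
have key e : 0 < e -> \forall m \near \oo, L2 (fun x => f x - f_ m x) /\
    sqI (fun x => f x - f_ m x) <= e.
  move=> e0; have [M hM] := cf _ e0; exists M => // m /= Mm.
  apply: (@fatou_sqI (fun k x => f_ (s k) x - f_ m x)).
  - by move=> n; exact: L2B.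
  - by apply: measurable_funB => //; have [] := lf_ m.
  - apply: filterS ff => x h; apply: cvgB => //; exact: cvg_cst.
  - exists M => // k /= Mk; apply: hM => //; exact: leq_trans (sle k).
have lf : L2 f.
  have [m _ /(_ m (leqnn m))[h _]] := key 1 ltr01.
  by have := L2D h (lf_ m); under eq_fun do rewrite subrK.
exists f; split=> //; apply/cvgrPdist_le => e e0.
apply: filterS (key e e0) => n [_]; rewrite sub0r normrN ger0_norm ?sqI_ge0//.
congr (_ <= _); congr I; apply/funext => x; ring.
Qed.

End L1.

(** * Iterated integrals and null sets of product measures *)

Section fubiniR.
Context d1 d2 (T1 : measurableType d1) (T2 : measurableType d2) (R : realType).
Variables (m1 : {sigma_finite_measure set T1 -> \bar R})
  (m2 : {sigma_finite_measure set T2 -> \bar R}).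
Implicit Types f : T1 * T2 -> R.
Local Notation m12 := (m1 \x m2)%E.

Lemma measurable_section1 d (U : measurableType d) (f : T1 * T2 -> U) x :
  measurable_fun [set: T1 * T2] f -> measurable_fun [set: T2] (fun y => f (x, y)).
Proof. by move=> mf; exact: measurableT_comp. Qed.

Lemma fubini1 f : L1 m12 f -> L1 m1 (fun x => I m2 (fun y => f (x, y))) /\
  I m12 f = I m1 (fun x => I m2 (fun y => f (x, y))).
Proof.
move=> lf; have iF := integrable_fubini_F lf.
have mF := measurable_int _ iF.
have mI : measurable_fun [set: T1] (fun x => I m2 (fun y => f (x, y))).
  by apply: (measurableT_comp (fine_measurable measurableT) mF).
have E : {ae m1, forall x, fubini_F m2 (EFin \o f) x = (I m2 (fun y => f (x, y)))%:E}.
  apply: filterS (ae_integrable1 lf) => x h.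
  by rewrite EFin_I.
have lI : L1 m1 (fun x => I m2 (fun y => f (x, y))).
  apply/integrableP; split; first exact/measurable_EFinP.
  move/integrableP : iF => [_]; apply: le_lt_trans.
  rewrite le_eqVlt; apply/orP; left; apply/eqP; apply: ae_eq_integral => //.
  - by apply: measurableT_comp => //; exact/measurable_EFinP.
  - exact: measurableT_comp.
  - by apply: filterS E => x /= -> _.
split=> //; apply: EFin_inj; rewrite !EFin_I//.
rewrite -(integral12_prod_meas1 lf); apply: ae_eq_integral => //.
  exact/measurable_EFinP.
by apply: filterS E => x /= -> _.
Qed.

Lemma fubini2 f : L1 m12 f -> L1 m2 (fun y => I m1 (fun x => f (x, y))) /\
  I m12 f = I m2 (fun y => I m1 (fun x => f (x, y))).
Proof.
move=> lf; have mf := L1_measurable lf.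
have mF : measurable_fun [set: T2] (fubini_G m1 (EFin \o f)) by exact: measurable_fubini_G lf.
have iF : m2.-integrable [set: T2] (fubini_G m1 (EFin \o f)).
  apply/integrableP; split => //.
  have h : measurable_fun [set: T1 * T2] (EFin \o f) by exact/measurable_EFinP.
  have := (integrable21ltyP m1 m2 h).1 lf; apply: le_lt_trans; apply: ge0_le_integral => //.
  - exact: measurableT_comp.
  - apply: (measurable_fun_fubini_tonelli_G (fun z => `|(f z)%:E|%E)) => //=.
    by apply/measurable_EFinP; exact: measurableT_comp.
  - move=> y _; apply: le_abse_integral => //; apply/measurable_EFinP.
    exact: measurableT_comp.
have mI : measurable_fun [set: T2] (fun y => I m1 (fun x => f (x, y))).
  by apply: (measurableT_comp (fine_measurable measurableT) mF).
have E : {ae m2, forall y, fubini_G m1 (EFin \o f) y = (I m1 (fun x => f (x, y)))%:E}.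
  apply: filterS (ae_integrable2 lf) => x h.
  by rewrite EFin_I.
have lI : L1 m2 (fun y => I m1 (fun x => f (x, y))).
  apply/integrableP; split; first exact/measurable_EFinP.
  move/integrableP : iF => [_]; apply: le_lt_trans.
  rewrite le_eqVlt; apply/orP; left; apply/eqP; apply: ae_eq_integral => //.
  - by apply: measurableT_comp => //; exact/measurable_EFinP.
  - exact: measurableT_comp.
  - by apply: filterS E => x /= -> _.
split=> //; apply: EFin_inj; rewrite !EFin_I//.
rewrite -(integral21_prod_meas1 lf); apply: ae_eq_integral => //.
  exact/measurable_EFinP.
by apply: filterS E => x /= -> _.
Qed.

Lemma tonelli1 f : measurable_fun [set: T1 * T2] f ->
  (forall x, L1 m2 (fun y => f (x, y))) ->
  L1 m1 (fun x => I m2 (fun y => `|f (x, y)|)) -> L1 m12 f.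
Proof.
move=> mf ls lI; apply/integrable12ltyP; first exact/measurable_EFinP.
have := L1_lty lI (fun x => I_ge0 _ (fun y => normr_ge0 _)); apply: le_lt_trans.
rewrite le_eqVlt; apply/orP; left; apply/eqP; apply: eq_integral => x _.
by rewrite EFin_I//; exact: L1_norm (ls x).
Qed.

Lemma tonelli2 f : measurable_fun [set: T1 * T2] f ->
  (forall y, L1 m1 (fun x => f (x, y))) ->
  L1 m2 (fun y => I m1 (fun x => `|f (x, y)|)) -> L1 m12 f.
Proof.
move=> mf ls lI; apply/integrable21ltyP; first exact/measurable_EFinP.
have := L1_lty lI (fun x => I_ge0 _ (fun y => normr_ge0 _)); apply: le_lt_trans.
rewrite le_eqVlt; apply/orP; left; apply/eqP; apply: eq_integral => x _.
by rewrite EFin_I//; exact: L1_norm (ls x).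
Qed.

Lemma L1_tensor (f : T1 -> R) (g : T2 -> R) : L1 m1 f -> L1 m2 g ->
  L1 m12 (fun z => f z.1 * g z.2) /\
  I m12 (fun z => f z.1 * g z.2) = I m1 f * I m2 g.
Proof.
move=> lf lg; have lfg : L1 m12 (fun z => f z.1 * g z.2).
  apply: tonelli1 => [|x|].
  - by apply: measurable_funM; apply: measurableT_comp => //;
      [exact: L1_measurable lf|exact: L1_measurable lg].
  - exact: (L1Z (f x) lg).
  - apply: (L1_le _ (L1Z (I m2 (fun y => `|g y|)) (L1_norm lf))).
      have -> : (fun x => I m2 (fun y => `|f (x, y).1 * g (x, y).2|)) =
          (fun x => `|f x| * I m2 (fun y => `|g y|)).
        apply/funext => x; rewrite -I_Z; last exact: L1_norm.
        by congr I; apply/funext => y; rewrite normrM.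
      apply: measurable_funM => //; apply: measurableT_comp => //.
      exact: L1_measurable lf.
    move=> x; rewrite ger0_norm ?I_ge0// mulrC -I_Z; last exact: L1_norm.
    by rewrite le_eqVlt; apply/orP; left; apply/eqP; congr I;
      apply/funext => y; rewrite normrM.
split=> //; rewrite (fubini1 lfg).2 mulrC -I_Z//; congr I; apply/funext => x /=.
by rewrite I_Z// mulrC.
Qed.

Lemma ae_fst (P : T1 -> Prop) : {ae m1, forall x, P x} -> {ae m12, forall z, P z.1}.
Proof.
case=> N [mN N0 sN]; exists (N `*` setT); split; first exact: measurableX.
- rewrite product_measure1E// -[RHS](mul0e (m2 setT)); congr (_ * _)%E; exact: N0.
- by move=> z nP; split => //; exact: sN.
Qed.

Lemma ae_snd (P : T2 -> Prop) : {ae m2, forall x, P x} -> {ae m12, forall z, P z.2}.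
Proof.
case=> N [mN N0 sN]; exists (setT `*` N); split; first exact: measurableX.
- rewrite product_measure1E// -[RHS](mule0 (m1 setT)); congr (_ * _)%E; exact: N0.
- by move=> z nP; split => //; exact: sN.
Qed.

Lemma ae_section1 (P : T1 * T2 -> Prop) : {ae m12, forall z, P z} ->
  {ae m1, forall x, {ae m2, forall y, P (x, y)}}.
Proof.
case=> N [mN N0 sN].
have mx : measurable_fun [set: T1] (m2 \o xsection N).
  exact: measurable_fun_xsection.
have /(ae_eq_integral_abs _ measurableT mx) : (\int[m1]_x `|(m2 \o xsection N) x|)%E = 0%E.
  rewrite -[RHS]N0 /product_measure1; apply: eq_integral => x _.
  by rewrite gee0_abs.
apply: filterS => x /(_ Logic.I) Nx; exists (xsection N x); split => //.
  exact: measurable_xsection.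
by move=> y nP; rewrite /xsection /= inE; exact: sN.
Qed.

End fubiniR.

Section swap.
Context d1 (T : measurableType d1) (R : realType).
Variables (m : {sigma_finite_measure set T -> \bar R}).
Local Notation mm := (m \x m)%E.

Let swap (z : T * T) := (z.2, z.1).

Let measurable_swapT : measurable_fun [set: T * T] (swap).
Proof. by apply/measurable_fun_pairP; split; [exact: measurable_snd|exact: measurable_fst]. Qed.

Lemma L1_swap (f : T * T -> R) : L1 mm f -> L1 mm (fun z => f (z.2, z.1)).
Proof.
move=> lf; have mf := L1_measurable lf.
have mf' : measurable_fun [set: T * T] (fun z => f (z.2, z.1)).
  exact: (measurableT_comp mf measurable_swapT).
apply/integrable12ltyP; first exact/measurable_EFinP.
have h : measurable_fun [set: T * T] (EFin \o f) by exact/measurable_EFinP.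
exact: (integrable21ltyP m m h).1 lf.
Qed.

Lemma I_swap (f : T * T -> R) : L1 mm f -> I mm (fun z => f (z.2, z.1)) = I mm f.
Proof. by move=> lf; rewrite (fubini2 lf).2 (fubini1 (L1_swap lf)).2. Qed.

(** The measures of a set and of its mirror image are computed by the two iterated integrals taken
    in opposite orders. *)
Lemma ae_swap (P : T * T -> Prop) : {ae mm, forall z, P z} -> {ae mm, forall z, P (z.2, z.1)}.
Proof.
case=> N [mN N0 sN]; have mN' : measurable (swap @^-1` N).
  by rewrite -[X in measurable X]setTI; exact: measurable_swapT.
exists (swap @^-1` N); split => //; last by move=> z nP; exact: sN.
have mi (A : set (T * T)) : measurable A ->
    measurable_fun [set: T * T] (fun z => (\1_A z)%:E : \bar R).
  by move=> mA; apply/measurable_EFinP; exact: measurable_indic.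
have E (A : set (T * T)) : measurable A -> mm A = (\int[mm]_z (\1_A z)%:E)%E.
  by move=> mA; rewrite integral_indic// setIT.
rewrite E// (fubini_tonelli1 (fun z => (\1_(swap @^-1` N) z)%:E))//; last exact: mi.
transitivity (mm N); last exact: N0.
by rewrite E// (fubini_tonelli2 (fun z => (\1_N z)%:E))//; exact: mi.
Qed.

End swap.

(** * Lebesgue measure on R^n *)

Section leb.
Context {R : realType}.

Lemma ge0_integral_lebS n (f : 'rV[R]_n.+1 -> \bar R) :
  measurable_fun [set: 'rV[R]_n.+1] f -> (forall x, 0 <= f x)%E ->
  (\int[leb n.+1]_x f x =
   \int[@lebesgue_measure R]_a \int[leb n]_v f (row_cons (a, v)))%E.
Proof.
move=> mf f0.
have mfr : measurable_fun [set: measurableTypeR R * 'rV[R]_n] (f \o @row_cons R n).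
  by apply: measurableT_comp => //; exact: measurable_row_cons.
rewrite -[RHS](fubini_tonelli1 (f \o @row_cons R n))//=.
exact: (@ge0_integral_pushforward _ _ _ _ _ _ (@measurable_row_cons R n)).
Qed.

Let aff (a b : R) (t : measurableTypeR R) : measurableTypeR R := a * t + b.

Let measurable_aff (a b : R) : measurable_fun [set: measurableTypeR R] (aff a b).
Proof. by apply: measurable_funD => //; exact: measurable_funM. Qed.

(** Scaled by [|a|], the pushforward agrees with Lebesgue measure on half-open intervals, which
    determine the measure. *)
Lemma lebesgue_affine (a b : R) (A : set (measurableTypeR R)) : a != 0 -> measurable A ->
  (pushforward (@lebesgue_measure R) (aff a b) A = (`|a|^-1)%:E * lebesgue_measure A)%E.
Proof.
move=> a0 mA.
pose mu' : {measure set (measurableTypeR R) -> \bar R} :=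
  measure_function_pushforward__canonical__measure_function_Measure
    (@lebesgue_measure R) (measurable_aff a b).
rewrite (@lebesgue_measure_unique R (mscale (NngNum (normr_ge0 a)) mu') _ A mA).
  rewrite /mscale/= muleA -EFinM mulVf ?mul1e// normr_eq0//.
move=> _ [[x y] /= xy <-].
rewrite /mscale /= /mu' /= /pushforward.
(* For [a < 0] the order is reversed, and the preimage of an interval closed on the right is closed
   on the left. *)
have -> : aff a b @^-1` `]x, y]%classic =
  if 0 < a then `](x - b) / a, (y - b) / a]%classic else `[(y - b) / a, (x - b) / a[%classic.
  case: ifPn => ag0; apply/seteqP; split => t /=; rewrite !in_itv/= /aff.
  - by move=> /andP[h1 h2]; rewrite ltr_pdivrMr// ler_pdivlMr//; apply/andP; split; lra.
  - rewrite ltr_pdivrMr// ler_pdivlMr// => /andP[h1 h2]; apply/andP; split; lra.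
  - have al0 : a < 0 by rewrite lt_neqAle a0 leNgt.
    by move=> /andP[h1 h2]; rewrite ltr_ndivlMr// ler_ndivrMr//; apply/andP; split; lra.
  - have al0 : a < 0 by rewrite lt_neqAle a0 leNgt.
    by rewrite ltr_ndivlMr// ler_ndivrMr// => /andP[h1 h2]; apply/andP; split; lra.
case: ifPn => ag0; rewrite !lebesgue_measure_itv/= !lte_fin.
  rewrite ltr_pM2r ?invr_gt0// ltrD2r; case: ifPn => xy'; last by rewrite mule0.
  by rewrite gtr0_norm// -!EFinB -EFinM; congr (_%:E); field.
have al0 : a < 0 by rewrite lt_neqAle a0 leNgt.
rewrite ltr_nM2r ?invr_lt0// ltrD2r; case: ifPn => xy'; last by rewrite mule0.
by rewrite ltr0_norm// -!EFinB -EFinM; congr (_%:E); field.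
Qed.

Lemma ge0_integral_affine1 (a b : R) (f : R -> \bar R) : a != 0 ->
  measurable_fun [set: R] f -> (forall x, 0 <= f x)%E ->
  (\int[@lebesgue_measure R]_t f (a * t + b)%R =
   (`|a|^-1)%:E * \int[@lebesgue_measure R]_t f t)%E.
Proof.
move=> a0 mf f0.
have ia : 0 <= `|a|^-1 by rewrite invr_ge0.
rewrite -[RHS](@ge0_integral_mscale _ _ _ _ setT _ (NngNum ia))//.
rewrite -[LHS](@ge0_integral_pushforward _ _ _ _ _ _ (measurable_aff a b) _ setT)//.
by apply: eq_measure_integral => A mA _ /=; exact: lebesgue_affine.
Qed.

Lemma row_cons_affine n (a : R) (b : 'rV[R]_n.+1) t v :
  a *: row_cons (t, v) + b =
  row_cons (a * t + b ord0 ord0, a *: v + \row_j b ord0 (lift ord0 j)) :> 'rV[R]_n.+1.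
Proof.
apply/rowP => i; rewrite !mxE; case: (unliftP ord0 i) => [j ->|->] /=; by rewrite ?mxE.
Qed.

Lemma measurable_affine n (a : R) (b : 'rV[R]_n) :
  measurable_fun [set: 'rV[R]_n] (fun x => a *: x + b).
Proof.
apply/measurable_fun_rVP => i.
rewrite (_ : (fun t => _) = (fun x : 'rV[R]_n => a * x ord0 i + b ord0 i)); last first.
  by apply/funext => x; rewrite !mxE.
by apply: measurable_funD => //; apply: measurable_funM => //; exact: measurable_coord.
Qed.

(** Induction on the dimension: splitting off the first coordinate costs one factor [|a|^-1]. *)
Lemma ge0_integral_affine n (a : R) (b : 'rV[R]_n) (f : 'rV[R]_n -> \bar R) : a != 0 ->
  measurable_fun [set: 'rV[R]_n] f -> (forall x, 0 <= f x)%E ->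
  (\int[leb n]_x f (a *: x + b)%R = (`|a|^-1 ^+ n)%:E * \int[leb n]_x f x)%E.
Proof.
move=> a0; elim: n b f => [|n ih] b f mf f0.
  rewrite expr0 mul1e; apply: eq_integral => x _.
  by congr f; apply/rowP => -[].
have mg : measurable_fun [set: 'rV[R]_n.+1] (fun x => f (a *: x + b)).
  by apply: measurableT_comp => //; exact: measurable_affine.
rewrite !ge0_integral_lebS//.
under eq_integral => t _.
  under eq_integral do rewrite row_cons_affine.
  over.
have mfc : measurable_fun [set: measurableTypeR R * 'rV[R]_n] (f \o @row_cons R n).
  by apply: measurableT_comp => //; exact: measurable_row_cons.
have E t : (\int[leb n]_x f (row_cons (a * t + b ord0 ord0,
    a *: x + \row_j b ord0 (lift ord0 j)))%R = (`|a|^-1 ^+ n)%:E *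
    \int[leb n]_x f (row_cons (a * t + b ord0 ord0, x)%R))%E.
  rewrite (ih (\row_j b ord0 (lift ord0 j)) (fun x => f (row_cons (a * t + b ord0 ord0, x)))%R)//.
  exact: (measurable_section1 _ mfc).
under eq_integral do rewrite E.
have mF : measurable_fun [set: measurableTypeR R] (fun t => \int[leb n]_x f (row_cons (t, x)))%E.
  exact: (measurable_fun_fubini_tonelli_F _ mfc (fun=> f0 _)).
have F0 t : (0 <= \int[leb n]_x f (row_cons (t, x)))%E by exact: integral_ge0.
rewrite (ge0_integral_affine1 (b ord0 ord0) (f := fun t => (`|a|^-1 ^+ n)%:E *
    \int[leb n]_x f (row_cons (t, x)))%E a0); last 2 first.
- by apply: emeasurable_funM.
- by move=> t; rewrite mule_ge0// lee_fin exprn_ge0// invr_ge0.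
rewrite ge0_integralZl//.
by rewrite muleA -EFinM exprS.
Qed.

Lemma L1_affine n (a : R) (b : 'rV[R]_n) (f : 'rV[R]_n -> R) : a != 0 ->
  L1 (leb n) f -> L1 (leb n) (fun x => f (a *: x + b)).
Proof.
move=> a0 lf; have mf := L1_measurable lf.
apply/integrableP; split.
  by apply/measurable_EFinP; apply: measurableT_comp => //; exact: measurable_affine.
rewrite (ge0_integral_affine b (f := fun x => `|(f x)%:E|%E) a0)//; last first.
  by apply: measurableT_comp => //; exact/measurable_EFinP.
rewrite lte_mul_pinfty// ?lee_fin ?exprn_ge0 ?invr_ge0//.
by move/integrableP : lf => [_].
Qed.

Lemma I_affine n (a : R) (b : 'rV[R]_n) (f : 'rV[R]_n -> R) : a != 0 ->
  L1 (leb n) f -> I (leb n) (fun x => f (a *: x + b)) = `|a|^-1 ^+ n * I (leb n) f.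
Proof.
move=> a0 lf; have mf := L1_measurable lf.
have mE : measurable_fun [set: 'rV[R]_n] (EFin \o f) by exact/measurable_EFinP.
apply: EFin_inj; rewrite EFinM !EFin_I//; last exact: L1_affine.
rewrite integralE [in RHS]integralE.
have -> : (fun x => (f (a *: x + b))%:E)^\+%E = (fun x => (EFin \o f)^\+%E (a *: x + b)).
  exact: (funepos_comp (EFin \o f) (fun x => a *: x + b)).
have -> : (fun x => (f (a *: x + b))%:E)^\-%E = (fun x => (EFin \o f)^\-%E (a *: x + b)).
  exact: (funeneg_comp (EFin \o f) (fun x => a *: x + b)).
rewrite (ge0_integral_affine b (f := (EFin \o f)^\+%E) a0)//; last exact: measurable_funepos.
rewrite (ge0_integral_affine b (f := (EFin \o f)^\-%E) a0)//; last exact: measurable_funeneg.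
have fp : (\int[leb n]_x (EFin \o f)^\+ x)%E \is a fin_num by exact: (integrable_pos_fin_num measurableT lf).
have fn : (\int[leb n]_x (EFin \o f)^\- x)%E \is a fin_num by exact: (integrable_neg_fin_num measurableT lf).
rewrite (_ : (fun x => (f x)%:E) = EFin \o f)//.
move: fp fn; move: (\int[leb n]_x _)%E (\int[leb n]_x _)%E => [p| |] [q| |] // _ _.
exact: (congr1 EFin (esym (mulrBr _ _ _))).
Qed.

Lemma L1_lebS n (f : 'rV[R]_n.+1 -> R) : measurable_fun [set: 'rV[R]_n.+1] f ->
  L1 (@lebesgue_measure R \x leb n)%E (f \o @row_cons R n) ->
  L1 (leb n.+1) f /\
  I (leb n.+1) f = I (@lebesgue_measure R \x leb n)%E (f \o @row_cons R n).
Proof.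
move=> mf lf; have mE : measurable_fun [set: 'rV[R]_n.+1] (EFin \o f) by exact/measurable_EFinP.
have h := @integrable_pushforward _ _ _ _ _ _ (@measurable_row_cons R n) _ setT _ mE lf measurableT.
split; first exact: h.
apply: EFin_inj; rewrite !EFin_I//.
exact: (@integral_pushforward _ _ _ _ _ _ (@measurable_row_cons R n) _ setT _ mE lf measurableT).
Qed.

Lemma L1_prod n (g : 'I_n -> R -> R) : (forall i, L1 (@lebesgue_measure R) (g i)) ->
  L1 (leb n) (fun x => \prod_i g i (x ord0 i)) /\
  I (leb n) (fun x => \prod_i g i (x ord0 i)) = \prod_i I (@lebesgue_measure R) (g i).
Proof.
elim: n g => [|n ih] g lg.
  have -> : (fun x : 'rV[R]_0 => \prod_(i < 0) g i (x ord0 i)) = fun=> 1.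
    by apply/funext => x; rewrite big_ord0.
  have l1 : L1 (@leb R 0) (fun=> 1).
    apply/integrableP; split; first exact: measurable_cst.
    by rewrite /= integral_dirac//= diracT mul1e normr1 ltry.
  split => //; rewrite big_ord0; apply: EFin_inj; rewrite EFin_I//=.
  by rewrite integral_dirac//= diracT mul1e.
have [ih1 ih2] := ih (fun i => g (lift ord0 i)) (fun i => lg (lift ord0 i)).
have [t1 t2] := L1_tensor (lg ord0) ih1.
have E : (fun x : 'rV[R]_n.+1 => \prod_i g i (x ord0 i)) \o @row_cons R n =
   (fun z => g ord0 z.1 * (\prod_i g (lift ord0 i) (z.2 ord0 i))).
  apply/funext => -[t v] /=; rewrite big_ord_recl mxE unlift_none; congr (_ * _).
  by apply: eq_bigr => i _; rewrite mxE liftK.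
have mg : measurable_fun [set: 'rV[R]_n.+1] (fun x => \prod_i g i (x ord0 i)).
  apply: measurable_prod => i _; apply: (measurableT_comp (L1_measurable (lg i))).
  exact: measurable_coord.
have [] := @L1_lebS n _ mg; first by rewrite E.
by move=> h1 ->; split => //; rewrite big_ord_recl -ih2 -t2 E.
Qed.

Lemma norm_coord n (x : 'rV[R]_n) i : `|x ord0 i| <= `|x|.
Proof.
rewrite [leRHS]/normr /= mx_normrE.
exact: (le_bigmax _ (fun ij : 'I_1 * 'I_n => `|x ij.1 ij.2|) (ord0, i)).
Qed.

Lemma norm_row_lt n (x : 'rV[R]_n) e : 0 < e -> (forall i, `|x ord0 i| < e) -> `|x| < e.
Proof.
move=> e0 h; rewrite [ltLHS]/normr /= mx_normrE; apply/bigmax_ltP; split => // -[i j] _ /=.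
by rewrite (ord1 i).
Qed.

Lemma norm_row_le n (x : 'rV[R]_n) e : 0 <= e -> (forall i, `|x ord0 i| <= e) -> `|x| <= e.
Proof.
move=> e0 h; rewrite [leLHS]/normr /= mx_normrE; apply/bigmax_leP; split => // -[i j] _ /=.
by rewrite (ord1 i).
Qed.

Lemma edot_ge0 n (x : 'rV[R]_n) : 0 <= edot x x.
Proof. by apply: sumr_ge0 => i _; rewrite -expr2 sqr_ge0. Qed.

Lemma norm_sqr_le_edot n (x : 'rV[R]_n) : `|x| ^+ 2 <= edot x x.
Proof.
have : `|x| <= Num.sqrt (edot x x).
  apply: norm_row_le => [|i]; first exact: sqrtr_ge0.
  rewrite -sqrtr_sqr ler_wsqrtr// /edot (bigD1 i)//= -expr2 lerDl.
  by apply: sumr_ge0 => j _; rewrite -expr2 sqr_ge0.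
move=> h; rewrite -[leRHS]sqr_sqrtr ?edot_ge0//.
by rewrite lerXn2r// nnegrE// sqrtr_ge0.
Qed.

Lemma edot_le_norm n (x : 'rV[R]_n) : edot x x <= n%:R * `|x| ^+ 2.
Proof.
rewrite /edot; apply: (@le_trans _ _ (\sum_(i < n) `|x| ^+ 2)).
  apply: ler_sum => i _; rewrite -expr2 -real_normK ?num_real//.
  by rewrite lerXn2r// ?nnegrE// norm_coord.
by rewrite sumr_const card_ord mulr_natl.
Qed.

(** For [r > 0] this is the sup-norm ball; in the coordinatewise form its indicator is a product. *)
Definition cube n (c : 'rV[R]_n) (r : R) : set 'rV[R]_n :=
  [set x | forall i, `|x ord0 i - c ord0 i| < r].

Lemma cube_ball n (c : 'rV[R]_n) r : 0 < r -> cube c r = ball c r.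
Proof.
move=> r0; rewrite mx_norm_ball; apply/seteqP; split => x; rewrite /cube /ball_ /=.
  by move=> h; apply: norm_row_lt => // i; rewrite !mxE distrC.
by move=> h i; rewrite distrC; apply: le_lt_trans h; have := norm_coord (c - x) i; rewrite !mxE.
Qed.

Lemma indic_cube n (c : 'rV[R]_n) r x :
  \1_(cube c r) x = \prod_i \1_(`]c ord0 i - r, c ord0 i + r[%classic) (x ord0 i) :> R.
Proof.
have P i : (x ord0 i \in `]c ord0 i - r, c ord0 i + r[%classic) = (`|x ord0 i - c ord0 i| < r).
  by rewrite mem_setE in_itv/= ltr_distl.
rewrite indicE; have [/set_mem h|h] := boolP (x \in cube c r).
  by rewrite big1// => i _; rewrite indicE P h.
have : ~ cube c r x by move/negP : h => h h'; apply: h; exact: mem_set.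
move=> /existsNP[i /negP hi]; rewrite (bigD1 i)//= indicE P.
by rewrite (negbTE hi) mul0r.
Qed.

Lemma measurable_cube n (c : 'rV[R]_n) r : measurable (cube c r).
Proof.
have -> : cube c r = \bigcap_(i in [set: 'I_n]) (fun x : 'rV[R]_n => x ord0 i) @^-1`
    `]c ord0 i - r, c ord0 i + r[%classic.
  apply/seteqP; split => x /= h i; first by move=> _; rewrite /= in_itv/= -ltr_distl.
  by have := h i Logic.I; rewrite /= in_itv/= -ltr_distl.
apply: fin_bigcap_measurable => // i _; rewrite -[X in measurable X]setTI.
exact: measurable_coord.
Qed.

Lemma leb_cube n (c : 'rV[R]_n) r : 0 <= r -> leb n (cube c r) = ((2 * r) ^+ n)%:E.
Proof.
move=> r0.
have li i : L1 (@lebesgue_measure R) (\1_(`]c ord0 i - r, c ord0 i + r[%classic)).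
  exact: integrable_indic_itv.
have [l1 l2] := @L1_prod n _ li.
have := EFin_I l1; rewrite l2 => h.
have -> : leb n (cube c r) = (\int[leb n]_x (\1_(cube c r) x)%:E)%E.
  by rewrite integral_indic ?setIT//; exact: measurable_cube.
under eq_integral do rewrite indic_cube.
rewrite -h; congr (_%:E); rewrite (eq_bigr (fun=> 2 * r)).
  by rewrite prodr_const card_ord.
move=> i _; apply: EFin_inj; rewrite EFin_I//.
rewrite integral_indic//= setIT.
rewrite [LHS](lebesgue_measure_itv `]c ord0 i - r, c ord0 i + r[) /= lte_fin.
case: ifPn => [_|]; first by rewrite -EFinB; congr (_%:E); ring.
rewrite -leNgt => h'; congr (_%:E); lra.
Qed.

(** The cubes of triple radius are kept inside [A] to leave room for a smooth bump that equals 1 on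
    the small cube. *)
Lemma open_cubes n (A : set 'rV[R]_n) : open A ->
  exists2 P : 'rV[rat]_n * nat -> Prop,
    forall p, P p -> cube (map_mx ratr p.1) (3 * p.2.+1%:R^-1) `<=` A &
    A = \bigcup_(p in P) cube (map_mx ratr p.1) (p.2.+1%:R^-1).
Proof.
move=> oA; exists (fun p => cube (map_mx ratr p.1) (3 * p.2.+1%:R^-1) `<=` A) => //.
apply/seteqP; split => [x Ax|x [p hp px]]; last first.
  apply: hp => i; apply: lt_le_trans (px i) _.
  by rewrite ler_peMl ?invr_ge0// ler1n.
have [e /= e0 he] : nbhs_ball x A by rewrite nbhs_ballE; exact: open_nbhs_nbhs.
(* If the rational centre is within [k.+1%:R^-1] of [x], its cube of triple radius stays within four
   times that distance of [x]. *)
have [k hk] : exists k : nat, 4 * k.+1%:R^-1 < e.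
  have e20 : 0 < e / 4 by rewrite divr_gt0.
  have [k _ /(_ k (leqnn k)) hk] := near_infty_natSinv_lt (PosNum e20).
  by exists k; rewrite mulrC -ltr_pdivlMr.
have k0 : 0 < k.+1%:R^-1 :> R by rewrite invr_gt0.
have /choice[q hq] (i : 'I_n) : exists q : rat, `|x ord0 i - ratr q| < k.+1%:R^-1.
  have [] := @dense_rat R (ball (x ord0 i) (k.+1%:R^-1)).
  - by exists (x ord0 i); exact: ballxx.
  - exact: ball_open.
  - by move=> z [hz [q _ qz]]; exists q; rewrite qz.
have xq : cube (map_mx ratr (\row_i q i)) k.+1%:R^-1 x by move=> i; rewrite !mxE.
exists (\row_i q i, k) => //= y hy; apply: he.
rewrite -cube_ball// => i; have := xq i; have := hy i; rewrite !mxE => h1 h2.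
rewrite (_ : y ord0 i - x ord0 i = (y ord0 i - ratr (q i)) - (x ord0 i - ratr (q i))); last by ring.
apply: le_lt_trans (ler_normB _ _) (lt_trans (ltrD h1 h2) _).
by apply: le_lt_trans hk; move: k0; move: (k.+1%:R^-1 : R) => k' k0; lra.
Qed.

(** The sigma-algebra is generated by the coordinates; open sets enter it as countable unions of
    rational cubes. *)
Lemma open_rV_measurable n (A : set 'rV[R]_n) : open A -> measurable A.
Proof.
move=> /open_cubes[P _ ->]; rewrite bigcup_mkcond.
apply: countable_bigcupT_measurable => [|p]; last by case: ifPn => _ //; exact: measurable_cube.
exact: countableP.
Qed.

Lemma continuous_rV_measurable n (f : 'rV[R]_n -> R) : continuous f ->
  measurable_fun [set: 'rV[R]_n] f.
Proof.
move=> cf; apply: (measurability _ (RGenOpens.measurableE R)).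
move=> _ [_ [a [b ->] <-]]; rewrite setTI; apply: open_rV_measurable.
by move/continuousP : cf; apply; exact: interval_open.
Qed.

Lemma leb_open_gt0 n (A : set 'rV[R]_n) : open A -> A !=set0 -> (0 < leb n A)%E.
Proof.
move=> oA [x Ax].
have [e /= e0 he] : nbhs_ball x A by rewrite nbhs_ballE; exact: open_nbhs_nbhs.
apply: (@lt_le_trans _ _ (leb n (cube x e))).
  by rewrite leb_cube ?(ltW e0)// lte_fin exprn_gt0// mulr_gt0.
apply: le_measure; rewrite ?inE; [exact: measurable_cube|exact: open_rV_measurable|].
by rewrite cube_ball.
Qed.

Lemma ae_open_ex n (A : set 'rV[R]_n) (P : 'rV[R]_n -> Prop) : open A -> A !=set0 ->
  {ae leb n, forall x, P x} -> exists2 x, A x & P x.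
Proof.
move=> oA A0 [N [mN N0 sN]]; apply: contrapT => h.
have : (leb n A <= leb n N)%E.
  apply: le_measure; rewrite ?inE//; first exact: open_rV_measurable.
  by move=> x Ax; apply: sN => /= Px; apply: h; exists x.
by rewrite [leb n N]N0 leNgt leb_open_gt0.
Qed.

Lemma bounded_sub_cube n (A : set 'rV[R]_n) : bounded_set A ->
  exists2 r : R, 0 < r & A `<=` cube 0 r.
Proof.
move=> [M [Mreal hM]]; exists (`|M| + 2); first by rewrite ltr_wpDl.
move=> x Ax i; rewrite mxE subr0; apply: le_lt_trans (norm_coord x i) _.
apply: (@le_lt_trans _ _ (`|M| + 1)); last by rewrite ltrD2l ltr1n.
apply: hM => //=; apply: le_lt_trans (ler_norm _) _.
by rewrite ltrDl.
Qed.

Lemma L1_indic_cube n (c : 'rV[R]_n) r : 0 <= r -> L1 (leb n) (\1_(cube c r)).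
Proof.
move=> r0; apply/L1_ge0P => //.
  by apply: measurable_indic; exact: measurable_cube.
rewrite integral_indic ?setIT; [|by []|exact: measurable_cube].
by rewrite [X in (X < _)%E](leb_cube c r0) ltry.
Qed.

Lemma I_indic_cube n (c : 'rV[R]_n) r : 0 <= r -> I (leb n) (\1_(cube c r)) = (2 * r) ^+ n.
Proof.
move=> r0; apply: EFin_inj; rewrite EFin_I; last exact: L1_indic_cube.
rewrite integral_indic ?setIT; [|by []|exact: measurable_cube].
exact: leb_cube.
Qed.

Lemma L1_bounded_supp n (f : 'rV[R]_n -> R) r M : measurable_fun [set: 'rV[R]_n] f ->
  0 <= r -> (forall x, ~ cube 0 r x -> f x = 0) -> (forall x, `|f x| <= M) -> L1 (leb n) f.
Proof.
move=> mf r0 f0 fM; apply: (L1_le mf (L1Z M (L1_indic_cube 0 r0))) => x.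
rewrite indicE; have [_|/negP h] := boolP (x \in cube 0 r); first by rewrite mulr1.
by rewrite f0 ?normr0 ?mulr0// => h'; apply: h; exact: mem_set.
Qed.

Lemma L1_indicM d (T : measurableType d) (mu : {measure set T -> \bar R}) (A : set T)
  (f : T -> R) : measurable A -> L1 mu f -> L1 mu (fun x => \1_A x * f x).
Proof.
move=> mA lf; apply: (L1_le _ (L1_norm lf)).
  by apply: measurable_funM; [exact: measurable_indic|exact: L1_measurable lf].
by move=> x; rewrite normrM indicE; case: (x \in A); rewrite ?normr1 ?mul1r// normr0 mul0r.
Qed.

Lemma measurable_edot n d (T : measurableType d) (f g : T -> 'rV[R]_n) :
  measurable_fun [set: T] f -> measurable_fun [set: T] g ->
  measurable_fun [set: T] (fun x => edot (f x) (g x)).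
Proof.
move=> mf mg; apply: measurable_sum => i; apply: measurable_funM.
  by have /measurable_fun_rVP := mf; exact.
by have /measurable_fun_rVP := mg; exact.
Qed.

Lemma measurable_rVB n d (T : measurableType d) (f g : T -> 'rV[R]_n) :
  measurable_fun [set: T] f -> measurable_fun [set: T] g ->
  measurable_fun [set: T] (fun x => f x - g x).
Proof.
move=> /measurable_fun_rVP mf /measurable_fun_rVP mg; apply/measurable_fun_rVP => i.
under eq_fun do rewrite !mxE.
by apply: measurable_funB; [exact: mf|exact: mg].
Qed.

Lemma measurable_rVD n d (T : measurableType d) (f g : T -> 'rV[R]_n) :
  measurable_fun [set: T] f -> measurable_fun [set: T] g ->
  measurable_fun [set: T] (fun x => f x + g x).
Proof.
move=> /measurable_fun_rVP mf /measurable_fun_rVP mg; apply/measurable_fun_rVP => i.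
under eq_fun do rewrite !mxE.
by apply: measurable_funD; [exact: mf|exact: mg].
Qed.

End leb.

(** * Smooth functions with compact support *)

Section smooth1.
Context {R : realType}.

(* coinductive smoothness: S is a family closed under differentiation *)
Definition smooth1 (f : R -> R) : Prop := exists S : set (R -> R), S f /\
  forall g, S g -> exists2 g', S g' & forall x : R, is_derive x 1 g (g' x).

Lemma smooth1_derive f : smooth1 f ->
  exists2 f', smooth1 f' & forall x : R, is_derive x 1 f (f' x).
Proof.
by move=> [S [Sf hS]]; have [g Sg fg] := hS _ Sf; exists g => //; exists S.
Qed.

Lemma smooth1_continuous f : smooth1 f -> continuous f.
Proof.
move=> /smooth1_derive[f' _ h] x; have [d _] := h x.
exact/differentiable_continuous/derivable1_diffP.
Qed.

(** Coinduction up to smoothness: a derivative may leave [S] for a function already known to be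
    smooth. *)
Lemma smooth1_ind (S : set (R -> R)) : (forall g, S g ->
  exists2 g', (smooth1 g' \/ S g') & forall x : R, is_derive x 1 g (g' x)) ->
  forall g, S g -> smooth1 g.
Proof.
move=> hS g Sg; exists [set h | smooth1 h \/ S h]; split; first by right.
move=> h [/smooth1_derive[h' sh' d]|/hS[h' sh' d]]; exists h' => //.
by left.
Qed.

(** Finite sums of products of smooth functions are closed under differentiation by the Leibniz
    rule, and both sums and products are special cases. *)
Definition lsum (l : seq ((R -> R) * (R -> R))) : R -> R :=
  fun x => \sum_(p <- l) p.1 x * p.2 x.

Definition all_smooth (l : seq ((R -> R) * (R -> R))) : Prop :=
  foldr (fun p P => [/\ smooth1 p.1, smooth1 p.2 & P]) True l.

Lemma smooth1_lsum l : all_smooth l -> smooth1 (lsum l).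
Proof.
move=> hl; apply: (@smooth1_ind [set h | exists2 l, all_smooth l & h = lsum l]); last by exists l.
move=> _ [{hl}l hl ->].
suff [h' [l' hl' ->] d] : exists2 h', (exists2 l', all_smooth l' & h' = lsum l') &
    forall x : R, is_derive x 1 (lsum l) (h' x).
  by exists (lsum l') => //; right; exists l'.
elim: l hl => [_|[a b] l ih /= [sa sb /ih[_ [l' hl' ->] dl]]].
  exists (lsum [::]); first by exists [::].
  move=> x; rewrite (_ : lsum [::] = cst 0); first exact: is_derive_cst.
  by apply/funext => y; rewrite /lsum big_nil.
have [a' sa' da] := smooth1_derive sa; have [b' sb' db] := smooth1_derive sb.
exists (lsum [:: (a, b'), (a', b) & l']); first by exists [:: (a, b'), (a', b) & l'].
move=> x; rewrite (_ : lsum ((a, b) :: l) = (a * b) + lsum l); last first.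
  by apply/funext => y; rewrite /lsum big_cons.
apply: is_derive_eq.
by rewrite /lsum !big_cons /= addrA /GRing.scale/= [b x * _]mulrC.
Qed.

Lemma smooth1_cst (c : R) : smooth1 (cst c).
Proof.
apply: (@smooth1_ind [set h | exists c, h = cst c]); last by exists c.
by move=> _ [k ->]; exists (cst 0); [right; exists 0|move=> x; exact: is_derive_cst].
Qed.

Lemma smooth1M f g : smooth1 f -> smooth1 g -> smooth1 (fun x => f x * g x).
Proof.
move=> sf sg; rewrite (_ : (fun x => _) = lsum [:: (f, g)]); first exact: smooth1_lsum.
by apply/funext => x; rewrite /lsum big_seq1.
Qed.

Lemma smooth1D f g : smooth1 f -> smooth1 g -> smooth1 (fun x => f x + g x).
Proof.
move=> sf sg; have s1 := smooth1_cst 1.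
rewrite (_ : (fun x => _) = lsum [:: (f, cst 1); (g, cst 1)]); first exact: smooth1_lsum.
by apply/funext => x; rewrite /lsum big_cons big_seq1 /= !mulr1.
Qed.

Lemma smooth1_affine f (a b : R) : smooth1 f -> smooth1 (fun x => f (a * x + b)).
Proof.
move=> sf; apply: (@smooth1_ind [set h | exists c g, smooth1 g /\ h = fun x => c * g (a * x + b)]).
  move=> _ [c [g [/smooth1_derive[g' sg' dg] ->]]].
  exists (fun x => (c * a) * g' (a * x + b)); first by right; exists (c * a), g'.
  move=> x; have d1 : is_derive x 1 (fun x : R => a * x + b) a.
    rewrite (_ : (fun x : R => _) = (a *: id) + cst b)//.
    by apply: is_derive_eq; rewrite addr0 /GRing.scale/= mulr1.
  have d2 := @is_derive1_comp R g (fun x => a * x + b) x _ _ (dg (a * x + b)) d1.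
  rewrite (_ : (fun x => _) = c *: (g \o (fun x => a * x + b)))//.
  by apply: is_derive_eq; rewrite /GRing.scale/=; ring.
exists 1, f; split => //; apply/funext => x; by rewrite mul1r.
Qed.

(** The quotients [g / f ^+ k] with [g] smooth form a class closed under differentiation. *)
Lemma smooth1V f : smooth1 f -> (forall x, f x != 0) -> smooth1 (fun x => (f x)^-1).
Proof.
move=> sf f0; have [f' sf' df] := smooth1_derive sf.
apply: (@smooth1_ind [set h | exists k g, smooth1 g /\ h = fun x => g x * (f x)^-1 ^+ k]).
  move=> _ [k [g [sg ->]]]; have [g' sg' dg] := smooth1_derive sg.
  exists (fun x => (g' x * f x + (- k%:R) * (g x * f' x)) * (f x)^-1 ^+ k.+1).
    right; exists k.+1, (fun x => g' x * f x + - k%:R * (g x * f' x)); split => //.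
    apply: smooth1D; first exact: smooth1M.
    by apply: (smooth1M (smooth1_cst _)); exact: smooth1M.
  move=> x; have d1 := is_deriveV (f0 x) (df x).
  rewrite (_ : (fun x => _) = g * ((fun x => (f x)^-1) ^+ k)); last first.
    by apply/funext => y /=; rewrite /GRing.mul/= exprfctE.
  apply: is_derive_eq; rewrite exprfctE /GRing.scale/=.
  case: k => [|k]; first by rewrite mulr0n !mul0r mulr0 oppr0 mul0r addr0 expr0 expr1 mul1r -mulrA mulfV ?mulr1 ?add0r.
  rewrite /= -mulr_natl -exprVn; have zf := mulfV (f0 x); move: zf; move: (f x)^-1 => z zf.
  apply/subr0_eq; rewrite !exprS.
  rewrite (_ : _ - _ = g' x * z * z ^+ k * (1 - f x * z)); last by ring.
  by rewrite zf subrr mulr0.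
by exists 1%N, (cst 1); split; [exact: smooth1_cst|apply/funext => x; rewrite mul1r expr1].
Qed.

(* t |-> p(1/t) exp(-1/t) for t > 0, extended by 0 *)
Definition flat (p : {poly R}) (t : R) : R :=
  if 0 < t then p.[t^-1] * expR (- t^-1) else 0.

Lemma horner_bound (p : {poly R}) : exists2 C : R, 0 <= C &
  forall x, 1 <= x -> `|p.[x]| <= C * x ^+ size p.
Proof.
exists (\sum_(i < size p) `|p`_i|); first by apply: sumr_ge0.
move=> x x1; rewrite horner_coef (le_trans (ler_norm_sum _ _ _))// mulr_suml.
apply: ler_sum => i _; rewrite normrM normrX ler_wpM2l// ger0_norm; last exact: le_trans x1.
by rewrite ler_weXn2l// ltnW.
Qed.

(** A quadratic bound at the origin is what makes the difference quotients there tend to 0. *)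
Lemma flat_bound (p : {poly R}) : exists2 C : R, 0 <= C &
  forall t, `|t| < 1 -> `|flat p t| <= C * t ^+ 2.
Proof.
(* [m.+1] exceeds the growth exponent [size p] by two; the term of degree [m.+1] of the exponential
   series therefore leaves the factor [t ^+ 2]. *)
have [C C0 hC] := horner_bound p; pose m := ((size p).+1)%N.
exists (C * m.+1`!%:R); first by rewrite mulr_ge0.
move=> t t1; rewrite /flat; case: ifPn => t0; last by rewrite normr0 mulr_ge0 ?sqr_ge0 ?mulr_ge0.
have ti : 1 <= t^-1 by rewrite invf_ge1// ltW// (le_lt_trans (ler_norm _) t1).
have ti0 : 0 < t^-1 by rewrite invr_gt0.
have e1 : (t^-1) ^+ m.+1 / m.+1`!%:R <= expR (t^-1).
  by apply: le_trans (expR_ge1Dxn m (ltW ti0)); rewrite lerDr.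
rewrite normrM (ger0_norm (expR_ge0 _)) expRN.
rewrite ler_pdivrMr ?expR_gt0//; apply: le_trans (hC _ ti) _.
rewrite -mulrA -mulrA ler_wpM2l//.
apply: (@le_trans _ _ (m.+1`!%:R * (t ^+ 2 * ((t^-1) ^+ m.+1 / m.+1`!%:R)))); last first.
  by rewrite -[leRHS]mulrA ler_wpM2l// ler_wpM2l// sqr_ge0.
rewrite [leRHS](_ : _ = t ^+ 2 * (t^-1) ^+ m.+1); last first.
  have : m.+1`!%:R != 0 :> R by rewrite pnatr_eq0 -lt0n fact_gt0.
  by move: (t^-1 ^+ m.+1) (m.+1`!%:R : R) => y w w0; field.
rewrite (_ : t ^+ 2 * t^-1 ^+ m.+1 = t^-1 ^+ size p)// /m [X in _ * X]exprS [X in _ * (_ * X)]exprS.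
by move: (t^-1 ^+ size p) => y; field; rewrite gt_eqF.
Qed.

(** In X = 1/t, the t-derivative of p(X) exp(-X) is X^2 (p - p')(X) exp(-X), so the class is stable.
    At 0 the derivative is 0 by [flat_bound]. *)
Lemma flat_derive (p : {poly R}) (x : R) :
  is_derive x 1 (flat p) (flat ('X^2 * (p - p^`())) x).
Proof.
have [x0|x0|x0] := ltgtP x 0.
- have -> : flat ('X^2 * (p - p^`())) x = 0 by rewrite /flat ltNge (ltW x0).
  apply/is_derive1_caratheodory; exists (fun z => (flat p z) / (z - x)); split.
  + move=> z; have -> : flat p x = 0 by rewrite /flat ltNge (ltW x0).
    have [->|zx] := eqVneq z x; first by rewrite /flat ltNge (ltW x0)/= !subrr mulr0.
    by rewrite subr0 divfK// subr_eq0.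
  + apply: cvg_near_cst; near=> z.
    by rewrite /flat !ltNge (ltW x0) /= ltW ?mul0r//; near: z; exact: lt_nbhsl.
  + by rewrite /flat ltNge (ltW x0)/= mul0r.
- have d1 : is_derive x 1 (fun t : R => t^-1) (- x ^- 2).
    have := @is_deriveV R id x 1 1; rewrite /= (gt_eqF x0) => /(_ isT _).
    by rewrite /GRing.scale/= mulr1; apply.
  have d2 := @is_derive1_comp R (horner p) (fun t => t^-1) x _ _ (is_derive_poly p x^-1) d1.
  have d3 : is_derive x 1 (fun t : R => - t^-1) (x ^- 2).
    by rewrite -[x ^- 2]opprK; exact: is_deriveN.
  have d4 := @is_derive1_comp R expR (fun t => - t^-1) x _ _ (is_derive_expR _) d3.
  have d5 : is_derive x 1 ((horner p \o (fun t => t^-1)) * (expR \o (fun t => - t^-1)))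
      (flat ('X^2 * (p - p^`())) x).
    apply: is_derive_eq; rewrite /flat x0 /GRing.scale/= !hornerE /= -exprVn.
    by ring.
  have [d6 d7] := d5.
  split; first by apply: near_eq_derivable d6 => //; near=> t;
    rewrite /flat ifT//; near: t; exact: lt_nbhsr.
  by rewrite -d7; apply: near_eq_derive => //; near=> t; rewrite /flat ifT//; near: t; exact: lt_nbhsr.
- rewrite x0 (_ : flat _ 0 = 0); last by rewrite /flat ltxx.
  have [C C0 hC] := flat_bound p.
  apply/is_derive1_caratheodory; exists (fun z => flat p z / z); split.
  + move=> z; rewrite {2}/flat ltxx !subr0.
    have [->|z0] := eqVneq z 0; first by rewrite /flat ltxx mulr0.
    by rewrite divfK.
  + have f0 : flat p 0 / 0 = 0 by rewrite /flat ltxx mul0r.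
    rewrite /prop_for /continuous_at f0; apply/cvgrPdist_le => e e0.
    apply/nbhs_ballP; exists (Num.min 1 (e / (C + 1))) => /=.
      by rewrite lt_min ltr01/= divr_gt0// ltr_wpDl.
    move=> z; rewrite /ball/= !sub0r !normrN lt_min => /andP[z1 z2].
    rewrite normrM normfV.
    have [->|z0] := eqVneq z 0; first by rewrite normr0 invr0 mulr0 ltW.
    rewrite ler_pdivrMr ?normr_gt0//; apply: le_trans (hC _ z1) _.
    rewrite -real_normK ?num_real// expr2 mulrA ler_wpM2r//.
    move: z2; rewrite ltr_pdivlMr ?ltr_wpDl// => z2.
    by have := normr_ge0 z; nra.
  + by rewrite /flat ltxx mul0r.
Unshelve. all: by end_near. Qed.

Lemma smooth1_flat p : smooth1 (flat p).
Proof.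
apply: (@smooth1_ind [set h | exists p, h = flat p]); last by exists p.
move=> _ [q ->]; exists (flat ('X^2 * (q - q^`()))); last exact: flat_derive.
by right; exists ('X^2 * (q - q^`())).
Qed.

Definition step (t : R) : R := flat 1 t / (flat 1 t + flat 1 (1 - t)).

Lemma flat1_ge0 t : 0 <= flat 1 t.
Proof. by rewrite /flat; case: ifP => // _; rewrite hornerE mul1r expR_ge0. Qed.

Lemma flat1_gt0 t : 0 < t -> 0 < flat 1 t.
Proof. by rewrite /flat => ->; rewrite hornerE mul1r expR_gt0. Qed.

Lemma step_den_gt0 t : 0 < flat 1 t + flat 1 (1 - t).
Proof.
have [t0|t0] := ltP 0 t; first by rewrite ltr_pwDl ?flat1_gt0 ?flat1_ge0.
by rewrite ltr_wpDl ?flat1_ge0// flat1_gt0//; lra.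
Qed.

Lemma smooth1_step : smooth1 step.
Proof.
apply: (smooth1M (smooth1_flat 1)); apply: smooth1V; last by move=> t; rewrite gt_eqF// step_den_gt0.
apply: (smooth1D (smooth1_flat 1)).
rewrite (_ : (fun x => _) = (fun x => flat 1 ((-1) * x + 1))); last by apply/funext => x; congr flat; ring.
exact: smooth1_affine (smooth1_flat 1).
Qed.

Lemma step_ge0 t : 0 <= step t.
Proof. by rewrite divr_ge0 ?flat1_ge0// ltW// step_den_gt0. Qed.

Lemma step_le1 t : step t <= 1.
Proof. by rewrite ler_pdivrMr ?step_den_gt0// mul1r lerDl flat1_ge0. Qed.

Lemma step0 t : t <= 0 -> step t = 0.
Proof. by move=> t0; rewrite /step /flat ltNge t0 /= mul0r. Qed.

Lemma step1 t : 1 <= t -> step t = 1.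
Proof.
move=> t1; have h : ~~ (0 < 1 - t) by rewrite -leNgt subr_le0.
rewrite /step [flat 1 (1 - t)]/flat (negbTE h) addr0 divff// gt_eqF// flat1_gt0//.
exact: lt_le_trans t1.
Qed.

End smooth1.

Section continuity.
Context {R : realType} (T : topologicalType).
Implicit Types f g : T -> R.

Lemma ctsD f g : continuous f -> continuous g -> continuous (fun x => f x + g x).
Proof. by move=> cf cg x; apply: cvgD; [exact: cf|exact: cg]. Qed.

Lemma ctsM f g : continuous f -> continuous g -> continuous (fun x => f x * g x).
Proof. by move=> cf cg x; apply: cvgM; [exact: cf|exact: cg]. Qed.

End continuity.

(** * Smooth functions of several variables *)

Section smoothV.
Context {R : realType} {n : nat}.
Local Notation V := 'rV[R]_n.
Local Notation e_ i := (delta_mx ord0 i : V).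

(** Continuity is part of the closure condition because existence of partial derivatives does not
    imply it. *)
Definition smoothV (f : V -> R) : Prop := exists S : set (V -> R), S f /\
  forall g, S g -> continuous g /\
    forall i, exists2 g', S g' & forall x, is_derive x (e_ i) g (g' x).

Lemma smoothV_continuous f : smoothV f -> continuous f.
Proof. by move=> [S [Sf /(_ _ Sf)[]]]. Qed.

Lemma smoothV_derive f i : smoothV f ->
  exists2 f', smoothV f' & forall x, is_derive x (e_ i) f (f' x).
Proof.
by move=> [S [Sf hS]]; have [_ /(_ i)[g Sg fg]] := hS _ Sf; exists g => //; exists S.
Qed.

Lemma smoothV_ind (S : set (V -> R)) : (forall g, S g -> continuous g /\ forall i,
  exists2 g', (smoothV g' \/ S g') & forall x, is_derive x (e_ i) g (g' x)) ->
  forall g, S g -> smoothV g.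
Proof.
move=> hS g Sg; exists [set h | smoothV h \/ S h]; split; first by right.
move=> h [sh|/hS[ch dh]]; last by split => // i; have [h' sh' d] := dh i; exists h'.
split=> [|i]; first exact: smoothV_continuous.
by have [h' sh' d] := smoothV_derive i sh; exists h' => //; left.
Qed.

Lemma smoothVP f : smoothV f <-> forall k, class_C k f.
Proof.
split=> [sf k l|cf].
  have key m : smoothV (partials m f).
    elim: m => // i m ih /=; have [g sg dg] := smoothV_derive i ih.
    rewrite (_ : partial i _ = g)//; apply/funext => x; rewrite /partial.
    by have [_ ->] := dg x.
  split=> [_|_ i x]; first exact: smoothV_continuous.
  by have [g _ dg] := smoothV_derive i (key l); have [] := dg x.
exists [set partials l f | l in setT]; split; first by exists [::].
move=> _ [l _ <-]; split; first by have [/(_ (leqnn _))] := cf (size l) l.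
move=> i; exists (partials (i :: l) f); first by exists (i :: l).
move=> x; apply: DeriveDef => //.
by have [_ /(_ (ltnSn _))] := cf (size l).+1 l; exact.
Qed.

Definition vsum (l : seq ((V -> R) * (V -> R))) : V -> R :=
  fun x => \sum_(p <- l) p.1 x * p.2 x.

Definition all_smoothV (l : seq ((V -> R) * (V -> R))) : Prop :=
  foldr (fun p P => [/\ smoothV p.1, smoothV p.2 & P]) True l.

Lemma smoothV_vsum l : all_smoothV l -> smoothV (vsum l).
Proof.
move=> hl; apply: (@smoothV_ind [set h | exists2 l, all_smoothV l & h = vsum l]); last by exists l.
move=> _ [{hl}l hl ->]; split.
  elim: l hl => [_|[a b] l ih /= [sa sb /ih cl]].
    rewrite (_ : vsum [::] = cst 0); first exact: cst_continuous.
    by apply/funext => y; rewrite /vsum big_nil.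
  rewrite (_ : vsum ((a, b) :: l) = (fun x => a x * b x + vsum l x)); last first.
    by apply/funext => y; rewrite /vsum big_cons.
  apply: ctsD cl; apply: ctsM; exact: smoothV_continuous.
move=> i.
suff [h' [l' hl' ->] d] : exists2 h', (exists2 l', all_smoothV l' & h' = vsum l') &
    forall x, is_derive x (e_ i) (vsum l) (h' x).
  by exists (vsum l') => //; right; exists l'.
elim: l hl => [_|[a b] l ih /= [sa sb /ih[_ [l' hl' ->] dl]]].
  exists (vsum [::]); first by exists [::].
  move=> x; rewrite (_ : vsum [::] = cst 0); first exact: is_derive_cst.
  by apply/funext => y; rewrite /vsum big_nil.
have [a' sa' da] := smoothV_derive i sa; have [b' sb' db] := smoothV_derive i sb.
exists (vsum [:: (a, b'), (a', b) & l']); first by exists [:: (a, b'), (a', b) & l'].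
move=> x; rewrite (_ : vsum ((a, b) :: l) = (a * b) + vsum l); last first.
  by apply/funext => y; rewrite /vsum big_cons.
apply: is_derive_eq.
by rewrite /vsum !big_cons /= addrA /GRing.scale/= [b x * _]mulrC.
Qed.

Lemma smoothV_cst (c : R) : smoothV (cst c).
Proof.
apply: (@smoothV_ind [set h | exists c, h = cst c]); last by exists c.
move=> _ [k ->]; split=> [|i]; first exact: cst_continuous.
by exists (cst 0); [right; exists 0|move=> x; exact: is_derive_cst].
Qed.

Lemma smoothVM f g : smoothV f -> smoothV g -> smoothV (fun x => f x * g x).
Proof.
move=> sf sg; rewrite (_ : (fun x => _) = vsum [:: (f, g)]); first exact: smoothV_vsum.
by apply/funext => x; rewrite /vsum big_seq1.
Qed.

Lemma smoothVD f g : smoothV f -> smoothV g -> smoothV (fun x => f x + g x).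
Proof.
move=> sf sg; have s1 := smoothV_cst 1.
rewrite (_ : (fun x => _) = vsum [:: (f, cst 1); (g, cst 1)]); first exact: smoothV_vsum.
by apply/funext => x; rewrite /vsum big_cons big_seq1 /= !mulr1.
Qed.

Lemma smoothVB f g : smoothV f -> smoothV g -> smoothV (fun x => f x - g x).
Proof.
move=> sf sg; have := smoothVD sf (smoothVM (smoothV_cst (-1)) sg).
by under eq_fun do rewrite mulN1r.
Qed.

Lemma smoothV_prod (J : Type) (s : seq J) (F : J -> V -> R) :
  (forall j, smoothV (F j)) -> smoothV (fun x => \prod_(j <- s) F j x).
Proof.
move=> sF; elim: s => [|j s ih]; first by under eq_fun do rewrite big_nil; exact: smoothV_cst.
by under eq_fun do rewrite big_cons; exact: smoothVM.
Qed.

(** The prefactor [c] closes the class: differentiating along the j-th direction multiplies it by 1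
    or by 0. *)
Lemma smoothV_coord (g : R -> R) i : smooth1 g -> smoothV (fun x => g (x ord0 i)).
Proof.
move=> sg; apply: (@smoothV_ind [set h | exists c g, smooth1 g /\ h = fun x : V => c * g (x ord0 i)]); last first.
  by exists 1, g; split => //; apply/funext => x; rewrite mul1r.
move=> _ [c [{sg}g [sg ->]]]; split=> [|j].
  apply: ctsM; [exact: cst_continuous|move=> x].
  apply: (@continuous_comp _ _ _ (fun x : V => x ord0 i) g); first exact: coord_continuous.
  exact: smooth1_continuous.
have [g' sg' dg] := smooth1_derive sg.
exists (fun x => c * (i == j)%:R * g' (x ord0 i)).
  by right; exists (c * (i == j)%:R), g'.
move=> x.
have E h : c * g ((h *: e_ j + x) ord0 i) = c * g (h * (i == j)%:R + x ord0 i).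
  by rewrite !mxE eqxx.
have d1 : is_derive (0 : R) 1 (fun h : R => h * (i == j)%:R + x ord0 i) (i == j)%:R.
  rewrite (_ : (fun h : R => _) = (i == j)%:R *: id + cst (x ord0 i)); last first.
    by apply/funext => h /=; rewrite mulrC.
  by apply: is_derive_eq; rewrite addr0 /GRing.scale/= mulr1.
have d2 := @is_derive1_comp R g _ 0 _ _ (dg _) d1; rewrite mul0r add0r in d2.
have d3 : is_derive (0 : R) 1 (c *: (g \o (fun h : R => h * (i == j)%:R + x ord0 i)))
    (c * (i == j)%:R * g' (x ord0 i)).
  by apply: is_derive_eq; rewrite /GRing.scale/=; ring.
have E2 : (fun h : R => (fun x : V => c * g (x ord0 i)) (h *: e_ j + x)) =
   c *: (g \o (fun h : R => h * (i == j)%:R + x ord0 i)) by apply/funext => h /=; exact: E.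
have EQ : (fun h : R => h^-1 *: (((fun x : V => c * g (x ord0 i)) \o shift x) (h *: e_ j) -
      c * g (x ord0 i))) = (fun h : R => h^-1 *: (((c *: (g \o (fun h : R => h * (i == j)%:R + x ord0 i)))
      \o shift 0) (h *: 1) - (c *: (g \o (fun h : R => h * (i == j)%:R + x ord0 i))) 0)).
  apply/funext => h /=; rewrite E; congr (_ *: (_ - _)).
    by rewrite addr0 [h *: 1]mulr1.
  by rewrite /GRing.scale/= mul0r add0r.
by have [d4 d5] := d3; split; [rewrite /derivable EQ|rewrite /derive EQ].
Qed.

Lemma smoothV_lipschitz f (L : R) : smoothV f ->
  (forall i f', (forall x, is_derive x (e_ i) f (f' x)) -> forall x, `|f' x| <= L) ->
  forall x y : V, `|f x - f y| <= n%:R * L * `|x - y|.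
Proof.
move=> sf fL x y.
(* The path from [y] to [x] that changes one coordinate at a time; the mean value theorem applies on
   each of its [n] segments. *)
pose z (k : nat) : V := \row_i if (i < k)%N then x ord0 i else y ord0 i.
have zn : z n = x by apply/rowP => i; rewrite mxE ltn_ord.
have z0 : z 0%N = y by apply/rowP => i; rewrite mxE.
rewrite -{1}zn -{1}z0 -(telescope_sumr (fun k => f (z k)))// big_mkord.
apply: le_trans (ler_norm_sum _ _ _) _.
rewrite (_ : n%:R * L * `|x - y| = \sum_(i < n) (L * `|x - y|)); last first.
  by rewrite sumr_const card_ord -[RHS]mulr_natl mulrA.
apply: ler_sum => i _.
have [g sg dg] := smoothV_derive i sf.
pose d := x ord0 i - y ord0 i.
have zS : z i.+1 = d *: e_ i + z i.
  apply/rowP => j; rewrite !mxE eqxx /= ltnS leq_eqVlt.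
  have [->|ji] := eqVneq j i.
    by rewrite eqxx /= ltnn mulr1 /d subrK.
  by rewrite [_ == _ :> nat](negbTE ji) /= mulr0 add0r.
have dF (t : R) : is_derive t 1 (fun t : R => f (t *: e_ i + z i)) (g (t *: e_ i + z i)).
  have [h1 h2] := dg (t *: e_ i + z i).
  have E h : f ((h * 1 + t) *: e_ i + z i) = f (h *: e_ i + (t *: e_ i + z i)).
    by rewrite mulr1 scalerDl addrA.
  have EQ : (fun h : R => h^-1 *: (((fun t : R => f (t *: e_ i + z i)) \o shift t) (h *: 1) -
      f (t *: e_ i + z i))) = (fun h : R => h^-1 *: ((f \o shift (t *: e_ i + z i)) (h *: e_ i) -
      f (t *: e_ i + z i))).
    by apply/funext => h; rewrite /= -E.
  by split; [rewrite /derivable EQ|rewrite /derive EQ].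
rewrite zS -[in X in _ - X](add0r (z i)) -(scale0r (e_ i)).
have cF : continuous (fun t : R => f (t *: e_ i + z i)).
  by move=> t; apply/differentiable_continuous/derivable1_diffP; have [] := dF t.
have key a b : a <= b -> `|f (b *: e_ i + z i) - f (a *: e_ i + z i)| <= L * `|b - a|.
  move=> ab; have [c _ ->] := @MVT_segment R (fun t : R => f (t *: e_ i + z i))
    (fun t => g (t *: e_ i + z i)) a b ab (fun t _ => dF t)
    (continuous_subspaceT cF).
  by rewrite normrM ler_wpM2r//; exact: fL dg _.
have : `|f (d *: e_ i + z i) - f (0 *: e_ i + z i)| <= L * `|d|.
  have [d0|d0] := leP 0 d; first by have := key _ _ d0; rewrite subr0.
  by have := key _ _ (ltW d0); rewrite sub0r normrN distrC.
move/le_trans; apply; rewrite ler_wpM2l//; last first.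
  by have := norm_coord (x - y) i; rewrite !mxE.
by apply: le_trans (fL i g dg x).
Qed.

End smoothV.

Section Ccr.
Context {R : realType} {n : nat}.
Local Notation V := 'rV[R]_n.
Local Notation e_ i := (delta_mx ord0 i : V).

Definition csupp (U : set V) (f : V -> R) : Prop :=
  exists K, [/\ compact K, K `<=` U & forall x, ~ K x -> f x = 0].

Definition Ccr (U : set V) (f : V -> R) : Prop := smoothV f /\ csupp U f.

Lemma CcrP U (f : V -> R[i]) :
  Cc_infty U f <-> Ccr U (fun x => complex.Re (f x)) /\ Ccr U (fun x => complex.Im (f x)).
Proof.
split=> [[cf [K [cK KU fK]]]|[[sr [K1 [cK1 KU1 f1]]] [si [K2 [cK2 KU2 f2]]]]].
  split; split; try (by apply/smoothVP => k; have [] := cf k);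
    by exists K; split => // x /fK ->.
split; first by move=> k; split; [move/smoothVP : sr|move/smoothVP : si]; exact.
exists (K1 `|` K2); split; [exact: compactU|by rewrite subUset|].
move=> x /not_orP[h1 h2]; rewrite [f x]complexE (f1 _ h1) (f2 _ h2).
by rewrite mulr0 addr0.
Qed.

Lemma Cc_real U (f : V -> R) : Ccr U f -> Cc_infty U (fun x => (f x)%:C%C).
Proof.
move=> cf; apply/CcrP; split => //=; case: cf => _ [K [cK KU _]].
by split; [exact: smoothV_cst|exists K].
Qed.

Lemma Ccr_sub U1 U2 f : U1 `<=` U2 -> Ccr U1 f -> Ccr U2 f.
Proof.
move=> U12 [sf [K [cK KU fK]]]; split => //; exists K; split => //.
exact: subset_trans KU U12.
Qed.

Lemma csuppM U f g : csupp U f -> csupp U (fun x => g x * f x).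
Proof. by move=> [K [cK KU fK]]; exists K; split => // x /fK ->; rewrite mulr0. Qed.

Lemma CcrM U f g : smoothV g -> Ccr U f -> Ccr U (fun x => g x * f x).
Proof. by move=> sg [sf cf]; split; [exact: smoothVM|exact: csuppM]. Qed.

Lemma csuppD U f g : csupp U f -> csupp U g -> csupp U (fun x => f x + g x).
Proof.
move=> [K1 [cK1 KU1 f1]] [K2 [cK2 KU2 f2]]; exists (K1 `|` K2).
split; [exact: compactU|by rewrite subUset|].
by move=> x /not_orP[h1 h2]; rewrite f1// f2// addr0.
Qed.

Lemma CcrD U f g : Ccr U f -> Ccr U g -> Ccr U (fun x => f x + g x).
Proof. by move=> [sf cf] [sg cg]; split; [exact: smoothVD|exact: csuppD]. Qed.

Lemma CcrZ U k f : Ccr U f -> Ccr U (fun x => k * f x).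
Proof. by move=> cf; apply: (CcrM _ cf); exact: smoothV_cst. Qed.

Lemma CcrB U f g : Ccr U f -> Ccr U g -> Ccr U (fun x => f x - g x).
Proof. by move=> cf cg; have := CcrD cf (CcrZ (-1) cg); under eq_fun do rewrite mulN1r. Qed.

Lemma Ccr0 U : Ccr U (fun=> 0).
Proof. by split; [exact: smoothV_cst|exists set0; split => //; exact: compact0]. Qed.

Lemma csupp_bounded U f : continuous f -> csupp U f -> exists2 M, 0 <= M & forall x, `|f x| <= M.
Proof.
move=> cf [K [cK _ fK]].
have /compact_bounded[M [_ hM]] : compact (f @` K).
  by apply: continuous_compact => //; exact: continuous_subspaceT.
exists (`|M| + 1); first by rewrite addr_ge0.
move=> x; have [Kx|/fK ->] := pselect (K x); last by rewrite normr0 addr_ge0.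
apply: (hM (`|M| + 1)); last by exists x.
by rewrite (le_lt_trans (ler_norm _))// ltrDl.
Qed.

Lemma csupp_cube U f : csupp U f -> exists2 r, 0 < r & forall x, ~ cube 0 r x -> f x = 0.
Proof.
move=> [K [cK _ fK]]; have [r r0 Kr] := bounded_sub_cube (compact_bounded cK).
by exists r => // x nx; apply: fK => /Kr.
Qed.

Lemma csupp_derive U f f' i : (forall x, is_derive x (e_ i) f (f' x)) -> csupp U f -> csupp U f'.
Proof.
move=> df [K [cK KU fK]]; exists K; split => // x nKx.
have oK : open (~` K) by apply: closed_openC; apply: compact_closed => //; exact: norm_hausdorff.
have [_ <-] := df x.
have : \forall y \near x, f y = cst 0 y.
  by apply: filterS (open_nbhs_nbhs (conj oK nKx)) => y; exact: fK.
move/(near_eq_derive (e_ i)) => ->.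
exact: derive_cst.
Qed.

Lemma Ccr_measurable U f : Ccr U f -> measurable_fun [set: V] f.
Proof. by move=> [sf _]; apply: continuous_rV_measurable; exact: smoothV_continuous. Qed.

Lemma Ccr_bounded U f : Ccr U f -> exists2 M, 0 <= M & forall x, `|f x| <= M.
Proof. by move=> [sf cf]; apply: csupp_bounded cf; exact: smoothV_continuous. Qed.

Lemma Ccr_L1 U f : Ccr U f -> L1 (leb n) f.
Proof.
move=> cf; have [M M0 fM] := Ccr_bounded cf; have [r r0 fr] := csupp_cube cf.2.
exact: (L1_bounded_supp (Ccr_measurable cf) (ltW r0) fr fM).
Qed.

Lemma Ccr_L2 U f : Ccr U f -> L2 (leb n) f.
Proof.
move=> cf; split; first exact: Ccr_measurable cf.
exact: Ccr_L1 (CcrM cf.1 cf).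
Qed.

Lemma Ccr_lipschitz U f : Ccr U f -> exists2 L, 0 <= L & forall x y, `|f x - f y| <= L * `|x - y|.
Proof.
move=> [sf cf].
have /choice[M hM] (i : 'I_n) : exists M, 0 <= M /\ forall f', (forall x, is_derive x (e_ i) f (f' x)) ->
    forall x, `|f' x| <= M.
  have [g sg dg] := smoothV_derive i sf.
  have [M M0 hM] := csupp_bounded (smoothV_continuous sg) (csupp_derive dg cf).
  exists M; split => // f' df' x; have [_ <-] := df' x; have [_ ->] := dg x; exact: hM.
exists (n%:R * \sum_i M i); first by rewrite mulr_ge0// sumr_ge0// => i _; have [] := hM i.
apply: smoothV_lipschitz => // i f' df x; have [_ h] := hM i.
apply: le_trans (h _ df x) _; rewrite (bigD1 i)//= lerDl sumr_ge0// => j _.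
by have [] := hM j.
Qed.

Lemma Ccr_schwartz U (f : V -> R[i]) : Cc_infty U f -> schwartz f.
Proof.
move=> cf; split; first by have [] := cf.
move=> m b; rewrite /mderiv; set l := flatten _.
have key g k : Ccr U g -> exists M : R, forall x, (1 + enorm x) ^+ k * `|partials l g x| <= M.
  move=> cg; have {cg} : Ccr U (partials l g).
    elim: l => // i l ih /=; have [g' sg' dg] := smoothV_derive i ih.1.
    rewrite (_ : partial i _ = g'); last by apply/funext => x; have [_ <-] := dg x.
    by split => //; exact: csupp_derive dg ih.2.
  move=> cg; have [M M0 gM] := Ccr_bounded cg; have [r r0 gr] := csupp_cube cg.2.
  exists ((1 + Num.sqrt (n%:R * r ^+ 2)) ^+ k * M) => x.
  have B0 : 0 <= 1 + Num.sqrt (n%:R * r ^+ 2) by rewrite addr_ge0 ?sqrtr_ge0.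
  have [cx|/gr ->] := pselect (cube 0 r x); last first.
    by rewrite normr0 mulr0 mulr_ge0// exprn_ge0.
  apply: ler_pM => //; first by rewrite exprn_ge0// addr_ge0 ?sqrtr_ge0.
  apply: lerXn2r; rewrite ?nnegrE ?addr_ge0 ?sqrtr_ge0//.
  rewrite lerD2l ler_wsqrtr//; apply: le_trans (edot_le_norm x) _.
  rewrite ler_wpM2l// lerXn2r ?nnegrE ?(ltW r0)//.
  by apply: norm_row_le (ltW r0) _ => i; have := cx i; rewrite mxE subr0 => /ltW.
have [/(key _ m)[M1 h1] /(key _ m)[M2 h2]] := (CcrP U f).1 cf.
exists (M1 + M2) => x; apply: le_trans (lerD (h1 x) (h2 x)).
rewrite -mulrDr ler_wpM2l//; first by rewrite exprn_ge0// addr_ge0 ?sqrtr_ge0.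
move: (partials _ _ _) (partials _ _ _) => a c.
suff : Num.sqrt (c ^+ 2 + a ^+ 2) <= `|c| + `|a| by [].
have ca0 : 0 <= `|c| + `|a| by rewrite addr_ge0.
rewrite -(ger0_norm ca0) -sqrtr_sqr ler_wsqrtr// sqrrD !real_normK ?num_real//.
by rewrite addrAC lerDl mulrn_wge0// mulr_ge0.
Qed.

(** A product of one-dimensional plateaus: 1 on the cube of radius [r], and 0 off the cube of radius
    [2 * r]. *)
Definition bump (c : V) (r : R) (x : V) : R :=
  \prod_i (step (r^-1 * x ord0 i + (2 - r^-1 * c ord0 i)) *
           step (- r^-1 * x ord0 i + (2 + r^-1 * c ord0 i))).

Lemma smoothV_bump c r : smoothV (bump c r).
Proof.
apply: smoothV_prod => i; apply: smoothVM; apply: (@smoothV_coord _ _ (fun t => step (_ * t + _)));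
  exact: smooth1_affine smooth1_step.
Qed.

Lemma bump_ge0 c r x : 0 <= bump c r x.
Proof. by apply: prodr_ge0 => i _; rewrite mulr_ge0 ?step_ge0. Qed.

Lemma bump_le1 c r x : bump c r x <= 1.
Proof. by apply: prodr_ile1 => i _; rewrite mulr_ge0 ?step_ge0//= mulr_ile1 ?step_ge0 ?step_le1. Qed.

Lemma bump1 (c : V) (r : R) (x : V) : 0 < r -> (forall i, `|x ord0 i - c ord0 i| <= r) -> bump c r x = 1.
Proof.
move=> r0 h; apply: big1 => i _; have := h i; rewrite ler_norml => /andP[h1 h2].
rewrite !step1 ?mulr1//.
  rewrite (_ : _ + _ = 1 + (r + c ord0 i - x ord0 i) / r); last by field; rewrite gt_eqF.
  by rewrite lerDl divr_ge0 ?(ltW r0)//; lra.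
rewrite (_ : _ + _ = 1 + (r - c ord0 i + x ord0 i) / r); last by field; rewrite gt_eqF.
by rewrite lerDl divr_ge0 ?(ltW r0)//; lra.
Qed.

Lemma bump0 (c : V) (r : R) (x : V) (i : 'I_n) : 0 < r -> 2 * r <= `|x ord0 i - c ord0 i| -> bump c r x = 0.
Proof.
move=> r0 h; rewrite /bump (bigD1 i)//= [X in X * _ = _](_ : _ = 0) ?mul0r//.
have [h1|h1] := leP 0 (x ord0 i - c ord0 i).
  rewrite [X in _ * X]step0 ?mulr0//.
  rewrite (_ : _ + _ = (2 * r - (x ord0 i - c ord0 i)) / r); last by field; rewrite gt_eqF.
  by rewrite pmulr_lle0 ?invr_gt0//; move: h; rewrite ger0_norm//; lra.
rewrite step0 ?mul0r//.
rewrite (_ : _ + _ = (2 * r + (x ord0 i - c ord0 i)) / r); last by field; rewrite gt_eqF.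
by rewrite pmulr_lle0 ?invr_gt0//; move: h; rewrite ltr0_norm//; lra.
Qed.

Lemma compact_ccube (c : V) (r : R) : compact [set x : V | forall i, `|x ord0 i - c ord0 i| <= r].
Proof.
have := @rV_compact R n (fun i => `[c ord0 i - r, c ord0 i + r]%classic) (fun i => @segment_compact _ _ _).
congr compact; apply/seteqP; split => x /= h i; have := h i;
  by rewrite /= in_itv/= ler_distl.
Qed.

Lemma Ccr_bump (U : set V) c r : 0 < r -> cube c (3 * r) `<=` U -> Ccr U (bump c r).
Proof.
move=> r0 cU; split; first exact: smoothV_bump.
exists [set x : V | forall i, `|x ord0 i - c ord0 i| <= 2 * r]; split.
- exact: compact_ccube.
- by apply: subset_trans cU => x h i; apply: le_lt_trans (h i) _; lra.
- by move=> x /existsNP[i /negP]; rewrite -ltNge => /ltW; exact: bump0.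
Qed.

(** Finitely many cubes on which a bump equals 1 cover [K]. One minus the product of the complements
    [1 - bump] is 1 as soon as one of the bumps is, and it is supported in the union of their
    supports. *)
Lemma cutoff (U K : set V) : open U -> compact K -> K `<=` U ->
  exists2 chi, Ccr U chi & forall x, K x -> chi x = 1.
Proof.
move=> oU cK KU.
have /choice[r hr] (x : V) : exists r : R, 0 < r /\ (K x -> cube x (3 * r) `<=` U).
  have [Kx|nKx] := pselect (K x); last by exists 1.
  have [e /= e0 he] : nbhs_ball x U by rewrite nbhs_ballE; apply: open_nbhs_nbhs; split => //; exact: KU.
  exists (e / 3); split; first by rewrite divr_gt0.
  by move=> _; rewrite mulrC divfK// cube_ball.
move: cK; rewrite compact_cover => /(_ V K (fun x => cube x (r x)))[].
- by move=> x Kx; rewrite cube_ball ?(hr x).1//; exact: ball_open.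
- move=> x Kx; exists x => // i; rewrite subrr normr0; exact: (hr x).1.
move=> D DK KD.
exists (fun x => 1 - \prod_(c <- finmap.enum_fset D) (1 - bump c (r c) x)).
  have : forall l : seq V, (forall c, c \in l -> K c) ->
      Ccr U (fun x => 1 - \prod_(c <- l) (1 - bump c (r c) x)).
    elim=> [_|c l ih hl].
      rewrite (_ : (fun x => _) = fun=> 0); first exact: Ccr0.
      by apply/funext => x; rewrite big_nil subrr.
    rewrite (_ : (fun x => _) = (fun x => (1 - \prod_(c <- l) (1 - bump c (r c) x)) +
       (\prod_(c <- l) (1 - bump c (r c) x)) * bump c (r c) x)); last first.
      by apply/funext => x; rewrite big_cons; ring.
    apply: CcrD; first by apply: ih => c' h; apply: hl; rewrite inE h orbT.
    apply: CcrM.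
      apply: smoothV_prod => c'; apply: smoothVB; [exact: smoothV_cst|exact: smoothV_bump].
    apply: Ccr_bump; first exact: (hr c).1.
    by apply: (hr c).2; apply: hl; rewrite inE eqxx.
  apply => c cD; apply/set_mem; exact: DK.
move=> x /KD[c /= cD xc].
rewrite (big_rem c)//= bump1 ?subrr ?mul0r ?subr0//; first exact: (hr c).1.
by move=> i; exact: ltW (xc i).
Qed.

End Ccr.

Lemma ge0_I0_ae d (T : measurableType d) (R : realType) (mu : {measure set T -> \bar R})
  (f : T -> R) : L1 mu f -> (forall x, 0 <= f x) -> I mu f = 0 -> {ae mu, forall x, f x = 0}.
Proof.
move=> lf f0 If; have mf : measurable_fun [set: T] (EFin \o f).
  by apply/measurable_EFinP; exact: L1_measurable lf.
have : (\int[mu]_x `|(EFin \o f) x| = 0)%E.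
  rewrite (eq_integral (fun x => (f x)%:E)) -?EFin_I ?If// => x _.
  by rewrite /= ger0_norm.
move/(ae_eq_integral_abs mu measurableT mf); apply: filterS => x /(_ Logic.I) /=.
by move=> [].
Qed.

(** * The fundamental lemma of the calculus of variations *)

Section fundamental.
Context {R : realType} {n : nat}.
Local Notation V := 'rV[R]_n.

Definition box (a b : V) : set V := [set x | forall i, a ord0 i < x ord0 i < b ord0 i].

Definition boxes : set (set V) := [set A | exists a b, A = box a b].

Lemma cube_box (c : V) r : cube c r = box (c - const_mx r) (c + const_mx r).
Proof.
apply/seteqP; split => x h i; have := h i; rewrite !mxE ltr_distl//.
Qed.

Lemma boxes_setI : setI_closed boxes.
Proof.
move=> _ _ [a [b ->]] [a' [b' ->]].
exists (\row_i Num.max (a ord0 i) (a' ord0 i)), (\row_i Num.min (b ord0 i) (b' ord0 i)).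
apply/seteqP; split => x /=.
  move=> [h1 h2] i; rewrite !mxE gt_max lt_min.
  by have /andP[-> ->] := h1 i; have /andP[-> ->] := h2 i.
move=> h; split => i; have := h i; rewrite !mxE gt_max lt_min => /andP[/andP[? ?] /andP[? ?]];
  exact/andP.
Qed.

Lemma measurable_boxes (A : set V) : measurable A -> <<s boxes >> A.
Proof.
have sB := smallest_sigma_algebra [set: V] boxes.
have oB (U : set V) : open U -> <<s boxes >> U.
  move=> /open_cubes[P _ ->]; rewrite bigcup_mkcond.
  apply: (@countable_bigcupT_measurable _ (g_sigma_algebraType boxes)) => [|p].
    exact: countableP.
  case: ifPn => _; last exact: (@measurable0 _ (g_sigma_algebraType boxes)).
  by apply: sub_sigma_algebra; rewrite cube_box; eexists; eexists.
apply: smallest_sub => // B; rewrite -bigcup_seq => -[i _ [C mC <-]]; rewrite setTI.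
have mi : measurable_fun [set: g_sigma_algebraType boxes]
    (fun x : g_sigma_algebraType boxes => (x : V) ord0 i : R).
  apply: (measurability _ (RGenOpens.measurableE R)).
  move=> _ [_ [a [b ->] <-]]; rewrite setTI; apply: oB.
  have /continuousP := @coord_continuous R 1 n ord0 i; apply; exact: interval_open.
by have := mi measurableT C mC; rewrite setTI.
Qed.

Lemma measurable_box a b : measurable (box a b).
Proof.
have -> : box a b = \bigcap_(i in [set: 'I_n]) (fun x : V => x ord0 i) @^-1`
    `]a ord0 i, b ord0 i[%classic.
  apply/seteqP; split => x /= h i; first by move=> _; rewrite /= in_itv; exact: h.
  by have := h i Logic.I; rewrite /= in_itv.
apply: fin_bigcap_measurable => // i _; rewrite -[X in measurable X]setTI.
exact: measurable_coord.
Qed.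

Lemma box_bounded a b : exists2 r : R, 0 < r & box a b `<=` cube 0 r.
Proof.
exists (\sum_i (`|a ord0 i| + `|b ord0 i|) + 1).
  by rewrite ltr_wpDl// sumr_ge0// => i _; rewrite addr_ge0.
move=> x h i; rewrite mxE subr0 (bigD1 i)//= -addrA.
apply: (@lt_le_trans _ _ (`|a ord0 i| + `|b ord0 i| + 1)); last first.
  by rewrite lerD2l lerDr sumr_ge0// => j _; rewrite addr_ge0.
have /andP[h1 h2] := h i; rewrite ltr_norml.
have a1 := ler_norm (- a ord0 i); have a2 := ler_norm (b ord0 i); rewrite normrN in a1.
by have := normr_ge0 (a ord0 i); have := normr_ge0 (b ord0 i) => b0 a0; apply/andP; split; lra.
Qed.

(** Dynkin's argument: the sets over which [w] has integral 0 form a lambda-system containing the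
    boxes, which are stable under intersection. It then contains the sets where [w] has a given
    sign. *)
Lemma ae0_boxes (w : V -> R) : L1 (leb n) w ->
  (forall a b, I (leb n) (fun x => \1_(box a b) x * w x) = 0) ->
  {ae leb n, forall x, w x = 0}.
Proof.
move=> lw w0; have mw := L1_measurable lw.
pose D := [set A : set V | measurable A /\ I (leb n) (fun x => \1_A x * w x) = 0].
have lA (A : set V) : measurable A -> L1 (leb n) (fun x => \1_A x * w x).
  by move=> mA; exact: L1_indicM.
have bnd (A : set V) x : `|\1_A x * w x| <= `|w x|.
  by rewrite normrM indicE; case: (x \in A); rewrite ?normr1 ?mul1r// normr0 mul0r.
have cov (F : nat -> set V) : (forall k, measurable (F k)) -> {homo F : k m / (k <= m)%N >-> k `<=` m} ->
    I (leb n) (fun x => \1_(F k) x * w x) @[k --> \oo] --> I (leb n) (fun x => \1_(\bigcup_k F k) x * w x).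
  move=> mF ndF.
  have mU : measurable (\bigcup_k F k) by exact: bigcupT_measurable.
  have [|||||_] := @dct _ _ _ (leb n) (fun k x => \1_(F k) x * w x)
    (fun x => \1_(\bigcup_k F k) x * w x) (fun x => `|w x|).
  - by move=> k; apply: measurable_funM => //; exact: measurable_indic.
  - by apply: measurable_funM => //; exact: measurable_indic.
  - apply: aeW => x.
    have [[k _ Fkx]|nF] := pselect ((\bigcup_k F k) x).
      apply: cvg_near_cst; exists k => // m /= km.
      by congr (_ * _); rewrite !indicE !mem_set//; [exists k|exact: ndF Fkx].
    apply: cvg_near_cst; apply: nearW => k.
    by congr (_ * _); rewrite !indicE !memNset// => h; apply: nF; exists k.
  - exact: L1_norm.
  - by move=> k; apply: aeW => x; exact: bnd.
  exact.
(* The whole space must belong to the system; it is reached as an increasing union of cubes. *)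
have w0T : I (leb n) w = 0.
  pose F k := cube (0 : V) k%:R.
  have E : \bigcup_k F k = [set: V].
    apply/seteqP; split => // x _.
    have [k hk] : exists k : nat, `|x| < k%:R by exists (Num.bound `|x|); exact: archi_boundP.
    by exists k => // i; rewrite mxE subr0; exact: le_lt_trans (norm_coord x i) hk.
  have ndF : {homo F : k m / (k <= m)%N >-> k `<=` m}.
    by move=> k m km x h' i; apply: lt_le_trans (h' i) _; rewrite ler_nat.
  have := cov F (fun k => measurable_cube _ _) ndF; rewrite E.
  rewrite (_ : (fun k => I _ _) = fun=> 0); last first.
    by apply/funext => k; rewrite [F _]cube_box w0.
  rewrite (_ : (fun x => _) = w); last by apply/funext => x; rewrite indicT mul1r.
  by move=> h; apply/esym; apply: (cvg_unique _ (cvg_cst 0) h).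
have lD : lambda_system [set: V] D.
  split => //.
  - split; first exact: measurableT.
    by rewrite -[RHS]w0T; congr I; apply/funext => x; rewrite indicT mul1r.
  - move=> A B BA [mA A0] [mB B0]; split; first exact: measurableD.
    rewrite -[RHS](subrr 0) -{1}A0 -B0 -I_B; [|exact: lA|exact: lA].
    congr I; apply/funext => x; rewrite -mulrBl; congr (_ * _).
    rewrite !indicE in_setD; have [xB|xB] := boolP (x \in B); last by rewrite subr0 andbT.
    by rewrite (mem_set (BA _ (set_mem xB))) subrr.
  - move=> F ndF DF; have mF k : measurable (F k) by have [] := DF k.
    split; first exact: bigcupT_measurable.
    apply: (cvg_unique _ (cov F mF _)) => //; first by move=> k m /ndF; rewrite subsetEset.
    rewrite (_ : (fun k => _) = fun=> 0); first exact: cvg_cst.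
    by apply/funext => k; have [] := DF k.
have key (A : set V) : measurable A -> I (leb n) (fun x => \1_A x * w x) = 0.
  move=> /measurable_boxes mA.
  have [] // := @lambda_system_subset V boxes boxes_setI setT D lD _ _ A mA.
  by move=> _ [a [b ->]]; split; [exact: measurable_box|exact: w0].
have mp : measurable (w @^-1` `[0, +oo[%classic).
  by rewrite -[X in measurable X]setTI; exact: mw.
set A := w @^-1` `[0, +oo[%classic in mp.
have inA x : (x \in A) = (0 <= w x).
  by apply/idP/idP => [/set_mem|h]; rewrite /A/= ?in_itv/= ?andbT//; apply/mem_set; rewrite /= in_itv/= andbT.
have h1 : {ae leb n, forall x, \1_A x * w x = 0}.
  apply: ge0_I0_ae (lA _ mp) _ (key _ mp) => x.
  by rewrite indicE inA; case: (leP 0 (w x)) => [h|_] /=; rewrite ?mul1r ?mul0r.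
have h2 : {ae leb n, forall x, - (\1_(~` A) x * w x) = 0}.
  apply: ge0_I0_ae; first exact: L1N (lA _ (measurableC mp)).
    move=> x; rewrite indicE in_setC inA; case: (leP 0 (w x)) => [h|h] /=.
      by rewrite mul0r oppr0.
    by rewrite mul1r oppr_ge0 ltW.
  by rewrite I_N ?key ?oppr0//; [exact: measurableC|exact: lA (measurableC mp)].
apply: filterS2 h1 h2 => x; rewrite !indicE in_setC inA.
by case: (leP 0 (w x)) => /= _; rewrite ?mul1r// => _ /eqP; rewrite oppr_eq0 => /eqP.
Qed.

(** Unlike [bump], this is supported in the closed box itself: the transition takes place inside, in
    a layer of width [1 / m], so the limit is the indicator of the open box. *)
Definition bbump (a b : V) (m : nat) (x : V) : R :=
  \prod_i (step (m%:R * x ord0 i + - (m%:R * a ord0 i)) * step (- m%:R * x ord0 i + m%:R * b ord0 i)).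

Lemma Ccr_bbump a b m : (0 < m)%N -> Ccr [set: V] (bbump a b m).
Proof.
move=> m0; have mR : 0 < m%:R :> R by rewrite ltr0n.
split.
  apply: smoothV_prod => i; apply: smoothVM; apply: (@smoothV_coord _ _ (fun t => step (_ * t + _)));
    exact: smooth1_affine smooth1_step.
exists [set x : V | forall i, a ord0 i <= x ord0 i <= b ord0 i]; split => //.
  have := @rV_compact R n (fun i => `[a ord0 i, b ord0 i]%classic) (fun i => @segment_compact _ _ _).
  congr compact; apply/seteqP; split => x /= h i; have := h i; by rewrite /= in_itv/=.
move=> x /existsNP[i /negP]; rewrite negb_and -!ltNge => h.
rewrite /bbump (bigD1 i)//= [X in X * _ = _](_ : _ = 0) ?mul0r//.
have [h1|h1] := orP h.
  by rewrite step0 ?mul0r// -mulrBr pmulr_rle0// subr_le0 ltW.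
by rewrite [X in _ * X]step0 ?mulr0// mulNr addrC -mulrBr pmulr_rle0// subr_le0 ltW.
Qed.

Lemma bbump_ge0 a b m x : 0 <= bbump a b m x.
Proof. by apply: prodr_ge0 => i _; rewrite mulr_ge0 ?step_ge0. Qed.

Lemma bbump_le1 a b m x : bbump a b m x <= 1.
Proof. by apply: prodr_ile1 => i _; rewrite mulr_ge0 ?step_ge0//= mulr_ile1 ?step_ge0 ?step_le1. Qed.

Lemma bbump_out a b m x : ~ box a b x -> bbump a b m x = 0.
Proof.
move=> /existsNP[i /negP]; rewrite negb_and -!leNgt => h.
rewrite /bbump (bigD1 i)//= [X in X * _ = _](_ : _ = 0) ?mul0r//.
have [h1|h1] := orP h.
  by rewrite step0 ?mul0r// -mulrBr mulr_ge0_le0// subr_le0.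
by rewrite [X in _ * X]step0 ?mulr0// mulNr addrC -mulrBr mulr_ge0_le0// subr_le0.
Qed.

Lemma bbump_cvg a b x : bbump a b m.+1 x @[m --> \oo] --> (\1_(box a b) x : R).
Proof.
have [xb|xb] := pselect (box a b x); last first.
  rewrite indicE memNset//; apply: cvg_near_cst; apply: nearW => m; exact: bbump_out.
rewrite indicE mem_set//; apply: cvg_near_cst.
have /choice[N hN] (i : 'I_n) : exists N : nat, forall m : nat, (N <= m)%N ->
    1 <= m%:R * (x ord0 i - a ord0 i) /\ 1 <= m%:R * (b ord0 i - x ord0 i).
  have /andP[h1 h2] := xb i.
  pose e := Num.min (x ord0 i - a ord0 i) (b ord0 i - x ord0 i).
  have e0 : 0 < e by rewrite lt_min !subr_gt0 h1 h2.
  exists (Num.bound e^-1) => m Nm.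
  have me : 1 <= m%:R * e.
    rewrite -ler_pdivrMr// div1r; apply: le_trans (ltW (archi_boundP _)) _; last by rewrite ler_nat.
    by rewrite invr_ge0 ltW.
  by split; apply: le_trans me _; rewrite ler_wpM2l// /e ge_min lexx ?orbT.
exists (\sum_i N i)%N => // m /= hm; apply: big1 => i _.
have Nm : (N i <= m.+1)%N.
  by apply: leq_trans (leqW hm); rewrite (bigD1 i)//= leq_addr.
have [h1 h2] := hN i _ Nm.
rewrite !step1 ?mulr1//; first by rewrite mulNr addrC -mulrBr.
by rewrite -mulrBr.
Qed.

(** Dominated convergence along [bbump] passes from test functions to boxes. As [w] is only
    integrable on cubes, [ae0_boxes] is applied to its restriction to each large cube. *)
Lemma ae0_test (w : V -> R) : measurable_fun [set: V] w ->
  (forall r, 0 < r -> L1 (leb n) (fun x => \1_(cube 0 r) x * w x)) ->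
  (forall phi, Ccr [set: V] phi -> I (leb n) (fun x => w x * phi x) = 0) ->
  {ae leb n, forall x, w x = 0}.
Proof.
move=> mw lw w0.
have bx a b : I (leb n) (fun x => \1_(box a b) x * w x) = 0.
  have [r r0 br] := box_bounded a b.
  have [|||||_] := @dct _ _ _ (leb n) (fun m x => w x * bbump a b m.+1 x)
    (fun x => \1_(box a b) x * w x) (fun x => `|\1_(cube 0 r) x * w x|).
  - move=> m; apply: measurable_funM => //.
    exact: Ccr_measurable (Ccr_bbump a b (ltn0Sn m)).
  - by apply: measurable_funM => //; apply: measurable_indic; exact: measurable_box.
  - apply: aeW => x; rewrite [X in _ --> X]mulrC; apply: cvgMr; exact: bbump_cvg.
  - exact: L1_norm (lw r r0).
  - move=> m; apply: aeW => x; rewrite !normrM mulrC ler_wpM2r//.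
    rewrite ger0_norm ?bbump_ge0// indicE.
    have [xc|/negP xc] := boolP (x \in cube 0 r); first by rewrite normr1 bbump_le1.
    by rewrite normr0 bbump_out// => /br xc'; apply: xc; exact: mem_set.
  rewrite (_ : (fun m => _) = fun=> 0); last first.
    by apply/funext => m; exact: w0 (Ccr_bbump a b (ltn0Sn m)).
  by move=> h; apply: (cvg_unique _ h (cvg_cst 0)).
have key (k : nat) : {ae leb n, forall x, \1_(cube 0 k.+1%:R) x * w x = 0}.
  apply: ae0_boxes; first exact: lw.
  move=> a b; rewrite cube_box.
  have [a' [b' E]] : boxes (box a b `&` box (0 - const_mx k.+1%:R) (0 + const_mx k.+1%:R)).
    by apply: boxes_setI; eexists; eexists.
  rewrite -[RHS](bx a' b') -E; congr I; apply/funext => x.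
  by rewrite mulrA indicI.
have := ae_foralln key; apply: filterS => x h.
have := h (Num.bound `|x|); rewrite indicE mem_set ?mul1r// => i.
rewrite mxE subr0; apply: le_lt_trans (norm_coord x i) _.
by apply: lt_trans (archi_boundP _) _ => //; rewrite ltr_nat.
Qed.

(** Multiplying by a bump localises: testing [w * bump] with any [phi] amounts to testing [w] with
    [phi * bump], which is supported in [U]. Countably many cubes cover [U]. *)
Lemma ae0_test_open (U : set V) (w : V -> R) : open U -> measurable_fun [set: V] w ->
  (forall phi, Ccr U phi -> L1 (leb n) (fun x => w x * phi x) /\ I (leb n) (fun x => w x * phi x) = 0) ->
  {ae leb n, forall x, U x -> w x = 0}.
Proof.
move=> oU mw h; have [P PU UE] := open_cubes oU.
have key (p : 'rV[rat]_n * nat) : P p -> {ae leb n, forall x, cube (map_mx ratr p.1) (p.2.+1%:R^-1) x -> w x = 0}.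
  move=> Pp; set c := map_mx _ _; set r : R := _^-1.
  have r0 : 0 < r by rewrite invr_gt0.
  have cb : Ccr U (bump c r) by exact: Ccr_bump (PU p Pp).
  have [lb _] := h _ cb.
  have : {ae leb n, forall x, w x * bump c r x = 0}.
    apply: ae0_test; first exact: L1_measurable lb.
      by move=> r' r'0; apply: L1_indicM => //; exact: measurable_cube.
    move=> phi cphi; rewrite (_ : (fun x => _) = (fun x => w x * (phi x * bump c r x))).
      by have [] := h _ (CcrM cphi.1 cb).
    by apply/funext => x; rewrite -mulrA [bump _ _ _ * _]mulrC.
  apply: filterS => x hx xc; move: hx; rewrite bump1 ?mulr1// => i.
  exact: ltW (xc i).
have : {ae leb n, forall x, forall k, if unpickle k is Some p then P p -> cube (map_mx ratr p.1) (p.2.+1%:R^-1) x -> w x = 0 else True}.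
  apply: ae_foralln => k; case: (unpickle k) => [p|]; last by apply: aeW.
  have [/key|nP] := pselect (P p); first by apply: filterS => x hx _.
  by apply: aeW => x /nP.
apply: filterS => x hx; rewrite UE => -[p Pp xp].
by have := hx (pickle p); rewrite pickleK; apply.
Qed.

End fundamental.

(** Valid for every measurable [f], since [I] is [fine] applied to a difference of two Tonelli
    integrals, each measurable in the parameter. *)
Lemma measurable_I2 d1 d2 (T1 : measurableType d1) (T2 : measurableType d2) (R : realType)
  (m2 : {sigma_finite_measure set T2 -> \bar R}) (f : T1 * T2 -> R) :
  measurable_fun [set: T1 * T2] f ->
  measurable_fun [set: T1] (fun x => I m2 (fun y => f (x, y))).
Proof.
move=> mf; have mE : measurable_fun [set: T1 * T2] (EFin \o f) by exact/measurable_EFinP.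
rewrite (_ : (fun x => _) = fine \o (fun x => \int[m2]_y ((EFin \o f)^\+ (x, y)) -
    \int[m2]_y ((EFin \o f)^\- (x, y)))%E); last first.
  apply/funext => x /=; rewrite /I /Rintegral integralE; congr (fine (_ - _)).
    by congr (integral _ _ _); exact: (funepos_comp (EFin \o f) (fun y => (x, y))).
  by congr (integral _ _ _); exact: (funeneg_comp (EFin \o f) (fun y => (x, y))).
apply: (measurableT_comp (fine_measurable measurableT)); apply: emeasurable_funB.
  apply: (measurable_fun_fubini_tonelli_F ((EFin \o f)^\+%E)) => //.
  exact: measurable_funepos.
apply: (measurable_fun_fubini_tonelli_F ((EFin \o f)^\-%E)) => //.
exact: measurable_funeneg.
Qed.

(** * The Hartley transform on L^2 *)

Section weight1.
Context {R : realType}.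
Local Notation leb1 := (@lebesgue_measure R).

Lemma L1_oneDsqrV : L1 leb1 (fun t => 2 / (1 + t ^+ 2)) /\ 0 < I leb1 (fun t => 2 / (1 + t ^+ 2)).
Proof.
have E : (fun t : R => 2 / (1 + t ^+ 2)) = (fun t => 2 * (oneDsqr t)^-1) by [].
have mo : measurable_fun [set: R] (fun t : R => (oneDsqr t)^-1).
  by apply: continuous_measurable_fun; exact: continuous_oneDsqrV.
have i1 : (\int[leb1]_t ((oneDsqr t)^-1)%:E = pi%:E)%E.
  rewrite (@ge0_symfun_integralT _ (fun t => (oneDsqr t)^-1)).
  - by rewrite -set_itvcy integral0y_oneDsqr -EFinM; congr (_%:E); field.
  - by move=> x; rewrite invr_ge0 (le_trans ler01 (oneDsqr_ge1 _)).
  - exact: continuous_oneDsqrV.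
  - by move=> x /=; rewrite /oneDsqr sqrrN.
have l1 : L1 leb1 (fun t => (oneDsqr t)^-1).
  by apply/L1_ge0P => //; rewrite i1 ltry.
rewrite E; split; first exact: L1Z.
rewrite I_Z//; have -> : I leb1 (fun t => (oneDsqr t)^-1) = pi.
  by apply: EFin_inj; rewrite EFin_I.
by rewrite mulr_gt0// pi_gt0.
Qed.

(** Serves as summation weight because its cosine transform [2 / (1 + z ^+ 2)] is elementary,
    positive and integrable. *)
Definition wexp (t : R) : R := expR (- `|t|).

Lemma wexp_continuous : continuous wexp.
Proof.
move=> t; apply: continuous_comp; last exact: continuous_expR.
by apply: continuousN; exact: norm_continuous.
Qed.

(** Adding 1 to the cosine makes the integrand nonnegative, as the fundamental theorem on a
    half-line requires. *)
Lemma wexp_half (z : R) :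
  (\int[leb1]_(t in `[0%R, +oo[) (expR (- t) * (1 + cos (z * t)))%:E = (1 + (1 + z ^+ 2)^-1)%:E)%E.
Proof.
pose F (t : R) := - expR (- t) + expR (- t) * (z * sin (z * t) - cos (z * t)) / (1 + z ^+ 2).
have z0 : 0 < 1 + z ^+ 2 by rewrite ltr_pwDl// sqr_ge0.
have dF (t : R) : is_derive t 1 F (expR (- t) * (1 + cos (z * t))).
  have d1 : is_derive t 1 (fun t : R => expR (- t)) (- expR (- t)).
    have d0 : is_derive t 1 (-%R : R -> R) (- 1) by exact: is_deriveNid.
    by have := @is_derive1_comp R expR -%R t _ _ (is_derive_expR _) d0; rewrite mulrN1.
  have d2 : is_derive t 1 (fun t : R => z * t) z.
    rewrite (_ : (fun t : R => z * t) = z *: id)//; apply: is_derive_eq.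
    by rewrite /GRing.scale/= mulr1.
  have d3 := @is_derive1_comp R sin (fun t => z * t) t _ _ (is_derive_sin _) d2.
  have d4 := @is_derive1_comp R cos (fun t => z * t) t _ _ (is_derive_cos _) d2.
  have -> : F = (- (fun t : R => expR (- t))) + (1 + z ^+ 2)^-1 *:
    ((fun t : R => expR (- t)) * (z *: (sin \o (fun t => z * t)) - (cos \o (fun t => z * t)))).
    by apply/funext => r; rewrite /F !fctE /GRing.scale /=; ring.
  have dd := is_deriveD (is_deriveN d1)
    (is_deriveZ (1 + z ^+ 2)^-1 (is_deriveM d1 (is_deriveB (is_deriveZ z d3) d4))).
  apply: (is_derive_eq dd); rewrite !fctE /= /GRing.scale/= /GRing.scale/=.
  set k := (1 + z ^+ 2)^-1; have kz : k * (1 + z ^+ 2) = 1 by rewrite mulVf ?gt_eqF.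
  transitivity (expR (- t) + k * (1 + z ^+ 2) * (expR (- t) * cos (z * t))); first by ring.
  by rewrite kz; ring.
rewrite (@ge0_continuous_FTC2y _ _ F _ 0).
- rewrite sub0e -EFinN; congr (_%:E).
  by rewrite /F mulr0 sin0 cos0 oppr0 expR0 mulr0 sub0r; field; rewrite gt_eqF.
- by move=> t _; rewrite mulr_ge0 ?expR_ge0// -lerBlDl sub0r cos_geN1.
- apply: continuous_subspaceT; apply: ctsM.
    by move=> t; apply: continuous_comp; [exact: opp_continuous|exact: continuous_expR].
  apply: ctsD; first exact: cst_continuous.
  by move=> t; apply: continuous_comp; [exact: mulrl_continuous|exact: continuous_cos].
- have eN : expR (- t) @[t --> +oo%R] --> (0 : R) by exact: cvgr_expR.
  pose k := 1 + (`|z| + 1) / (1 + z ^+ 2).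
  have bF (t : R) : - (k * expR (- t)) <= F t <= k * expR (- t).
    have e0 := expR_gt0 (- t).
    have s1 : `|z * sin (z * t) - cos (z * t)| <= `|z| + 1.
      rewrite (le_trans (ler_normB _ _))// normrM lerD ?cos_max//.
      by rewrite ler_piMr// sin_max.
    have nF : `|F t| <= k * expR (- t).
      rewrite /F (le_trans (ler_normD _ _))// /k mulrDl mul1r normrN (gtr0_norm e0) lerD2l.
      rewrite normrM normrM (gtr0_norm e0) (gtr0_norm (x := (1 + z ^+ 2)^-1)) ?invr_gt0//.
      by rewrite [leRHS]mulrC [leRHS]mulrA ler_pM2r ?invr_gt0// ler_pM2l.
    by rewrite -ler_norml.
  apply: (@squeeze_cvgr _ _ _ _ (fun t => - (k * expR (- t))) (fun t => k * expR (- t))).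
  - by apply: nearW => t; exact: bF.
  - by rewrite -oppr0 -(mulr0 k); apply: cvgN; apply: cvgMr => //; exact: cvg_cst.
  - by rewrite -(mulr0 k); apply: cvgM => //; exact: cvg_cst.
- by move=> x _; have [] := dF x.
- by apply: cvg_at_right_filter; apply: differentiable_continuous; apply/derivable1_diffP; have [] := dF 0.
- by move=> x _; rewrite derive1E; have [_ ->] := dF x.
Qed.

Lemma wexp_cos_ge0 (z : R) :
  L1 leb1 (fun t => wexp t * (1 + cos (z * t))) /\
  I leb1 (fun t => wexp t * (1 + cos (z * t))) = 2 * (1 + (1 + z ^+ 2)^-1).
Proof.
have c0 : continuous (fun t : R => wexp t * (1 + cos (z * t))).
  apply: ctsM; first exact: wexp_continuous.
  apply: ctsD; first exact: cst_continuous.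
  by move=> t; apply: continuous_comp; [exact: mulrl_continuous|exact: continuous_cos].
have p0 (t : R) : 0 <= wexp t * (1 + cos (z * t)).
  by rewrite mulr_ge0 ?expR_ge0//; have := cos_geN1 (z * t); lra.
have E : (\int[leb1]_t (wexp t * (1 + cos (z * t)))%:E = (2 * (1 + (1 + z ^+ 2)^-1))%:E)%E.
  rewrite (@ge0_symfun_integralT _ (fun t => wexp t * (1 + cos (z * t))))//; last first.
    by move=> t /=; rewrite /wexp normrN mulrN cosN.
  rewrite -set_itvcy EFinM; congr (_ * _)%E; rewrite -wexp_half; apply: eq_integral => t.
  by rewrite inE/= in_itv/= andbT => t0; rewrite /wexp ger0_norm.
have l : L1 leb1 (fun t => wexp t * (1 + cos (z * t))).
  apply/L1_ge0P => //; first exact: continuous_measurable_fun.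
  by rewrite E ltry.
by split => //; apply: EFin_inj; rewrite EFin_I.
Qed.

Lemma wexp_L1 : L1 leb1 wexp /\ I leb1 wexp = 2.
Proof.
have [l i] := wexp_cos_ge0 0.
have E : wexp = (fun t => 2^-1 * (wexp t * (1 + cos (0 * t)))).
  by apply/funext => t; rewrite mul0r cos0; field.
split; first by rewrite E; exact: L1Z.
by rewrite E I_Z// i expr0n/= addr0 invr1; field.
Qed.

Lemma wexp_cos (z : R) : L1 leb1 (fun t => wexp t * cos (z * t)) /\
  I leb1 (fun t => wexp t * cos (z * t)) = 2 / (1 + z ^+ 2).
Proof.
have [l i] := wexp_cos_ge0 z; have [l0 i0] := wexp_L1.
have E : (fun t => wexp t * cos (z * t)) = (fun t => wexp t * (1 + cos (z * t)) - wexp t).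
  by apply/funext => t; ring.
rewrite E; split; first exact: L1B.
by rewrite I_B// i i0; ring.
Qed.

Lemma wexp_sin (z : R) : L1 leb1 (fun t => wexp t * sin (z * t)).
Proof.
have [l0 i0] := wexp_L1.
apply: (L1_le _ l0); last first.
  by move=> t; rewrite normrM ger0_norm ?expR_ge0// ler_piMr ?expR_ge0// sin_max.
apply: continuous_measurable_fun; apply: ctsM; first exact: wexp_continuous.
by move=> t; apply: continuous_comp; [exact: mulrl_continuous|exact: continuous_sin].
Qed.

End weight1.

Section edot.
Context {R : realType} {n : nat}.
Implicit Types x y z : 'rV[R]_n.

Lemma edotC x y : edot x y = edot y x.
Proof. by apply: eq_bigr => i _; rewrite mulrC. Qed.

Lemma edotDl x y z : edot (x + y) z = edot x z + edot y z.
Proof. by rewrite /edot -big_split/=; apply: eq_bigr => i _; rewrite mxE mulrDl. Qed.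

Lemma edotZl a x y : edot (a *: x) y = a * edot x y.
Proof. by rewrite /edot mulr_sumr; apply: eq_bigr => i _; rewrite mxE mulrA. Qed.

Lemma edotNl x y : edot (- x) y = - edot x y.
Proof. by rewrite -scaleN1r edotZl mulN1r. Qed.

Lemma edotBl x y z : edot (x - y) z = edot x z - edot y z.
Proof. by rewrite edotDl edotNl. Qed.

Lemma edotDr x y z : edot z (x + y) = edot z x + edot z y.
Proof. by rewrite !(edotC z) edotDl. Qed.

Lemma edotZr a x y : edot y (a *: x) = a * edot y x.
Proof. by rewrite !(edotC y) edotZl. Qed.

Lemma edotNr x y : edot y (- x) = - edot y x.
Proof. by rewrite !(edotC y) edotNl. Qed.

Lemma edotBr x y z : edot z (x - y) = edot z x - edot z y.
Proof. by rewrite !(edotC z) edotBl. Qed.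

Lemma edot0 x : edot 0 x = 0.
Proof. by rewrite -(scale0r 0) edotZl mul0r. Qed.

Lemma measurable_edotr x : measurable_fun [set: 'rV[R]_n] (edot x).
Proof. exact: measurable_edot. Qed.

End edot.

Section weight.
Context {R : realType}.

Definition wght n (x : 'rV[R]_n) : R := \prod_i wexp (x ord0 i).

(** The Fourier transform of [wght]: a product of one-dimensional Poisson kernels, not
    normalised. *)
Definition gker n (z : 'rV[R]_n) : R := \prod_i (2 / (1 + z ord0 i ^+ 2)).

Lemma wght_gt0 n (x : 'rV[R]_n) : 0 < wght x.
Proof. by apply: prodr_gt0 => i _; exact: expR_gt0. Qed.

Lemma wght_le1 n (x : 'rV[R]_n) : wght x <= 1.
Proof.
have -> : 1 = \prod_(i < n) (1 : R) by rewrite big1_eq.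
apply: ler_prod => i _; rewrite expR_ge0/= /wexp -expR0 ler_expR oppr_le0; exact: normr_ge0.
Qed.

Lemma wghtN n (x : 'rV[R]_n) : wght (- x) = wght x.
Proof. by apply: eq_bigr => i _; rewrite mxE /wexp normrN. Qed.

Lemma wghtZ2 n (x : 'rV[R]_n) : wght x ^+ 2 = wght (2 *: x).
Proof.
rewrite /wght expr2 -big_split/=; apply: eq_bigr => i _.
rewrite mxE /wexp -expRD normrM ger0_norm//; congr expR; ring.
Qed.

Lemma measurable_wght n : measurable_fun [set: 'rV[R]_n] (@wght n).
Proof.
apply: measurable_prod => i _.
apply: (measurableT_comp (continuous_measurable_fun (@wexp_continuous R))).
exact: measurable_coord.
Qed.

Lemma L1_wght n : L1 (leb n) (@wght n).
Proof. by have [] := @L1_prod R n (fun=> @wexp R) (fun=> (wexp_L1 (R := R)).1). Qed.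

Lemma L1_wght_cos n (z : 'rV[R]_n) : L1 (leb n) (fun x => wght x * cos (edot z x)).
Proof.
apply: (L1_le _ (L1_wght n)).
  apply: measurable_funM; first exact: measurable_wght.
  by apply: (measurableT_comp (continuous_measurable_fun (@continuous_cos R))); exact: measurable_edotr.
by move=> x; rewrite normrM gtr0_norm ?wght_gt0// ler_piMr ?(ltW (wght_gt0 _))// cos_max.
Qed.

Lemma L1_wght_sin n (z : 'rV[R]_n) : L1 (leb n) (fun x => wght x * sin (edot z x)).
Proof.
apply: (L1_le _ (L1_wght n)).
  apply: measurable_funM; first exact: measurable_wght.
  by apply: (measurableT_comp (continuous_measurable_fun (@continuous_sin R))); exact: measurable_edotr.
by move=> x; rewrite normrM gtr0_norm ?wght_gt0// ler_piMr ?(ltW (wght_gt0 _))// sin_max.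
Qed.

Lemma I_odd n (f : 'rV[R]_n -> R) : L1 (leb n) f -> (forall x, f (- x) = - f x) -> I (leb n) f = 0.
Proof.
move=> lf of_; have := @I_affine R n (-1) 0 f.
rewrite oppr_eq0 oner_eq0 normrN normr1 invr1 expr1n mul1r => /(_ isT lf).
under eq_fun do rewrite addr0 scaleN1r of_.
by rewrite I_N// => h; lra.
Qed.

Lemma I_wght_sin n (z : 'rV[R]_n) : I (leb n) (fun x => wght x * sin (edot z x)) = 0.
Proof.
apply: I_odd; first exact: L1_wght_sin.
by move=> x; rewrite wghtN edotNr sinN mulrN.
Qed.

(** Induction on the dimension by the addition formula for the cosine; the product of sines
    integrates to 0 by oddness. *)
Lemma I_wght_cos n (z : 'rV[R]_n) : I (leb n) (fun x => wght x * cos (edot z x)) = gker z.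
Proof.
elim: n z => [|n IH] z.
  transitivity (I (leb 0) (fun x : 'rV[R]_0 => \prod_(i < 0) (fun=> @wexp R) i (x ord0 i))).
    by congr I; apply/funext => x; rewrite /wght /edot !big_ord0 cos0 mulr1.
  by rewrite (L1_prod (fun i : 'I_0 => (wexp_L1 (R := R)).1)).2 /gker !big_ord0.
pose z' : 'rV[R]_n := \row_j z ord0 (lift ord0 j).
have Ew t (v : 'rV[R]_n) : wght (row_cons (t, v)) = wexp t * wght v.
  rewrite /wght big_ord_recl mxE unlift_none/=; congr (_ * _); apply: eq_bigr => i _.
  by rewrite mxE liftK.
have Ee t (v : 'rV[R]_n) : edot z (row_cons (t, v)) = z ord0 ord0 * t + edot z' v.
  rewrite /edot big_ord_recl mxE unlift_none/=; congr (_ + _); apply: eq_bigr => i _.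
  by rewrite !mxE liftK.
have [lc ic] := L1_tensor (m1 := @lebesgue_measure R) (m2 := leb n)
  (wexp_cos (z ord0 ord0)).1 (L1_wght_cos z').
have [ls is_] := L1_tensor (m1 := @lebesgue_measure R) (m2 := leb n)
  (wexp_sin (z ord0 ord0)) (L1_wght_sin z').
have E : (fun x => wght x * cos (edot z x)) \o @row_cons R n =
  (fun p => wexp p.1 * cos (z ord0 ord0 * p.1) * (wght p.2 * cos (edot z' p.2)) -
            wexp p.1 * sin (z ord0 ord0 * p.1) * (wght p.2 * sin (edot z' p.2))).
  by apply/funext => -[t v]; rewrite /= Ew Ee cosD; ring.
have [_ ->] := @L1_lebS R n (fun x => wght x * cos (edot z x))
  (L1_measurable (L1_wght_cos z)) ltac:(rewrite E; exact: L1B).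
rewrite E I_B// ic is_ IH I_wght_sin mulr0 subr0 (wexp_cos _).2 /gker big_ord_recl.
by congr (_ * _); apply: eq_bigr => i _; rewrite mxE.
Qed.

Lemma gker_gt0 n (z : 'rV[R]_n) : 0 < gker z.
Proof. by apply: prodr_gt0 => i _; rewrite divr_gt0// ltr_pwDl// sqr_ge0. Qed.

Lemma gker_le n (z : 'rV[R]_n) : gker z <= 2 ^+ n.
Proof.
rewrite -[X in _ ^+ X]card_ord -prodr_const; apply: ler_prod => i _.
have h : 0 < 1 + z ord0 i ^+ 2 by rewrite ltr_pwDl// sqr_ge0.
rewrite divr_ge0 ?(ltW h)//= ler_pdivrMr// -[leLHS]mulr1 ler_pM2l//.
by rewrite lerDl sqr_ge0.
Qed.

Lemma gkerN n (z : 'rV[R]_n) : gker (- z) = gker z.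
Proof. by apply: eq_bigr => i _; rewrite mxE sqrrN. Qed.

Lemma L1_gker n : L1 (leb n) (@gker n).
Proof. by have [] := @L1_prod R n (fun _ t => 2 / (1 + t ^+ 2)) (fun=> (L1_oneDsqrV (R := R)).1). Qed.

(** Equal to (2 pi)^n: the constant in Plancherel's identity for [hart]. *)
Definition cG n : R := I (leb n) (@gker n).

Lemma cG_gt0 n : 0 < cG n.
Proof.
rewrite /cG (@L1_prod R n (fun _ t => 2 / (1 + t ^+ 2)) (fun=> (L1_oneDsqrV (R := R)).1)).2.
by apply: prodr_gt0 => i _; have [] := L1_oneDsqrV (R := R).
Qed.

(* the Fourier transform of the dilated weight [wght (e *: _)] *)
Definition pker n (e : R) (z : 'rV[R]_n) : R := e^-1 ^+ n * gker (e^-1 *: z).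

Lemma I_wghtZ_cos n (e : R) (z : 'rV[R]_n) : 0 < e ->
  I (leb n) (fun x => wght (e *: x) * cos (edot z x)) = pker e z.
Proof.
move=> e0; have := @I_affine R n e 0 (fun x => wght x * cos (edot (e^-1 *: z) x)).
rewrite gt_eqF// gtr0_norm// => /(_ isT (L1_wght_cos _)); rewrite I_wght_cos /pker => <-.
congr I; apply/funext => x; rewrite addr0 edotZl edotZr mulrA mulVf ?gt_eqF// mul1r//.
Qed.

Lemma I_wghtZ_sin n (e : R) (z : 'rV[R]_n) : 0 < e ->
  I (leb n) (fun x => wght (e *: x) * sin (edot z x)) = 0.
Proof.
move=> e0; have := @I_affine R n e 0 (fun x => wght x * sin (edot (e^-1 *: z) x)).
rewrite gt_eqF// gtr0_norm// => /(_ isT (L1_wght_sin _)); rewrite I_wght_sin mulr0 => <-.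
congr I; apply/funext => x; rewrite addr0 edotZl edotZr mulrA mulVf ?gt_eqF// mul1r//.
Qed.

Lemma L1_wghtZ n (e : R) : 0 < e -> L1 (leb n) (fun x => wght (e *: x)).
Proof.
move=> e0; have := @L1_affine R n e 0 (@wght n); rewrite gt_eqF// => /(_ isT (L1_wght n)).
by under eq_fun do rewrite addr0.
Qed.

Lemma pkerN n (e : R) (z : 'rV[R]_n) : pker e (- z) = pker e z.
Proof. by rewrite /pker scalerN gkerN. Qed.

Lemma pker_ge0 n (e : R) (z : 'rV[R]_n) : 0 < e -> 0 <= pker e z.
Proof. by move=> e0; rewrite mulr_ge0 ?exprn_ge0 ?invr_ge0 ?(ltW e0)// ltW// gker_gt0. Qed.

Lemma pker_le n (e : R) (z : 'rV[R]_n) : 0 < e -> pker e z <= e^-1 ^+ n * 2 ^+ n.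
Proof. by move=> e0; rewrite ler_pM2l ?exprn_gt0 ?invr_gt0// gker_le. Qed.

Lemma measurable_gker n : measurable_fun [set: 'rV[R]_n] (@gker n).
Proof. exact: L1_measurable (L1_gker n). Qed.

Lemma measurable_pker n (e : R) : measurable_fun [set: 'rV[R]_n] (@pker n e).
Proof.
apply: measurable_funM => //; apply: (measurableT_comp (@measurable_gker n)).
have := @measurable_affine R n e^-1 0; by under eq_fun do rewrite addr0.
Qed.

Lemma I_pker n (e : R) (f : 'rV[R]_n -> R) (x : 'rV[R]_n) M : 0 < e ->
  measurable_fun [set: 'rV[R]_n] f -> (forall y, `|f y| <= M) ->
  L1 (leb n) (fun y => f y * pker e (x - y)) /\
  I (leb n) (fun y => f y * pker e (x - y)) = I (leb n) (fun t => f (x - e *: t) * gker t).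
Proof.
move=> e0 mf fM; have ei0 : e^-1 != 0 by rewrite invr_eq0 gt_eqF.
have l0 : L1 (leb n) (fun y => pker e (x - y)).
  apply: L1Z; have := @L1_affine R n (- e^-1) (e^-1 *: x) (@gker n).
  rewrite oppr_eq0 ei0 => /(_ isT (L1_gker n)).
  by congr (L1 _ _); apply/funext => y; rewrite scaleNr scalerBr addrC.
have M0 : 0 <= M := le_trans (normr_ge0 _) (fM 0).
have mx : measurable_fun [set: 'rV[R]_n] (fun y => x - y) by exact: measurable_rVB.
have lf : L1 (leb n) (fun y => f y * pker e (x - y)).
  apply: (L1_le _ (L1Z M l0)).
    by apply: measurable_funM => //; apply: measurableT_comp mx; exact: measurable_pker.
  by move=> y; rewrite normrM (ger0_norm (pker_ge0 _ e0)) ler_wpM2r// pker_ge0.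
split => //; have := @I_affine R n (- e) x (fun y => f y * pker e (x - y)).
rewrite oppr_eq0 gt_eqF// => /(_ isT lf); rewrite normrN gtr0_norm// => h.
have e1 : e^-1 ^+ n != 0 by rewrite expf_neq0.
apply: (mulfI e1); rewrite -h -I_Z.
  congr I; apply/funext => t; rewrite addrC scaleNr /pker subKr scalerA.
  by rewrite mulVf ?gt_eqF// scale1r; ring.
apply: (L1_le _ (L1Z M (L1_gker n))).
  apply: measurable_funM; last exact: measurable_gker.
  apply: (measurableT_comp mf); have := @measurable_affine R n (- e) x.
  by congr (measurable_fun _ _); apply/funext => t; rewrite addrC scaleNr.
by move=> t; rewrite normrM (gtr0_norm (gker_gt0 _)) ler_wpM2r// ltW// gker_gt0.
Qed.

End weight.

Lemma cts_seq (R : realType) (U : topologicalType) (f : U -> R) (u : nat -> U) a :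
  continuous f -> u m @[m --> \oo] --> a -> f (u m) @[m --> \oo] --> f a.
Proof. by move=> cf cu; exact: (@cvg_comp _ _ _ u f \oo (nbhs a) (nbhs (f a)) cu (cf a)). Qed.

Lemma cvg_seq_eq (R : realType) (u v : nat -> R) (a b : R) :
  u m @[m --> \oo] --> a -> v m @[m --> \oo] --> b -> u =1 v -> a = b.
Proof. by move=> ua vb /funext uv; apply: (cvg_unique _ ua); rewrite // uv. Qed.

(** * The transform and Plancherel's identity *)

Section hartley.
Context {R : realType} {n : nat}.
Local Notation V := 'rV[R]_n.
Local Notation mu := (@leb R n).
Local Notation c_ := (@cG R n).

(* [cas] makes the transform real and self-adjoint: the Fourier transform is the even part
   of [hart] minus i times the odd part *)
Definition cas (t : R) : R := cos t + sin t.

Definition hart (u : V -> R) (xi : V) : R := I mu (fun x => cas (edot x xi) * u x).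

Lemma cas_le2 t : `|cas t| <= 2.
Proof. by rewrite (le_trans (ler_normD _ _))// -[2]/(1 + 1) lerD ?cos_max ?sin_max. Qed.

Lemma casM a b : cas a * cas b = cos (a - b) + sin (a + b).
Proof. by rewrite /cas cosD sinD cosN sinN; ring. Qed.

Lemma cas_continuous : continuous cas.
Proof. by apply: ctsD; [exact: continuous_cos|exact: continuous_sin]. Qed.

Lemma measurable_cas d (T : measurableType d) (f g : T -> V) : measurable_fun [set: T] f ->
  measurable_fun [set: T] g -> measurable_fun [set: T] (fun t => cas (edot (f t) (g t))).
Proof.
move=> mf mg; apply: (measurableT_comp (continuous_measurable_fun cas_continuous)).
exact: measurable_edot.
Qed.

Lemma L1_cas u xi : L1 mu u -> L1 mu (fun x => cas (edot x xi) * u x).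
Proof.
move=> lu; apply: (L1_le _ (L1Z 2 (L1_norm lu))).
  by apply: measurable_funM; [exact: measurable_cas|exact: L1_measurable lu].
by move=> x; rewrite normrM ler_wpM2r// cas_le2.
Qed.

Lemma hart_le u xi : L1 mu u -> `|hart u xi| <= 2 * I mu (fun x => `|u x|).
Proof.
move=> lu; rewrite (le_trans (I_norm (L1_cas _ lu)))// -I_Z; last exact: L1_norm.
apply: I_le; [exact/L1_norm/L1_cas|exact/L1Z/L1_norm|].
by move=> x; rewrite normrM ler_wpM2r// cas_le2.
Qed.

Lemma measurable_hart u : measurable_fun [set: V] u -> measurable_fun [set: V] (hart u).
Proof.
move=> mu_; apply: (@measurable_I2 _ _ V V R mu (fun p : V * V => cas (edot p.2 p.1) * u p.2)).
apply: measurable_funM; first exact: measurable_cas.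
exact: measurableT_comp.
Qed.

Lemma hartZ k u : L1 mu u -> hart (fun x => k * u x) = (fun xi => k * hart u xi).
Proof.
move=> lu; apply/funext => xi; rewrite /hart -I_Z; last exact: L1_cas.
by congr I; apply/funext => x; rewrite mulrCA.
Qed.

Lemma hartD u v : L1 mu u -> L1 mu v ->
  hart (fun x => u x + v x) = (fun xi => hart u xi + hart v xi).
Proof.
move=> lu lv; apply/funext => xi; rewrite /hart -I_D; [|exact: L1_cas..].
by congr I; apply/funext => x; rewrite mulrDr.
Qed.

Lemma L1_hartM u g : L1 mu u -> L1 mu g -> L1 mu (fun xi => hart u xi * g xi).
Proof.
move=> lu lg; apply: (L1_le _ (L1Z (2 * I mu (fun x => `|u x|)) (L1_norm lg))).
  by apply: measurable_funM; [apply: measurable_hart; exact: L1_measurable lu|exact: L1_measurable lg].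
by move=> x; rewrite normrM ler_wpM2r// hart_le.
Qed.

Lemma hart_mult u g : L1 mu u -> L1 mu g ->
  I mu (fun xi => hart u xi * g xi) = I mu (fun x => u x * hart g x).
Proof.
move=> lu lg; pose F (p : V * V) := cas (edot p.1 p.2) * (u p.1 * g p.2).
have [lt _] := L1_tensor (m1 := mu) (m2 := mu) lu lg.
have lF : L1 (mu \x mu)%E F.
  apply: (L1_le _ (L1Z 2 (L1_norm lt))); last first.
    by move=> x; rewrite normrM ler_wpM2r// cas_le2.
  by apply: measurable_funM; [exact: measurable_cas|exact: L1_measurable lt].
have [_ e1] := fubini1 lF; have [_ e2] := fubini2 lF.
transitivity (I (mu \x mu)%E F); [rewrite e2|rewrite e1]; congr I; apply/funext => x.
  rewrite /hart mulrC -I_Z; last exact: L1_cas.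
  by congr I; apply/funext => y; rewrite /F/=; ring.
rewrite /hart -I_Z; last exact: L1_cas.
by congr I; apply/funext => y; rewrite /F/= edotC; ring.
Qed.

Lemma hart_wght (e : R) x y : 0 < e ->
  hart (fun xi => cas (edot xi x) * wght (e *: xi)) y = pker e (x - y).
Proof.
move=> e0; rewrite /hart.
transitivity (I mu (fun xi => wght (e *: xi) * cos (edot (x - y) xi) +
  wght (e *: xi) * sin (edot (x + y) xi))).
  congr I; apply/funext => xi; rewrite mulrA mulrC -mulrDr; congr (_ * _).
  by rewrite mulrC casM edotBl edotDl !(edotC xi).
rewrite I_D; [by rewrite I_wghtZ_cos// I_wghtZ_sin// addr0|..].
- apply: (L1_le _ (L1_wghtZ n e0)).
    apply: measurable_funM; first exact: L1_measurable (L1_wghtZ n e0).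
    by apply: (measurableT_comp (continuous_measurable_fun (@continuous_cos R))); exact: measurable_edotr.
  by move=> t; rewrite normrM gtr0_norm ?wght_gt0// ler_piMr ?(ltW (wght_gt0 _))// cos_max.
- apply: (L1_le _ (L1_wghtZ n e0)).
    apply: measurable_funM; first exact: L1_measurable (L1_wghtZ n e0).
    by apply: (measurableT_comp (continuous_measurable_fun (@continuous_sin R))); exact: measurable_edotr.
  by move=> t; rewrite normrM gtr0_norm ?wght_gt0// ler_piMr ?(ltW (wght_gt0 _))// sin_max.
Qed.

(** The weight makes the integrals absolutely convergent. Formally, removing it would turn the
    kernel on the right into a multiple of the delta function, which [pker] regularises. *)
Lemma hart_bilin (e : R) u v : 0 < e -> L1 mu u -> L1 mu v ->
  I mu (fun xi => wght (e *: xi) * (hart u xi * hart v xi)) =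
  I mu (fun x => u x * I mu (fun y => v y * pker e (x - y))).
Proof.
move=> e0 lu lv; have lw := L1_wghtZ n e0.
have lhv : L1 mu (fun xi => hart v xi * wght (e *: xi)) by exact: L1_hartM.
transitivity (I mu (fun xi => hart u xi * (hart v xi * wght (e *: xi)))).
  by congr I; apply/funext => xi; ring.
rewrite (hart_mult lu lhv); congr I; apply/funext => x; congr (_ * _).
transitivity (I mu (fun xi => cas (edot xi x) * (hart v xi * wght (e *: xi)))); first by [].
transitivity (I mu (fun xi => hart v xi * (cas (edot xi x) * wght (e *: xi)))).
  by congr I; apply/funext => xi; ring.
rewrite (hart_mult lv (L1_cas _ lw)).
by congr I; apply/funext => y; rewrite hart_wght.
Qed.

Definition eps (m : nat) : R := m.+1%:R^-1.

Lemma eps_gt0 m : 0 < eps m. Proof. by rewrite invr_gt0. Qed.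

Lemma eps_cvg : eps m @[m --> \oo] --> (0 : R).
Proof. exact: cvg_harmonic. Qed.

Lemma cvg_prods (J : Type) (s : seq J) (F : J -> nat -> R) (l : J -> R) :
  (forall j, F j m @[m --> \oo] --> l j) ->
  \prod_(j <- s) F j m @[m --> \oo] --> \prod_(j <- s) l j.
Proof.
move=> h; elim: s => [|j s IH].
  by under eq_fun do rewrite big_nil; rewrite big_nil; exact: cvg_cst.
by under eq_fun do rewrite big_cons; rewrite big_cons; exact: cvgM.
Qed.

Lemma wght_cvg (x : V) (k : R) : wght ((k * eps m) *: x) @[m --> \oo] --> (1 : R).
Proof.
rewrite (_ : 1 = \prod_(i < n) wexp 0); last first.
  by rewrite big1// => i _; rewrite /wexp normr0 oppr0 expR0.
apply: cvg_prods => i.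
under eq_fun do rewrite mxE.
apply: (cts_seq (@wexp_continuous R)).
rewrite -(mul0r (x ord0 i)) -(mulr0 k); apply: cvgM; last exact: cvg_cst.
by apply: cvgM; [exact: cvg_cst|exact: eps_cvg].
Qed.

(** The weighted norms are bounded uniformly in the dilation, and Fatou's lemma removes the
    weight. *)
Lemma hart_L2 u : L1 mu u -> L2 mu u -> L2 mu (hart u) /\ sqI mu (hart u) <= c_ * sqI mu u.
Proof.
move=> lu l2; have mu_ := L1_measurable lu.
have key (e : R) : 0 < e -> I mu (fun xi => wght (e *: xi) * (hart u xi * hart u xi)) <= c_ * sqI mu u.
  move=> e0; rewrite hart_bilin//.
  have mP : measurable_fun [set: V * V] (fun p => pker e (p.1 - p.2)).
    by apply: (measurableT_comp (@measurable_pker R n e)); exact: measurable_rVB.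
  have I1 x : L1 mu (fun y => pker e (x - y)) /\ I mu (fun y => pker e (x - y)) = c_.
    have [|y|] := @I_pker R n e (fun=> 1) x 1 e0; [by []|by rewrite normr1|].
    by under eq_fun do rewrite mul1r; move=> l ->; split => //; congr I; apply/funext => t; rewrite mul1r.
  have [lt _] := L1_tensor (m1 := mu) (m2 := mu) lu lu.
  pose F (p : V * V) := u p.1 * (u p.2 * pker e (p.1 - p.2)).
  have lF : L1 (mu \x mu)%E F.
    apply: (L1_le _ (L1Z (e^-1 ^+ n * 2 ^+ n) (L1_norm lt))).
      apply: measurable_funM; first exact: measurableT_comp.
      by apply: measurable_funM => //; exact: measurableT_comp.
    by move=> p; rewrite /F mulrA normrM mulrC ler_wpM2r// ger0_norm ?pker_le// pker_ge0.
  pose G (p : V * V) := u p.1 ^+ 2 * pker e (p.1 - p.2).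
  have lG : L1 (mu \x mu)%E G.
    apply: tonelli1.
    - by apply: measurable_funM => //; apply: measurable_funX; exact: measurableT_comp.
    - by move=> x; exact: (L1Z (u x ^+ 2) (I1 x).1).
    - rewrite (_ : (fun x => _) = (fun x => c_ * u x ^+ 2)); first exact: L1Z l2.2.
      apply/funext => x; rewrite -(I1 x).2 mulrC -I_Z; last exact: (I1 x).1.
      congr I; apply/funext => y; rewrite ger0_norm// mulr_ge0 ?sqr_ge0//; exact: pker_ge0.
  have iG : I (mu \x mu)%E G = c_ * sqI mu u.
    rewrite (fubini1 lG).2 /sqI -I_Z; last exact: l2.2.
    congr I; apply/funext => x; rewrite /G/= I_Z ?(I1 x).2; first by rewrite mulrC.
    exact: (I1 x).1.
  have -> : I mu (fun x => u x * I mu (fun y => u y * pker e (x - y))) = I (mu \x mu)%E F.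
    rewrite (fubini1 lF).2; congr I; apply/funext => x; rewrite /F/= I_Z//.
    apply: (L1_le _ (L1Z (e^-1 ^+ n * 2 ^+ n) (L1_norm lu))).
      by apply: measurable_funM => //; exact: L1_measurable (I1 x).1.
    by move=> y; rewrite normrM mulrC ler_wpM2r// ger0_norm ?pker_le// pker_ge0.
  have lG' := L1_swap lG.
  (* Schur's test: [u x * u y] is at most the mean of the two squares, and the kernel has integral
     [c_] in either variable. *)
  apply: (le_trans (y := I (mu \x mu)%E (fun p => 2^-1 * (G p + G (p.2, p.1))))).
    apply: I_le => //; first by apply: L1Z; exact: L1D.
    move=> [x y]; rewrite /F /G/= -(pkerN e (x - y)) opprB.
    have := pker_ge0 (y - x) e0; set q := pker _ _ => q0.
    by have := mulr_ge0 q0 (sqr_ge0 (u x - u y)); lra.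
  rewrite I_Z ?I_D//; last exact: L1D.
  by rewrite I_swap// iG; lra.
have mh := measurable_hart mu_.
apply: (@fatou_sqI _ _ _ mu (fun m xi => wght (eps m *: xi) * hart u xi) (hart u) _).
- move=> m; have mw : measurable_fun [set: V] (fun xi => wght (eps m *: xi)).
    exact: L1_measurable (L1_wghtZ n (eps_gt0 m)).
  split; first exact: measurable_funM.
  have lw2 : L1 mu (fun xi => wght ((2 * eps m) *: xi)) by apply: L1_wghtZ; rewrite mulr_gt0// eps_gt0.
  apply: (L1_le _ (L1Z ((2 * I mu (fun x => `|u x|)) ^+ 2) lw2)).
    by apply: measurable_funX; exact: measurable_funM.
  move=> x; rewrite exprMn wghtZ2 scalerA normrM (gtr0_norm (wght_gt0 _)) [leLHS]mulrC.
  rewrite ler_wpM2r ?(ltW (wght_gt0 _))// normrX lerXn2r ?nnegrE//; last exact: hart_le.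
  exact: le_trans (hart_le x lu).
- exact: mh.
- apply: aeW => x; rewrite -[X in _ --> X]mul1r; apply: cvgM; last exact: cvg_cst.
  by under eq_fun do rewrite -[eps _]mul1r; exact: wght_cvg.
(* The square of the weight is [wght] at twice the dilation, hence [key] at [2 * eps m]. *)
- apply: nearW => m; apply: le_trans (key (2 * eps m) _); last by rewrite mulr_gt0// eps_gt0.
  rewrite /sqI le_eqVlt; apply/orP; left; apply/eqP; congr I; apply/funext => x.
  by rewrite exprMn wghtZ2 scalerA expr2.
Qed.

(** As [v] is bounded and continuous, its averages against the approximate identity converge
    pointwise and boundedly, so both sides of [hart_bilin] pass to the limit. *)
Lemma hart_parseval u v : L1 mu u -> L2 mu u -> Ccr setT v ->
  I mu (fun xi => hart u xi * hart v xi) = c_ * I mu (fun x => u x * v x).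
Proof.
move=> lu l2u cv; have [M M0 vM] := Ccr_bounded cv.
have lv := Ccr_L1 cv; have l2v := Ccr_L2 cv; have mv := Ccr_measurable cv.
have [hu _] := hart_L2 lu l2u; have [hv _] := hart_L2 lv l2v.
have cv1 : I mu (fun xi => wght (eps m *: xi) * (hart u xi * hart v xi)) @[m --> \oo] -->
    I mu (fun xi => hart u xi * hart v xi).
  have lh := L2M hu hv.
  apply: (proj2 (dct _ _ _ (L1_norm lh) _)); last 1 first.
  - move=> m; apply: aeW => x; rewrite normrM gtr0_norm ?wght_gt0//.
    by rewrite ler_piMl// wght_le1.
  - move=> m; apply: measurable_funM; last exact: L1_measurable lh.
    exact: L1_measurable (L1_wghtZ n (eps_gt0 m)).
  - exact: L1_measurable lh.
  - apply: aeW => x; rewrite -[X in _ --> X]mul1r; apply: cvgM; last exact: cvg_cst.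
    by under eq_fun do rewrite -[eps _]mul1r; exact: wght_cvg.
pose Psi m x := I mu (fun t => v (x - eps m *: t) * gker t).
have mvg m x : measurable_fun [set: V] (fun t => v (x - eps m *: t) * gker t).
  apply: measurable_funM; last exact: measurable_gker.
  apply: (measurableT_comp mv); have := @measurable_affine R n (- eps m) x.
  by congr (measurable_fun _ _); apply/funext => t; rewrite addrC scaleNr.
have bvg m x t : `|v (x - eps m *: t) * gker t| <= M * gker t.
  by rewrite normrM (gtr0_norm (gker_gt0 _)) ler_wpM2r// ltW// gker_gt0.
have lvg m x : L1 mu (fun t => v (x - eps m *: t) * gker t).
  by apply: (L1_le _ (L1Z M (L1_gker n))).
have PE m x : I mu (fun y => v y * pker (eps m) (x - y)) = Psi m x.
  by rewrite (I_pker _ (eps_gt0 m) mv vM).2.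
have cvP x : Psi m x @[m --> \oo] --> c_ * v x.
  rewrite /cG mulrC -I_Z; last exact: L1_gker.
  apply: (proj2 (dct _ _ _ (L1Z M (L1_gker n)) _)) => //.
  - by apply: measurable_funM => //; exact: measurable_gker.
  - apply: aeW => t; apply: cvgM; last exact: cvg_cst.
    apply: (cts_seq (smoothV_continuous cv.1)).
    rewrite -[X in _ --> X]subr0; apply: cvgB; first exact: cvg_cst.
    by rewrite -(scale0r t); apply: cvgZr_tmp; exact: eps_cvg.
  - by move=> m; apply: aeW => t.
have mPsi m : measurable_fun [set: V] (Psi m).
  apply: (@measurable_I2 _ _ V V R mu (fun p : V * V => v (p.1 - eps m *: p.2) * gker p.2)).
  apply: measurable_funM; last exact: measurableT_comp (@measurable_gker R n) _.
  apply: (measurableT_comp mv); apply: measurable_rVB => //.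
  have := @measurable_affine R n (eps m) 0; under eq_fun do rewrite addr0; move=> h.
  exact: measurableT_comp h _.
have bP m x : `|Psi m x| <= M * c_.
  rewrite (le_trans (I_norm (lvg m x)))// /cG -I_Z; last exact: L1_gker.
  apply: I_le => //; [exact: L1_norm|exact/L1Z/L1_gker].
have cv2 : I mu (fun x => u x * Psi m x) @[m --> \oo] --> I mu (fun x => u x * (c_ * v x)).
  apply: (proj2 (dct _ _ _ (L1Z (M * c_) (L1_norm lu)) _)).
  - by move=> m; apply: measurable_funM => //; exact: L1_measurable lu.
  - apply: measurable_funM; first exact: L1_measurable lu.
    exact: measurable_funM.
  - by apply: aeW => x; apply: cvgM; [exact: cvg_cst|exact: cvP].
  - by move=> m; apply: aeW => x; rewrite normrM mulrC ler_wpM2r.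
have E : I mu (fun x => u x * (c_ * v x)) = c_ * I mu (fun x => u x * v x).
  by rewrite -I_Z; [congr I; apply/funext => x; ring|exact: L2M].
rewrite -E; apply: (cvg_seq_eq cv1 cv2) => m.
rewrite (hart_bilin (eps_gt0 m) lu lv); congr I; apply/funext => x; by rewrite PE.
Qed.

Lemma L2cvg_cauchy d (T : measurableType d) (m : {measure set T -> \bar R}) (f_ : nat -> T -> R) f :
  (forall k, L2 m (f_ k)) -> L2 m f -> L2cvg m f_ f ->
  forall e, 0 < e -> exists N, forall k l, (N <= k)%N -> (N <= l)%N ->
    sqI m (fun x => f_ k x - f_ l x) <= e.
Proof.
move=> lf_ lf cf e e0; have e4 : 0 < e / 4 by lra.
have /cvgrPdist_lt/(_ _ e4)[N _ HN] := cf.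
exists N => k l Nk Nl; have := HN k Nk; have := HN l Nl.
rewrite /= !sub0r !normrN !ger0_norm ?sqI_ge0// => hl hk.
have := @sqI_le2 _ _ _ m _ _ (L2B (lf_ k) lf) (L2N (L2B (lf_ l) lf)).
rewrite (_ : (fun x => _) = (fun x => f_ k x - f_ l x)); last by apply/funext => x; ring.
have -> : sqI m (fun x => - (f_ l x - f x)) = sqI m (fun x => f_ l x - f x).
  by congr I; apply/funext => x; rewrite sqrrN.
by move/le_trans; apply; lra.
Qed.

Lemma L1L2_dense u : L2 mu u -> exists u_ : nat -> V -> R,
  [/\ forall k, L1 mu (u_ k), forall k, L2 mu (u_ k) & L2cvg mu u_ u].
Proof.
move=> lu; have [mu_ lu2] := lu.
have mI k : measurable_fun [set: V] (\1_(cube (0 : V) k%:R) : V -> R).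
  by apply: measurable_indic; exact: measurable_cube.
have iE k x : (\1_(cube (0 : V) k%:R) x : R) = 0 \/ (\1_(cube (0 : V) k%:R) x : R) = 1.
  by rewrite indicE; case: (_ \in _); [right|left].
have l2 k : L2 mu (fun x => \1_(cube 0 k%:R) x * u x).
  apply: (L2_le _ lu); first exact: measurable_funM.
  by move=> x; rewrite normrM; case: (iE k x) => ->; rewrite ?normr0 ?normr1 ?mul0r ?mul1r.
exists (fun k x => \1_(cube 0 k%:R) x * u x); split => // [k|].
  apply: L2M => //; split=> //.
  rewrite (_ : (fun x => _) = \1_(cube (0 : V) k%:R)); first exact: L1_indic_cube.
  by apply/funext => x; case: (iE k x) => ->; rewrite ?expr0n ?expr1n.
rewrite /L2cvg /sqI -[X in _ --> X](@I_0 _ _ _ mu).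
apply: (proj2 (dct _ _ _ lu2 _)) => //.
- by move=> k; apply: measurable_funX; apply: measurable_funB => //; exact: (l2 k).1.
- apply: aeW => x; apply: cvg_near_cst; near=> k.
  have -> : (\1_(cube (0 : V) k%:R) x : R) = 1.
    rewrite indicE mem_set// => i; rewrite mxE subr0 (le_lt_trans (norm_coord x i))//.
    by near: k; exact: nbhs_infty_gtr.
  by rewrite mul1r subrr expr0n.
- move=> k; apply: aeW => x; rewrite ger0_norm ?sqr_ge0//.
  by case: (iE k x) => ->; rewrite ?mul1r ?subrr ?expr0n ?sqr_ge0// mul0r sub0r sqrrN.
Unshelve. all: end_near. Qed.

(** The transform on L^2, defined by duality through the self-adjointness of [hart], as the integral
    need not converge for [u] in L^2 alone. *)
Definition HT (u h : V -> R) : Prop := L2 mu h /\ forall phi, L1 mu phi -> L2 mu phi ->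
  I mu (fun x => u x * hart phi x) = I mu (fun x => h x * phi x).

Lemma L2_L1cube w r : L2 mu w -> 0 < r -> L1 mu (fun x => \1_(cube 0 r) x * w x).
Proof.
move=> lw r0; apply: L2M => //; split.
  by apply: measurable_indic; exact: measurable_cube.
rewrite (_ : (fun x => _) = \1_(cube (0 : V) r)); first by apply: L1_indic_cube; exact: ltW.
by apply/funext => x; rewrite indicE; case: (_ \in _); rewrite ?expr0n ?expr1n.
Qed.

Lemma L2_test0 w : L2 mu w -> (forall phi, Ccr setT phi -> I mu (fun x => w x * phi x) = 0) ->
  {ae mu, forall x, w x = 0}.
Proof. by move=> lw h; apply: ae0_test => //; [exact: lw.1|move=> r; exact: L2_L1cube]. Qed.

Lemma L2_test w w' : L2 mu w -> L2 mu w' ->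
  (forall phi, Ccr setT phi -> I mu (fun x => w x * phi x) = I mu (fun x => w' x * phi x)) ->
  {ae mu, forall x, w x = w' x}.
Proof.
move=> lw lw' h; have := L2_test0 (L2B lw lw') => H.
apply: filterS (H _) => [x /eqP|phi cp]; first by rewrite subr_eq0 => /eqP.
rewrite (_ : (fun x => _) = (fun x => w x * phi x - w' x * phi x)); last by apply/funext => x; rewrite mulrBl.
by rewrite I_B ?h ?subrr//; apply: L2M => //; exact: Ccr_L2 cp.
Qed.

Lemma HT_uniq u h h' : HT u h -> HT u h' -> {ae mu, forall x, h x = h' x}.
Proof.
move=> [lh Hh] [lh' Hh']; apply: L2_test => // phi cp.
by rewrite -Hh ?Hh'//; [exact: Ccr_L1 cp|exact: Ccr_L2 cp|exact: Ccr_L1 cp|exact: Ccr_L2 cp].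
Qed.

Lemma sqI_ae f g : L2 mu f -> L2 mu g -> {ae mu, forall x, f x = g x} -> sqI mu f = sqI mu g.
Proof.
move=> lf lg fg; apply: I_ae_eq; [exact: L1_measurable lf.2|exact: L1_measurable lg.2|].
by apply: filterS fg => x ->.
Qed.

Lemma HT_hart u : L1 mu u -> L2 mu u -> HT u (hart u).
Proof.
move=> lu l2; split=> [|phi lp l2p]; first by have [] := hart_L2 lu l2.
by rewrite hart_mult.
Qed.

(** The transform is the L^2 limit of the transforms of truncations. The third clause is Parseval's
    identity in the limit; [HT_sqI] turns it into the reverse norm inequality. *)
Let HT_ex0 u : L2 mu u -> exists h, [/\ HT u h, sqI mu h <= c_ * sqI mu u &
  forall psi, Ccr setT psi -> I mu (fun x => h x * hart psi x) = c_ * I mu (fun x => u x * psi x)].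
Proof.
move=> lu; have [u_ [l1 l2 uc]] := L1L2_dense lu.
have lh k : L2 mu (hart (u_ k)) by have [] := hart_L2 (l1 k) (l2 k).
have c0 := cG_gt0 (R := R) n.
have [h [l2h hc]] : exists h, L2 mu h /\ L2cvg mu (fun k => hart (u_ k)) h.
  apply: L2_complete => // e e0; have e1 : 0 < e / c_ by rewrite divr_gt0.
  have [N HN] := L2cvg_cauchy l2 lu uc e1; exists N => k l Nk Nl.
  have E : (fun x => hart (u_ k) x - hart (u_ l) x) = hart (fun x => u_ k x + -1 * u_ l x).
    rewrite hartD//; last exact: L1Z.
    by rewrite hartZ//; apply/funext => x; ring.
  have lk : L1 mu (fun x => u_ k x + -1 * u_ l x) by apply: L1D => //; exact: L1Z.
  have l2k : L2 mu (fun x => u_ k x + -1 * u_ l x) by apply: L2D => //; exact: L2Z.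
  rewrite E (le_trans (hart_L2 lk l2k).2)// mulrC -ler_pdivlMr//.
  rewrite (_ : (fun x => _) = (fun x => u_ k x - u_ l x)); first exact: HN.
  by apply/funext => x; rewrite mulN1r.
have cst f : L2cvg mu (fun=> f) f by exact: L2cvg_cst.
exists h; split.
- split=> // phi lp l2p; have [lhp _] := hart_L2 lp l2p.
  have a := L2cvgM l2 lu (fun=> lhp) lhp uc (cst _).
  have b := L2cvgM lh l2h (fun=> l2p) l2p hc (cst _).
  by apply: (cvg_seq_eq a b) => k; rewrite hart_mult.
- have a := L2cvg_sqI lh l2h hc; have b := L2cvg_sqI l2 lu uc.
  have b' : c_ * sqI mu (u_ k) @[k --> \oo] --> c_ * sqI mu u by apply: cvgM => //; exact: cvg_cst.
  apply: (ler_cvg_to a b'); apply: nearW => k; exact: (hart_L2 (l1 k) (l2 k)).2.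
- move=> psi cp; have [lhp _] := hart_L2 (Ccr_L1 cp) (Ccr_L2 cp).
  have a := L2cvgM l2 lu (fun=> Ccr_L2 cp) (Ccr_L2 cp) uc (cst _).
  have b := L2cvgM lh l2h (fun=> lhp) lhp hc (cst _).
  have a' : c_ * I mu (fun x => u_ k x * psi x) @[k --> \oo] --> c_ * I mu (fun x => u x * psi x).
    by apply: cvgM => //; exact: cvg_cst.
  by apply: (cvg_seq_eq b a') => k; rewrite hart_parseval.
Qed.

Lemma HT_ex u : L2 mu u -> exists h, HT u h.
Proof. by move=> /HT_ex0[h []]; exists h. Qed.

(** Transforming twice gives [c_ * u]. The norm bound for the second transform then yields
    [c_ ^+ 2 * sqI u <= c_ * sqI h], the inequality missing from [HT_ex0]. *)
Lemma HT_sqI u h : L2 mu u -> HT u h -> sqI mu h = c_ * sqI mu u.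
Proof.
move=> lu Hh; have [h1 [H1 le1 p1]] := HT_ex0 lu.
have E1 := sqI_ae H1.1 Hh.1 (HT_uniq H1 Hh).
have [h2 [H2 le2 _]] := HT_ex0 H1.1.
have c0 := cG_gt0 (R := R) n.
have lcu : L2 mu (fun x => c_ * u x) by exact: L2Z.
have E2 : sqI mu h2 = sqI mu (fun x => c_ * u x).
  apply: sqI_ae => //; first exact: H2.1.
  apply: L2_test => //; first exact: H2.1.
  move=> phi cp; have lp := Ccr_L2 cp.
  rewrite -H2.2//; last exact: Ccr_L1 cp.
  rewrite p1// -I_Z; last exact: L2M.
  by congr I; apply/funext => x; rewrite mulrA.
apply/eqP; rewrite -E1 eq_le le1/= -(ler_pM2l c0); apply: le_trans le2.
by rewrite E2 sqI_Z// mulrA expr2.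
Qed.

Lemma HT_lin k l u v h g : L2 mu u -> L2 mu v -> HT u h -> HT v g ->
  HT (fun x => k * u x + l * v x) (fun x => k * h x + l * g x).
Proof.
move=> lu lv [lh Hh] [lg Hg]; split=> [|phi lp l2p]; first by apply: L2D; exact: L2Z.
have [lhp _] := hart_L2 lp l2p.
rewrite (_ : (fun x => _ * hart phi x) = (fun x => k * (u x * hart phi x) + l * (v x * hart phi x))); last first.
  by apply/funext => x; ring.
rewrite I_D ?I_Z ?Hh ?Hg//; [|exact: L2M|exact: L2M|by apply: L1Z; exact: L2M..].
rewrite -!I_Z; [|exact: L2M..]; rewrite -I_D; [|by apply: L1Z; exact: L2M..].
by congr I; apply/funext => x; ring.
Qed.

Lemma I_reflect (f : V -> R) : L1 mu f ->
  L1 mu (fun x => f (- x)) /\ I mu (fun x => f (- x)) = I mu f.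
Proof.
move=> lf; have := @L1_affine R n (-1) 0 f; have := @I_affine R n (-1) 0 f.
have -> : (fun x => f (-1 *: x + 0)) = (fun x => f (- x)).
  by apply/funext => x; rewrite addr0 scaleN1r.
rewrite oppr_eq0 oner_eq0 normrN normr1 invr1 expr1n mul1r => /(_ isT lf) e /(_ isT lf).
by rewrite e.
Qed.

Lemma L2_reflect (f : V -> R) : L2 mu f -> L2 mu (fun x => f (- x)).
Proof.
move=> [mf lf]; split; last exact: (I_reflect lf).1.
apply: (measurableT_comp mf); have := @measurable_affine R n (-1) 0.
by congr (measurable_fun _ _); apply/funext => x; rewrite addr0 scaleN1r.
Qed.

End hartley.

(** * Bessel potential spaces *)

Section lnorm2.
Context d (T : measurableType d) (R : realType) (mu : {measure set T -> \bar R}).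
Implicit Types q : T -> R.
Local Notation N2 q := (Lnorm mu 2%:E (fun x => (Num.sqrt (q x))%:E)).

Lemma Lnorm2E q : (forall x, 0 <= q x) -> N2 q = ((\int[mu]_x (q x)%:E) `^ 2^-1)%E.
Proof.
move=> q0; rewrite unlock; congr (_ `^ _)%E; apply: eq_integral => x _.
rewrite gee0_abs ?lee_fin ?sqrtr_ge0// poweR_EFin -powR12_sqrt// -powRrM mulVf//.
by rewrite powRr1.
Qed.

Lemma Lnorm2_L1 q : measurable_fun [set: T] q -> (forall x, 0 <= q x) ->
  (N2 q < +oo)%E <-> L1 mu q.
Proof.
move=> mq q0; rewrite Lnorm2E//; split=> [h|lq].
  by apply/L1_ge0P => //; apply: lty_poweRy h; rewrite invr_eq0.
by apply: poweR_lty; exact: L1_lty.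
Qed.

Lemma Lnorm2_sqrt q : (forall x, 0 <= q x) -> L1 mu q -> N2 q = (Num.sqrt (I mu q))%:E.
Proof. by move=> q0 lq; rewrite Lnorm2E// -EFin_I// poweR_EFin powR12_sqrt// I_ge0. Qed.

(** An extended norm that tends to 0 is finite only from some index on, hence integrability appears
    under [near]. *)
Lemma Lnorm2_near (q_ : nat -> T -> R) : (forall k, measurable_fun [set: T] (q_ k)) ->
  (forall k x, 0 <= q_ k x) ->
  N2 (q_ k) @[k --> \oo] --> 0%E <->
  forall e, 0 < e -> \forall k \near \oo, L1 mu (q_ k) /\ I mu (q_ k) <= e.
Proof.
move=> mq q0; split=> [/fine_cvgP[fn cv] e e0|h].
  have se0 : 0 < Num.sqrt e by rewrite sqrtr_gt0.
  have [N1 _ H1] := fn; have /cvgrPdist_lt/(_ _ se0)[N2 _ H2] := cv.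
  exists (maxn N1 N2) => // k /=; rewrite geq_max => /andP[k1 k2].
  have lq : L1 mu (q_ k).
    by apply/Lnorm2_L1 => //; have := H1 k k1; rewrite /= fin_numElt => /andP[].
  split=> //; have := H2 k k2; rewrite /= Lnorm2_sqrt//= sub0r normrN ger0_norm ?sqrtr_ge0//.
  by rewrite ltr_sqrt// => /ltW.
apply/fine_cvgP; split.
  have [N _ H] := h _ (@ltr01 R); exists N => // k /= Nk.
  by rewrite Lnorm2_sqrt//; case: (H k Nk).
apply/cvgrPdist_le => e e0; have e20 : 0 < e ^+ 2 by rewrite exprn_gt0.
have [N _ H] := h _ e20; exists N => // k /= Nk; have [lq iq] := H k Nk.
rewrite Lnorm2_sqrt//= sub0r normrN ger0_norm ?sqrtr_ge0//.
have se : Num.sqrt (e ^+ 2) = e by rewrite sqrtr_sqr gtr0_norm.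
by rewrite -se ler_sqrt// ltW.
Qed.

End lnorm2.

Section complexL2.
Context d (T : measurableType d) (R : realType) (mu : {measure set T -> \bar R}).
Implicit Types f : T -> R[i].

Definition qnorm f x := complex.Re (f x) ^+ 2 + complex.Im (f x) ^+ 2.

Lemma normcE (z : R[i]) : normc z = Num.sqrt (complex.Re z ^+ 2 + complex.Im z ^+ 2).
Proof. by case: z. Qed.

Lemma qnorm_ge0 f x : 0 <= qnorm f x.
Proof. by rewrite addr_ge0// sqr_ge0. Qed.

Lemma cL2normE f : cL2norm mu f = Lnorm mu 2%:E (fun x => (Num.sqrt (qnorm f x))%:E).
Proof. by congr (Lnorm _ _ _); apply/funext => x; rewrite normcE. Qed.

Lemma measurable_qnorm f : cmeasurable f -> measurable_fun [set: T] (qnorm f).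
Proof. by move=> [mr mi]; apply: measurable_funD; exact: measurable_funX. Qed.

Lemma cL2P f : cL2 mu f <->
  L2 mu (fun x => complex.Re (f x)) /\ L2 mu (fun x => complex.Im (f x)).
Proof.
split=> [[mf]|[[mr lr] [mi li]]].
  rewrite cL2normE Lnorm2_L1; [|exact: measurable_qnorm|exact: qnorm_ge0].
  move=> lq; case: mf => mr mi; split; split=> //; apply: (L1_le _ lq).
  - exact: measurable_funX.
  - by move=> x; rewrite ger0_norm ?sqr_ge0// lerDl sqr_ge0.
  - exact: measurable_funX.
  - by move=> x; rewrite ger0_norm ?sqr_ge0// lerDr sqr_ge0.
split; first by split.
rewrite cL2normE Lnorm2_L1; [exact: L1D|apply: measurable_qnorm; by split|exact: qnorm_ge0].
Qed.

End complexL2.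

Section schwartz.
Context {R : realType} {n : nat}.
Local Notation V := 'rV[R]_n.
Local Notation mu := (@leb R n).

Lemma schwartz_cts (f : V -> R[i]) : schwartz f ->
  continuous (fun x => complex.Re (f x)) /\ continuous (fun x => complex.Im (f x)).
Proof. by move=> [sf _]; have [r i] := sf 0%N; split; [exact: (r [::]).1|exact: (i [::]).1]. Qed.

Lemma schwartz_bound (f : V -> R[i]) : schwartz f -> exists2 M, 0 <= M &
  forall x, normc (f x) <= M * gker x.
Proof.
(* Two powers of decay per coordinate: [(1 + enorm x) ^+ (2 * n)] dominates the product of the
   factors [1 + x ord0 i ^+ 2]. *)
move=> [_ /(_ (2 * n)%N [ffun=> 0%N])[M HM]].
have E x : mderiv [ffun=> 0%N] f x = f x.
  rewrite /mderiv; have -> : flatten [seq nseq ([ffun=> 0%N] i) i | i <- enum 'I_n] = [::].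
    by elim: (enum 'I_n) => //= i l ->; rewrite ffunE.
  by rewrite /=; case: (f x).
have en (x : V) : 0 <= enorm x by exact: sqrtr_ge0.
have ng (z : R[i]) : 0 <= normc z by rewrite normcE sqrtr_ge0.
have M0 : 0 <= M by apply: le_trans (HM 0); rewrite mulr_ge0// exprn_ge0// addr_ge0.
exists M => // x; have := HM x; rewrite E => h.
have p0 : 0 < \prod_(i < n) (1 + x ord0 i ^+ 2) by apply: prodr_gt0 => i _; rewrite ltr_pwDl// sqr_ge0.
have -> : gker x = 2 ^+ n / \prod_(i < n) (1 + x ord0 i ^+ 2).
  by rewrite /gker big_split/= prodr_const card_ord prodfV.
rewrite mulrA ler_pdivlMr//; apply: (le_trans (y := M)); last first.
  by rewrite ler_peMr// exprn_ege1// ler1n.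
apply: le_trans h; rewrite mulrC ler_wpM2r// exprM.
rewrite -[X in _ ^+ X](card_ord n) -prodr_const; apply: ler_prod => i _.
rewrite addr_ge0 ?sqr_ge0//=; have x2 : x ord0 i ^+ 2 <= enorm x ^+ 2.
  rewrite sqr_sqrtr ?edot_ge0// /edot (bigD1 i)//= -expr2 lerDl.
  by apply: sumr_ge0 => j _; rewrite -expr2 sqr_ge0.
by have := en x; nra.
Qed.

Lemma gker_L2 : L2 mu (@gker R n).
Proof.
split; first exact: measurable_gker.
apply: (L1_le _ (L1Z (2 ^+ n) (L1_gker n))); first by apply: measurable_funX; exact: measurable_gker.
by move=> x; rewrite ger0_norm ?sqr_ge0// expr2 ler_wpM2r ?gker_le// ltW// gker_gt0.
Qed.

Lemma schwartz_L12 (f : V -> R[i]) : schwartz f ->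
  [/\ L1 mu (fun x => complex.Re (f x)), L2 mu (fun x => complex.Re (f x)),
      L1 mu (fun x => complex.Im (f x)) & L2 mu (fun x => complex.Im (f x))].
Proof.
move=> sf; have [cr ci] := schwartz_cts sf; have [M M0 HM] := schwartz_bound sf.
have mr := continuous_rV_measurable cr; have mi := continuous_rV_measurable ci.
have br x : `|complex.Re (f x)| <= M * gker x.
  apply: le_trans (HM x); rewrite normcE -sqrtr_sqr ler_sqrt ?addr_ge0 ?sqr_ge0//.
  by rewrite lerDl sqr_ge0.
have bi x : `|complex.Im (f x)| <= M * gker x.
  apply: le_trans (HM x); rewrite normcE -sqrtr_sqr ler_sqrt ?addr_ge0 ?sqr_ge0//.
  by rewrite lerDr sqr_ge0.
have g0 x : 0 <= M * gker (x : V) by rewrite mulr_ge0// ltW// gker_gt0.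
split.
- exact: (L1_le mr (L1Z M (L1_gker n)) br).
- by apply: (L2_le mr (L2Z M gker_L2)) => x; rewrite (ger0_norm (g0 x)).
- exact: (L1_le mi (L1Z M (L1_gker n)) bi).
- by apply: (L2_le mi (L2Z M gker_L2)) => x; rewrite (ger0_norm (g0 x)).
Qed.

End schwartz.

(** * The Fourier transform and the H^s norm in terms of the Hartley transform *)

Section fourier_hartley.
Context {R : realType} {n : nat}.
Local Notation V := 'rV[R]_n.
Local Notation mu := (@leb R n).
Implicit Types h g : V -> R.

Definition ev h (x : V) := 2^-1 * (h x + h (- x)).
Definition od h (x : V) := 2^-1 * (h x - h (- x)).

Lemma L2_ev h : L2 mu h -> L2 mu (ev h).
Proof. by move=> l; apply: L2Z; apply: L2D => //; exact: L2_reflect. Qed.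

Lemma L2_od h : L2 mu h -> L2 mu (od h).
Proof. by move=> l; apply: L2Z; apply: L2B => //; exact: L2_reflect. Qed.

Lemma hart_reflect h x : L1 mu h -> hart h (- x) = hart (fun y => h (- y)) x.
Proof.
move=> lh; rewrite /hart -(I_reflect (L1_cas (- x) lh)).2.
by congr I; apply/funext => y; rewrite edotNl edotNr opprK.
Qed.

Lemma ev_hart h x : L1 mu h ->
  ev (hart h) x = I mu (fun y => cos (edot y x) * h y).
Proof.
move=> lh; rewrite /ev /hart -I_D; [|exact: L1_cas..].
rewrite -I_Z; last by apply: L1D; exact: L1_cas.
by congr I; apply/funext => y; rewrite edotNr /cas cosN sinN; field.
Qed.

Lemma od_hart h x : L1 mu h ->
  od (hart h) x = I mu (fun y => sin (edot y x) * h y).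
Proof.
move=> lh; rewrite /od /hart -I_B; [|exact: L1_cas..].
rewrite -I_Z; last by apply: L1B; exact: L1_cas.
by congr I; apply/funext => y; rewrite edotNr /cas cosN sinN; field.
Qed.

Lemma L1_trig (g : R -> R) h x : continuous g -> (forall t, `|g t| <= 1) -> L1 mu h ->
  L1 mu (fun y => g (edot y x) * h y).
Proof.
move=> cg g1 lh; apply: (L1_le _ (L1_norm lh)).
  apply: measurable_funM; last exact: L1_measurable lh.
  by apply: (measurableT_comp (continuous_measurable_fun cg)); exact: measurable_edot.
by move=> y; rewrite normrM ler_piMl.
Qed.

Lemma fourierE (f : V -> R[i]) x :
  L1 mu (fun x => complex.Re (f x)) -> L1 mu (fun x => complex.Im (f x)) ->
  complex.Re (fourier f x) = ev (hart (fun x => complex.Re (f x))) x + od (hart (fun x => complex.Im (f x))) x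
  /\ complex.Im (fourier f x) = ev (hart (fun x => complex.Im (f x))) x - od (hart (fun x => complex.Re (f x))) x.
Proof.
move=> lr li; rewrite !ev_hart// !od_hart//.
have lc h : L1 mu h -> L1 mu (fun y => cos (edot y x) * h y).
  by apply: L1_trig; [exact: continuous_cos|exact: cos_max].
have ls h : L1 mu h -> L1 mu (fun y => sin (edot y x) * h y).
  by apply: L1_trig; [exact: continuous_sin|exact: sin_max].
rewrite -I_D; [|exact: lc|exact: ls]; rewrite -I_B; [|exact: lc|exact: ls].
split; rewrite /fourier /cintegral/=; congr I; apply/funext => y;
  by rewrite /expi cosN sinN; case: (f y) => a b /=; ring.
Qed.

Lemma I_ev f g : L2 mu f -> L2 mu g -> I mu (fun x => f x * ev g x) = I mu (fun x => ev f x * g x).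
Proof.
move=> lf lg; have lf' := L2_reflect lf; have lg' := L2_reflect lg.
have e : I mu (fun x => f x * g (- x)) = I mu (fun x => f (- x) * g x).
  by rewrite -(I_reflect (L2M lf lg')).2; congr I; apply/funext => x; rewrite opprK.
transitivity (2^-1 * (I mu (fun x => f x * g x) + I mu (fun x => f x * g (- x)))).
  rewrite -I_D; [|exact: L2M..]; rewrite -I_Z; last by apply: L1D; exact: L2M.
  by congr I; apply/funext => x; rewrite /ev; ring.
rewrite e -I_D; [|exact: L2M..]; rewrite -I_Z; last by apply: L1D; exact: L2M.
by congr I; apply/funext => x; rewrite /ev; ring.
Qed.

Lemma I_od f g : L2 mu f -> L2 mu g -> I mu (fun x => f x * od g x) = I mu (fun x => od f x * g x).
Proof.
move=> lf lg; have lf' := L2_reflect lf; have lg' := L2_reflect lg.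
have e : I mu (fun x => f x * g (- x)) = I mu (fun x => f (- x) * g x).
  by rewrite -(I_reflect (L2M lf lg')).2; congr I; apply/funext => x; rewrite opprK.
transitivity (2^-1 * (I mu (fun x => f x * g x) - I mu (fun x => f x * g (- x)))).
  rewrite -I_B; [|exact: L2M..]; rewrite -I_Z; last by apply: L1B; exact: L2M.
  by congr I; apply/funext => x; rewrite /od; ring.
rewrite e -I_B; [|exact: L2M..]; rewrite -I_Z; last by apply: L1B; exact: L2M.
by congr I; apply/funext => x; rewrite /od; ring.
Qed.

Lemma hart_ev p : L1 mu p -> hart (ev p) = ev (hart p).
Proof.
move=> lp; have lp' := (I_reflect lp).1.
rewrite /ev hartZ ?hartD//; last exact: L1D.
by apply/funext => x; rewrite hart_reflect.
Qed.

Lemma hart_od p : L1 mu p -> hart (od p) = od (hart p).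
Proof.
move=> lp; have lp' := (I_reflect lp).1.
have -> : od p = (fun x => 2^-1 * (p x + -1 * p (- x))).
  by apply/funext => x; rewrite /od mulN1r.
rewrite hartZ ?hartD ?hartZ//; [|exact: L1Z|by apply: L1D => //; exact: L1Z].
by apply/funext => x; rewrite /od hart_reflect// mulN1r.
Qed.

Lemma HT_ev a h p : HT a h -> L1 mu p -> L2 mu p ->
  I mu (fun x => a x * ev (hart p) x) = I mu (fun x => ev h x * p x).
Proof.
move=> [lh Hh] lp l2p; rewrite -hart_ev// Hh; [exact: I_ev| |exact: L2_ev].
by apply: L1Z; apply: L1D => //; exact: (I_reflect lp).1.
Qed.

Lemma HT_od a h p : HT a h -> L1 mu p -> L2 mu p ->
  I mu (fun x => a x * od (hart p) x) = I mu (fun x => od h x * p x).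
Proof.
move=> [lh Hh] lp l2p; rewrite -hart_od// Hh; [exact: I_od| |exact: L2_od].
by apply: L1Z; apply: L1B => //; exact: (I_reflect lp).1.
Qed.

(** The Fourier transform of a real function is [ev h - i od h]; for a + i b this gives (ev ha + od
    hb) + i (ev hb - od ha). *)
Definition fourier_of (ha hb : V -> R) (x : V) : R[i] :=
  Complex (ev ha x + od hb x) (ev hb x - od ha x).

(** [fourier_of ha hb] satisfies the duality that defines [fourierL2], and testing with real test
    functions shows that this duality determines an L^2 function almost everywhere. The choice made
    by [xget] is thereby controlled. *)
Lemma fourierL2_ae (u : V -> R[i]) ha hb :
  L2 mu (fun x => complex.Re (u x)) -> L2 mu (fun x => complex.Im (u x)) ->
  HT (fun x => complex.Re (u x)) ha -> HT (fun x => complex.Im (u x)) hb ->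
  cL2 mu (fourierL2 u) /\ {ae mu, forall x, fourierL2 u x = fourier_of ha hb x}.
Proof.
move=> lr li Hr Hi; set w := fourier_of ha hb.
have lha := Hr.1; have lhb := Hi.1.
have lw : cL2 mu w.
  apply/cL2P; split; first by apply: L2D; [exact: L2_ev|exact: L2_od].
  by apply: L2B; [exact: L2_ev|exact: L2_od].
have wP phi : schwartz phi -> cintegral mu (fun x => u x * fourier phi x) =
    cintegral mu (fun xi => w xi * phi xi).
  move=> sp; have [l1r l2r l1i l2i] := schwartz_L12 sp.
  have [hr _] := hart_L2 l1r l2r; have [hi _] := hart_L2 l1i l2i.
  pose p x := complex.Re (phi x); pose q x := complex.Im (phi x).
  pose a x := complex.Re (u x); pose b x := complex.Im (u x).
  have M := L2M; have E := L2_ev; have O := L2_od.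
  rewrite /cintegral; congr Complex.
    transitivity (I mu (fun x => a x * ev (hart p) x + a x * od (hart q) x -
        (b x * ev (hart q) x - b x * od (hart p) x))).
      congr I; apply/funext => x; have [e1 e2] := fourierE x l1r l1i.
      transitivity (a x * complex.Re (fourier phi x) - b x * complex.Im (fourier phi x)).
        by rewrite /a /b; case: (u x) (fourier phi x) => ? ? [].
      by rewrite e1 e2 -/p -/q; ring.
    rewrite I_B; [|by apply: L1D; apply: M; auto|by apply: L1B; apply: M; auto].
    rewrite I_D; [|by apply: M; auto..]; rewrite I_B; [|by apply: M; auto..].
    rewrite (HT_ev Hr l1r l2r) (HT_od Hr l1i l2i) (HT_ev Hi l1i l2i) (HT_od Hi l1r l2r).
    rewrite -I_D; [|by apply: M; auto..]; rewrite -I_B; [|by apply: M; auto..].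
    rewrite -I_B; [|by apply: L1D; apply: M; auto|by apply: L1B; apply: M; auto].
    by congr I; apply/funext => x; rewrite /w /fourier_of /p /q; case: (phi x) => c d /=; ring.
  transitivity (I mu (fun x => a x * ev (hart q) x - a x * od (hart p) x +
        (b x * ev (hart p) x + b x * od (hart q) x))).
    congr I; apply/funext => x; have [e1 e2] := fourierE x l1r l1i.
    transitivity (a x * complex.Im (fourier phi x) + b x * complex.Re (fourier phi x)).
      by rewrite /a /b; case: (u x) (fourier phi x) => ? ? [] ? ? /=; ring.
    by rewrite e1 e2 -/p -/q; ring.
  rewrite I_D; [|by apply: L1B; apply: M; auto|by apply: L1D; apply: M; auto].
  rewrite I_B; [|by apply: M; auto..]; rewrite I_D; [|by apply: M; auto..].
  rewrite (HT_ev Hr l1i l2i) (HT_od Hr l1r l2r) (HT_ev Hi l1r l2r) (HT_od Hi l1i l2i).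
  rewrite -I_D; [|by apply: M; auto..]; rewrite -I_B; [|by apply: M; auto..].
  rewrite -I_D; [|by apply: L1B; apply: M; auto|by apply: L1D; apply: M; auto].
  by congr I; apply/funext => x; rewrite /w /fourier_of /p /q; case: (phi x) => c d /=; ring.
have [lF FP] : cL2 mu (fourierL2 u) /\ forall phi, schwartz phi ->
    cintegral mu (fun x => u x * fourier phi x) = cintegral mu (fun xi => fourierL2 u xi * phi xi).
  exact: (xgetPex (fun=> 0) (ex_intro [set w | cL2 mu w /\ forall phi, schwartz phi ->
    cintegral mu (fun x => u x * fourier phi x) = cintegral mu (fun xi => w xi * phi xi)] w (conj lw wP))).
split=> //; have /cL2P[fr fi] := lF; have /cL2P[wr wi] := lw.
have key phi : Ccr setT phi ->
    I mu (fun x => complex.Re (fourierL2 u x) * phi x) = I mu (fun x => complex.Re (w x) * phi x) /\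
    I mu (fun x => complex.Im (fourierL2 u x) * phi x) = I mu (fun x => complex.Im (w x) * phi x).
  move=> cp; have sp := Ccr_schwartz (Cc_real cp).
  have := FP _ sp; rewrite wP// /cintegral => -[e1 e2]; split.
    transitivity (I mu (fun x => complex.Re (fourierL2 u x * (phi x)%:C%C))).
      by congr I; apply/funext => x; case: (fourierL2 u x) => ? ? /=; ring.
    rewrite /I -e1; congr Rintegral; apply/funext => x; rewrite /w /fourier_of /=; ring.
  transitivity (I mu (fun x => complex.Im (fourierL2 u x * (phi x)%:C%C))).
    by congr I; apply/funext => x; case: (fourierL2 u x) => ? ? /=; ring.
  rewrite /I -e2; congr Rintegral; apply/funext => x; rewrite /w /fourier_of /=; ring.
have ae1 := L2_test fr wr (fun phi cp => (key phi cp).1).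
have ae2 := L2_test fi wi (fun phi cp => (key phi cp).2).
apply: filterS2 ae1 ae2 => x; case: (fourierL2 u x) (w x) => ? ? [? ?] /= -> ->//.
Qed.

Definition bwt (s : R) (x : V) : R := (Num.sqrt (1 + edot x x)) `^ s.

Lemma bwt_gt0 s x : 0 < bwt s x.
Proof. by rewrite powR_gt0// sqrtr_gt0 ltr_pwDl// edot_ge0. Qed.

Lemma bwtN s x : bwt s (- x) = bwt s x.
Proof. by rewrite /bwt edotNl edotNr opprK. Qed.

Lemma measurable_bwt s : measurable_fun [set: V] (bwt s).
Proof.
apply: (measurableT_comp (measurable_powR s)).
apply: (measurableT_comp (continuous_measurable_fun (@sqrt_continuous R))).
by apply: measurable_funD => //; exact: measurable_edot.
Qed.

(** Reflection preserves integrals, so only even parts count. This exchanges the squared modulus of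
    the Fourier transform for [ha ^+ 2 + hb ^+ 2]: the discrepancy is odd. *)
Lemma even_rearrange (q1 q2 : V -> R) : measurable_fun [set: V] q1 -> measurable_fun [set: V] q2 ->
  (forall x, 0 <= q1 x) -> (forall x, 0 <= q2 x) ->
  (forall x, q1 x + q1 (- x) = q2 x + q2 (- x)) ->
  L1 mu q1 -> L1 mu q2 /\ I mu q2 = I mu q1.
Proof.
move=> m1 m2 p1 p2 e l1; have [l1' e1] := I_reflect l1.
have l2 : L1 mu q2.
  apply: (L1_le m2 (L1D l1 l1')) => x; rewrite ger0_norm//= e lerDl; exact: p2.
split=> //; have [l2' e2] := I_reflect l2.
have := I_D l2 l2'; rewrite (_ : (fun x => _) = (fun x => q1 x + q1 (- x))).
  by rewrite I_D// e1 e2; lra.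
by apply/funext => x; rewrite e.
Qed.

Definition hq (s : R) (ha hb : V -> R) (x : V) := bwt s x ^+ 2 * (ha x ^+ 2 + hb x ^+ 2).

Lemma qnorm_bessel s (u : V -> R[i]) x :
  qnorm (bessel s u) x = bwt s x ^+ 2 * qnorm (fourierL2 u) x.
Proof. by rewrite /qnorm /bessel -/(bwt s x); case: (fourierL2 u x) => a b /=; ring. Qed.

Lemma bessel_hq s (u : V -> R[i]) ha hb :
  L2 mu (fun x => complex.Re (u x)) -> L2 mu (fun x => complex.Im (u x)) ->
  HT (fun x => complex.Re (u x)) ha -> HT (fun x => complex.Im (u x)) hb ->
  [/\ cmeasurable (bessel s u), L1 mu (qnorm (bessel s u)) <-> L1 mu (hq s ha hb) &
   L1 mu (hq s ha hb) -> I mu (qnorm (bessel s u)) = I mu (hq s ha hb)].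
Proof.
move=> lr li Hr Hi; have [[[mr mi] _] ae] := fourierL2_ae lr li Hr Hi.
have mb := measurable_bwt s.
have mB : cmeasurable (bessel s u).
  split.
    rewrite (_ : (fun x => _) = (fun x => bwt s x * complex.Re (fourierL2 u x))); first exact: measurable_funM.
    by apply/funext => x; rewrite /bessel -/(bwt s x); case: (fourierL2 u x) => a b /=; ring.
  rewrite (_ : (fun x => _) = (fun x => bwt s x * complex.Im (fourierL2 u x))); first exact: measurable_funM.
  by apply/funext => x; rewrite /bessel -/(bwt s x); case: (fourierL2 u x) => a b /=; ring.
pose q x := bwt s x ^+ 2 * qnorm (fourier_of ha hb) x.
have ha2 := Hr.1; have hb2 := Hi.1.
have mq : measurable_fun [set: V] q.
  apply: measurable_funM; first exact: measurable_funX.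
  apply: measurable_qnorm; split.
    by apply: measurable_funD; [exact: (L2_ev ha2).1|exact: (L2_od hb2).1].
  by apply: measurable_funB; [exact: (L2_ev hb2).1|exact: (L2_od ha2).1].
have mh : measurable_fun [set: V] (hq s ha hb).
  apply: measurable_funM; first exact: measurable_funX.
  by apply: measurable_funD; apply: measurable_funX; [exact: ha2.1|exact: hb2.1].
have aq : {ae mu, forall x, qnorm (bessel s u) x = q x}.
  by apply: filterS ae => x e; rewrite qnorm_bessel /q /qnorm e.
have mqb := measurable_qnorm mB.
have q0 x : 0 <= q x by rewrite mulr_ge0 ?sqr_ge0 ?qnorm_ge0.
have h0 x : 0 <= hq s ha hb x by rewrite mulr_ge0 ?addr_ge0 ?sqr_ge0.
have e x : q x + q (- x) = hq s ha hb x + hq s ha hb (- x).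
  by rewrite /q /hq /qnorm bwtN /= /ev /od opprK; field.
have aq' : {ae mu, forall x, q x = qnorm (bessel s u) x} by apply: filterS aq => x ->.
split=> //.
- split=> [l|l].
    by apply: (even_rearrange mq mh q0 h0 e _).1; exact: L1_ae_eq aq l.
  by apply: (L1_ae_eq mqb aq'); apply: (even_rearrange mh mq h0 q0 _ l).1 => x; rewrite e.
- move=> l; rewrite (I_ae_eq mqb mq aq).
  by apply: (even_rearrange mh mq h0 q0 _ l).2 => x; rewrite e.
Qed.

Definition HsR (s : R) (a : V -> R) : Prop := L2 mu a /\
  forall h, HT a h -> L1 mu (fun x => bwt s x ^+ 2 * h x ^+ 2).

(** [e] bounds the squared H^s norm. All transforms [h] are quantified over because [HT] fixes them
    only up to null sets. *)
Definition hsn (s : R) (a : V -> R) (e : R) : Prop := forall h, HT a h ->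
  L1 mu (fun x => bwt s x ^+ 2 * h x ^+ 2) /\ I mu (fun x => bwt s x ^+ 2 * h x ^+ 2) <= e.

Lemma L1_hq s ha hb : measurable_fun [set: V] ha -> measurable_fun [set: V] hb ->
  L1 mu (hq s ha hb) <-> L1 mu (fun x => bwt s x ^+ 2 * ha x ^+ 2) /\
    L1 mu (fun x => bwt s x ^+ 2 * hb x ^+ 2).
Proof.
move=> ma mb; have mw := measurable_bwt s; split=> [l|[la lb]].
  split; apply: (L1_le _ l).
  - by apply: measurable_funM; exact: measurable_funX.
  - move=> x; have h0 h : 0 <= bwt s x ^+ 2 * h x ^+ 2 by rewrite mulr_ge0 ?sqr_ge0.
    by rewrite (ger0_norm (h0 _)) /hq mulrDr lerDl; exact: h0.
  - by apply: measurable_funM; exact: measurable_funX.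
  - move=> x; have h0 h : 0 <= bwt s x ^+ 2 * h x ^+ 2 by rewrite mulr_ge0 ?sqr_ge0.
    by rewrite (ger0_norm (h0 _)) /hq mulrDr lerDr; exact: h0.
by have := L1D la lb; congr (L1 _ _); apply/funext => x; rewrite /hq mulrDr.
Qed.

Lemma I_hq s ha hb : L1 mu (fun x => bwt s x ^+ 2 * ha x ^+ 2) ->
  L1 mu (fun x => bwt s x ^+ 2 * hb x ^+ 2) -> I mu (hq s ha hb) =
  I mu (fun x => bwt s x ^+ 2 * ha x ^+ 2) + I mu (fun x => bwt s x ^+ 2 * hb x ^+ 2).
Proof. by move=> la lb; rewrite -I_D//; congr I; apply/funext => x; rewrite /hq mulrDr. Qed.

Lemma HT_weight_uniq s a h h' : HT a h -> HT a h' ->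
  L1 mu (fun x => bwt s x ^+ 2 * h x ^+ 2) ->
  L1 mu (fun x => bwt s x ^+ 2 * h' x ^+ 2) /\
  I mu (fun x => bwt s x ^+ 2 * h' x ^+ 2) = I mu (fun x => bwt s x ^+ 2 * h x ^+ 2).
Proof.
move=> H H' l; have u := HT_uniq H H'.
have m' : measurable_fun [set: V] (fun x => bwt s x ^+ 2 * h' x ^+ 2).
  by apply: measurable_funM; apply: measurable_funX; [exact: measurable_bwt|exact: H'.1.1].
split; first by apply: (L1_ae_eq m' _ l); apply: filterS u => x ->.
by apply: (I_ae_eq m' (L1_measurable l)); apply: filterS u => x ->.
Qed.

Lemma HsP s (u : V -> R[i]) :
  Hs s u <-> HsR s (fun x => complex.Re (u x)) /\ HsR s (fun x => complex.Im (u x)).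
Proof.
split=> [[/cL2P[lr li] [_ nb]]|[[lr Hr] [li Hi]]].
  have key ha hb : HT (fun x => complex.Re (u x)) ha -> HT (fun x => complex.Im (u x)) hb ->
      L1 mu (fun x => bwt s x ^+ 2 * ha x ^+ 2) /\ L1 mu (fun x => bwt s x ^+ 2 * hb x ^+ 2).
    move=> ra ib; have [mB eq _] := bessel_hq s lr li ra ib.
    apply/L1_hq; [exact: ra.1.1|exact: ib.1.1|]; apply/eq.
    by move: nb; rewrite cL2normE Lnorm2_L1//; [exact: measurable_qnorm|exact: qnorm_ge0].
  have [ha ra] := HT_ex lr; have [hb ib] := HT_ex li.
  by split; split=> // h Hh; [exact: (key _ _ Hh ib).1|exact: (key _ _ ra Hh).2].
have [ha ra] := HT_ex lr; have [hb ib] := HT_ex li.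
have [mB eq _] := bessel_hq s lr li ra ib.
split; first exact/cL2P; split=> //.
rewrite cL2normE Lnorm2_L1; [|exact: measurable_qnorm|exact: qnorm_ge0].
by apply/eq/L1_hq; [exact: ra.1.1|exact: ib.1.1|split; [exact: Hr|exact: Hi]].
Qed.

Lemma Hs_cvgP s (u_ : nat -> V -> R[i]) (u : V -> R[i]) :
  (forall k, cL2 mu (u_ k)) -> cL2 mu u ->
  Hs_cvg s u_ u <-> forall e, 0 < e -> \forall k \near \oo,
    hsn s (fun x => complex.Re (u_ k x) - complex.Re (u x)) e /\
    hsn s (fun x => complex.Im (u_ k x) - complex.Im (u x)) e.
Proof.
move=> lu_ lu; have /cL2P[lr li] := lu.
pose v k x := u_ k x - u x.
have vR k : (fun x => complex.Re (v k x)) = (fun x => complex.Re (u_ k x) - complex.Re (u x)).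
  by apply/funext => x; rewrite /v; case: (u_ k x) (u x) => ? ? [].
have vI k : (fun x => complex.Im (v k x)) = (fun x => complex.Im (u_ k x) - complex.Im (u x)).
  by apply/funext => x; rewrite /v; case: (u_ k x) (u x) => ? ? [].
have lvr k : L2 mu (fun x => complex.Re (v k x)).
  by rewrite vR; apply: L2B => //; have /cL2P[] := lu_ k.
have lvi k : L2 mu (fun x => complex.Im (v k x)).
  by rewrite vI; apply: L2B => //; have /cL2P[] := lu_ k.
have mB k : cmeasurable (bessel s (v k)).
  have [ha ra] := HT_ex (lvr k); have [hb ib] := HT_ex (lvi k).
  by have [] := bessel_hq s (lvr k) (lvi k) ra ib.
have -> : Hs_cvg s u_ u <-> forall e, 0 < e -> \forall k \near \oo,
    L1 mu (qnorm (bessel s (v k))) /\ I mu (qnorm (bessel s (v k))) <= e.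
  rewrite -Lnorm2_near; [|by move=> k; exact: measurable_qnorm|by move=> k x; exact: qnorm_ge0].
  rewrite /Hs_cvg (_ : (fun k => Hs_norm s (fun x => u_ k x - u x)) =
    (fun k => Lnorm mu 2%:E (fun x => (Num.sqrt (qnorm (bessel s (v k)) x))%:E)))//.
  by apply/funext => k; exact: cL2normE.
split=> H e e0.
  have [N _ HN] := H e e0; exists N => // k /= Nk; have [l i] := HN k Nk.
  have [ha ra] := HT_ex (lvr k); have [hb ib] := HT_ex (lvi k).
  have [_ eq1 i1] := bessel_hq s (lvr k) (lvi k) ra ib; have l1 := proj1 eq1 l.
  have /(L1_hq s ra.1.1 ib.1.1)[la lb] := l1.
  have := i; rewrite (i1 l1) I_hq// => iab.
  have pa : 0 <= I mu (fun x => bwt s x ^+ 2 * ha x ^+ 2) by apply: I_ge0 => x; rewrite mulr_ge0 ?sqr_ge0.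
  have pb : 0 <= I mu (fun x => bwt s x ^+ 2 * hb x ^+ 2) by apply: I_ge0 => x; rewrite mulr_ge0 ?sqr_ge0.
  rewrite -vR -vI; split=> h Hh.
    by have [? ->] := HT_weight_uniq ra Hh la; split=> //; lra.
  by have [? ->] := HT_weight_uniq ib Hh lb; split=> //; lra.
have e2 : 0 < e / 2 by lra.
have [N _ HN] := H _ e2; exists N => // k /= Nk; have := HN k Nk; rewrite -vR -vI => -[hr hi].
have [ha ra] := HT_ex (lvr k); have [hb ib] := HT_ex (lvi k).
have [_ eq i1] := bessel_hq s (lvr k) (lvi k) ra ib.
have [la ia] := hr _ ra; have [lb ib'] := hi _ ib.
have l1 : L1 mu (hq s ha hb) by apply/L1_hq; [exact: ra.1.1|exact: ib.1.1|split].
by split; [exact/eq|rewrite i1// I_hq//; lra].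
Qed.

End fourier_hartley.

(** The sum of the [g k] has finite integral and dominates [|f|], since at each point one of its
    terms does. *)
Lemma L1_geometric d (T : measurableType d) (R : realType) (mu : {measure set T -> \bar R})
  (g : nat -> T -> R) (f : T -> R) (c th : R) : 0 <= c -> 0 < th < 1 ->
  (forall k, L1 mu (g k)) -> (forall k x, 0 <= g k x) -> (forall k, I mu (g k) <= c * th ^+ k) ->
  measurable_fun [set: T] f -> (forall x, exists k, `|f x| <= g k x) -> L1 mu f.
Proof.
move=> c0 /andP[t0 t1] lg g0 ig mf fg.
have mE k : measurable_fun [set: T] (fun x => (g k x)%:E).
  by apply/measurable_EFinP; exact: L1_measurable (lg k).
have gE k x : (0 <= (g k x)%:E)%E by rewrite lee_fin.
have S := @integral_nneseries _ _ _ mu setT measurableT (fun k x => (g k x)%:E) mE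
  (fun k x _ => gE k x).
have fin : (\sum_(0 <= k <oo) \int[mu]_x (g k x)%:E <= (c / (1 - th))%:E)%E.
  apply: lime_le; first by apply: is_cvg_nneseries => k _ _; exact: integral_ge0.
  apply: nearW => N; apply: (le_trans (y := (\sum_(0 <= k < N) (c * th ^+ k)%:E)%E)).
    by apply: lee_sum => k _; rewrite -EFin_I// lee_fin.
  rewrite sumEFin lee_fin; have := @geometric_le_lim R N c th c0 t0.
  by rewrite gtr0_norm// => /(_ t1); rewrite /series.
apply/integrableP; split; first exact/measurable_EFinP.
apply: le_lt_trans (ltry (c / (1 - th))); apply: le_trans fin; rewrite -S.
apply: ge0_le_integral => //.
- by apply/measurable_EFinP; exact: (measurableT_comp (@normr_measurable R setT) mf).
- by apply: ge0_emeasurable_sum.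
- move=> x _; have [k fk] := fg x.
  apply: (le_trans (y := (\sum_(0 <= i < k.+1) (g i x)%:E)%E)).
    by rewrite big_nat_recr//= -[leLHS]add0e leeD ?sume_ge0// lee_fin.
  by apply: nneseries_lim_ge => i _ _.
Qed.

(** * The Gagliardo energy *)

Section trig.
Context {R : realType}.

Lemma sin_le_norm (x : R) : `|sin x| <= `|x|.
Proof.
wlog x0 : x / 0 < x.
  move=> H; case: (ltrgtP x 0) => [x0|x0|->]; last by rewrite sin0 normr0.
    by rewrite -normrN -sinN -[leRHS]normrN; apply: H; rewrite oppr_gt0.
  exact: H.
have [|c _] := @MVT R sin cos 0 x x0 (fun t _ => is_derive_sin t).
  by apply: continuous_subspaceT; exact: continuous_sin.
by rewrite sin0 !subr0 => ->; rewrite normrM ler_piMl// cos_max.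
Qed.

Lemma cos_sin2 (t : R) : 2 - 2 * cos t = 4 * sin (t / 2) ^+ 2.
Proof.
have := cos2Dsin2 (t / 2); have := cosD (t / 2) (t / 2).
rewrite (_ : t / 2 + t / 2 = t); last by field.
by rewrite -!expr2 => ->; nra.
Qed.

Lemma cos_sqr_bound (t : R) : 0 <= 2 - 2 * cos t <= minr 4 (t ^+ 2).
Proof.
rewrite cos_sin2 mulr_ge0 ?sqr_ge0//= le_min; apply/andP; split.
  by rewrite -[leRHS]mulr1 ler_wpM2l// -real_normK ?num_real// expr_le1// sin_max.
have := sin_le_norm (t / 2); rewrite -(ler_pXn2r (n := 2)) ?nnegrE//.
by rewrite !real_normK ?num_real// => h; apply: (le_trans (y := 4 * (t / 2) ^+ 2)); [lra|lra].
Qed.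

(** The interval [1/2, 3/2] stays away from the zeros of [2 - 2 * cos t], because pi is at least
    2. *)
Lemma cos_mid_bound : exists2 c : R, 0 < c & forall t, `|t - 1| <= 2^-1 -> c <= 2 - 2 * cos t.
Proof.
have pi2 := @pi_ge2 R.
have h : cos (2^-1 : R) < 1.
  have i1 : (2^-1 : R) \in `[0, pi] by rewrite in_itv/=; apply/andP; split; lra.
  have i0 : (0 : R) \in `[0, pi] by rewrite in_itv/= lexx pi_ge0.
  by have := ltr_cos i0 i1; rewrite cos0 => ->; rewrite invr_gt0.
exists (2 - 2 * cos 2^-1); first by lra.
move=> t; rewrite ler_norml => /andP[t1 t2].
suff : cos t <= cos 2^-1 by lra.
have [->//|te] := eqVneq t 2^-1.
by apply: ltW; rewrite ltr_cos ?in_itv/=; [rewrite lt_neqAle eq_sym te/=; lra|lra|lra].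
Qed.

End trig.

(** * The homogeneous kernel and its Fourier symbol *)

Section kernel.
Context {R : realType} {n : nat} (s : R).
Hypothesis s01 : 0 < s < 1.
Hypothesis n0 : (0 < n)%N.
Local Notation V := 'rV[R]_n.
Local Notation mu := (@leb R n).

Definition pexp : R := n%:R / 2 + s + 1.

(** For z nonzero this is |z|^(-n-2s), and it is 0 at the origin. The unreduced form matches the
    squared length of [zeta]. *)
Definition kap (z : V) : R := edot z z / (enorm z `^ pexp) ^+ 2.

Lemma enorm_ge0 (z : V) : 0 <= enorm z.
Proof. exact: sqrtr_ge0. Qed.

Lemma enorm_sqr (z : V) : enorm z ^+ 2 = edot z z.
Proof. by rewrite sqr_sqrtr// edot_ge0. Qed.

Lemma norm_le_enorm (z : V) : `|z| <= enorm z.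
Proof.
by rewrite -(ler_pXn2r (n := 2)) ?nnegrE ?enorm_ge0// enorm_sqr norm_sqr_le_edot.
Qed.

Lemma enormZ a (z : V) : 0 <= a -> enorm (a *: z) = a * enorm z.
Proof.
by move=> a0; rewrite /enorm edotZl edotZr mulrA -expr2 sqrtrM ?sqr_ge0// sqrtr_sqr ger0_norm.
Qed.

Lemma enormN (z : V) : enorm (- z) = enorm z.
Proof. by rewrite /enorm edotNl edotNr opprK. Qed.

Lemma edot_eq0 (z : V) : edot z z = 0 -> z = 0.
Proof.
move=> h; apply/eqP; rewrite -normr_eq0 -sqrf_eq0 eq_le sqr_ge0 andbT -h.
exact: norm_sqr_le_edot.
Qed.

Lemma kap_ge0 z : 0 <= kap z.
Proof. by rewrite divr_ge0 ?edot_ge0 ?sqr_ge0. Qed.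

Lemma kapN z : kap (- z) = kap z.
Proof. by rewrite /kap enormN edotNl edotNr opprK. Qed.

Lemma kap0 : kap 0 = 0.
Proof. by rewrite /kap edot0 mul0r. Qed.

Lemma measurable_enorm : measurable_fun [set: V] (@enorm R n).
Proof.
apply: (measurableT_comp (continuous_measurable_fun (@sqrt_continuous R))).
exact: measurable_edot.
Qed.

Lemma measurable_kap : measurable_fun [set: V] kap.
Proof.
apply: measurable_funM; first exact: measurable_edot.
apply: (eq_measurable_fun (fun x : V => ((enorm x `^ pexp) ^+ 2) `^ (- 1))) => [x _|].
  by rewrite powR_inv1// sqr_ge0.
apply: (measurableT_comp (measurable_powR (- 1))); apply: measurable_funX.
by apply: (measurableT_comp (measurable_powR pexp)); exact: measurable_enorm.
Qed.

(** For [a > 0] this is a^(-n-2s), the factor by which [kap] changes under dilation by [a]. *)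
Definition hdeg (a : R) : R := a ^+ 2 / (a `^ pexp) ^+ 2.

Lemma kapZ a z : 0 <= a -> kap (a *: z) = hdeg a * kap z.
Proof.
move=> a0; rewrite /kap enormZ// powRM ?enorm_ge0// edotZl edotZr /hdeg exprMn invfM; ring.
Qed.

Lemma hdegM a b : 0 <= a -> 0 <= b -> hdeg (a * b) = hdeg a * hdeg b.
Proof. by move=> a0 b0; rewrite /hdeg powRM// !exprMn invfM; ring. Qed.

Lemma hdeg_gt0 a : 0 < a -> 0 < hdeg a.
Proof. by move=> a0; rewrite divr_gt0 ?exprn_gt0 ?powR_gt0. Qed.

Lemma hdegE a : 0 < a -> a ^+ n * hdeg a * (a `^ s) ^+ 2 = 1.
Proof.
move=> a0.
have e : (a `^ pexp) ^+ 2 = a ^+ n * a ^+ 2 * (a `^ s) ^+ 2.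
  have q m : a ^+ m = a `^ m%:R by rewrite powR_mulrn// ltW.
  rewrite (q n) (q 2%N) -!powR_mulrn ?powR_ge0// -!powRrM -!powRD ?(gt_eqF a0) ?implybT//.
  by congr (_ `^ _); rewrite /pexp; field.
have ? : (a `^ pexp) ^+ 2 != 0 by rewrite expf_neq0// gt_eqF// powR_gt0.
have -> : a ^+ n * hdeg a * (a `^ s) ^+ 2 = (a ^+ n * a ^+ 2 * (a `^ s) ^+ 2) / (a `^ pexp) ^+ 2.
  by rewrite /hdeg; ring.
by rewrite -e divff.
Qed.

Lemma hdeg_le1 (z : V) : 1 <= `|z| -> kap z <= 1.
Proof.
move=> z1; have e1 : 1 <= enorm z := le_trans z1 (norm_le_enorm z).
have e0 : 0 < enorm z by apply: lt_le_trans e1.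
rewrite /kap -enorm_sqr ler_pdivrMr ?mul1r ?exprn_gt0 ?powR_gt0//.
rewrite lerXn2r ?nnegrE ?powR_ge0 ?(ltW e0)//.
rewrite -[leLHS]powRr1 ?(ltW e0)// ler_powR// /pexp.
have := ler0n R n; case/andP: s01; lra.
Qed.

Lemma dyadic (r : R) : 1 <= r -> exists k : nat, 2 ^+ k <= r < 2 ^+ k.+1.
Proof.
move=> r1; have r0 : 0 < r by apply: lt_le_trans r1.
have ex : exists k : nat, r < 2 ^+ k.
  have ri : 0 < r^-1 by rewrite invr_gt0.
  have [k hk] := pow2_large ri; exists k.+1; apply: (le_lt_trans (y := 2 ^+ k)).
    by move: hk; rewrite exprVn lef_pV2 ?posrE ?exprn_gt0.
  by rewrite ltr_eXn2l// ltr1n.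
case: (ex_minnP ex) => -[|k]; first by rewrite expr0 ltNge r1.
by move=> rk /(_ k) h; exists k; rewrite rk andbT leNgt; apply/negP => /h; rewrite ltnn.
Qed.

Definition ann (z : V) : R := \1_(cube (0 : V) 2 `\` cube 0 1) z.

Lemma cube0E (r : R) (z : V) : 0 < r -> cube 0 r z <-> `|z| < r.
Proof.
move=> r0; split=> [h|h i]; first by apply: norm_row_lt => // i; have := h i; rewrite mxE subr0.
by rewrite mxE subr0 (le_lt_trans (norm_coord z i)).
Qed.

Lemma annE (z : V) : ann z = ((1 <= `|z|) && (`|z| < 2))%:R.
Proof.
rewrite /ann indicE; congr (_%:R); congr nat_of_bool; apply/idP/idP.
  rewrite inE => -[/(cube0E _ (ltr0n _ 2)) h1 h2]; rewrite h1 andbT leNgt.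
  by apply/negP => /(cube0E _ ltr01).
move=> /andP[h1 h2]; rewrite inE; split; first exact/(cube0E _ (ltr0n _ 2)).
by move/(cube0E _ ltr01); rewrite ltNge h1.
Qed.

Lemma ann_ge0 z : 0 <= ann z. Proof. by rewrite annE. Qed.

Lemma measurable_ann : measurable_fun [set: V] ann.
Proof. by apply: measurable_indic; apply: measurableD; exact: measurable_cube. Qed.

(** [ann (a^-1 ^+ k *: z)] is the indicator of the annulus dilated by [a ^+ k]. Rescaling it to the
    unit annulus costs the Jacobian [a ^+ n] and the homogeneity factor [b], once for each of the
    [k] dilations. *)
Lemma homog_annuli (f : V -> R) (a b B : R) : 0 < a -> 0 < b ->
  measurable_fun [set: V] f -> (forall z, 0 <= f z) -> (forall z, f (a *: z) = b * f z) ->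
  (forall z, 1 <= `|z| -> `|z| < 2 -> f z <= B) ->
  forall k, L1 mu (fun z => f z * ann (a^-1 ^+ k *: z)) /\
    I mu (fun z => f z * ann (a^-1 ^+ k *: z)) =
      I mu (fun z => f z * ann z) * (a ^+ n * b) ^+ k.
Proof.
move=> a0 b0 mf f0 fa fB k.
have B0 (z : V) : 1 <= `|z| -> `|z| < 2 -> 0 <= B by move=> h1 h2; exact: (le_trans (f0 z) (fB z h1 h2)).
have l0 : L1 mu (fun z => f z * ann z).
  apply: (@L1_bounded_supp R n _ 2 `|B|) => //.
  - by apply: measurable_funM => //; exact: measurable_ann.
  - move=> z nz; rewrite annE; case: ltP => h; last by rewrite andbF mulr0.
    by exfalso; apply: nz; exact/(cube0E _ (ltr0n _ 2)).
  - move=> z; rewrite annE; case: andP => [[h1 h2]|_]; last by rewrite mulr0 normr0.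
    by rewrite mulr1 (ger0_norm (f0 z)) (ger0_norm (B0 z h1 h2)) fB.
have fk j z : f (a ^+ j *: z) = b ^+ j * f z.
  elim: j => [|j IH]; first by rewrite !expr0 scale1r mul1r.
  by rewrite !exprS -scalerA fa IH mulrA.
have ak0 : a ^+ k != 0 by rewrite expf_neq0// gt_eqF.
have aki0 : a^-1 ^+ k != 0 by rewrite exprVn invr_eq0.
pose G y := b ^+ k * (f y * ann y); have lG : L1 mu G by exact: L1Z.
have E : (fun z => f z * ann (a^-1 ^+ k *: z)) = (fun z => G (a^-1 ^+ k *: z + 0)).
  apply/funext => z; rewrite /G; rewrite addr0 mulrA -fk scalerA -exprMn mulfV ?gt_eqF//.
  by rewrite expr1n scale1r.
rewrite E; split; first exact: (L1_affine 0 aki0 lG).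
rewrite (I_affine 0 aki0 lG) I_Z// gtr0_norm ?exprn_gt0 ?invr_gt0//.
by rewrite -exprVn invrK exprMn -!exprM mulnC; ring.
Qed.

Lemma eka_ge0 z w : 0 <= edot z z * kap z * ann w.
Proof. by rewrite mulr_ge0 ?ann_ge0// mulr_ge0 ?edot_ge0 ?kap_ge0. Qed.

Definition mink (z : V) : R := minr 1 (edot z z) * kap z.

Lemma mink_ge0 z : 0 <= mink z.
Proof. by rewrite mulr_ge0 ?kap_ge0// le_min ler01 edot_ge0. Qed.

Lemma measurable_mink : measurable_fun [set: V] mink.
Proof.
apply: measurable_funM; last exact: measurable_kap.
by apply: measurable_minr => //; exact: measurable_edot.
Qed.

(** Over dyadic annuli the integrals are geometric, with ratio 2^(-2s) towards infinity and 2^(2s)/4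
    towards the origin; both are below 1 exactly because 0 < s < 1. *)
Lemma L1_mink : L1 mu mink.
Proof.
have [sp s1] := andP s01.
have p2 : 1 < (2 : R) `^ s < 2.
  have l2 : 0 < ln (2 : R) by rewrite ln_gt0// ltr1n.
  have e2 : expR (ln (2 : R)) = 2 by apply: lnK; rewrite posrE.
  rewrite /powR pnatr_eq0/= -[X in _ && (_ < X)]e2 -[X in (X < _) && _](expR0 R) !ltr_expR.
  by rewrite mulr_gt0//= gtr_pMl.
have q0 : 0 < (2 : R) `^ s by rewrite powR_gt0.
have h2 := hdegE (ltr0n R 2).
have hh : (2^-1 : R) ^+ n * hdeg 2^-1 * 4^-1 = (2 `^ s) ^+ 2 / 4.
  have e : hdeg 2 * hdeg 2^-1 = 1.
    by rewrite -hdegM ?invr_ge0// mulfV// /hdeg powR1 !expr1n divr1.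
  have t0 : (2 : R) ^+ n != 0 by rewrite expf_neq0.
  have d0 : hdeg 2 != 0 by rewrite gt_eqF// hdeg_gt0.
  have -> : hdeg 2^-1 = (hdeg 2)^-1 by apply: (mulfI d0); rewrite e mulfV.
  have -> : ((2 : R) `^ s) ^+ 2 = (2 ^+ n * hdeg 2)^-1.
    by apply: (mulfI (x := 2 ^+ n * hdeg 2)); rewrite ?mulf_neq0// h2 mulfV// mulf_neq0.
  by rewrite exprVn [in RHS]invfM.
have H1 := @homog_annuli kap 2 (hdeg 2) 1 (ltr0n R 2) (hdeg_gt0 (ltr0n R 2)) measurable_kap
  kap_ge0 (fun z => kapZ z (ler0n R 2)) (fun z h _ => hdeg_le1 h).
have hi : 0 < (2^-1 : R) by rewrite invr_gt0.
have H2 := @homog_annuli (fun z => edot z z * kap z) 2^-1 (hdeg 2^-1 * 4^-1) (n%:R * 4) hi.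
have {}H2 : forall k, L1 mu (fun z => edot z z * kap z * ann (2^-1^-1 ^+ k *: z)) /\
    I mu (fun z => edot z z * kap z * ann (2^-1^-1 ^+ k *: z)) =
      I mu (fun z => edot z z * kap z * ann z) * (2^-1 ^+ n * (hdeg 2^-1 * 4^-1)) ^+ k.
  apply: H2.
  - by rewrite mulr_gt0 ?hdeg_gt0 ?invr_gt0.
  - by apply: measurable_funM; [exact: measurable_edot|exact: measurable_kap].
  - by move=> z; rewrite mulr_ge0 ?edot_ge0 ?kap_ge0.
  - by move=> z; rewrite kapZ ?ltW// edotZl edotZr; field.
  - move=> z h1 h2'; rewrite -[leRHS]mulr1; apply: ler_pM; rewrite ?edot_ge0 ?kap_ge0 ?hdeg_le1//.
    rewrite (le_trans (edot_le_norm z))// ler_wpM2l// -[leRHS]/(4%:R) (_ : 4 = 2 ^+ 2); last by ring.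
    by rewrite lerXn2r ?nnegrE// ltW.
rewrite invrK in H2.
pose c1 := I mu (fun z => kap z * ann z); pose c2 := I mu (fun z => edot z z * kap z * ann z).
have c10 : 0 <= c1 by apply: I_ge0 => z; rewrite mulr_ge0 ?kap_ge0 ?ann_ge0.
have c20 : 0 <= c2 by apply: I_ge0 => z; exact: eka_ge0.
pose th := maxr (2 ^+ n * hdeg 2) (2^-1 ^+ n * (hdeg 2^-1 * 4^-1)).
have t1 : 0 < 2 ^+ n * hdeg 2 < 1.
  have X0 : 0 < 2 ^+ n * hdeg 2 by rewrite mulr_gt0 ?exprn_gt0 ?hdeg_gt0.
  rewrite X0/= -[ltRHS]h2 ltr_pMr// exprn_egt1//.
  by case/andP: p2.
have t2 : 0 < 2^-1 ^+ n * (hdeg 2^-1 * 4^-1) < 1.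
  rewrite mulrA hh divr_gt0 ?exprn_gt0//= ltr_pdivrMr// mul1r.
  by case/andP: p2 => _ p2; rewrite (_ : 4 = 2 ^+ 2 :> R) ?ltrXn2r//; ring.
have th01 : 0 < th < 1 by rewrite /th lt_max gt_max; move: t1 t2 => /andP[-> ->] /andP[_ ->].
apply: (@L1_geometric _ _ _ mu (fun k z => kap z * ann (2^-1 ^+ k *: z) +
  edot z z * kap z * ann (2 ^+ k *: z)) _ (c1 + c2) th) => //.
- by rewrite addr_ge0.
- by move=> k; apply: L1D; [exact: (H1 k).1|exact: (H2 k).1].
- by move=> k z; rewrite addr_ge0 ?eka_ge0// mulr_ge0 ?kap_ge0 ?ann_ge0.
- move=> k; rewrite I_D; [|exact: (H1 k).1|exact: (H2 k).1].
  rewrite (H1 k).2 (H2 k).2 -/c1 -/c2 mulrDl lerD// ler_wpM2l// lerXn2r// ?nnegrE.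
  + by case/andP: t1 => /ltW.
  + by case/andP: th01 => /ltW.
  + by rewrite /th le_max lexx.
  + by case/andP: t2 => /ltW.
  + by case/andP: th01 => /ltW.
  + by rewrite /th le_max lexx orbT.
- exact: measurable_mink.
move=> z; rewrite (ger0_norm (mink_ge0 z)).
have [->|z0] := eqVneq z 0.
  by exists 0%N; rewrite /mink kap0 !mulr0 !mul0r addr0.
have nz : 0 < `|z| by rewrite normr_gt0.
case: (leP 1 `|z|) => z1.
  have [k /andP[k1 k2]] := dyadic z1; exists k.
  have -> : ann (2^-1 ^+ k *: z) = 1.
    rewrite annE normrZ gtr0_norm ?exprn_gt0 ?invr_gt0// exprVn.
    by rewrite mulrC ler_pdivlMr ?exprn_gt0// mul1r k1 ltr_pdivrMr ?exprn_gt0// -exprS k2.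
  rewrite mulr1 /mink -[leLHS]addr0; apply: lerD; last by exact: eka_ge0.
  by rewrite ler_piMl ?kap_ge0// ge_min lexx.
have zi : 1 <= `|z|^-1 by rewrite invf_ge1// ltW.
have [k /andP[k1 k2]] := dyadic zi.
(* Inverting [|z|] moves the closed end of the dyadic interval: [k] serves if [2 ^+ k * |z|] is
   exactly 1, and [k.+1] otherwise. *)
have [k' a1] : exists k', ann (2 ^+ k' *: z) = 1.
  have u1 : 2 ^+ k * `|z| <= 1 by rewrite -ler_pdivlMr// mul1r.
  have u2 : 1 < 2 ^+ k.+1 * `|z| by rewrite -ltr_pdivrMr// mul1r.
  have [e|ne] := eqVneq (2 ^+ k * `|z|) 1.
    by exists k; rewrite annE normrZ gtr0_norm ?exprn_gt0// e lexx ltr1n.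
  exists k.+1; rewrite annE normrZ gtr0_norm ?exprn_gt0// (ltW u2)/=.
  by rewrite exprS -mulrA gtr_pMr// lt_neqAle ne u1.
exists k'; rewrite a1 mulr1 /mink -[leLHS]add0r; apply: lerD.
  by rewrite mulr_ge0 ?kap_ge0 ?ann_ge0.
by rewrite ler_wpM2r ?kap_ge0// ge_min lexx orbT.
Qed.

(** The Fourier multiplier of the Gagliardo energy: [2 - 2 * cos (edot z xi)] is the squared modulus
    of exp(i z.xi) - 1, which a shift by [z] produces. *)
Definition symb (xi : V) : R := I mu (fun z => (2 - 2 * cos (edot z xi)) * kap z).

Lemma cauchy_edot (x y : V) : edot x y ^+ 2 <= edot x x * edot y y.
Proof.
have [y0|y0] := eqVneq (edot y y) 0.
  by rewrite (edot_eq0 y0) -(scale0r 0) edotZr mul0r expr0n mulr_ge0 ?edot_ge0.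
have yp : 0 < edot y y by rewrite lt_neqAle eq_sym y0 edot_ge0.
have := edot_ge0 (edot y y *: x - edot x y *: y).
rewrite edotBl !edotBr !edotZl !edotZr (edotC y x) => h.
by rewrite -(ler_pM2l yp); nra.
Qed.

Lemma symb_integrand (xi : V) :
  L1 mu (fun z => (2 - 2 * cos (edot z xi)) * kap z) /\
  forall z, 0 <= (2 - 2 * cos (edot z xi)) * kap z <= (4 + edot xi xi) * mink z.
Proof.
have b z : 0 <= (2 - 2 * cos (edot z xi)) * kap z <= (4 + edot xi xi) * mink z.
  have /andP[c1 c2] := cos_sqr_bound (edot z xi).
  rewrite mulr_ge0 ?kap_ge0//= /mink [leRHS]mulrA ler_wpM2r ?kap_ge0//.
  move: c2; rewrite le_min => /andP[c2 c3].
  have := cauchy_edot z xi; have := edot_ge0 xi; have := edot_ge0 z => z0 x0 cs.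
  by rewrite minEle; case: ifP => h; nra.
split=> //; apply: (L1_le _ (L1Z (4 + edot xi xi) L1_mink)).
  apply: measurable_funM; last exact: measurable_kap.
  apply: measurable_funB => //; apply: measurable_funM => //.
  by apply: (measurableT_comp (continuous_measurable_fun (@continuous_cos R))); exact: measurable_edot.
by move=> z; have /andP[h1 h2] := b z; rewrite ger0_norm.
Qed.

Lemma symb_ge0 xi : 0 <= symb xi.
Proof. by apply: I_ge0 => z; have /andP[] := (symb_integrand xi).2 z. Qed.

(** The substitution of [r^-1 *: z] for [z] and the homogeneity of [kap] give degree 2s; estimates
    of [symb] are thus reduced to unit vectors. *)
Lemma symbZ (r : R) (e : V) : 0 < r -> symb (r *: e) = (r `^ s) ^+ 2 * symb e.
Proof.
move=> r0; have ri : 0 < r^-1 by rewrite invr_gt0.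
have rn : r^-1 != 0 by rewrite gt_eqF.
have [l _] := symb_integrand (r *: e); have := I_affine 0 rn l.
rewrite gtr0_norm// invrK.
have -> : (fun z : V => (2 - 2 * cos (edot (r^-1 *: z + 0) (r *: e))) * kap (r^-1 *: z + 0)) =
  (fun z => hdeg r^-1 * ((2 - 2 * cos (edot z e)) * kap z)).
  apply/funext => z; rewrite addr0 kapZ ?ltW// edotZl edotZr mulrA mulVf ?gt_eqF// mul1r; ring.
rewrite I_Z; last exact: (symb_integrand e).1.
rewrite -/(symb e) -/(symb _) => h.
have h1 := hdegE ri.
have rp : 0 < r `^ s by rewrite powR_gt0.
have h2 : r^-1 `^ s * r `^ s = 1 by rewrite -powRM ?ltW// mulVf ?gt_eqF// powR1.
have rn0 : 0 < r ^+ n by rewrite exprn_gt0.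
apply: (mulfI (x := r ^+ n)); first by rewrite gt_eqF.
rewrite -h; have h3 : r^-1 ^+ n * r ^+ n = 1 by rewrite -exprMn mulVf ?expr1n// gt_eqF.
have -> : hdeg r^-1 = r ^+ n * (r `^ s) ^+ 2.
  have -> : hdeg r^-1 = (r^-1 ^+ n * r ^+ n) * hdeg r^-1 * (r^-1 `^ s * r `^ s) ^+ 2.
    by rewrite h2 h3 expr1n mulr1 mul1r.
  by rewrite -[RHS]mulr1 -h1; ring.
by ring.
Qed.

Lemma symb_unit (e : V) : enorm e = 1 -> symb e <= 5 * I mu mink.
Proof.
move=> e1; have [l b] := symb_integrand e.
rewrite -I_Z; last exact: L1_mink.
apply: I_le => //; first exact: (L1Z _ L1_mink).
by move=> z; have /andP[_] := b z; rewrite -enorm_sqr e1 expr1n (_ : 4 + 1 = 5)//; ring.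
Qed.

Lemma symb_unit_ge : exists2 c, 0 < c & forall e : V, enorm e = 1 -> c <= symb e.
Proof.
have [c c0 hc] := @cos_mid_bound R.
have n0' : 0 < n%:R :> R by rewrite ltr0n.
(* On the cube of radius [r] around the unit vector [e], [edot z e] differs from 1 by at most
   [n%:R * r], that is 1/2, so [cos_mid_bound] applies. *)
pose r : R := (2 * n%:R)^-1; have r0 : 0 < r by rewrite invr_gt0 mulr_gt0.
have r2 : r <= 2^-1 by rewrite lef_pV2 ?posrE ?mulr_gt0// ler_pMr// ler1n.
(* On that cube [enorm z] is at most [2 * n%:R] and [edot z z] at least 1/4, whence
   [kap z >= 4^-1 / K]. *)
pose K : R := ((2 * n%:R) `^ pexp) ^+ 2.
have K0 : 0 < K by rewrite exprn_gt0// powR_gt0// mulr_gt0.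
have nn1 : 1 <= n%:R :> R by rewrite ler1n.
pose d := c * (4^-1 / K) * (2 * r) ^+ n.
exists d.
  apply: mulr_gt0; last by rewrite exprn_gt0// mulr_gt0.
  by apply: mulr_gt0 => //; apply: divr_gt0 => //; rewrite invr_gt0.
move=> e e1; have [l b] := symb_integrand e.
have lc := @L1_indic_cube R n e r (ltW r0).
have -> : d = I mu (fun z => c * (4^-1 / K) * \1_(cube e r) z).
  by rewrite I_Z// I_indic_cube ?ltW.
apply: I_le => //; first exact: L1Z.
move=> z; rewrite indicE; case: (boolP (z \in _)) => zc; last first.
  by rewrite mulr0; have /andP[] := b z.
move: zc; rewrite inE => zc; rewrite mulr1.
have ei i : `|e ord0 i| <= 1.
  by rewrite (le_trans (norm_coord e i))// (le_trans (norm_le_enorm e))// e1.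
have ee : edot e e = 1 by rewrite -enorm_sqr e1 expr1n.
have t : `|edot z e - 1| <= 2^-1.
  have -> : edot z e - 1 = edot (z - e) e by rewrite edotBl ee.
  rewrite /edot (le_trans (ler_norm_sum _ _ _))//.
  apply: (le_trans (y := \sum_(i < n) r)).
    apply: ler_sum => i _; rewrite normrM !mxE; have /ltW zi := zc i.
    by rewrite -[leRHS]mulr1 ler_pM.
  have -> // : \sum_(i < n) r = 2^-1.
  by rewrite sumr_const card_ord -mulr_natr /r; field; rewrite lt0r_neq0.
have zz : 4^-1 <= edot z z.
  have := cauchy_edot z e; rewrite ee mulr1; apply: le_trans.
  by move: t; rewrite ler_norml => /andP[t1 t2]; nra.
have zn : enorm z <= 2 * n%:R.
  rewrite -(ler_pXn2r (n := 2)) ?nnegrE ?enorm_ge0 ?mulr_ge0// enorm_sqr.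
  rewrite (le_trans (edot_le_norm z))// exprMn.
  have nz : `|z| <= 2.
    apply: norm_row_le => // i; have := zc i; have := ei i.
    by have := ler_normD (z ord0 i - e ord0 i) (e ord0 i); rewrite subrK; lra.
  have z2 : `|z| ^+ 2 <= 2 ^+ 2 by rewrite lerXn2r ?nnegrE.
  have := normr_ge0 z; nra.
apply: ler_pM; [by rewrite ltW|by rewrite mulr_ge0 ?invr_ge0 ?ltW|exact: hc|].
apply: ler_pM => //; first by rewrite invr_ge0 ltW.
have zp : 0 < enorm z.
  rewrite lt_neqAle enorm_ge0 andbT eq_sym; apply: contraTneq zz => h.
  by rewrite -enorm_sqr h expr0n/= -ltNge invr_gt0.
have p0 : 0 <= pexp by rewrite /pexp; case/andP: s01 => ? ?; lra.
have zK : (enorm z `^ pexp) ^+ 2 <= K.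
  rewrite /K lerXn2r ?nnegrE ?powR_ge0//; apply: ge0_ler_powR; rewrite ?nnegrE ?enorm_ge0 ?mulr_ge0//.
by rewrite lef_pV2 ?posrE// exprn_gt0// powR_gt0.
Qed.

Lemma bwt_bounds (xi : V) : ((enorm xi) `^ s) ^+ 2 <= bwt s xi ^+ 2 <= 8 * (1 + ((enorm xi) `^ s) ^+ 2).
Proof.
have [sp s1] := andP s01; have e0 := enorm_ge0 xi.
have q0 : 0 <= Num.sqrt (1 + edot xi xi) := sqrtr_ge0 _.
have q1 : 1 <= Num.sqrt (1 + edot xi xi).
  by rewrite -{1}sqrtr1 ler_sqrt ?lerDl ?addr_ge0 ?edot_ge0.
apply/andP; split.
  rewrite lerXn2r ?nnegrE ?powR_ge0// ge0_ler_powR ?nnegrE ?(ltW sp)//.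
  by rewrite ler_sqrt ?lerDr// addr_ge0// edot_ge0.
have h : bwt s xi <= 2 * (1 + (enorm xi) `^ s).
  have qe : Num.sqrt (1 + edot xi xi) <= 1 + enorm xi.
    rewrite -(ler_pXn2r (n := 2)) ?nnegrE ?addr_ge0// sqr_sqrtr ?addr_ge0 ?edot_ge0//.
    by rewrite -enorm_sqr; nra.
  have p2 : (2 : R) `^ s <= 2.
    by rewrite -[leRHS]powRr1// ler_powR ?(ltW s1)// ler1n.
  have [le1|ge1] := leP (enorm xi) 1.
    apply: (le_trans (y := 2 `^ s)).
      by rewrite ge0_ler_powR ?nnegrE ?(ltW sp)// (le_trans qe)//; lra.
    by rewrite (le_trans p2)// ler_pMr// lerDl powR_ge0.
  apply: (le_trans (y := (2 * enorm xi) `^ s)).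
    by rewrite ge0_ler_powR ?nnegrE ?mulr_ge0 ?(ltW sp)// (le_trans qe)//; lra.
  rewrite powRM// ler_pM ?powR_ge0// lerDr//.
have b0 := bwt_gt0 s xi; have p0 : 0 <= (enorm xi) `^ s by rewrite powR_ge0.
have := lerXn2r 2 (ltW b0) (le_trans (ltW b0) h) h.
by have := sqr_ge0 (1 - (enorm xi) `^ s); nra.
Qed.

Lemma symb_upper : exists2 C, 0 <= C & forall xi, symb xi <= C * bwt s xi ^+ 2.
Proof.
have C0 : 0 <= 5 * I mu mink by rewrite mulr_ge0// I_ge0// => z; exact: mink_ge0.
exists (5 * I mu mink) => // xi; have [->|x0] := eqVneq xi 0.
  have -> : symb 0 = 0.
    rewrite -(@I_0 _ _ _ mu); congr I; apply/funext => z.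
    by rewrite -(scale0r 0) edotZr mul0r cos0 mulr1 subrr mul0r.
  by rewrite mulr_ge0// sqr_ge0.
have r0 : 0 < enorm xi.
  rewrite lt_neqAle enorm_ge0 andbT eq_sym; apply: contra x0 => /eqP h.
  by apply/eqP; apply: edot_eq0; rewrite -enorm_sqr h expr0n.
have -> : symb xi = ((enorm xi) `^ s) ^+ 2 * symb ((enorm xi)^-1 *: xi).
  by rewrite -symbZ// scalerA mulfV ?gt_eqF// scale1r.
have e1 : enorm ((enorm xi)^-1 *: xi) = 1 by rewrite enormZ ?invr_ge0 ?ltW// mulVf ?gt_eqF.
rewrite mulrC; apply: ler_pM; rewrite ?symb_ge0 ?sqr_ge0 ?symb_unit//.
by case/andP: (bwt_bounds xi).
Qed.

Lemma symb_lower : exists2 C, 0 <= C & forall xi, bwt s xi ^+ 2 <= C * (1 + symb xi).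
Proof.
have [c c0 hc] := symb_unit_ge.
exists (8 * (1 + c^-1)); first by rewrite mulr_ge0// addr_ge0// invr_ge0 ltW.
move=> xi; have /andP[_ b] := bwt_bounds xi; apply: le_trans b _.
rewrite -mulrA ler_pM2l//; have ci : 0 < c^-1 by rewrite invr_gt0.
have m0 := symb_ge0 xi.
suff : ((enorm xi) `^ s) ^+ 2 <= c^-1 * symb xi by nra.
have [->|x0] := eqVneq xi 0.
  by rewrite /enorm edot0 sqrtr0 powR0 ?gt_eqF ?expr0n ?mulr_ge0 ?symb_ge0 ?ltW//; case/andP: s01.
have r0 : 0 < enorm xi.
  rewrite lt_neqAle enorm_ge0 andbT eq_sym; apply: contra x0 => /eqP h.
  by apply/eqP; apply: edot_eq0; rewrite -enorm_sqr h expr0n.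
have e1 : enorm ((enorm xi)^-1 *: xi) = 1 by rewrite enormZ ?invr_ge0 ?ltW// mulVf ?gt_eqF.
have -> : symb xi = ((enorm xi) `^ s) ^+ 2 * symb ((enorm xi)^-1 *: xi).
  by rewrite -symbZ// scalerA mulfV ?gt_eqF// scale1r.
by rewrite mulrCA ler_peMr ?sqr_ge0// -(mulVf (lt0r_neq0 c0)) ler_pM2l// hc.
Qed.

End kernel.

(** * The energy of test functions on the Fourier side *)

Section energy.
Context {R : realType} {n : nat} (s : R).
Hypothesis s01 : 0 < s < 1.
Hypothesis n0 : (0 < n)%N.
Local Notation V := 'rV[R]_n.
Local Notation mu := (@leb R n).
Local Notation mm := (mu \x mu)%E.
Local Notation c_ := (@cG R n).
Local Notation kap := (@kap R n s).
Local Notation mink := (@mink R n s).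
Local Notation symb := (@symb R n s).
Implicit Types phi u h : V -> R.

Lemma L1_shift phi z : L1 mu phi -> L1 mu (fun x => phi (x + z)) /\
  I mu (fun x => phi (x + z)) = I mu phi.
Proof.
move=> lp; have o1 : (1 : R) != 0 by rewrite oner_eq0.
have := L1_affine z o1 lp; have := I_affine z o1 lp.
rewrite normr1 invr1 expr1n mul1r.
have -> : (fun x => phi (1 *: x + z)) = (fun x => phi (x + z)) by apply/funext => x; rewrite scale1r.
by [].
Qed.

Lemma L2_shift phi z : L2 mu phi -> L2 mu (fun x => phi (x + z)).
Proof.
move=> [mp lp]; split; last exact: (L1_shift z lp).1.
apply: (measurableT_comp mp); have := @measurable_affine R n 1 z.
by congr (measurable_fun _ _); apply/funext => x; rewrite scale1r.
Qed.

Lemma hart_shift phi z xi : L1 mu phi ->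
  hart (fun x => phi (x + z)) xi = cos (edot z xi) * hart phi xi - sin (edot z xi) * hart phi (- xi).
Proof.
move=> lp; rewrite /hart.
have l := L1_cas xi lp; have l' := L1_cas (- xi) lp.
rewrite -!I_Z// -I_B; [|exact: L1Z..].
have := (L1_shift z (L1B (L1Z (cos (edot z xi)) l) (L1Z (sin (edot z xi)) l'))).2 => <-.
congr I; apply/funext => x; rewrite !edotNr edotDl /cas !(cosN, sinN) cosD sinD.
have := cos2Dsin2 (edot z xi); set a := cos (edot z xi); set b := sin (edot z xi) => h.
set p := phi _; set C := cos _; set S := sin _.
transitivity ((a ^+ 2 + b ^+ 2) * ((C + S) * p)); last by ring.
by rewrite h mul1r.
Qed.

Definition dsq phi (z : V) : R := sqI mu (fun x => phi (x + z) - phi x).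

Lemma dsq_hart phi z : L1 mu phi -> L2 mu phi ->
  c_ * dsq phi z = I mu (fun xi => (2 - 2 * cos (edot z xi)) * hart phi xi ^+ 2).
Proof.
move=> lp l2p; have [lz _] := L1_shift z lp; have l2z := L2_shift z l2p.
pose d x := phi (x + z) + -1 * phi x.
have ld : L1 mu d by apply: L1D => //; exact: L1Z.
have l2d : L2 mu d by apply: L2D => //; exact: L2Z.
have -> : dsq phi z = sqI mu d by congr sqI; apply/funext => x; rewrite /d mulN1r.
rewrite -(HT_sqI l2d (HT_hart ld l2d)) /sqI.
have [lh _] := hart_L2 lp l2p; have lh' := L2_reflect lh.
have E xi : hart d xi = (cos (edot z xi) - 1) * hart phi xi - sin (edot z xi) * hart phi (- xi).
  by rewrite /d hartD//= ?hartZ ?hart_shift//; [ring|exact: L1Z].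
pose q1 xi := (2 - 2 * cos (edot z xi)) * hart phi xi ^+ 2.
have mc : measurable_fun [set: V] (fun xi => 2 - 2 * cos (edot z xi)).
  apply: measurable_funB => //; apply: measurable_funM => //.
  by apply: (measurableT_comp (continuous_measurable_fun (@continuous_cos R))); exact: measurable_edot.
have q0 xi : 0 <= q1 xi by rewrite mulr_ge0 ?sqr_ge0//; case/andP: (cos_sqr_bound (edot z xi)).
have lq : L1 mu q1.
  apply: (L1_le _ (L1Z 4 lh.2)).
    by apply: measurable_funM => //; apply: measurable_funX; exact: lh.1.
  move=> xi; rewrite ger0_norm ?q0// /q1 ler_wpM2r ?sqr_ge0//.
  by case/andP: (cos_sqr_bound (edot z xi)) => _; rewrite le_min => /andP[].
have md : measurable_fun [set: V] (fun xi => hart d xi ^+ 2).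
  by apply: measurable_funX; exact: (measurable_hart (L1_measurable ld)).
(* [hart d] mixes the values at [xi] and [- xi]; the mixed terms cancel once the squares at the two
   points are added. *)
apply: (even_rearrange (L1_measurable lq) md q0 (fun xi => sqr_ge0 _) _ lq).2.
move=> xi; rewrite !E /q1 !edotNr cosN sinN opprK.
have := cos2Dsin2 (edot z xi); set a := cos (edot z xi); set b := sin (edot z xi) => h.
set p := hart phi xi; set q := hart phi (- xi).
have -> : b ^+ 2 = 1 - a ^+ 2 -> ((a - 1) * p - b * q) ^+ 2 + ((a - 1) * q - - b * p) ^+ 2 =
   (2 - 2 * a) * p ^+ 2 + (2 - 2 * a) * q ^+ 2 by move=> hb; transitivity ((a - 1) ^+ 2 * (p ^+ 2 + q ^+ 2) + b ^+ 2 * (p ^+ 2 + q ^+ 2)); [ring|rewrite hb; ring].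
  by [].
by rewrite -h; ring.
Qed.

Definition kmin_bound phi (C : R) := forall z, dsq phi z <= C * minr 1 (edot z z).

Lemma dsq_bound phi : Ccr setT phi -> exists2 C, 0 <= C & kmin_bound phi C.
Proof.
move=> cp; have [L L0 hL] := Ccr_lipschitz cp; have [r r0 hr] := csupp_cube cp.2.
have lp := Ccr_L2 cp.
(* [C1] serves for [edot z z < 1]: the Lipschitz bound on the cube of radius [r + 1], off which both
   values vanish. [C2] serves for the remaining shifts, through (a - b)^2 <= 2 a^2 + 2 b^2. *)
pose C1 := L ^+ 2 * (2 * (r + 1)) ^+ n; pose C2 := 4 * sqI mu phi.
have C10 : 0 <= C1 by rewrite mulr_ge0 ?sqr_ge0// exprn_ge0// mulr_ge0// addr_ge0// ltW.
have C20 : 0 <= C2 by rewrite mulr_ge0// sqI_ge0.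
exists (C1 + C2); first by rewrite addr_ge0.
move=> z; have d2 : dsq phi z <= C2.
  have := sqI_le2 (L2_shift z lp) (L2N lp).
  have -> : sqI mu (fun x => phi (x + z)) = sqI mu phi.
    by rewrite /sqI; exact: (L1_shift z lp.2).2.
  have -> : sqI mu (fun x => - phi x) = sqI mu phi.
    by congr I; apply/funext => x; rewrite sqrrN.
  by rewrite /dsq /C2; lra.
rewrite minEle; case: ifP => [_|/negbT]; first by rewrite mulr1; lra.
rewrite -ltNge => z1; have zn : `|z| ^+ 2 <= edot z z := norm_sqr_le_edot z.
have z1' : `|z| < 1.
  by rewrite -(ltr_pXn2r (n := 2)) ?nnegrE// expr1n (le_lt_trans zn).
apply: (le_trans (y := C1 * edot z z)); last by rewrite ler_wpM2r ?edot_ge0// lerDl.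
have r1 : 0 <= r + 1 by rewrite addr_ge0// ltW.
have lc := @L1_indic_cube R n 0 (r + 1) r1.
have -> : C1 * edot z z = I mu (fun x => L ^+ 2 * edot z z * \1_(cube 0 (r + 1)) x).
  by rewrite I_Z// I_indic_cube// /C1; ring.
apply: I_le; [exact: (L2B (L2_shift z lp) lp).2|exact: L1Z|].
move=> x; rewrite indicE; case: (boolP (x \in _)) => [_|]; rewrite ?mulr1 ?mulr0.
  apply: (le_trans (y := (L * `|z|) ^+ 2)).
    rewrite -real_normK ?num_real// lerXn2r ?nnegrE ?mulr_ge0//.
    by have := hL (x + z) x; rewrite addrAC subrr add0r.
  by rewrite exprMn ler_wpM2l// sqr_ge0.
rewrite notin_setE => xc.
have nx : ~ cube 0 r x.
  by move=> h; apply: xc => i; apply: (lt_trans (h i)); rewrite ltrDl.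
have nxz : ~ cube 0 r (x + z).
  move=> h; apply: xc => i; have := h i; rewrite !mxE !subr0 => h1.
  have := norm_coord z i; have := ler_normB (x ord0 i + z ord0 i) (z ord0 i).
  by rewrite addrK; lra.
by rewrite (hr _ nx) (hr _ nxz) subrr expr0n.
Qed.

(** A scalar stand-in for the fractional gradient: [sqI] of it is the Gagliardo energy without the
    constant. *)
Definition dq u (z : V * V) : R := (u z.2 - u z.1) * Num.sqrt (kap (z.1 - z.2)).

Lemma dq_sqr u z : dq u z ^+ 2 = (u z.2 - u z.1) ^+ 2 * kap (z.1 - z.2).
Proof. by rewrite exprMn sqr_sqrtr// kap_ge0. Qed.

Lemma measurable_kap2 : measurable_fun [set: V * V] (fun z => kap (z.1 - z.2)).
Proof. by apply: (measurableT_comp (@measurable_kap R n s)); exact: measurable_rVB. Qed.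

Lemma measurable_dq u : measurable_fun [set: V] u -> measurable_fun [set: V * V] (dq u).
Proof.
move=> mu_; apply: measurable_funM.
  by apply: measurable_funB; exact: measurableT_comp.
apply: (measurableT_comp (continuous_measurable_fun (@sqrt_continuous R))).
exact: measurable_kap2.
Qed.

Lemma L1_minkC (f : V -> R) C : measurable_fun [set: V] f -> (forall z, 0 <= f z <= C * mink z) -> L1 mu f.
Proof.
move=> mf fC; apply: (L1_le mf (L1Z C (L1_mink s01))) => z.
by have /andP[h1 h2] := fC z; rewrite ger0_norm.
Qed.

(* substituting y = x + z turns the Gagliardo energy into an integral of [dsq phi] *)
Lemma energy_dsq phi : Ccr setT phi ->
  [/\ L2 mm (dq phi), L1 mu (fun z => kap z * dsq phi z) &
   sqI mm (dq phi) = I mu (fun z => kap z * dsq phi z)].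
Proof.
move=> cp; have [C C0 hC] := dsq_bound cp; have lp := Ccr_L2 cp; have mp := Ccr_measurable cp.
have [L L0 hL] := Ccr_lipschitz cp; have [M M0 hM] := Ccr_bounded cp.
pose g (p : V * V) := (phi (p.1 + p.2) - phi p.1) ^+ 2 * kap p.2.
have mg : measurable_fun [set: V * V] g.
  apply: measurable_funM; last by apply: (measurableT_comp (@measurable_kap R n s)).
  apply: measurable_funX; apply: measurable_funB; last exact: measurableT_comp.
  by apply: (measurableT_comp mp); exact: measurable_rVD.
have lz z : L1 mu (fun x => g (x, z)).
  rewrite (_ : (fun x => _) = (fun x => kap z * (phi (x + z) - phi x) ^+ 2)).
    exact: (L1Z (kap z) (L2B (L2_shift z lp) lp).2).
  by apply/funext => x; rewrite /g mulrC.
have iz z : I mu (fun x => g (x, z)) = kap z * dsq phi z.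
  rewrite /dsq /sqI -I_Z; last exact: (L2B (L2_shift z lp) lp).2.
  by congr I; apply/funext => x; rewrite /g mulrC.
have g0 p : 0 <= g p by rewrite mulr_ge0 ?sqr_ge0 ?kap_ge0.
have lk : L1 mu (fun z => kap z * dsq phi z).
  apply: (@L1_minkC _ C).
    rewrite (_ : (fun z => _) = (fun z => I mu (fun x => (fun q : V * V => g (q.2, q.1)) (z, x)))).
      apply: (@measurable_I2 _ _ V V R mu (fun q : V * V => g (q.2, q.1))).
      have ms : measurable_fun [set: V * V] (fun q : V * V => (q.2, q.1)) by exact: measurable_fun_pair.
      exact: (measurableT_comp mg ms).
    by apply/funext => z; rewrite iz.
  move=> z; rewrite mulr_ge0 ?kap_ge0 ?sqI_ge0//= /mink mulrA mulrC ler_wpM2r ?kap_ge0//.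
have lg : L1 mm g.
  apply: tonelli2 => //; rewrite (_ : (fun z => _) = (fun z => kap z * dsq phi z))//.
  by apply/funext => z; rewrite -iz; congr I; apply/funext => x; rewrite ger0_norm.
have Mb x z : (phi (x + z) - phi x) ^+ 2 <= (4 * M ^+ 2 + L ^+ 2) * minr 1 (edot z z).
  have h1 := hL (x + z) x; rewrite addrAC subrr add0r in h1.
  have h2 := hM (x + z); have h3 := hM x; have zn := norm_sqr_le_edot z.
  rewrite -real_normK ?num_real//.
  have h4 : `|phi (x + z) - phi x| <= 2 * M by have := ler_normB (phi (x + z)) (phi x); lra.
  have a0 := normr_ge0 (phi (x + z) - phi x); have zz0 := normr_ge0 z.
  rewrite minEle; case: ifP => h; first by nra.
  have : `|phi (x + z) - phi x| ^+ 2 <= (L * `|z|) ^+ 2 by rewrite lerXn2r ?nnegrE ?mulr_ge0.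
  have := edot_ge0 z; have := sqr_ge0 M; have := sqr_ge0 L; rewrite exprMn; nra.
have gx x : L1 mu (fun z => g (x, z)).
  apply: (@L1_minkC _ (4 * M ^+ 2 + L ^+ 2)); first exact: measurable_section1 mg.
  by move=> z; rewrite g0/= /g/= /mink [leRHS]mulrA ler_wpM2r ?kap_ge0.
have ex x z : g (x, z) = dq phi (x, z + x) ^+ 2.
  rewrite dq_sqr /g/= (addrC z x); congr (_ * _).
  by rewrite opprD addrA subrr add0r kapN.
have o1 : (1 : R) != 0 by rewrite oner_eq0.
have md : measurable_fun [set: V * V] (fun z => dq phi z ^+ 2).
  by apply: measurable_funX; exact: measurable_dq.
have dx x : L1 mu (fun y => dq phi (x, y) ^+ 2) /\
    I mu (fun y => dq phi (x, y) ^+ 2) = I mu (fun z => g (x, z)).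
  have e : (fun y => dq phi (x, y) ^+ 2) = (fun y => (fun z => g (x, z)) (1 *: y + - x)).
    by apply/funext => y; rewrite ex scale1r subrK.
  split; first by rewrite e; exact: (L1_affine (- x) o1 (gx x)).
  by rewrite e (I_affine (- x) o1 (gx x)) normr1 invr1 expr1n mul1r.
have [lI iI] := fubini1 lg.
have ld : L1 mm (fun z => dq phi z ^+ 2).
  apply: tonelli1 => //; first by move=> x; exact: (dx x).1.
  rewrite (_ : (fun x => _) = (fun x => I mu (fun z => g (x, z))))//.
  apply/funext => x; rewrite -(dx x).2; congr I; apply/funext => y; by rewrite ger0_norm// sqr_ge0.
split=> //; first by split=> //; exact: measurable_dq.
rewrite /sqI (fubini1 ld).2 (_ : (fun x => _) = (fun x => I mu (fun z => g (x, z)))); last first.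
  by apply/funext => x; rewrite (dx x).2.
rewrite -iI (fubini2 lg).2; congr I; apply/funext => z; exact: iz.
Qed.

(** Plancherel for each fixed shift [z], integrated against [kap z]; exchanging the integrals
    collects the factor [symb xi]. *)
Lemma energy_symb phi : Ccr setT phi ->
  L1 mu (fun xi => symb xi * hart phi xi ^+ 2) /\
  c_ * sqI mm (dq phi) = I mu (fun xi => symb xi * hart phi xi ^+ 2).
Proof.
move=> cp; have [_ lk ->] := energy_dsq cp.
have lp := Ccr_L1 cp; have l2p := Ccr_L2 cp; have [lh _] := hart_L2 lp l2p.
have mh := lh.1.
pose F (p : V * V) := (2 - 2 * cos (edot p.1 p.2)) * kap p.1 * hart phi p.2 ^+ 2.
have mF : measurable_fun [set: V * V] F.
  apply: measurable_funM; last by apply: measurable_funX; exact: measurableT_comp.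
  apply: measurable_funM; last by apply: (measurableT_comp (@measurable_kap R n s)).
  apply: measurable_funB => //; apply: measurable_funM => //.
  by apply: (measurableT_comp (continuous_measurable_fun (@continuous_cos R))); exact: measurable_edot.
have b (z xi : V) := cos_sqr_bound (edot z xi).
have F0 p : 0 <= F p.
  by rewrite mulr_ge0 ?sqr_ge0// mulr_ge0 ?kap_ge0//; case/andP: (b p.1 p.2).
have lz z : L1 mu (fun xi => (2 - 2 * cos (edot z xi)) * hart phi xi ^+ 2).
  apply: (L1_le _ (L1Z 4 lh.2)).
    apply: measurable_funM; last exact: measurable_funX.
    apply: measurable_funB => //; apply: measurable_funM => //.
    by apply: (measurableT_comp (continuous_measurable_fun (@continuous_cos R))); exact: measurable_edot.
  move=> xi; have /andP[h1 h2] := b z xi; rewrite (ger0_norm (mulr_ge0 h1 (sqr_ge0 _))).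
  by rewrite ler_wpM2r ?sqr_ge0//; move: h2; rewrite le_min => /andP[].
have Ez z : (fun xi => F (z, xi)) = (fun xi => kap z * ((2 - 2 * cos (edot z xi)) * hart phi xi ^+ 2)).
  by apply/funext => xi; rewrite /F/=; ring.
have iz z : I mu (fun xi => F (z, xi)) = c_ * (kap z * dsq phi z).
  by rewrite Ez I_Z// -dsq_hart//; ring.
have lF : L1 mm F.
  apply: tonelli1 => //; first by move=> z; rewrite Ez; exact: L1Z.
  rewrite (_ : (fun x => _) = (fun z => c_ * (kap z * dsq phi z))); first exact: L1Z.
  by apply/funext => z; rewrite -iz; congr I; apply/funext => xi; rewrite ger0_norm.
have Exi xi : I mu (fun z => F (z, xi)) = symb xi * hart phi xi ^+ 2.
  rewrite mulrC /symb -I_Z; last exact: (symb_integrand s01 xi).1.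
  by congr I; apply/funext => z; rewrite /F/= mulrC.
have [l2 i2] := fubini2 lF; have [l1 i1] := fubini1 lF.
have E2 : (fun y => I mu (fun x => F (x, y))) = (fun xi => symb xi * hart phi xi ^+ 2).
  by apply/funext => xi.
rewrite E2 in l2 i2; split=> //; rewrite -i2 i1 -I_Z//.
by congr I; apply/funext => z; rewrite iz.
Qed.

Lemma HsR_Ccr phi : Ccr setT phi -> L1 mu (fun xi => bwt s xi ^+ 2 * hart phi xi ^+ 2).
Proof.
move=> cp; have [ls _] := energy_symb cp; have [C C0 hC] := symb_lower s01 n0.
have [lh _] := hart_L2 (Ccr_L1 cp) (Ccr_L2 cp).
apply: (L1_le _ (L1Z C (L1D lh.2 ls))).
  by apply: measurable_funM; apply: measurable_funX; [exact: measurable_bwt|exact: lh.1].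
move=> xi; rewrite (ger0_norm (mulr_ge0 (sqr_ge0 _) (sqr_ge0 _))).
have := hC xi; have := sqr_ge0 (hart phi xi); nra.
Qed.

Lemma energy_upper : exists2 C, 0 <= C & forall phi, Ccr setT phi ->
  sqI mm (dq phi) <= C * I mu (fun xi => bwt s xi ^+ 2 * hart phi xi ^+ 2).
Proof.
have [C C0 hC] := @symb_upper R n s s01; have c0 := @cG_gt0 R n.
exists (c_^-1 * C); first by rewrite mulr_ge0// invr_ge0 ltW.
move=> phi cp; have [ls e] := energy_symb cp; have lb := HsR_Ccr cp.
rewrite -(ler_pM2l c0) e !mulrA mulfV ?gt_eqF// mul1r -I_Z//; apply: I_le => //; first exact: L1Z.
by move=> xi; rewrite mulrA ler_wpM2r ?sqr_ge0.
Qed.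

Lemma energy_lower : exists2 C, 0 <= C & forall phi, Ccr setT phi ->
  I mu (fun xi => bwt s xi ^+ 2 * hart phi xi ^+ 2) <= C * (sqI mu phi + sqI mm (dq phi)).
Proof.
have [C C0 hC] := symb_lower s01 n0; have c0 := @cG_gt0 R n.
exists (C * c_); first by rewrite mulr_ge0// ltW.
move=> phi cp; have [ls e] := energy_symb cp; have lb := HsR_Ccr cp.
have lp := Ccr_L1 cp; have l2p := Ccr_L2 cp; have [lh _] := hart_L2 lp l2p.
have Es := HT_sqI l2p (HT_hart lp l2p).
rewrite -mulrA mulrDr -Es e /sqI -I_D//; last exact: lh.2.
rewrite -I_Z; last by apply: L1D => //; exact: lh.2.
apply: I_le => //; first by apply: L1Z; apply: L1D => //; exact: lh.2.
move=> xi; have := hC xi; have := sqr_ge0 (hart phi xi); nra.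
Qed.

End energy.

Section closed_lim.
Context d (T : measurableType d) (R : realType) (m : {measure set T -> \bar R}).

Lemma L2cvg_ae (f_ : nat -> T -> R) f g : L2 m g -> L2 m f ->
  {ae m, forall x, f x = g x} -> L2cvg m f_ f -> (forall n, L2 m (f_ n)) -> L2cvg m f_ g.
Proof.
move=> lg lf fg cf l_; rewrite /L2cvg.
rewrite (_ : (fun n => _) = (fun n => sqI m (fun x => f_ n x - f x)))//.
apply/funext => n; apply: I_ae_eq; [exact: L1_measurable (L2B (l_ n) lg).2|
  exact: L1_measurable (L2B (l_ n) lf).2|by apply: filterS fg => x ->].
Qed.

(** A closed-graph argument: for an L^2-Cauchy sequence, a pointwise limit along a subsequence must
    be the L^2 limit. It serves for difference quotients and for multiplication by the Bessel
    weight. *)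
Lemma closed_lim (f_ : nat -> T -> R) (f : T -> R) (sg : nat -> nat) :
  (forall n, L2 m (f_ n)) -> measurable_fun [set: T] f ->
  (forall n, (n <= sg n)%N) -> {ae m, forall x, f_ (sg n) x @[n --> \oo] --> f x} ->
  (forall e, 0 < e -> exists N, forall k l, (N <= k)%N -> (N <= l)%N ->
    sqI m (fun x => f_ k x - f_ l x) <= e) ->
  L2 m f /\ L2cvg m f_ f.
Proof.
move=> l_ mf sgn ae C; have [g [lg cg]] := L2_complete l_ C.
have cs : L2cvg m (fun n => f_ (sg n)) g.
  apply/cvgrPdist_lt => e e0; have /cvgrPdist_lt/(_ _ e0)[N _ HN] := cg.
  by exists N => // k Nk; exact: (HN _ (leq_trans Nk (sgn k))).
have [t [tn aet]] := L2cvg_subseq (fun n => l_ (sg n)) lg cs.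
have fg : {ae m, forall x, g x = f x}.
  apply: filterS2 ae aet => x a b; apply: (cvg_seq_eq b (v := fun n => f_ (sg (t n)) x)) => //.
  apply/cvgrPdist_lt => e e0; have /cvgrPdist_lt/(_ _ e0)[N _ HN] := a.
  by exists N => // k Nk; exact: (HN _ (leq_trans Nk (tn k))).
have lf : L2 m f.
  split=> //; apply: (L1_ae_eq (measurable_funX 2 mf) _ lg.2).
  by apply: filterS fg => x ->.
by split=> //; exact: (L2cvg_ae lf lg fg cg l_).
Qed.

Lemma L2cvg_near (f_ : nat -> T -> R) f : L2cvg m f_ f <->
  forall e, 0 < e -> \forall n \near \oo, sqI m (fun x => f_ n x - f x) <= e.
Proof.
split=> [/cvgrPdist_le H e /H[N _ HN]|H].
  by exists N => // n /HN; rewrite /= sub0r normrN ger0_norm ?sqI_ge0.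
apply/cvgrPdist_le => e /H[N _ HN]; exists N => // n /HN.
by rewrite /= sub0r normrN ger0_norm ?sqI_ge0.
Qed.

End closed_lim.

(** * Sobolev functions as limits of test functions *)

Section spaces.
Context {R : realType} {n : nat} (s : R).
Hypothesis s01 : 0 < s < 1.
Hypothesis n0 : (0 < n)%N.
Local Notation V := 'rV[R]_n.
Local Notation mu := (@leb R n).
Local Notation mm := (mu \x mu)%E.
Local Notation c_ := (@cG R n).
Local Notation dq := (@dq R n s).
Local Notation kap := (@kap R n s).
Implicit Types u v : V -> R.

Lemma dqB u v z : dq (fun x => u x - v x) z = dq u z - dq v z.
Proof. by rewrite /dq; ring. Qed.

Lemma dqD u v z : dq (fun x => u x + v x) z = dq u z + dq v z.
Proof. by rewrite /dq; ring. Qed.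

Lemma dqZ k u z : dq (fun x => k * u x) z = k * dq u z.
Proof. by rewrite /dq; ring. Qed.

Lemma dq_Ccr u : Ccr setT u -> L2 mm (dq u).
Proof. by move=> cu; have [] := energy_dsq s01 cu. Qed.

Lemma dq_lim (phi_ : nat -> V -> R) u : (forall k, Ccr setT (phi_ k)) -> L2 mu u ->
  L2cvg mu phi_ u ->
  (forall e, 0 < e -> exists N, forall k l, (N <= k)%N -> (N <= l)%N ->
    sqI mm (dq (fun x => phi_ k x - phi_ l x)) <= e) ->
  L2 mm (dq u) /\ L2cvg mm (fun k => dq (phi_ k)) (dq u).
Proof.
move=> cp lu cu C; have [sg [sgn ae]] := L2cvg_subseq (fun k => Ccr_L2 (cp k)) lu cu.
apply: (closed_lim (sg := sg)) => //.
- by move=> k; exact: dq_Ccr.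
- by apply: measurable_dq; exact: lu.1.
- apply: filterS2 (ae_fst mu ae) (ae_snd mu ae) => z a b.
  by apply: cvgM; [exact: cvgB|exact: cvg_cst].
- move=> e /C[N HN]; exists N => k l Nk Nl; move: (HN k l Nk Nl).
  by congr (sqI _ _ <= _); apply/funext => z; rewrite dqB.
Qed.

(** The real counterpart of [tildeHs]: one sequence of test functions converges in L^2 and in
    energy. With [U = setT] it is the space on which the form is evaluated. *)
Definition HU (U : set V) u : Prop := [/\ L2 mu u, L2 mm (dq u) & exists phi_,
  [/\ forall k, Ccr U (phi_ k), L2cvg mu phi_ u & L2cvg mm (fun k => dq (phi_ k)) (dq u)]].

Lemma HU_sub (U1 U2 : set V) u : U1 `<=` U2 -> HU U1 u -> HU U2 u.
Proof.
move=> U12 [l1 l2 [phi [cp a b]]]; split=> //; exists phi; split=> // k.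
exact: (Ccr_sub U12 (cp k)).
Qed.

Lemma HU_Ccr U u : Ccr U u -> HU U u.
Proof.
move=> cu; have cT := Ccr_sub (@subsetT _ U) cu.
split; [exact: Ccr_L2 cu|exact: dq_Ccr|exists (fun=> u); split=> //; exact: L2cvg_cst].
Qed.

Lemma HU_D U u v : HU U u -> HU U v -> HU U (fun x => u x + v x).
Proof.
move=> [lu du [p [cp pu dpu]]] [lv dv [q [cq qv dqv]]].
have T k : Ccr setT (p k) by exact: (Ccr_sub (@subsetT _ U) (cp k)).
have T' k : Ccr setT (q k) by exact: (Ccr_sub (@subsetT _ U) (cq k)).
have E : dq (fun x => u x + v x) = (fun z => dq u z + dq v z) by apply/funext => z; exact: dqD.
split; [exact: L2D|by rewrite E; exact: L2D|exists (fun k x => p k x + q k x); split].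
- by move=> k; exact: CcrD.
- by apply: L2cvgD => // k; exact: Ccr_L2 (cp k) || exact: Ccr_L2 (cq k).
- rewrite E; have -> : (fun k => dq (fun x => p k x + q k x)) = (fun k z => dq (p k) z + dq (q k) z).
    by apply/funext => k; apply/funext => z; exact: dqD.
  by apply: L2cvgD => // k; exact: dq_Ccr.
Qed.

Lemma HU0 U : HU U (fun=> 0).
Proof. by apply: HU_Ccr; exact: Ccr0. Qed.

Lemma bwt_ge1 (x : V) : 1 <= bwt s x.
Proof.
have [sp _] := andP s01; rewrite /bwt.
have q1 : 1 <= Num.sqrt (1 + edot x x).
  by rewrite -{1}sqrtr1 ler_sqrt ?lerDl ?addr_ge0 ?edot_ge0.
by rewrite -[leLHS](powRr0 (Num.sqrt (1 + edot x x))) ler_powR ?(ltW sp).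
Qed.

Lemma hsn_sqI u e : L2 mu u -> hsn s u e -> sqI mu u <= c_^-1 * e.
Proof.
move=> lu hs; have [h H] := HT_ex lu; have [l i] := hs _ H; have c0 := @cG_gt0 R n.
rewrite -(ler_pM2l c0) mulrA mulfV ?gt_eqF// mul1r -(HT_sqI lu H); apply: le_trans i.
apply: I_le => //; first exact: H.1.2.
by move=> x; rewrite ler_peMl ?sqr_ge0// exprn_ege1// bwt_ge1.
Qed.

(** [energy_upper] is available for test functions, so it is applied to [phi_ k - phi_ l] rather
    than to [phi_ k - u]; both transforms are compared with that of [u]. *)
Lemma hsn_HU U (phi_ : nat -> V -> R) u : L2 mu u -> (forall k, Ccr U (phi_ k)) ->
  (forall e, 0 < e -> \forall k \near \oo, hsn s (fun x => phi_ k x - u x) e) ->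
  [/\ HU U u, L2cvg mu phi_ u & L2cvg mm (fun k => dq (phi_ k)) (dq u)].
Proof.
move=> lu cp H; have lp k := Ccr_L2 (cp k).
have T k : Ccr setT (phi_ k) by exact: (Ccr_sub (@subsetT _ U) (cp k)).
have c0 := @cG_gt0 R n; have ci : 0 < c_^-1 by rewrite invr_gt0.
have cu : L2cvg mu phi_ u.
  apply/L2cvg_near => e e0; have e1 : 0 < c_ * e by rewrite mulr_gt0.
  have [N _ HN] := H _ e1; exists N => // k /HN hs.
  by have := hsn_sqI (L2B (lp k) lu) hs; rewrite mulrA mulVf ?gt_eqF// mul1r.
have [C C0 hC] := energy_upper s01 n0.
have [ld cd] : L2 mm (dq u) /\ L2cvg mm (fun k => dq (phi_ k)) (dq u).
  apply: dq_lim => // e e0; have e1 : 0 < e / (4 * (C + 1)) by rewrite divr_gt0// mulr_gt0// ltr_wpDl.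
  have [N _ HN] := H _ e1; exists N => k l Nk Nl.
  have ck : Ccr setT (fun x => phi_ k x - phi_ l x) by exact: CcrB.
  apply: le_trans (hC _ ck) _.
  have [hu Hu] := HT_ex lu.
  have HD j : HT (fun x => phi_ j x - u x) (fun xi => hart (phi_ j) xi - hu xi).
    have := HT_lin 1 (-1) (lp j) lu (HT_hart (Ccr_L1 (cp j)) (lp j)) Hu.
    by congr HT; apply/funext => x; rewrite mul1r mulN1r.
  have [lk ik] := HN k Nk _ (HD k); have [ll il] := HN l Nl _ (HD l).
  have E : hart (fun x => phi_ k x - phi_ l x) = (fun xi => hart (phi_ k) xi - hart (phi_ l) xi).
    have -> : (fun x => phi_ k x - phi_ l x) = (fun x => phi_ k x + -1 * phi_ l x).
      by apply/funext => x; rewrite mulN1r.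
    rewrite hartD ?hartZ; [by apply/funext => x; rewrite mulN1r|..].
    - exact: Ccr_L1 (cp l).
    - exact: Ccr_L1 (cp k).
    - by apply: L1Z; exact: Ccr_L1 (cp l).
  have b : I mu (fun xi => bwt s xi ^+ 2 * hart (fun x => phi_ k x - phi_ l x) xi ^+ 2) <=
      e / (C + 1).
    apply: (le_trans (y := I mu (fun xi => 2 * (bwt s xi ^+ 2 * (hart (phi_ k) xi - hu xi) ^+ 2 +
        bwt s xi ^+ 2 * (hart (phi_ l) xi - hu xi) ^+ 2)))).
      apply: I_le; [exact: (HsR_Ccr s01 n0 ck)|by apply: L1Z; exact: L1D|].
      move=> xi; rewrite E.
      have := mulr_ge0 (sqr_ge0 (bwt s xi)) (sqr_ge0 ((hart (phi_ k) xi - hu xi) + (hart (phi_ l) xi - hu xi))).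
      by lra.
    rewrite I_Z ?I_D//; last exact: L1D.
    have -> : e / (C + 1) = 2 * (e / (4 * (C + 1)) + e / (4 * (C + 1))).
      by field; rewrite gt_eqF// ltr_wpDl.
    by rewrite ler_pM2l// lerD.
  apply: (le_trans (ler_wpM2l C0 b)).
  by rewrite mulrCA ler_piMr ?(ltW e0)// ler_pdivrMr ?ltr_wpDl// mul1r lerDl.
by split=> //; split=> //; exists phi_.
Qed.

(** Mirror image of [hsn_HU]: [energy_lower] makes the weighted transforms Cauchy, and [closed_lim]
    identifies their limit with the weighted transform of [u]. *)
Lemma HU_hsn U (phi_ : nat -> V -> R) u : L2 mu u -> (forall k, Ccr U (phi_ k)) ->
  L2cvg mu phi_ u -> L2 mm (dq u) -> L2cvg mm (fun k => dq (phi_ k)) (dq u) ->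
  HsR s u /\ forall e, 0 < e -> \forall k \near \oo, hsn s (fun x => phi_ k x - u x) e.
Proof.
move=> lu cp cu du cd; have lp k := Ccr_L2 (cp k).
have T k : Ccr setT (phi_ k) by exact: (Ccr_sub (@subsetT _ U) (cp k)).
have [H Hu] := HT_ex lu.
have [C C0 hC] := energy_lower s01 n0; have c0 := @cG_gt0 R n.
pose h k := hart (phi_ k).
have lh k : L2 mu (h k) by have [] := hart_L2 (Ccr_L1 (cp k)) (lp k).
have Hh k : HT (phi_ k) (h k) by apply: HT_hart; [exact: Ccr_L1 (cp k)|exact: lp].
have HD k : HT (fun x => phi_ k x - u x) (fun xi => h k xi - H xi).
  have := HT_lin 1 (-1) (lp k) lu (Hh k) Hu.
  by congr HT; apply/funext => x; rewrite mul1r mulN1r.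
have ch : L2cvg mu h H.
  rewrite /L2cvg; rewrite (_ : (fun k => _) = (fun k => c_ * sqI mu (fun x => phi_ k x - u x))).
    by rewrite -(mulr0 c_); apply: cvgM => //; exact: cvg_cst.
  by apply/funext => k; rewrite -(HT_sqI _ (HD k))//; exact: L2B.
have [sg [sgn ae]] := L2cvg_subseq lh Hu.1 ch.
have mb := @measurable_bwt R n s.
have lb k : L2 mu (fun xi => bwt s xi * h k xi).
  split; first by apply: measurable_funM => //; exact: (lh k).1.
  by have := HsR_Ccr s01 n0 (T k); congr (L1 _ _); apply/funext => xi; rewrite exprMn.
have [lB cB] : L2 mu (fun xi => bwt s xi * H xi) /\
    L2cvg mu (fun k xi => bwt s xi * h k xi) (fun xi => bwt s xi * H xi).
  apply: (closed_lim (sg := sg)) => //.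
  - by apply: measurable_funM => //; exact: Hu.1.1.
  - by apply: filterS ae => xi a; apply: cvgM => //; exact: cvg_cst.
  - move=> e e0; have e1 : 0 < e / (2 * (C + 1)) by rewrite divr_gt0// mulr_gt0// ltr_wpDl.
    have [N1 H1] := L2cvg_cauchy lp lu cu e1.
    have [N2 H2] := L2cvg_cauchy (fun k => dq_Ccr (T k)) du cd e1.
    exists (maxn N1 N2) => k l; rewrite !geq_max => /andP[k1 k2] /andP[l1 l2].
    have ck : Ccr setT (fun x => phi_ k x - phi_ l x) by exact: CcrB.
    have := hC _ ck.
    have -> : I mu (fun xi => bwt s xi ^+ 2 * hart (fun x => phi_ k x - phi_ l x) xi ^+ 2) =
        sqI mu (fun xi => bwt s xi * h k xi - bwt s xi * h l xi).
      congr I; apply/funext => xi.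
      have -> : (fun x => phi_ k x - phi_ l x) = (fun x => phi_ k x + -1 * phi_ l x).
        by apply/funext => x; rewrite mulN1r.
      rewrite hartD ?hartZ; [by rewrite /h; ring|..].
      - exact: Ccr_L1 (cp l).
      - exact: Ccr_L1 (cp k).
      - by apply: L1Z; exact: Ccr_L1 (cp l).
    move/le_trans; apply.
    have -> : dq (fun x => phi_ k x - phi_ l x) = (fun z => dq (phi_ k) z - dq (phi_ l) z).
      by apply/funext => z; exact: dqB.
    apply: (le_trans (ler_wpM2l C0 (lerD (H1 k l k1 l1) (H2 k l k2 l2)))).
    have -> : e / (2 * (C + 1)) + e / (2 * (C + 1)) = e / (C + 1).
      by field; rewrite gt_eqF// ltr_wpDl.
    by rewrite mulrCA ler_piMr ?(ltW e0)// ler_pdivrMr ?ltr_wpDl// mul1r lerDl.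
split.
  split=> // g Hg; apply: (HT_weight_uniq Hu Hg _).1.
  by have := lB.2; congr (L1 _ _); apply/funext => xi; rewrite exprMn.
move=> e e0; have /L2cvg_near/(_ e e0)[N _ HN] := cB; exists N => // k Nk g Hg.
have E : (fun xi => bwt s xi ^+ 2 * (h k xi - H xi) ^+ 2) = (fun xi => (bwt s xi * h k xi - bwt s xi * H xi) ^+ 2).
  by apply/funext => xi; ring.
have l0 : L1 mu (fun xi => bwt s xi ^+ 2 * (h k xi - H xi) ^+ 2).
  by rewrite E; exact: (L2B (lb k) lB).2.
have [l1 ->] := HT_weight_uniq (HD k) Hg l0; split=> //.
by rewrite E; exact: HN.
Qed.

Lemma tildeHsP U (v : V -> R[i]) : tildeHs s U v <->
  HU U (fun x => complex.Re (v x)) /\ HU U (fun x => complex.Im (v x)).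
Proof.
split=> [[/HsP[[lr _] [li _]] [phi [cp cv]]]|[[lr dr [p [cp pu dpu]]] [li di [q [cq qv dqv]]]]].
  have lc : cL2 mu v by apply/cL2P.
  have lp k : cL2 mu (phi k).
    by apply/cL2P; have /CcrP[a b] := cp k; split; [exact: Ccr_L2 a|exact: Ccr_L2 b].
  have /(Hs_cvgP s lp lc) H := cv.
  have cr k : Ccr U (fun x => complex.Re (phi k x)) by have /CcrP[] := cp k.
  have ci k : Ccr U (fun x => complex.Im (phi k x)) by have /CcrP[] := cp k.
  have [a _ _] := hsn_HU lr cr (fun e e0 => filterS (fun k => @proj1 _ _) (H e e0)).
  have [b _ _] := hsn_HU li ci (fun e e0 => filterS (fun k => @proj2 _ _) (H e e0)).
  by split.
have [hr Hr] := HU_hsn lr cp pu dr dpu; have [hi Hi] := HU_hsn li cq qv di dqv.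
split; first exact/HsP.
exists (fun k x => Complex (p k x) (q k x)); split.
  by move=> k; apply/CcrP; split; [exact: cp|exact: cq].
apply/Hs_cvgP.
- by move=> k; apply/cL2P; split; [exact: Ccr_L2 (cp k)|exact: Ccr_L2 (cq k)].
- exact/cL2P.
- by move=> e e0; apply: filterS2 (Hr e e0) (Hi e e0) => k a b; split.
Qed.

Lemma Hs_cvg_HU (u : V -> R[i]) (phi : nat -> V -> R[i]) : cL2 mu u ->
  (forall k, Cc_infty setT (phi k)) -> Hs_cvg s phi u ->
  L2cvg mm (fun k => dq (fun x => complex.Re (phi k x))) (dq (fun x => complex.Re (u x))) /\
  L2cvg mm (fun k => dq (fun x => complex.Im (phi k x))) (dq (fun x => complex.Im (u x))).
Proof.
move=> lc cp cv; have /cL2P[lr li] := lc.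
have lp k : cL2 mu (phi k).
  by apply/cL2P; have /CcrP[a b] := cp k; split; [exact: Ccr_L2 a|exact: Ccr_L2 b].
have /(Hs_cvgP s lp lc) H := cv.
have cr k : Ccr setT (fun x => complex.Re (phi k x)) by have /CcrP[] := cp k.
have ci k : Ccr setT (fun x => complex.Im (phi k x)) by have /CcrP[] := cp k.
have [_ _ a] := hsn_HU lr cr (fun e e0 => filterS (fun k => @proj1 _ _) (H e e0)).
have [_ _ b] := hsn_HU li ci (fun e e0 => filterS (fun k => @proj2 _ _) (H e e0)).
by split.
Qed.

End spaces.

Lemma Linfty_ae d (T : measurableType d) (R : realType) (m : {measure set T -> \bar R}) (f : T -> R) :
  Linfty m f -> exists2 M, 0 <= M & {ae m, forall x, `|f x| <= M}.
Proof.
move=> [mf]; rewrite unlock; case: ifPn => [mp fin|].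
  have ae := ess_sup_ge m (abse \o (fun x => (f x)%:E)).
  case: (ess_sup m _) fin ae => [r _ ae|//|_ ae].
    exists `|r| => //; apply: filterS ae => x /=; rewrite lee_fin => h.
    exact: le_trans h (ler_norm r).
  by exists 0 => //; apply: filterS ae => x /=; rewrite leeNy_eq.
(* If the whole space has measure 0, every bound holds almost everywhere. *)
rewrite -leNgt => m0 _; exists 0 => //; exists setT; split=> //.
by apply/eqP; rewrite eq_le m0 measure_ge0.
Qed.

Lemma mean_le (R : realFieldType) (p q r : R) : `|p| <= r -> `|q| <= r -> 2^-1 * (p + q) <= r.
Proof. by rewrite !ler_norml => /andP[? ?] /andP[? ?]; lra. Qed.

(** * The bilinear form *)

Section forms.
Context {R : realType} {n : nat} (s : R).
Hypothesis s01 : 0 < s < 1.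
Hypothesis n0 : (0 < n)%N.
Local Notation V := 'rV[R]_n.
Local Notation C := R[i].
Local Notation mu := (@leb R n).
Local Notation mm := (mu \x mu)%E.
Local Notation dq := (@dq R n s).
Local Notation kap := (@kap R n s).

Definition cz : R := (Num.sqrt (C_ns (R := R) (n := n) s) / Num.sqrt 2) ^+ 2.

Lemma zetaE (x y : V) i : zeta s x y i ord0 =
  Num.sqrt (C_ns (R := R) (n := n) s) / Num.sqrt 2 / enorm (x - y) `^ @pexp R n s * (x - y) ord0 i.
Proof. by rewrite /zeta !mxE. Qed.

Lemma zeta_swap (x y : V) i : zeta s y x i ord0 = - zeta s x y i ord0.
Proof. by rewrite !zetaE -opprB enormN mxE mulrN. Qed.

Lemma zeta_sq (x y : V) : \sum_i zeta s x y i ord0 ^+ 2 = cz * kap (x - y).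
Proof.
under eq_bigr do rewrite zetaE exprMn.
rewrite -mulr_sumr /cz /kap /edot.
under eq_bigr do rewrite expr2.
by rewrite expr_div_n; ring.
Qed.

Lemma measurable_zeta i : measurable_fun [set: V * V] (fun z => zeta s z.1 z.2 i ord0).
Proof.
have mB : measurable_fun [set: V * V] (fun z => z.1 - z.2) by exact: measurable_rVB.
have mi : measurable_fun [set: R] (fun x : R => x `^ (- 1)) by exact: measurable_powR.
apply: (eq_measurable_fun (fun z : V * V => Num.sqrt (C_ns (R := R) (n := n) s) / Num.sqrt 2 *
    (enorm (z.1 - z.2) `^ @pexp R n s) `^ (- 1) * (z.1 - z.2) ord0 i)) => [z _|].
  by rewrite zetaE powR_inv1// powR_ge0.
apply: measurable_funM; last exact: (measurableT_comp (@measurable_coord R n i) mB).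
apply: measurable_funM => //; apply: (measurableT_comp mi).
apply: (measurableT_comp (measurable_powR _)); exact: (measurableT_comp (@measurable_enorm R n) mB).
Qed.

Definition vsq (v : 'cV[C]_n) : R := \sum_i (complex.Re (v i ord0) ^+ 2 + complex.Im (v i ord0) ^+ 2).

Lemma cvec_normE v : cvec_norm v = Num.sqrt (vsq v).
Proof.
congr Num.sqrt; apply: eq_bigr => i _.
by rewrite normcE sqr_sqrtr// addr_ge0// sqr_ge0.
Qed.

Lemma vsq_ge0 v : 0 <= vsq v.
Proof. by apply: sumr_ge0 => i _; rewrite addr_ge0// sqr_ge0. Qed.

Lemma fgrad_smoothE (u : V -> C) z i :
  complex.Re (fgrad_smooth s u z i ord0) =
    (complex.Re (u z.2) - complex.Re (u z.1)) * zeta s z.1 z.2 i ord0 /\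
  complex.Im (fgrad_smooth s u z i ord0) =
    (complex.Im (u z.2) - complex.Im (u z.1)) * zeta s z.1 z.2 i ord0.
Proof.
rewrite /fgrad_smooth !mxE; case: (u z.2) (u z.1) => a b [c d] /=.
by split; ring.
Qed.

Lemma vsq_fgrad (u : V -> C) z : vsq (fgrad_smooth s u z) =
  cz * (dq (fun x => complex.Re (u x)) z ^+ 2 + dq (fun x => complex.Im (u x)) z ^+ 2).
Proof.
rewrite !dq_sqr -mulrDl mulrCA -zeta_sq mulr_sumr; apply: eq_bigr => i _.
by rewrite !(fgrad_smoothE u z i).1 !(fgrad_smoothE u z i).2; ring.
Qed.

Lemma measurable_vsq (F : V * V -> 'cV[C]_n) :
  (forall i, cmeasurable (fun z => F z i ord0)) -> measurable_fun [set: V * V] (fun z => vsq (F z)).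
Proof.
move=> mF; apply: measurable_sum => i; have [mr mi] := mF i.
by apply: measurable_funD; exact: measurable_funX.
Qed.

Lemma vecL2P (F : V * V -> 'cV[C]_n) : (forall i, cmeasurable (fun z => F z i ord0)) ->
  vecL2 mm F <-> L1 mm (fun z => vsq (F z)).
Proof.
move=> mF; rewrite /vecL2 /vecL2norm.
under [X in Lnorm _ _ X]eq_fun do rewrite cvec_normE.
rewrite (@Lnorm2_L1 _ _ _ mm (fun z => vsq (F z))); last 2 first.
- exact: measurable_vsq.
- by move=> z; exact: vsq_ge0.
by split=> [[]|].
Qed.

Lemma measurable_fgrad_smooth (u : V -> C) : cmeasurable u ->
  forall i, cmeasurable (fun z => fgrad_smooth s u z i ord0).
Proof.
move=> [mr mi] i; split.
  apply: (eq_measurable_fun (fun z : V * V => (complex.Re (u z.2) - complex.Re (u z.1)) * zeta s z.1 z.2 i ord0)).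
    by move=> z _; rewrite (fgrad_smoothE u z i).1.
  apply: measurable_funM; last exact: measurable_zeta.
  apply: measurable_funB.
    exact: (measurableT_comp mr (measurable_snd (T1 := V) (T2 := V))).
  exact: (measurableT_comp mr (measurable_fst (T1 := V) (T2 := V))).
apply: (eq_measurable_fun (fun z : V * V => (complex.Im (u z.2) - complex.Im (u z.1)) * zeta s z.1 z.2 i ord0)).
  by move=> z _; rewrite (fgrad_smoothE u z i).2.
apply: measurable_funM; last exact: measurable_zeta.
apply: measurable_funB.
  exact: (measurableT_comp mi (measurable_snd (T1 := V) (T2 := V))).
exact: (measurableT_comp mi (measurable_fst (T1 := V) (T2 := V))).
Qed.

Lemma vsqB_le (a b c : 'cV[C]_n) : vsq (a - b) <= 2 * (vsq (c - a) + vsq (c - b)).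
Proof.
rewrite /vsq -big_split/= mulr_sumr; apply: ler_sum => i _; rewrite !mxE.
case: (a i ord0) (b i ord0) (c i ord0) => a1 a2 [b1 b2] [c1 c2] /=.
have := sqr_ge0 (c1 - a1 + (c1 - b1)); have := sqr_ge0 (c2 - a2 + (c2 - b2)); nra.
Qed.

(** The sequence that comes with the chosen extension also makes [fgrad_smooth] of its terms
    converge to [fgrad_smooth s u], by [Hs_cvg_HU]; two L^2 limits of one sequence agree almost
    everywhere. *)
Lemma fgrad_ae (u : V -> C) : tildeHs s setT u ->
  (forall i, cmeasurable (fun z => fgrad s u z i ord0)) /\
  {ae mm, forall z, fgrad s u z = fgrad_smooth s u z}.
Proof.
move=> tu; have /(tildeHsP s01 n0)[[lr dr _] [li di _]] := tu.
have [[cu _] [phi [cp cv]]] := tu.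
have mu_ : cmeasurable u := cu.1.
have mG := measurable_fgrad_smooth mu_.
have key (psi : nat -> V -> C) : (forall k, Cc_infty setT (psi k)) -> Hs_cvg s psi u ->
    forall e, 0 < e -> \forall k \near \oo,
      L1 mm (fun z => vsq (fgrad_smooth s (psi k) z - fgrad_smooth s u z)) /\
      I mm (fun z => vsq (fgrad_smooth s (psi k) z - fgrad_smooth s u z)) <= e.
  move=> cpsi cvp e e0; have [/L2cvg_near a /L2cvg_near b] := Hs_cvg_HU s01 n0 cu cpsi cvp.
  have cz0 : 0 <= cz by exact: sqr_ge0.
  have e1 : 0 < e / (2 * (cz + 1)) by rewrite divr_gt0// mulr_gt0// ltr_wpDl.
  apply: filterS2 (a _ e1) (b _ e1) => k ak bk.
  have /CcrP[cr ci] := cpsi k.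
  pose dR z := dq (fun x => complex.Re (psi k x)) z - dq (fun x => complex.Re (u x)) z.
  pose dI z := dq (fun x => complex.Im (psi k x)) z - dq (fun x => complex.Im (u x)) z.
  have lR : L2 mm dR by apply: L2B => //; exact: (dq_Ccr s01 cr).
  have lI : L2 mm dI by apply: L2B => //; exact: (dq_Ccr s01 ci).
  have E : (fun z => vsq (fgrad_smooth s (psi k) z - fgrad_smooth s u z)) =
      (fun z => cz * (dR z ^+ 2 + dI z ^+ 2)).
    apply/funext => z.
    have -> : fgrad_smooth s (psi k) z - fgrad_smooth s u z = fgrad_smooth s (fun x => psi k x - u x) z.
      by rewrite /fgrad_smooth -scalerBl; congr (_ *: _); ring.
    rewrite vsq_fgrad /dR /dI -!dqB; congr (_ * (dq _ z ^+ 2 + dq _ z ^+ 2)); apply/funext => x.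
      by case: (psi k x) (u x) => ? ? [].
    by case: (psi k x) (u x) => ? ? [].
  rewrite E; have lRI := L1D lR.2 lI.2; split; first exact: L1Z.
  rewrite I_Z// I_D; [|exact: lR.2|exact: lI.2].
  apply: (le_trans (ler_wpM2l cz0 (lerD ak bk))).
  have -> : e / (2 * (cz + 1)) + e / (2 * (cz + 1)) = e / (cz + 1).
    by field; rewrite gt_eqF// ltr_wpDl.
  by rewrite mulrCA ler_piMr ?(ltW e0)// ler_pdivrMr ?ltr_wpDl// mul1r lerDl.
have mS (f : V -> C) (F : V * V -> 'cV[C]_n) : cmeasurable f -> (forall i, cmeasurable (fun z => F z i ord0)) ->
    measurable_fun [set: V * V] (fun z => vsq (fgrad_smooth s f z - F z)).
  move=> mf mF; apply: measurable_vsq => i; have [a b] := measurable_fgrad_smooth mf i.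
  have [c d] := mF i; split.
    apply: (eq_measurable_fun (fun z => complex.Re (fgrad_smooth s f z i ord0) - complex.Re (F z i ord0))).
      by move=> z _; rewrite !mxE; case: (_ * _) (F z i ord0) => ? ? [].
    exact: measurable_funB.
  apply: (eq_measurable_fun (fun z => complex.Im (fgrad_smooth s f z i ord0) - complex.Im (F z i ord0))).
    by move=> z _; rewrite !mxE; case: (_ * _) (F z i ord0) => ? ? [].
  exact: measurable_funB.
have mC (psi : nat -> V -> C) k : (forall k, Cc_infty setT (psi k)) -> cmeasurable (psi k).
  by move=> cpsi; have /CcrP[a b] := cpsi k; split; [exact: Ccr_measurable a|exact: Ccr_measurable b].
have NE (psi : nat -> V -> C) (F : V * V -> 'cV[C]_n) : (forall k, Cc_infty setT (psi k)) -> (forall i, cmeasurable (fun z => F z i ord0)) ->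
    vecL2norm mm (fun z => fgrad_smooth s (psi k) z - F z) @[k --> \oo] --> 0%E <->
    forall e, 0 < e -> \forall k \near \oo,
      L1 mm (fun z => vsq (fgrad_smooth s (psi k) z - F z)) /\
      I mm (fun z => vsq (fgrad_smooth s (psi k) z - F z)) <= e.
  move=> cpsi mF; rewrite -(@Lnorm2_near _ _ _ mm (fun k z => vsq (fgrad_smooth s (psi k) z - F z))).
  - rewrite (_ : (fun k => vecL2norm mm _) = (fun k => Lnorm mm 2%:E
      (fun z => (Num.sqrt (vsq (fgrad_smooth s (psi k) z - F z)))%:E)))//.
    by apply/funext => k; congr (Lnorm _ _ _); apply/funext => z; rewrite cvec_normE.
  - by move=> k; apply: mS => //; exact: mC.
  - by move=> k z; exact: vsq_ge0.
pose S := [set F | vecL2 mm F /\ exists phi_, [/\ forall k, Cc_infty setT (phi_ k), Hs_cvg s phi_ u &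
      vecL2norm mm (fun z => fgrad_smooth s (phi_ k) z - F z) @[k --> \oo] --> 0%E]].
have Sne : S (fgrad_smooth s u).
  split.
    apply/vecL2P => //.
    have := L1Z cz (L1D dr.2 di.2); congr (L1 _ _); apply/funext => z.
    by rewrite vsq_fgrad.
  exists phi; split=> //; apply/NE => //; exact: key.
have [[mF lF] [psi [cpsi cvp cF]]] : S (fgrad s u) by exact: (xgetPex (fun=> 0) (ex_intro S _ Sne)).
have /(NE _ _ cpsi mF) HF := cF; split=> //.
pose q z := vsq (fgrad s u z - fgrad_smooth s u z).
have mq : measurable_fun [set: V * V] q.
  apply: (eq_measurable_fun (fun z => vsq (fgrad_smooth s u z - fgrad s u z))); last exact: mS.
  move=> z _; rewrite /q /vsq; apply: eq_bigr => i _; rewrite !mxE.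
  by case: (_ * _) (fgrad s u z i ord0) => ? ? [? ?] /=; ring.
have q0 z : 0 <= q z by exact: vsq_ge0.
have qe e : 0 < e -> L1 mm q /\ I mm q <= e.
  move=> e0; have e4 : 0 < e / 4 by lra.
  have [N1 _ H1] := HF _ e4; have [N2 _ H2] := key _ cpsi cvp _ e4.
  have [l1 i1] := H1 (maxn N1 N2) (leq_maxl _ _).
  have [l2 i2] := H2 (maxn N1 N2) (leq_maxr _ _).
  have l3 := L1Z 2 (L1D l1 l2).
  have lq : L1 mm q.
    by apply: (L1_le mq l3) => z; rewrite ger0_norm//; exact: vsqB_le.
  split=> //; apply: (le_trans (I_le lq l3 _)); first by move=> z; exact: vsqB_le.
  by rewrite I_Z ?I_D//; [lra|exact: L1D].
have [lq _] := qe _ (@ltr01 R).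
have Iq : I mm q = 0.
  apply/eqP; rewrite eq_le I_ge0// andbT; apply/ler_addgt0Pr => e e0.
  by rewrite add0r; exact: (qe e e0).2.
apply: filterS (ge0_I0_ae lq q0 Iq) => z /eqP.
rewrite psumr_eq0 => [/allP h|i _]; last by rewrite addr_ge0// sqr_ge0.
apply/colP => i; have := h i (mem_index_enum i) => /=.
rewrite paddr_eq0 ?sqr_ge0// !sqrf_eq0 !mxE => /andP[/eqP a /eqP b].
apply/eqP; rewrite -subr_eq0; apply/eqP; move: a b.
by case: (_ - _) => a b /= -> ->.
Qed.

(** Both gradients at (x, y) are multiples of the same vector [zeta], so the matrix acts only
    through this quadratic form at [zeta]. *)
Definition KA (A : V -> V -> 'M[R]_n) (z : V * V) : R :=
  \sum_i \sum_j A z.1 z.2 i j * zeta s z.1 z.2 j ord0 * zeta s z.1 z.2 i ord0.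

Definition BR (K : V * V -> R) (a c : V -> R) : R :=
  I mm (fun z => (a z.2 - a z.1) * (c z.2 - c z.1) * K z).

Lemma B_integrand (M : 'M[R]_n) (a b : C) (z : 'cV[R]_n) :
  \sum_i (cmx M *m (a *: cmx z)) i ord0 * (b *: cmx z) i ord0 =
  a * b * (\sum_i \sum_j M i j * z j ord0 * z i ord0)%:C%C.
Proof.
rewrite rmorph_sum mulr_sumr; apply: eq_bigr => i _.
rewrite !mxE rmorph_sum mulr_suml mulr_sumr; apply: eq_bigr => j _.
by rewrite !mxE !rmorphM/=; ring.
Qed.

Lemma B_integrand_parts (M : 'M[R]_n) (F G : 'cV[C]_n) :
  complex.Re (\sum_i (cmx M *m F) i ord0 * G i ord0) =
    \sum_i \sum_j M i j * (complex.Re (F j ord0) * complex.Re (G i ord0) -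
      complex.Im (F j ord0) * complex.Im (G i ord0)) /\
  complex.Im (\sum_i (cmx M *m F) i ord0 * G i ord0) =
    \sum_i \sum_j M i j * (complex.Re (F j ord0) * complex.Im (G i ord0) +
      complex.Im (F j ord0) * complex.Re (G i ord0)).
Proof.
have ReS (J : finType) (f : J -> C) : complex.Re (\sum_j f j) = \sum_j complex.Re (f j).
  apply: (big_ind2 (fun z (x : R) => complex.Re z = x)) => //.
  by move=> [? ?] ? [? ?] ? /= -> ->.
have ImS (J : finType) (f : J -> C) : complex.Im (\sum_j f j) = \sum_j complex.Im (f j).
  apply: (big_ind2 (fun z (x : R) => complex.Im z = x)) => //.
  by move=> [? ?] ? [? ?] ? /= -> ->.
rewrite ReS ImS; split; apply: eq_bigr => i _; rewrite mxE mulr_suml ?ReS ?ImS;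
  by apply: eq_bigr => j _; rewrite !mxE; case: (F j ord0) (G i ord0) => ? ? [? ?] /=; ring.
Qed.

Lemma B_formE (A : V -> V -> 'M[R]_n) (u v : V -> C) :
  (forall i j, measurable_fun [set: V * V] (fun z => A z.1 z.2 i j)) ->
  tildeHs s setT u -> tildeHs s setT v ->
  (forall a c, HU s setT a -> HU s setT c ->
    L1 mm (fun z => (a z.2 - a z.1) * (c z.2 - c z.1) * KA A z)) ->
  let a x := complex.Re (u x) in let b x := complex.Im (u x) in
  let c x := complex.Re (v x) in let d x := complex.Im (v x) in
  B_form s A u v = Complex (BR (KA A) a c - BR (KA A) b d) (BR (KA A) a d + BR (KA A) b c).
Proof.
move=> mA tu tv lA a b c d.
have /(tildeHsP s01 n0)[ha hb] := tu; have /(tildeHsP s01 n0)[hc hd] := tv.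
have [mF ae] := fgrad_ae tu; have [mG ae'] := fgrad_ae tv.
pose f z := (u z.2 - u z.1) * (v z.2 - v z.1) * (KA A z)%:C%C.
pose g z := \sum_i (cmx (A z.1 z.2) *m fgrad s u z) i ord0 * fgrad s v z i ord0.
have aef : {ae mm, forall z, g z = f z}.
  by apply: filterS2 ae ae' => z e1 e2; rewrite /g e1 e2 B_integrand.
have fR z : complex.Re (f z) = (a z.2 - a z.1) * (c z.2 - c z.1) * KA A z -
    (b z.2 - b z.1) * (d z.2 - d z.1) * KA A z.
  by rewrite /f /a /b /c /d; case: (u z.2) (u z.1) (v z.2) (v z.1) => ? ? [? ?] [? ?] [? ?] /=; ring.
have fI z : complex.Im (f z) = (a z.2 - a z.1) * (d z.2 - d z.1) * KA A z +
    (b z.2 - b z.1) * (c z.2 - c z.1) * KA A z.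
  by rewrite /f /a /b /c /d; case: (u z.2) (u z.1) (v z.2) (v z.1) => ? ? [? ?] [? ?] [? ?] /=; ring.
rewrite /B_form /cintegral /BR -I_B; [|exact: lA..]; rewrite -I_D; [|exact: lA..].
congr Complex.
  apply: (I_ae_eq (f := fun z => complex.Re (g z))).
  - apply: (eq_measurable_fun (fun z : V * V => \sum_i \sum_j A z.1 z.2 i j *
        (complex.Re (fgrad s u z j ord0) * complex.Re (fgrad s v z i ord0) -
         complex.Im (fgrad s u z j ord0) * complex.Im (fgrad s v z i ord0)))).
      by move=> z _; rewrite /g (B_integrand_parts _ _ _).1.
    apply: measurable_sum => i; apply: measurable_sum => j; apply: measurable_funM => //.
    by apply: measurable_funB; apply: measurable_funM; (exact: (mF j).1 || exact: (mG i).1 ||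
      exact: (mF j).2 || exact: (mG i).2).
  - by apply: L1_measurable; apply: L1B; exact: lA.
  - by apply: filterS aef => z ->.
apply: (I_ae_eq (f := fun z => complex.Im (g z))).
- apply: (eq_measurable_fun (fun z : V * V => \sum_i \sum_j A z.1 z.2 i j *
        (complex.Re (fgrad s u z j ord0) * complex.Im (fgrad s v z i ord0) +
         complex.Im (fgrad s u z j ord0) * complex.Re (fgrad s v z i ord0)))).
    by move=> z _; rewrite /g (B_integrand_parts _ _ _).2.
  apply: measurable_sum => i; apply: measurable_sum => j; apply: measurable_funM => //.
  by apply: measurable_funD; apply: measurable_funM; (exact: (mF j).1 || exact: (mG i).1 ||
      exact: (mF j).2 || exact: (mG i).2).
- by apply: L1_measurable; apply: L1D; exact: lA.
- by apply: filterS aef => z ->.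
Qed.

Lemma measurable_KA (A : V -> V -> 'M[R]_n) :
  (forall i j, measurable_fun [set: V * V] (fun z => A z.1 z.2 i j)) ->
  measurable_fun [set: V * V] (KA A).
Proof.
move=> mA; apply: measurable_sum => i; apply: measurable_sum => j.
by apply: measurable_funM; [apply: measurable_funM => //|]; exact: measurable_zeta.
Qed.

Lemma KA_bound (A : V -> V -> 'M[R]_n) : mxLinfty mm (fun z => A z.1 z.2) ->
  exists2 M, 0 <= M & {ae mm, forall z, `|KA A z| <= M * kap (z.1 - z.2)}.
Proof.
move=> LA; have H i j : exists M, 0 <= M /\ {ae mm, forall z, `|A z.1 z.2 i j| <= M}.
  by have [M M0 h] := Linfty_ae (LA i j); exists M.
pose Mf (p : 'I_n * 'I_n) := projT1 (cid (H p.1 p.2)).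
have M0 p : 0 <= Mf p by rewrite /Mf; case: cid => M [].
have Mae : {ae mm, forall z, forall p, `|A z.1 z.2 p.1 p.2| <= Mf p}.
  have : forall p, {ae mm, forall z, `|A z.1 z.2 p.1 p.2| <= Mf p}.
    by move=> p; rewrite /Mf; case: cid => M [].
  move=> h; have : {ae mm, forall z, forall k : nat, forall p, unpickle k = Some p -> `|A z.1 z.2 p.1 p.2| <= Mf p}.
    apply/ae_foralln => k; case E : (unpickle k) => [p|]; last exact: aeW.
    by apply: filterS (h p) => z hz q [<-].
  by apply: filterS => z hz p; apply: (hz (pickle p)); rewrite pickleK.
have cz0 : 0 <= cz by exact: sqr_ge0.
exists ((\sum_p Mf p) * cz); first by rewrite mulr_ge0// sumr_ge0.
apply: filterS Mae => z hz; rewrite /KA pair_big/= (le_trans (ler_norm_sum _ _ _))//.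
rewrite -mulrA -zeta_sq mulr_suml; apply: ler_sum => -[i j] _ /=.
rewrite -mulrA normrM; apply: ler_pM => //; first exact: (hz (i, j)).
have le1 k : zeta s z.1 z.2 k ord0 ^+ 2 <= \sum_i zeta s z.1 z.2 i ord0 ^+ 2.
  by rewrite (bigD1 k)//= lerDl sumr_ge0// => l _; rewrite sqr_ge0.
rewrite normrM; have := le1 i; have := le1 j; set a := zeta _ _ _ j _; set b := zeta _ _ _ i _ => ha hb.
have := real_normK (num_real a); have := real_normK (num_real b) => eb ea.
have := sqr_ge0 (`|a| - `|b|); nra.
Qed.

(** The lower bound comes from ellipticity, which is assumed at every point, and the upper one from
    an essential bound; hence the two different quantifiers. *)
Record kernel (K : V * V -> R) (nu M : R) : Prop := Kernel {
  kern_meas : measurable_fun [set: V * V] K;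
  kern_nu : 0 < nu;
  kern_lower : forall z, nu * kap (z.1 - z.2) <= K z;
  kern_upper : {ae mm, forall z, K z <= M * kap (z.1 - z.2)};
  kern_sym : forall z, K (z.2, z.1) = K z }.

Lemma sympartE (A : V -> V -> 'M[R]_n) x y i j :
  sympart A x y i j = 4^-1 * (A x y i j + A y x i j + A x y j i + A y x j i).
Proof. by rewrite /sympart !mxE. Qed.

(** A quadratic form does not see transposition, and exchanging x and y changes the sign of both
    factors [zeta]. *)
Lemma KA_sympart (A : V -> V -> 'M[R]_n) z :
  KA (sympart A) z = 2^-1 * (KA A z + KA A (z.2, z.1)).
Proof.
have T (M : 'M[R]_n) (f : 'I_n -> R) : \sum_i \sum_j M j i * f j * f i = \sum_i \sum_j M i j * f j * f i.
  by rewrite exchange_big; apply: eq_bigr => i _; apply: eq_bigr => j _; ring.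
rewrite /KA; set f := fun i => zeta s z.1 z.2 i ord0.
have -> : \sum_i \sum_j A (z.2, z.1).1 (z.2, z.1).2 i j * zeta s (z.2, z.1).1 (z.2, z.1).2 j ord0 *
    zeta s (z.2, z.1).1 (z.2, z.1).2 i ord0 = \sum_i \sum_j A z.2 z.1 i j * f j * f i.
  apply: eq_bigr => i _; apply: eq_bigr => j _ /=.
  by rewrite (zeta_swap z.1 z.2 j) (zeta_swap z.1 z.2 i) !(mulrN, mulNr) opprK.
have -> : \sum_i \sum_j sympart A z.1 z.2 i j * f j * f i =
  4^-1 * (\sum_i \sum_j A z.1 z.2 i j * f j * f i +
  \sum_i \sum_j A z.2 z.1 i j * f j * f i + \sum_i \sum_j A z.1 z.2 j i * f j * f i +
  \sum_i \sum_j A z.2 z.1 j i * f j * f i).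
  rewrite -!big_split/= mulr_sumr; apply: eq_bigr => i _.
  rewrite -!big_split/= mulr_sumr; apply: eq_bigr => j _.
  by rewrite sympartE; move: (f i) (f j) => ? ?; ring.
rewrite !T; move: (\sum_i _) (\sum_i _) => p q; lra.
Qed.

Lemma tensorE (x y : V) i j : tensor x y i j = x ord0 i * y ord0 j.
Proof. by rewrite /tensor mxE big_ord1 mxE. Qed.

Lemma KA_kernel (A : V -> V -> 'M[R]_n) : 0 < cz -> mxLinfty mm (fun z => A z.1 z.2) ->
  assumption_A2 A -> exists nu M, kernel (KA (sympart A)) nu M.
Proof.
move=> cz0 LA [nu nu0 hA2]; have [M M0 hM] := KA_bound LA.
have mA i j : measurable_fun [set: V * V] (fun z => A z.1 z.2 i j) by exact: (LA i j).1.
have mK := measurable_KA mA.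
have ms : measurable_fun [set: V * V] (fun z : V * V => (z.2, z.1)) by exact: measurable_fun_pair.
have kapB (x y : V) : kap (y - x) = kap (x - y) by rewrite -opprB kapN.
exists (nu * cz), M; split.
- rewrite (_ : KA _ = (fun z => 2^-1 * (KA A z + KA A (z.2, z.1)))); last by apply/funext => z; exact: KA_sympart.
  apply: measurable_funM => //; apply: measurable_funD => //; exact: (measurableT_comp mK ms).
- by rewrite mulr_gt0.
- move=> z; have := hA2 z.1 z.2 (zeta s z.1 z.2)^T.
  rewrite enorm_sqr -mulrA.
  have -> : edot (zeta s z.1 z.2)^T (zeta s z.1 z.2)^T = cz * kap (z.1 - z.2).
    by rewrite -zeta_sq; apply: eq_bigr => i _; rewrite mxE expr2.
  move/le_trans; apply; rewrite le_eqVlt; apply/orP; left; apply/eqP.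
  apply: eq_bigr => i _; apply: eq_bigr => j _.
  have tE k : (zeta s z.1 z.2)^T ord0 k = zeta s z.1 z.2 k ord0 by rewrite mxE.
  by rewrite tensorE !tE -mulrA [X in _ * X]mulrC.
- apply: filterS2 hM (ae_swap hM) => z a b; rewrite KA_sympart.
  by apply: mean_le; [exact: a|rewrite (kapB z.2 z.1); exact: b].
- by move=> z; rewrite !KA_sympart/= addrC -surjective_pairing.
Qed.

Section kernel_form.
Variables (K : V * V -> R) (nu M : R).
Hypothesis kK : kernel K nu M.

Lemma kern_ge0 z : 0 <= K z.
Proof.
by apply: le_trans (kern_lower kK z); rewrite mulr_ge0 ?kap_ge0// ltW// (kern_nu kK).
Qed.

Lemma BR_L1 a c : measurable_fun [set: V] a -> measurable_fun [set: V] c ->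
  L2 mm (dq a) -> L2 mm (dq c) -> L1 mm (fun z => (a z.2 - a z.1) * (c z.2 - c z.1) * K z).
Proof.
move=> ma mc la lc; apply: (L1_le_ae _ (L1Z M (L1_norm (L2M la lc)))).
  apply: measurable_funM; last exact: kern_meas kK.
  by apply: measurable_funM; apply: measurable_funB; exact: measurableT_comp.
apply: filterS (kern_upper kK) => z Kz; rewrite normrM (ger0_norm (kern_ge0 z)).
have -> : dq a z * dq c z = (a z.2 - a z.1) * (c z.2 - c z.1) * kap (z.1 - z.2).
  have k0 := kap_ge0 s (z.1 - z.2).
  by rewrite /dq -[in RHS](sqr_sqrtr k0); ring.
by rewrite [in leRHS]normrM (ger0_norm (kap_ge0 _ _)) [leRHS]mulrCA ler_wpM2l.
Qed.

Lemma BR_Dl a b c : measurable_fun [set: V] a -> measurable_fun [set: V] b ->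
  measurable_fun [set: V] c -> L2 mm (dq a) -> L2 mm (dq b) -> L2 mm (dq c) ->
  BR K (fun x => a x + b x) c = BR K a c + BR K b c.
Proof.
move=> ma mb mc la lb lc; rewrite /BR -I_D; [|exact: BR_L1..].
by congr I; apply/funext => z; ring.
Qed.

Lemma BR_Zl k a c : measurable_fun [set: V] a -> measurable_fun [set: V] c ->
  L2 mm (dq a) -> L2 mm (dq c) -> BR K (fun x => k * a x) c = k * BR K a c.
Proof.
by move=> ma mc la lc; rewrite /BR -I_Z; [congr I; apply/funext => z; ring|exact: BR_L1].
Qed.

Lemma BR_C a c : BR K a c = BR K c a.
Proof. by congr I; apply/funext => z; ring. Qed.

Lemma BR_lower a : measurable_fun [set: V] a -> L2 mm (dq a) -> nu * sqI mm (dq a) <= BR K a a.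
Proof.
move=> ma la; rewrite /sqI -I_Z; last exact: la.2.
apply: I_le; [exact: (L1Z nu la.2)|exact: BR_L1|].
move=> z; rewrite dq_sqr mulrCA -expr2 ler_wpM2l ?sqr_ge0//; exact: kern_lower kK z.
Qed.

Lemma BR_upper a : measurable_fun [set: V] a -> L2 mm (dq a) -> BR K a a <= M * sqI mm (dq a).
Proof.
move=> ma la; rewrite /sqI -I_Z; last exact: la.2.
rewrite -subr_ge0 -I_B; [|exact: (L1Z M la.2)|exact: BR_L1].
have l0 := L1B (L1Z M la.2) (BR_L1 ma ma la la).
have : {ae mm, forall z, 0 <= M * dq a z ^+ 2 - (a z.2 - a z.1) * (a z.2 - a z.1) * K z}.
  apply: filterS (kern_upper kK) => z Kz; rewrite dq_sqr subr_ge0 [leRHS]mulrCA -expr2.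
  by rewrite ler_wpM2l ?sqr_ge0.
(* The integrand is nonnegative only almost everywhere, so it is replaced by its absolute value. *)
move=> h; rewrite (I_ae_eq (g := fun z => `|M * dq a z ^+ 2 - (a z.2 - a z.1) * (a z.2 - a z.1) * K z|)).
- by apply: I_ge0.
- exact: L1_measurable l0.
- exact: L1_measurable (L1_norm l0).
- by apply: filterS h => z hz; rewrite ger0_norm.
Qed.

End kernel_form.

(** The factor of differences is invariant under exchanging x and y, so the integral against [KA A]
    equals that against the average of [KA A] and its mirror image. *)
Lemma BR_sympart (A : V -> V -> 'M[R]_n) a c : mxLinfty mm (fun z => A z.1 z.2) ->
  HU s setT a -> HU s setT c ->
  L1 mm (fun z => (a z.2 - a z.1) * (c z.2 - c z.1) * KA A z) /\
  BR (KA A) a c = BR (KA (sympart A)) a c.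
Proof.
move=> LA [[ma _] la _] [[mc _] lc _]; have [M M0 hM] := KA_bound LA.
have mA i j : measurable_fun [set: V * V] (fun z => A z.1 z.2 i j) by exact: (LA i j).1.
have l0 : L1 mm (fun z => (a z.2 - a z.1) * (c z.2 - c z.1) * KA A z).
  apply: (L1_le_ae _ (L1Z M (L1_norm (L2M la lc)))).
    apply: measurable_funM; last exact: measurable_KA.
    by apply: measurable_funM; apply: measurable_funB; exact: measurableT_comp.
  apply: filterS hM => z Kz; rewrite normrM.
  have -> : dq a z * dq c z = (a z.2 - a z.1) * (c z.2 - c z.1) * kap (z.1 - z.2).
    have k0 := kap_ge0 s (z.1 - z.2).
    by rewrite /dq -[in RHS](sqr_sqrtr k0); ring.
  by rewrite [in leRHS]normrM (ger0_norm (kap_ge0 _ _)) mulrCA ler_wpM2l.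
split=> //; have l1 := L1_swap l0; have e := I_swap l0.
rewrite /BR; transitivity (2^-1 * (I mm (fun z => (a z.2 - a z.1) * (c z.2 - c z.1) * KA A z) +
   I mm (fun z => (a z.1 - a z.2) * (c z.1 - c z.2) * KA A (z.2, z.1)))).
  by rewrite e; field.
rewrite -(I_D l0 l1) -I_Z; last exact: (L1D l0 l1).
by congr I; apply/funext => z; rewrite KA_sympart; ring.
Qed.

Lemma BR_cvg K nu M (a_ : nat -> V -> R) a c : kernel K nu M ->
  (forall k, measurable_fun [set: V] (a_ k)) -> (forall k, L2 mm (dq (a_ k))) ->
  measurable_fun [set: V] a -> L2 mm (dq a) -> measurable_fun [set: V] c -> L2 mm (dq c) ->
  L2cvg mm (fun k => dq (a_ k)) (dq a) -> BR K (a_ k) c @[k --> \oo] --> BR K a c.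
Proof.
move=> kK ma_ la_ ma la mc lc ca.
(* [kernel] records no sign for [M]. *)
have M0 : exists2 M', 0 <= M' & {ae mm, forall z, K z <= M' * kap (z.1 - z.2)}.
  exists `|M| => //; apply: filterS (kern_upper kK) => z h; apply: (le_trans h).
  by rewrite ler_wpM2r ?kap_ge0// ler_norm.
have [M' M'0 hM] := M0.
(* Giving each argument a square root of [K] turns the form into an L^2 inner product, to which
   [L2cvgM] applies. *)
pose X (d : V -> R) z := (d z.2 - d z.1) * Num.sqrt (K z).
have K0 := kern_ge0 kK.
have lX d : measurable_fun [set: V] d -> L2 mm (dq d) -> L2 mm (X d).
  move=> md ld; split.
    apply: measurable_funM; first by apply: measurable_funB; exact: measurableT_comp.
    apply: (measurableT_comp (continuous_measurable_fun (@sqrt_continuous R))).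
    exact: kern_meas kK.
  have := BR_L1 kK md md ld ld; congr (L1 _ _); apply/funext => z.
  by rewrite /X exprMn sqr_sqrtr// expr2.
have eX d d' : (fun z => X d z * X d' z) = (fun z => (d z.2 - d z.1) * (d' z.2 - d' z.1) * K z).
  by apply/funext => z; rewrite /X -[in RHS](sqr_sqrtr (K0 z)); ring.
rewrite /BR -eX; under eq_fun do rewrite -eX.
apply: (L2cvgM (fun k => lX _ (ma_ k) (la_ k)) (lX _ ma la) (fun=> lX _ mc lc) (lX _ mc lc)); last exact: L2cvg_cst.
apply/L2cvg_near => e e0; have e1 : 0 < e / (M' + 1) by rewrite divr_gt0// ltr_wpDl.
have /L2cvg_near/(_ _ e1) := ca; apply: filterS => k hk.
have md : measurable_fun [set: V] (fun x => a_ k x - a x) by exact: measurable_funB.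
have ld : L2 mm (dq (fun x => a_ k x - a x)).
  have := L2B (la_ k) la; congr (L2 _ _); apply/funext => z; by rewrite dqB.
have kK' : kernel K nu M' by case: kK => *; split.
have -> : sqI mm (fun x => X (a_ k) x - X a x) = BR K (fun x => a_ k x - a x) (fun x => a_ k x - a x).
  rewrite /BR /sqI; congr I; apply/funext => z; rewrite /X -[in RHS](sqr_sqrtr (K0 z)).
  by move: (Num.sqrt _) (a_ k _) (a_ k _) (a _) (a _) => ? ? ? ? ?; ring.
apply: (le_trans (BR_upper kK' md ld)).
have -> : sqI mm (dq (fun x => a_ k x - a x)) = sqI mm (fun x => dq (a_ k) x - dq a x).
  by congr sqI; apply/funext => z; rewrite dqB.
apply: (le_trans (ler_wpM2l M'0 hk)).
by rewrite mulrCA ler_piMr ?(ltW e0)// ler_pdivrMr ?ltr_wpDl// mul1r lerDl.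
Qed.

End forms.

(** * The Gamma integral and differentiation under the integral *)

Section gamma.
Context {R : realType}.
Local Notation leb1 := (@lebesgue_measure R).

Lemma I_itv0 (r : R) : 0 <= r -> L1 leb1 (\1_(`[0, r]%classic : set R)) /\ I leb1 (\1_(`[0, r]%classic : set R)) = r.
Proof.
move=> r0; have e : (\int[leb1]_x (\1_(`[0, r]%classic : set R) x)%:E = r%:E)%E.
  rewrite integral_indic// setIT; apply: (eq_trans (@lebesgue_measure_itv R `[0%R, r])); rewrite /= lte_fin; case: ltP => h; first by rewrite sube0.
  by congr (_%:E); apply/eqP; rewrite eq_le r0 h.
have l : L1 leb1 (\1_(`[0, r]%classic : set R)).
  by apply/L1_ge0P => //; rewrite e ltry.
by split=> //; apply: EFin_inj; rewrite EFin_I.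
Qed.

Definition gfun (a t : R) : R := if 0 < t then t `^ (a - 1) * expR (- t) else 0.

Lemma gfun_ge0 a t : 0 <= gfun a t.
Proof. by rewrite /gfun; case: ifP => // _; rewrite mulr_ge0 ?powR_ge0 ?expR_ge0. Qed.

Lemma measurable_gfun a : measurable_fun [set: R] (gfun a).
Proof.
apply: measurable_fun_ifT => //; first exact: measurable_fun_ltr.
apply: measurable_funM; first exact: measurable_powR.
by apply: (measurableT_comp (continuous_measurable_fun (@continuous_expR R))); exact: oppr_measurable.
Qed.

Lemma gfun_L1 a : 0 < a -> L1 leb1 (gfun a).
Proof.
move=> a0; pose m := Num.Def.archi_bound a.
have am : a < m%:R by apply: archi_boundP; exact: ltW.
pose F : R := (m.+2)`!%:R.
have F0 : 0 < F by rewrite ltr0n fact_gt0.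
have h0 : 0 < (2^-1 : R) by rewrite invr_gt0.
have h1 : (2^-1 : R) < 1 by rewrite invf_lt1// ltr1n.
pose q : R := 2^-1 `^ a.
have q0 : 0 < q by rewrite powR_gt0.
have q1 : q < 1.
  by have := @gt0_ltr_powR R a a0 2^-1 1; rewrite powR1 !nnegrE; apply => //; exact: ltW.
pose th := maxr q 2^-1.
have th01 : 0 < th < 1 by rewrite /th lt_max gt_max q0 q1 h1.
have itv r := @I_itv0 r.
(* For 2^(-k-1) < t <= 2^-k one has t^(a-1) <= 2 2^k q^k; for 2^k <= t < 2^(k+1) one has t^(a-1)
   exp(-t) <= F t^-2 <= F 4^-k, where F = (m+2)! and a < m. The two terms have integrals 2 q^k and 2
   F 2^-k. *)
pose g k t := 2 * 2 ^+ k * q ^+ k * \1_(`[0, 2^-1 ^+ k]%classic : set R) t +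
  F * (4^-1 ^+ k) * \1_(`[0, 2 ^+ k.+1]%classic : set R) t.
have p1 k : 0 <= (2^-1 : R) ^+ k by rewrite exprn_ge0// ltW.
have p2 k : 0 <= (2 : R) ^+ k by rewrite exprn_ge0.
have p4 k : 0 <= (4^-1 : R) ^+ k by rewrite exprn_ge0// invr_ge0.
have pq k : 0 <= q ^+ k by rewrite exprn_ge0// ltW.
have c1 k : 0 <= 2 * 2 ^+ k * q ^+ k by rewrite !mulr_ge0.
have c2 k : 0 <= F * 4^-1 ^+ k by rewrite mulr_ge0// ltW.
have i0 (A : set R) t : 0 <= \1_A t :> R by rewrite indicE.
apply: (@L1_geometric _ _ _ leb1 g (gfun a) (2 + 2 * F) th) => //.
- by rewrite addr_ge0// mulr_ge0// ltW.
- by move=> k; apply: L1D; apply: L1Z; [exact: (itv _ (p1 k)).1|exact: (itv _ (p2 k.+1)).1].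
- by move=> k t; rewrite addr_ge0// mulr_ge0.
- move=> k; rewrite I_D; [|apply: L1Z; exact: (itv _ (p1 k)).1|apply: L1Z; exact: (itv _ (p2 k.+1)).1].
  rewrite !I_Z; [|exact: (itv _ (p2 k.+1)).1|exact: (itv _ (p1 k)).1].
  rewrite (itv _ (p1 k)).2 (itv _ (p2 k.+1)).2 [leRHS](mulrDl 2 (2 * F)); apply: lerD.
    have -> : 2 * 2 ^+ k * q ^+ k * 2^-1 ^+ k = 2 * q ^+ k.
      have e : 2 ^+ k * 2^-1 ^+ k = 1 :> R by rewrite -exprMn mulfV ?expr1n.
      by transitivity (2 * (2 ^+ k * 2^-1 ^+ k) * q ^+ k); [ring|rewrite e; ring].
    by rewrite ler_pM2l// lerXn2r ?nnegrE ?(ltW q0) ?(le_trans (ltW q0))// /th le_max lexx.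
  have -> : F * 4^-1 ^+ k * 2 ^+ k.+1 = 2 * F * 2^-1 ^+ k.
    rewrite exprS; have -> : (4^-1 : R) = 2^-1 * 2^-1 by rewrite -invfM -natrM.
    have e : 2 ^+ k * 2^-1 ^+ k = 1 :> R by rewrite -exprMn mulfV ?expr1n.
    rewrite exprMn; transitivity (2 * F * 2^-1 ^+ k * (2 ^+ k * 2^-1 ^+ k)); [ring|by rewrite e mulr1].
  rewrite ler_pM2l ?mulr_gt0// lerXn2r ?nnegrE ?(ltW h0) ?(le_trans (ltW h0))//.
    by rewrite /th le_max lexx orbT.
  by rewrite /th le_max lexx orbT.
- exact: measurable_gfun.
move=> t; rewrite (ger0_norm (gfun_ge0 a t)) /gfun; case: ifPn => t0; last first.
  by exists 0%N; rewrite addr_ge0// mulr_ge0.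
have ta : t `^ (a - 1) = t `^ a / t by rewrite powRB ?implybE ?(gt_eqF t0) ?orbT// powRr1// ltW.
case: (leP 1 t) => t1.
  have [k /andP[k1 k2]] := dyadic t1; exists k.
  rewrite /g -[leLHS]add0r; apply: lerD; first by rewrite mulr_ge0.
  have -> : \1_(`[0, 2 ^+ k.+1]%classic : set R) t = 1 :> R.
    by rewrite indicE mem_set//= in_itv/= (ltW t0) (ltW k2).
  rewrite mulr1 ta; have tm : t `^ a <= t ^+ m by rewrite -powR_mulrn ?(ltW t0)// ler_powR// ltW.
  have e1 : t ^+ m.+2 / F <= expR t.
    by apply: le_trans (expR_ge1Dxn m.+1 (ltW t0)); rewrite lerDr.
  have e2 : expR (- t) <= F / t ^+ m.+2.
    rewrite expRN -[leRHS]invrK lef_pV2 ?posrE ?expR_gt0 ?invr_gt0 ?divr_gt0 ?exprn_gt0//.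
    by rewrite invf_div.
  have ti : t^-1 <= 1 by rewrite invf_le1.
  apply: (le_trans (y := t ^+ m * (F / t ^+ m.+2))).
    apply: ler_pM; rewrite ?expR_ge0 ?divr_ge0 ?powR_ge0 ?(ltW t0)//.
    by rewrite (le_trans _ tm)// ler_piMr ?powR_ge0.
  have -> : t ^+ m * (F / t ^+ m.+2) = F * (t ^+ 2)^-1.
    have tm0 : t ^+ m != 0 by rewrite expf_neq0// gt_eqF.
    by rewrite -addn2 exprD; field; rewrite tm0 gt_eqF.
  rewrite ler_pM2l// -[(4^-1)]/(4^-1 : R) -exprVn exprVn -exprVn.
  have -> : (4^-1 : R) ^+ k = ((2 ^+ k) ^+ 2)^-1 by rewrite exprVn (exprAC 2 k 2) (_ : 2 ^+ 2 = 4 :> R)//; ring.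
  by rewrite exprVn lef_pV2 ?posrE ?exprn_gt0// lerXn2r ?nnegrE ?(ltW t0).
have ti : 1 <= t^-1 by rewrite invf_ge1// ltW.
have [k /andP[k1 k2]] := dyadic ti; exists k.
have tk : t <= 2^-1 ^+ k by rewrite exprVn -[t]invrK lef_pV2 ?posrE ?exprn_gt0 ?invr_gt0.
rewrite /g -[leLHS]addr0; apply: lerD; last by rewrite mulr_ge0.
have -> : \1_(`[0, 2^-1 ^+ k]%classic : set R) t = 1 :> R.
  by rewrite indicE mem_set//= in_itv/= (ltW t0) tk.
rewrite mulr1 ta; apply: (le_trans (y := t `^ a / t)).
  by rewrite ler_piMr ?divr_ge0 ?powR_ge0 ?(ltW t0)// expR_le1 oppr_le0 ltW.
rewrite mulrC; apply: ler_pM; rewrite ?invr_ge0 ?powR_ge0 ?(ltW t0)//; first by rewrite -exprS ltW.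
have -> : q ^+ k = (2^-1 ^+ k) `^ a by rewrite -(powR_mulrn k (ltW q0)) -(powR_mulrn k (ltW h0)) /q -!powRrM mulrC.
by rewrite ge0_ler_powR ?nnegrE ?(ltW a0) ?(ltW t0).
Qed.

Lemma gfun_gt0 a : 0 < a -> 0 < I leb1 (gfun a).
Proof.
move=> a0; have l := gfun_L1 a0; rewrite lt_neqAle I_ge0 ?andbT; last exact: gfun_ge0.
apply/eqP => /esym h; have [A [mA A0 sA]] := ge0_I0_ae l (gfun_ge0 a) h.
have : (leb1 `[1%R, 2%R]%classic <= leb1 A)%E.
  apply: le_measure; rewrite ?inE//; apply: subset_trans sA => t /=.
  rewrite in_itv/= => /andP[t1 _]; have t0 : 0 < t by apply: lt_le_trans t1.
  by rewrite /gfun t0; apply/eqP; rewrite gt_eqF// mulr_gt0 ?powR_gt0 ?expR_gt0.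
rewrite A0 lebesgue_measure_itv/= lte_fin ltr1n/= -EFinD lee_fin; lra.
Qed.

Lemma Gamma_integralE a : Gamma_integral a = I leb1 (gfun a).
Proof.
rewrite /Gamma_integral Rintegral_mkcond; congr Rintegral; apply/funext => t.
rewrite patchE /gfun; case: ifPn; rewrite ?inE ?notin_setE/= in_itv/= andbT => h; first by rewrite h.
by case: ifP.
Qed.

Lemma gfun_scale a tau : 0 < a -> 0 < tau ->
  L1 leb1 (fun t => gfun a (tau * t)) /\
  I leb1 (fun t => gfun a (tau * t)) = tau^-1 * I leb1 (gfun a).
Proof.
move=> a0 t0; have l := gfun_L1 a0; have tn : tau != 0 by rewrite gt_eqF.
have mt : measurable_fun [set: R] (fun t => gfun a (tau * t)).
  by apply: (measurableT_comp (measurable_gfun a)); exact: mulrl_measurable.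
have e : (\int[leb1]_t (gfun a (tau * t))%:E = (tau^-1)%:E * \int[leb1]_t (gfun a t)%:E)%E.
  have := @ge0_integral_affine1 R tau 0 (fun t => (gfun a t)%:E) tn.
  under eq_integral do rewrite addr0.
  rewrite gtr0_norm//; apply; last by move=> t; rewrite lee_fin gfun_ge0.
  by apply/measurable_EFinP; exact: measurable_gfun.
have l' : L1 leb1 (fun t => gfun a (tau * t)).
  have h : (\int[leb1]_t (gfun a (tau * t))%:E < +oo)%E by rewrite e -EFin_I// -EFinM ltry.
  apply/integrableP; split; first exact/measurable_EFinP.
  by under eq_integral do rewrite gee0_abs ?lee_fin ?gfun_ge0//.
by split=> //; apply: EFin_inj; rewrite EFin_I// e EFinM EFin_I.
Qed.

Lemma C_ns_gt0 (n : nat) (s : R) : 0 < s < 1 -> 0 < @C_ns R n s.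
Proof.
move=> /andP[s0 s1]; have pp := pi_gt0 R.
have G (a : R) : 0 < a -> 0 < Gamma_integral a by move=> a0; rewrite Gamma_integralE gfun_gt0.
have a0 : 0 < n%:R / 2 + s by have := ler0n R n; lra.
(* A positive Gamma integral divided by factors [- s + i], none of which vanishes for 0 < s < 1. *)
have g2 : Gamma (- s) != 0.
  rewrite /Gamma ltNge oppr_le0 (ltW s0)/= opprK mulf_neq0//.
    by rewrite gt_eqF// G// addrC subr_gt0 truncnS_gt.
  rewrite invr_eq0; apply/prodf_neq0 => -[[|i] hi] _ /=; first by rewrite addr0 oppr_eq0 gt_eqF.
  by rewrite gt_eqF// addrC subr_gt0 (lt_le_trans s1)// ler1n.
rewrite /C_ns divr_gt0 ?mulr_gt0 ?powR_gt0 ?normr_gt0// /Gamma a0; exact: G.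
Qed.

Lemma cz_gt0 (n : nat) (s : R) : 0 < s < 1 -> 0 < @cz R n s.
Proof. by move=> s01; rewrite exprn_gt0// divr_gt0// sqrtr_gt0// C_ns_gt0. Qed.

End gamma.

(** * Derivatives and power series under the integral sign *)

Section under_integral.
Context {R : realType}.

Lemma deriv_seq (f : R -> R) (l : R) (t_ : nat -> R) : is_derive (0 : R) (1 : R) f l ->
  (forall m, t_ m != 0) -> t_ m @[m --> \oo] --> (0 : R) ->
  (f (t_ m) - f 0) / t_ m @[m --> \oo] --> l.
Proof.
move=> [df <-] tn0 t0; have := df; rewrite /derivable => /cvg_ex[/= l' Hl].
have El : 'D_1 f 0 = l' by rewrite /derive; apply: cvg_lim Hl.
rewrite El; apply/cvgrPdist_le => e e0; have /cvgrPdist_le/(_ e e0) H := Hl.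
have : \forall h \near nbhs (0 : R), h != 0 -> `|l' - h^-1 *: (f (h *: 1 + 0) - f 0)| <= e by exact: H.
move/t0 => -[N _ HN]; exists N => // m /HN /(_ (tn0 m)).
by rewrite /GRing.scale/= mulr1 addr0 mulrC.
Qed.

(** If an integral vanishes for all small [t], so does its derivative at 0. The bounds are asked
    only where [w] is nonzero, as [Phi] is to be singular elsewhere. *)
Lemma deriv0_under d (T : measurableType d) (mu : {measure set T -> \bar R})
  (w : T -> R) (Phi Psi : R -> T -> R) (dl C : R) : 0 < dl -> L1 mu w ->
  (forall t, `|t| < dl -> measurable_fun [set: T] (Phi t)) ->
  measurable_fun [set: T] (Psi 0) ->
  (forall y (t : R), w y != 0 -> `|t| < dl -> is_derive t (1 : R) (Phi ^~ y) (Psi t y)) ->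
  (forall y t, w y != 0 -> `|t| < dl -> `|Psi t y| <= C) ->
  (forall t, `|t| < dl -> L1 mu (fun y => w y * Phi t y)) ->
  (forall t, `|t| < dl -> I mu (fun y => w y * Phi t y) = 0) ->
  I mu (fun y => w y * Psi 0 y) = 0.
Proof.
move=> dl0 lw mP mPsi dP bP lP iP.
(* [m.+2] keeps every [t_ m] strictly below [dl]. *)
pose t_ m : R := dl * (m.+2%:R)^-1.
have t0 m : 0 < t_ m by rewrite mulr_gt0// invr_gt0.
have tl m : t_ m < dl by rewrite /t_ gtr_pMr// invf_lt1// ltr1n.
have tn m : `|t_ m| < dl by rewrite gtr0_norm.
have zn : `|(0 : R)| < dl by rewrite normr0.
have tc : t_ m @[m --> \oo] --> (0 : R).
  rewrite -(mulr0 dl); apply: cvgM; first exact: cvg_cst.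
  by have := @cvg_harmonic R; rewrite -(cvg_shiftS (@harmonic R)).
have i0 : {ae mu, forall y, w y * ((Phi (t_ m) y - Phi 0 y) / t_ m) @[m --> \oo] --> w y * Psi 0 y}.
  apply: aeW => y; have [->|wy] := eqVneq (w y) 0.
    by rewrite mul0r; under eq_fun do rewrite mul0r; exact: cvg_cst.
  apply: cvgM; first exact: cvg_cst.
  by apply: (deriv_seq (f := Phi ^~ y)) => // [|m]; [exact: dP|rewrite gt_eqF].
have mw := L1_measurable lw.
have [] := @dct _ _ _ mu (fun m y => w y * ((Phi (t_ m) y - Phi 0 y) / t_ m)) (fun y => w y * Psi 0 y)
  (fun y => C * `|w y|) _ _ i0 (L1Z C (L1_norm lw)) _.
- move=> m; apply: measurable_funM => //; apply: measurable_funM => //.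
  by apply: measurable_funB; exact: mP.
- exact: measurable_funM.
- move=> m; apply: aeW => y; have [->|wy] := eqVneq (w y) 0; first by rewrite mul0r normr0 mulr0.
  rewrite normrM mulrC ler_wpM2r//.
  have lt c : c \in `]0, t_ m[ -> `|c| < dl.
    by rewrite in_itv/= => /andP[c0 c1]; rewrite gtr0_norm// (lt_trans c1).
  have [|c hc] := @MVT R (Phi ^~ y) (Psi ^~ y) 0 (t_ m) (t0 m) (fun t ht => dP y t wy (lt t ht)).
    apply: derivable_within_continuous => t; rewrite in_itv/= => /andP[ta tb].
    by apply: ex_derive; apply: dP => //; rewrite ger0_norm// (le_lt_trans tb).
  by rewrite subr0 => ->; rewrite mulfK ?gt_eqF//; apply: bP => //; exact: lt.
move=> _ cv; apply: (cvg_unique _ cv) => //.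
rewrite (_ : (fun m => _) = (fun=> 0)); first exact: cvg_cst.
apply/funext => m; rewrite (_ : (fun y => _) = (fun y => (t_ m)^-1 * (w y * Phi (t_ m) y - w y * Phi 0 y))).
  by rewrite I_Z ?I_B ?iP ?subrr ?mulr0//; [exact: lP|exact: lP|apply: L1B; exact: lP].
by apply/funext => y; ring.
Qed.

Lemma power_series_under d (T : measurableType d) (mu : {measure set T -> \bar R})
  (u sg : T -> R) (S : R) (c : nat -> R) (f : R -> R) : L1 mu u ->
  measurable_fun [set: T] sg -> (forall y, u y != 0 -> `|sg y| <= S) ->
  (forall k, `|c k| <= k`!%:R^-1) -> measurable_fun [set: R] f ->
  (forall x, series (fun k => c k * x ^+ k) @ \oo --> f x) ->
  (forall k, I mu (fun y => u y * sg y ^+ k) = 0) -> I mu (fun y => u y * f (sg y)) = 0.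
Proof.
move=> lu msg sS cb mf cf ik; have mu_ := L1_measurable lu.
have lk k : L1 mu (fun y => u y * sg y ^+ k).
  apply: (L1_le _ (L1Z (S ^+ k) (L1_norm lu))).
    by apply: measurable_funM => //; exact: measurable_funX.
  move=> y; have [->|uy] := eqVneq (u y) 0; first by rewrite mul0r normr0 mulr0.
  rewrite normrM mulrC ler_wpM2r// normrX lerXn2r ?nnegrE//; last exact: sS.
  by rewrite (le_trans _ (sS y uy)).
have E N : (fun y => u y * series (fun k => c k * sg y ^+ k) N) =
    (fun y => \sum_(0 <= k < N) c k * (u y * sg y ^+ k)).
  by apply/funext => y; rewrite /series/= mulr_sumr; apply: eq_bigr => k _; ring.
have lS N : L1 mu (fun y => u y * series (fun k => c k * sg y ^+ k) N).
  by rewrite E; apply: L1_sum => k; exact: L1Z.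
have iS N : I mu (fun y => u y * series (fun k => c k * sg y ^+ k) N) = 0.
  rewrite E I_sum => [|k]; last exact: L1Z.
  by rewrite big1// => k _; rewrite I_Z// ik mulr0.
have sb x N : `|series (fun k => c k * x ^+ k) N| <= expR `|x|.
  have h : series (exp_coeff `|x|) N <= expR `|x|.
    apply: nondecreasing_cvgn_le; last exact: is_cvg_series_exp_coeff.
    by apply/nondecreasing_seqP => m; rewrite /series/= big_nat_recr//= lerDl exp_coeff_ge0.
  apply: le_trans h; rewrite /series/= (le_trans (ler_norm_sum _ _ _))//.
  apply: ler_sum => k _; rewrite normrM normrX /exp_coeff/= mulrC ler_wpM2l// exprn_ge0//.
have [] := @dct _ _ _ mu (fun N y => u y * series (fun k => c k * sg y ^+ k) N)
  (fun y => u y * f (sg y)) (fun y => expR `|S| * `|u y|) _ _ _ (L1Z (expR `|S|) (L1_norm lu)) _.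
- by move=> N; exact: L1_measurable (lS N).
- by apply: measurable_funM => //; exact: measurableT_comp.
- by apply: aeW => y; apply: cvgM; [exact: cvg_cst|exact: cf].
- move=> N; apply: aeW => y; have [->|uy] := eqVneq (u y) 0; first by rewrite mul0r normr0 mulr0.
  rewrite normrM mulrC ler_wpM2r// (le_trans (sb _ _))// ler_expR.
  by rewrite (le_trans (sS y uy))// ler_norm.
move=> _ cv; apply: (cvg_unique _ cv) => //.
by rewrite (_ : (fun N => _) = (fun=> 0)); [exact: cvg_cst|apply/funext => N; exact: iS].
Qed.

Lemma expR_series (x : R) : series (fun k => k`!%:R^-1 * x ^+ k) @ \oo --> expR x.
Proof.
have := @is_cvg_series_exp_coeff R x; rewrite /expR.
by rewrite (_ : exp_coeff x = (fun k => k`!%:R^-1 * x ^+ k))// exp_coeffE.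
Qed.

Lemma cos_series (x : R) :
  series (fun k => (~~ odd k)%:R * (-1) ^+ k./2 / k`!%:R * x ^+ k) @ \oo --> cos x.
Proof. by have := @is_cvg_series_cos_coeff R x; rewrite cos.unlock cos_coeffE. Qed.

Lemma sin_series (x : R) :
  series (fun k => (odd k)%:R * (-1) ^+ k.-1./2 / k`!%:R * x ^+ k) @ \oo --> sin x.
Proof. by have := @is_cvg_series_sin_coeff R x; rewrite sin.unlock sin_coeffE. Qed.

End under_integral.

Lemma cube_norm (R : realType) (n : nat) (c x : 'rV[R]_n) r : 0 < r -> cube c r x <-> `|x - c| < r.
Proof.
move=> r0; split=> [h|h i]; first by apply: norm_row_lt => // i; rewrite !mxE.
by have := norm_coord (x - c) i; rewrite !mxE => /le_lt_trans; apply.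
Qed.

Lemma is_derive_quad (R : realType) (a b c t : R) :
  is_derive t (1 : R) (fun t => a + 2 * t * b + t ^+ 2 * c) (2 * b + 2 * t * c).
Proof.
have d1 : is_derive t (1 : R) (fun t : R => t) 1 by exact: is_derive_id.
have dd := is_deriveD (is_deriveD (is_derive_cst a t (1 : R)) (is_deriveZ (2 * b) d1))
  (is_deriveZ c (is_deriveM d1 d1)).
rewrite (_ : (fun t => _) = cst a + (2 * b) \*: (fun t : R => t) + c \*: ((fun t : R => t) * (fun t : R => t))).
  by apply: (is_derive_eq dd); rewrite /GRing.scale/=; ring.
by apply/funext => u; rewrite !fctE /= /GRing.scale/=; ring.
Qed.

(** * Unique continuation for Riesz potentials *)

Section ucp.
Context {R : realType} {n : nat}.
Local Notation V := 'rV[R]_n.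
Local Notation mu := (@leb R n).

Definition r2 (x y : V) : R := edot (x - y) (x - y).

Lemma r2_ge0 x y : 0 <= r2 x y. Proof. exact: edot_ge0. Qed.

Lemma measurable_r2 x : measurable_fun [set: V] (r2 x).
Proof. by apply: measurable_edot; exact: measurable_rVB. Qed.

Lemma r2_line (x y e : V) (t : R) : r2 (x + t *: e) y = r2 x y + 2 * t * edot e (x - y) + t ^+ 2 * edot e e.
Proof.
have E : x + t *: e - y = (x - y) + t *: e by rewrite addrAC.
rewrite /r2 E; move: (x - y) => d.
by rewrite edotDl !edotDr !edotZl !edotZr (edotC d e); ring.
Qed.

Lemma edot_line (x y e : V) (t : R) : edot e (x + t *: e - y) = edot e (x - y) + t * edot e e.
Proof.
have E : x + t *: e - y = (x - y) + t *: e by rewrite addrAC.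
by rewrite E; move: (x - y) => d; rewrite edotDr edotZr.
Qed.

Lemma r2_sum (x y : V) : \sum_(i < n) edot (delta_mx ord0 i) (x - y) ^+ 2 = r2 x y.
Proof.
apply: eq_bigr => i _; rewrite expr2; congr (_ * _); rewrite /edot (bigD1 i)//= mxE !eqxx mul1r;
  by rewrite big1 ?addr0// => j ji; rewrite mxE eqxx (negbTE ji) mul0r.
Qed.

Lemma edot_delta (i : 'I_n) : edot (delta_mx ord0 i : V) (delta_mx ord0 i) = 1.
Proof.
rewrite /edot (bigD1 i)//= mxE !eqxx mul1r big1 ?addr0// => j ji.
by rewrite mxE eqxx (negbTE ji) mul0r.
Qed.

Variables (w : V -> R) (x0 : V) (r d0 B : R).
Hypotheses (lw : L1 mu w) (r_gt0 : 0 < r) (d_gt0 : 0 < d0).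
Hypothesis hr : forall x y, cube x0 r x -> w y != 0 -> d0 <= r2 x y <= B.

Lemma cube_line (x e : V) : cube x0 r x -> exists2 dl, 0 < dl &
  forall t, `|t| < dl -> cube x0 r (x + t *: e).
Proof.
move=> /(cube_norm _ _ r_gt0) h; have e1 : 0 < `|e| + 1 by rewrite ltr_wpDl.
exists ((r - `|x - x0|) / (`|e| + 1)); first by rewrite divr_gt0// subr_gt0.
move=> t ht; apply/(cube_norm _ _ r_gt0); rewrite addrAC (le_lt_trans (ler_normD _ _))//.
rewrite -ltrBrDl normrZ; move: ht; rewrite ltr_pdivlMr//; apply: le_lt_trans.
by rewrite ler_wpM2l// lerDl.
Qed.

(** A power is monotone in a direction that depends on the sign of [c]; the sum of the two end
    values bounds it in either case. *)
Lemma powR_between c t : d0 <= t <= B -> 0 <= t `^ c <= d0 `^ c + B `^ c.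
Proof.
move=> /andP[t1 t2]; have t0 : 0 < t := lt_le_trans d_gt0 t1.
have B0 : 0 < B := lt_le_trans t0 t2.
rewrite powR_ge0/=; case: (leP 0 c) => c0.
  apply: (le_trans (y := B `^ c)); last by rewrite lerDr powR_ge0.
  by rewrite ge0_ler_powR ?nnegrE ?(ltW t0) ?(ltW B0).
apply: (le_trans (y := d0 `^ c)); last by rewrite lerDl powR_ge0.
rewrite -(opprK c) !(powRN _ (- c)) lef_pV2 ?posrE ?powR_gt0//.
by rewrite ge0_ler_powR ?nnegrE ?(ltW t0) ?(ltW d_gt0)// oppr_ge0 ltW.
Qed.

Lemma L1_wM (f : V -> R) C : measurable_fun [set: V] f ->
  (forall y, w y != 0 -> `|f y| <= C) -> L1 mu (fun y => w y * f y).
Proof.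
move=> mf fC; apply: (L1_le _ (L1Z C (L1_norm lw))).
  by apply: measurable_funM => //; exact: L1_measurable lw.
move=> y; have [->|wy] := eqVneq (w y) 0; first by rewrite mul0r normr0 mulr0.
by rewrite normrM mulrC ler_wpM2r// fC.
Qed.

Lemma I_w_eq (f g : V -> R) : (forall y, w y != 0 -> f y = g y) ->
  I mu (fun y => w y * f y) = I mu (fun y => w y * g y).
Proof.
move=> fg; congr I; apply/funext => y; have [->|wy] := eqVneq (w y) 0; first by rewrite !mul0r.
by rewrite fg.
Qed.

Lemma measurable_r2pow x c : measurable_fun [set: V] (fun y => r2 x y `^ c).
Proof. by apply: (measurableT_comp (measurable_powR c)); exact: measurable_r2. Qed.

Lemma measurable_edotB e x : measurable_fun [set: V] (fun y => edot e (x - y)).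
Proof. by apply: measurable_edot => //; exact: measurable_rVB. Qed.

Definition Cp c := d0 `^ c + B `^ c.

Lemma r2pow_bound c x y : cube x0 r x -> w y != 0 -> `|r2 x y `^ c| <= Cp c.
Proof. by move=> cx wy; have /andP[h1 h2] := powR_between c (hr cx wy); rewrite ger0_norm. Qed.

Lemma edot_bound e x y : cube x0 r x -> w y != 0 -> `|edot e (x - y)| <= 1 + edot e e * B.
Proof.
move=> cx wy; have /andP[_ h] := hr cx wy; have := cauchy_edot e (x - y).
have := ler_wpM2l (edot_ge0 e) h; rewrite -/(r2 x y) => h1 h2.
have h3 : `|edot e (x - y)| ^+ 2 <= edot e e * B by rewrite real_normK ?num_real// (le_trans h2).
have := sqr_ge0 (`|edot e (x - y)| - 2^-1); nra.
Qed.

Lemma r2_pos x y : cube x0 r x -> w y != 0 -> 0 < r2 x y.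
Proof. by move=> cx wy; have /andP[h _] := hr cx wy; exact: lt_le_trans h. Qed.

Lemma is_derive_r2pow c x y e t : 0 < r2 (x + t *: e) y ->
  is_derive t (1 : R) (fun t => r2 (x + t *: e) y `^ c)
    (c * r2 (x + t *: e) y `^ (c - 1) * (2 * edot e (x + t *: e - y))).
Proof.
move=> p0; have dq : is_derive t (1 : R) (fun t => r2 (x + t *: e) y) (2 * edot e (x + t *: e - y)).
  rewrite (_ : (fun t => _) = (fun t => r2 x y + 2 * t * edot e (x - y) + t ^+ 2 * edot e e)).
    by apply: (is_derive_eq (is_derive_quad _ _ _ _)); rewrite edot_line; ring.
  by apply/funext => u; rewrite r2_line.
exact: (is_derive1_comp (is_derive1_powR c p0) dq).
Qed.

(** Vanishing on an open set of [x] is what allows differentiation in [x]; membership in the cube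
    also separates [x] from the support of [w]. *)
Definition vanish (f : V -> V -> R) := forall x, cube x0 r x -> I mu (fun y => w y * f x y) = 0.

Lemma vanish_grad b e : vanish (fun x y => r2 x y `^ b) ->
  vanish (fun x y => b * r2 x y `^ (b - 1) * (2 * edot e (x - y))).
Proof.
move=> H x cx; have [dl dl0 hdl] := cube_line e cx.
have := @deriv0_under R _ _ mu w (fun t y => r2 (x + t *: e) y `^ b)
  (fun t y => b * r2 (x + t *: e) y `^ (b - 1) * (2 * edot e (x + t *: e - y)))
  dl (`|b| * Cp (b - 1) * (2 * (1 + edot e e * B))) dl0 lw.
rewrite scale0r addr0; apply.
- by move=> t ht; exact: measurable_r2pow.
- by apply: measurable_funM; apply: measurable_funM => //; [exact: measurable_r2pow|exact: measurable_edotB].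
- by move=> y t wy ht; apply: is_derive_r2pow; apply: r2_pos => //; exact: hdl.
- move=> y t wy ht; rewrite !normrM; apply: ler_pM; rewrite ?mulr_ge0//.
    by rewrite ler_wpM2l//; apply: r2pow_bound => //; exact: hdl.
  by rewrite ger0_norm// ler_pM2l//; apply: edot_bound => //; exact: hdl.
- move=> t ht; apply: (L1_wM (C := Cp b)); first exact: measurable_r2pow.
  by move=> y wy; apply: r2pow_bound => //; exact: hdl.
- by move=> t ht; apply: H; exact: hdl.
Qed.

Lemma vanish_hess c e : vanish (fun x y => edot e (x - y) * r2 x y `^ c) ->
  vanish (fun x y => edot e e * r2 x y `^ c +
    edot e (x - y) * (c * r2 x y `^ (c - 1) * (2 * edot e (x - y)))).
Proof.
move=> H x cx; have [dl dl0 hdl] := cube_line e cx.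
have := @deriv0_under R _ _ mu w (fun t y => edot e (x + t *: e - y) * r2 (x + t *: e) y `^ c)
  (fun t y => edot e e * r2 (x + t *: e) y `^ c + edot e (x + t *: e - y) *
     (c * r2 (x + t *: e) y `^ (c - 1) * (2 * edot e (x + t *: e - y))))
  dl (edot e e * Cp c + (1 + edot e e * B) * (`|c| * Cp (c - 1) * (2 * (1 + edot e e * B)))) dl0 lw.
rewrite scale0r addr0; apply.
- by move=> t ht; apply: measurable_funM; [exact: measurable_edotB|exact: measurable_r2pow].
- apply: measurable_funD; apply: measurable_funM => //.
  + exact: measurable_r2pow.
  + exact: measurable_edotB.
  + by apply: measurable_funM; apply: measurable_funM => //; [exact: measurable_r2pow|exact: measurable_edotB].
- move=> y t wy ht; have p0 : 0 < r2 (x + t *: e) y by apply: r2_pos => //; exact: hdl.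
  have dE : is_derive t (1 : R) (fun t => edot e (x + t *: e - y)) (edot e e).
    rewrite (_ : (fun t => _) = (fun t => edot e (x - y) + 2 * t * (2^-1 * edot e e) + t ^+ 2 * 0)).
      by apply: (is_derive_eq (is_derive_quad _ _ _ _)); field.
    by apply/funext => u; rewrite edot_line; field.
  apply: (is_derive_eq (is_deriveM dE (is_derive_r2pow c p0))).
  by rewrite /GRing.scale/= addrC [X in X + _]mulrC.
- move=> y t wy ht; have cxt := hdl t ht.
  rewrite (le_trans (ler_normD _ _))//; apply: lerD.
    by rewrite normrM (ger0_norm (edot_ge0 e)) ler_wpM2l ?edot_ge0//; exact: r2pow_bound.
  rewrite normrM; apply: ler_pM => //; first exact: edot_bound.
  rewrite !normrM; apply: ler_pM; rewrite ?mulr_ge0//.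
    by rewrite ler_wpM2l//; exact: r2pow_bound.
  by rewrite ger0_norm// ler_pM2l//; exact: edot_bound.
- move=> t ht; have cxt := hdl t ht.
  apply: (L1_wM (C := (1 + edot e e * B) * Cp c)).
    by apply: measurable_funM; [exact: measurable_edotB|exact: measurable_r2pow].
  by move=> y wy; rewrite normrM; apply: ler_pM => //; [exact: edot_bound|exact: r2pow_bound].
- by move=> t ht; apply: H; exact: hdl.
Qed.

(* r2 ^ b is not harmonic, so applying the Laplacian in x lowers the exponent by one *)
Lemma vanish_laplace b : b != 0 -> n%:R + 2 * (b - 1) != 0 ->
  vanish (fun x y => r2 x y `^ b) -> vanish (fun x y => r2 x y `^ (b - 1)).
Proof.
move=> b0 nb H x cx; pose e (i : 'I_n) : V := delta_mx ord0 i.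
have H1 i : vanish (fun x y => edot (e i) (x - y) * r2 x y `^ (b - 1)).
  move=> z cz; have := vanish_grad (e i) H cz => h.
  have : (2 * b) * I mu (fun y => w y * (edot (e i) (z - y) * r2 z y `^ (b - 1))) = 0.
    rewrite -I_Z; first by rewrite -h; congr I; apply/funext => y; ring.
    apply: (L1_wM (C := (1 + edot (e i) (e i) * B) * Cp (b - 1))).
      by apply: measurable_funM; [exact: measurable_edotB|exact: measurable_r2pow].
    by move=> y wy; rewrite normrM; apply: ler_pM => //; [exact: edot_bound|exact: r2pow_bound].
  by move/eqP; rewrite !mulf_eq0 pnatr_eq0 (negbTE b0)/= => /eqP.
pose g i y := edot (e i) (e i) * r2 x y `^ (b - 1) +
    edot (e i) (x - y) * ((b - 1) * r2 x y `^ (b - 1 - 1) * (2 * edot (e i) (x - y))).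
have lg i : L1 mu (fun y => w y * g i y).
  apply: (L1_wM (C := edot (e i) (e i) * Cp (b - 1) + (1 + edot (e i) (e i) * B) *
     (`|b - 1| * Cp (b - 1 - 1) * (2 * (1 + edot (e i) (e i) * B))))).
    apply: measurable_funD; apply: measurable_funM => //.
    + exact: measurable_r2pow.
    + exact: measurable_edotB.
    + by apply: measurable_funM; apply: measurable_funM => //; [exact: measurable_r2pow|exact: measurable_edotB].
  move=> y wy; rewrite (le_trans (ler_normD _ _))//; apply: lerD.
    by rewrite normrM (ger0_norm (edot_ge0 _)) ler_wpM2l ?edot_ge0//; exact: r2pow_bound.
  rewrite normrM; apply: ler_pM => //; first exact: edot_bound.
  rewrite !normrM; apply: ler_pM; rewrite ?mulr_ge0//.
    by rewrite ler_wpM2l//; exact: r2pow_bound.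
  by rewrite ger0_norm// ler_pM2l//; exact: edot_bound.
have ig i : I mu (fun y => w y * g i y) = 0 by exact: (vanish_hess (H1 i) cx).
have lb : L1 mu (fun y => w y * r2 x y `^ (b - 1)).
  apply: (L1_wM (C := Cp (b - 1))); first exact: measurable_r2pow.
  by move=> y wy; exact: r2pow_bound.
have S : I mu (fun y => \sum_i w y * g i y) = 0.
  by rewrite I_sum// big1.
(* Summing the second derivatives over the coordinates, the diagonal terms contribute [n%:R] and the
   squares of [edot (e i) (x - y)] contribute [2 * (b - 1)]. *)
have : (n%:R + 2 * (b - 1)) * I mu (fun y => w y * r2 x y `^ (b - 1)) = 0.
  rewrite -I_Z// -S; congr I; apply/funext => y.
  have [->|wy] := eqVneq (w y) 0.
    by rewrite mul0r mulr0 big1// => i _; rewrite mul0r.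
  rewrite -mulr_sumr mulrCA; congr (_ * _); rewrite big_split/=.
  have -> : \sum_i edot (e i) (e i) * r2 x y `^ (b - 1) = n%:R * r2 x y `^ (b - 1).
    under eq_bigr do rewrite edot_delta mul1r.
    by rewrite sumr_const card_ord mulr_natl.
  have -> : \sum_i edot (e i) (x - y) * ((b - 1) * r2 x y `^ (b - 1 - 1) * (2 * edot (e i) (x - y))) =
      2 * (b - 1) * r2 x y `^ (b - 1 - 1) * \sum_i edot (e i) (x - y) ^+ 2.
    by rewrite mulr_sumr; apply: eq_bigr => i _; ring.
  rewrite r2_sum; have p0 := r2_pos cx wy.
  have -> : r2 x y `^ (b - 1) = r2 x y `^ (b - 1 - 1) * r2 x y.
    by rewrite -[X in _ = _ * X]powRr1 ?ltW// -powRD ?subrK// (gt_eqF p0) implybT.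
  ring.
by move/eqP; rewrite mulf_eq0 (negbTE nb)/= => /eqP.
Qed.

(** With both expressions negative at the start, lowering the exponent keeps them negative, so
    neither exceptional factor of [vanish_laplace] is ever 0. *)
Lemma vanish_iter b : b < 0 -> n%:R + 2 * (b - 1) < 0 -> vanish (fun x y => r2 x y `^ b) ->
  forall p : nat, vanish (fun x y => r2 x y `^ b * (r2 x y)^-1 ^+ p).
Proof.
move=> b0 nb H p; have H' : vanish (fun x y => r2 x y `^ (b - p%:R)).
  elim: p => [|p IH]; first by rewrite subr0.
  have p0 := ler0n R p.
  rewrite -natr1 opprD addrA; apply: vanish_laplace => //.
    by rewrite lt_eqF// subr_lt0 (lt_le_trans b0).
  by rewrite lt_eqF//; lra.
move=> x cx; rewrite -[RHS](H' x cx); apply: I_w_eq => y wy; have p0 := r2_pos cx wy.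
by rewrite powRD ?(gt_eqF p0) ?implybT// powRN powR_mulrn ?(ltW p0)// exprVn.
Qed.

Lemma vanish_exp b lam x : b < 0 -> n%:R + 2 * (b - 1) < 0 -> vanish (fun x y => r2 x y `^ b) ->
  cube x0 r x -> I mu (fun y => w y * (r2 x y `^ b * expR (- (lam * (r2 x y)^-1)))) = 0.
Proof.
move=> b0 nb H cx; have K := vanish_iter b0 nb H.
have mi : measurable_fun [set: V] (fun y => (r2 x y)^-1).
  apply: (eq_measurable_fun (fun y => r2 x y `^ (- 1))) => [y _|]; last exact: measurable_r2pow.
  by rewrite powR_inv1// r2_ge0.
have lu : L1 mu (fun y => w y * r2 x y `^ b).
  by apply: (L1_wM (C := Cp b)) => [|y wy]; [exact: measurable_r2pow|exact: r2pow_bound].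
have := @power_series_under R _ _ mu (fun y => w y * r2 x y `^ b) (fun y => - (lam * (r2 x y)^-1))
  (`|lam| * d0^-1) (fun k => k`!%:R^-1) expR lu _ _ _ _ (@expR_series R) _.
rewrite (_ : (fun y => w y * r2 x y `^ b * expR _) = (fun y => w y * (r2 x y `^ b * expR (- (lam * (r2 x y)^-1))))); last first.
  by apply/funext => y; rewrite mulrA.
apply.
- by apply: measurable_funN; exact: measurable_funM.
- move=> y; rewrite mulf_eq0 negb_or => /andP[wy _]; have p0 := r2_pos cx wy.
  rewrite normrN normrM ler_wpM2l// gtr0_norm ?invr_gt0// lef_pV2//.
  by have /andP[] := hr cx wy.
- by move=> k; rewrite ger0_norm// invr_ge0.
- exact: continuous_measurable_fun (@continuous_expR R).
- move=> k; have := K k x cx => h.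
  have l : L1 mu (fun y => w y * (r2 x y `^ b * (r2 x y)^-1 ^+ k)).
    apply: (L1_wM (C := Cp b * d0^-1 ^+ k)).
      by apply: measurable_funM; [exact: measurable_r2pow|exact: measurable_funX].
    move=> y wy; have p0 := r2_pos cx wy; rewrite normrM; apply: ler_pM => //; first exact: r2pow_bound.
    rewrite normrX lerXn2r ?nnegrE ?invr_ge0 ?(ltW d_gt0)// gtr0_norm ?invr_gt0// lef_pV2//.
    by have /andP[] := hr cx wy.
  rewrite -[RHS](mulr0 ((- lam) ^+ k)) -[in RHS]h -I_Z//; congr I; apply/funext => y.
  by rewrite -mulNr exprMn; ring.
Qed.

Local Notation leb1 := (@lebesgue_measure R).

(* the Gamma integral turns the exponentials into positive powers of r2 *)
Lemma vanish_gamma b a x : b < 0 -> n%:R + 2 * (b - 1) < 0 -> vanish (fun x y => r2 x y `^ b) ->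
  cube x0 r x -> 0 < a -> I mu (fun y => w y * (r2 x y `^ b * r2 x y `^ a)) = 0.
Proof.
move=> b0 nb H cx a0.
(* The power [a - 1] of [r2] cancels the one inside [gfun]: for fixed t the integrand becomes
   [w r2^b] times t^(a-1) exp(-t/r2), and its integral over t restores the power [a]. *)
pose co y := w y * (r2 x y `^ b * r2 x y `^ (a - 1)).
pose F (z : R * V) := co z.2 * gfun a ((r2 x z.2)^-1 * z.1).
have mw := L1_measurable lw.
have mco : measurable_fun [set: V] co.
  by apply: measurable_funM => //; apply: measurable_funM; exact: measurable_r2pow.
have mi : measurable_fun [set: V] (fun y => (r2 x y)^-1).
  apply: (eq_measurable_fun (fun y => r2 x y `^ (- 1))) => [y _|]; last exact: measurable_r2pow.
  by rewrite powR_inv1// r2_ge0.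
have mF : measurable_fun [set: R * V] F.
  apply: measurable_funM; first exact: (measurableT_comp mco measurable_snd).
  apply: (measurableT_comp (measurable_gfun a)); apply: measurable_funM => //.
  exact: (measurableT_comp mi measurable_snd).
have sec y : L1 leb1 (fun t => F (t, y)) /\ (forall c : R, 
    I leb1 (fun t => c * gfun a ((r2 x y)^-1 * t)) = c * (r2 x y * I leb1 (gfun a))) \/ w y = 0.
  have [wy|wy] := eqVneq (w y) 0; [by right|left].
  have p0 : 0 < (r2 x y)^-1 by rewrite invr_gt0 r2_pos.
  have [l e] := gfun_scale a0 p0; split; first exact: (L1Z (co y) l).
  by move=> c; rewrite (I_Z c l) e invrK.
have G0 := gfun_gt0 a0.
have lC : L1 mu (fun y => co y * (r2 x y * I leb1 (gfun a))).
  rewrite (_ : (fun y => _) = (fun y => w y * (r2 x y `^ b * r2 x y `^ (a - 1) * r2 x y * I leb1 (gfun a)))).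
    apply: (L1_wM (C := Cp b * Cp (a - 1) * B * I leb1 (gfun a))).
      apply: measurable_funM => //; apply: measurable_funM; last exact: measurable_r2.
      by apply: measurable_funM; exact: measurable_r2pow.
    move=> y wy; rewrite normrM (ger0_norm (ltW G0)) ler_wpM2r ?(ltW G0)// !normrM.
    apply: ler_pM; rewrite ?mulr_ge0//; last first.
      by rewrite ger0_norm ?r2_ge0//; have /andP[] := hr cx wy.
    by apply: ler_pM => //; exact: r2pow_bound.
  by apply/funext => y; rewrite /co; ring.
have lF : L1 (leb1 \x mu)%E F.
  apply: tonelli2 => // [y|].
    have [[]//|wy] := sec y; rewrite /F /co/= wy.
    by under eq_fun do rewrite !mul0r; exact: integrable0.
  rewrite (_ : (fun y => _) = (fun y => `|co y * (r2 x y * I leb1 (gfun a))|)); first exact: L1_norm.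
  apply/funext => y; have [[_ h]|wy] := sec y; last first.
    rewrite /F /co/= wy !mul0r normr0 -[RHS](I_0 leb1).
    by congr I; apply/funext => t; rewrite !mul0r normr0.
  rewrite normrM [X in _ = _ * X]ger0_norm ?mulr_ge0 ?r2_ge0 ?(ltW G0)// -h.
  by congr I; apply/funext => t; rewrite /F normrM/= [X in _ * X = _]ger0_norm ?gfun_ge0.
have [_ e1] := fubini1 lF; have [_ e2] := fubini2 lF.
have z1 : I leb1 (fun t => I mu (fun y => F (t, y))) = 0.
  rewrite -[RHS](I_0 leb1); congr I; apply/funext => t; case: (ltP 0 t) => t0; last first.
    rewrite -[RHS](I_0 mu); congr I; apply/funext => y; rewrite /F /gfun/=.
    by rewrite ltNge (mulr_ge0_le0 _ t0) ?invr_ge0 ?r2_ge0//= mulr0.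
  have := vanish_exp t b0 nb H cx => h.
  rewrite -[RHS](mulr0 (t `^ (a - 1))) -h -I_Z; last first.
    apply: (L1_wM (C := Cp b)).
      apply: measurable_funM; first exact: measurable_r2pow.
      apply: (measurableT_comp (continuous_measurable_fun (@continuous_expR R))).
      by apply: measurable_funN; exact: measurable_funM.
    move=> y wy; rewrite normrM -[leRHS]mulr1; apply: ler_pM => //; first exact: r2pow_bound.
    by rewrite ger0_norm ?expR_ge0// expR_le1 oppr_le0 mulr_ge0 ?invr_ge0 ?r2_ge0 ?(ltW t0).
  congr I; apply/funext => y; rewrite /F /co/=; have [->|wy] := eqVneq (w y) 0.
    by rewrite !mul0r mulr0.
  have p0 := r2_pos cx wy; rewrite /gfun mulr_gt0 ?invr_gt0//.
  rewrite powRM ?invr_ge0 ?(ltW p0) ?(ltW t0)//.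
  have -> : (r2 x y)^-1 `^ (a - 1) = (r2 x y `^ (a - 1))^-1.
    by rewrite -powR_inv1 ?(ltW p0)// -!powRrM mulrC powRrM powR_inv1// powR_ge0.
  have q0 : r2 x y `^ (a - 1) != 0 by rewrite gt_eqF// powR_gt0.
  by rewrite (mulrC _^-1 t); field.
have : I leb1 (gfun a) * I mu (fun y => w y * (r2 x y `^ b * r2 x y `^ a)) = 0.
  rewrite -z1 -e1 e2 -I_Z; last first.
    apply: (L1_wM (C := Cp b * Cp a)); first by apply: measurable_funM; exact: measurable_r2pow.
    by move=> y wy; rewrite normrM; apply: ler_pM => //; exact: r2pow_bound.
  congr I; apply/funext => y; have [[_ h]|wy] := sec y.
    transitivity (co y * (r2 x y * I leb1 (gfun a))); last by rewrite -h.
    rewrite /co; have [->|wy] := eqVneq (w y) 0; first by rewrite !mul0r mulr0.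
    have p0 := r2_pos cx wy.
    have -> : r2 x y `^ a = r2 x y `^ (a - 1) * r2 x y.
      by rewrite -[X in _ = _ * X]powRr1 ?ltW// -powRD ?subrK// (gt_eqF p0) implybT.
    by ring.
  rewrite /F /co/= wy !mul0r mulr0 -[LHS](I_0 leb1).
  by congr I; apply/funext => t; rewrite !mul0r.
by move/eqP; rewrite mulf_eq0 (gt_eqF G0)/= => /eqP.
Qed.

Lemma vanish_gauss b x : b < 0 -> n%:R + 2 * (b - 1) < 0 -> vanish (fun x y => r2 x y `^ b) ->
  cube x0 r x -> I mu (fun y => w y * expR (- r2 x y)) = 0.
Proof.
move=> b0 nb H cx.
apply: (@power_series_under R _ _ mu w (fun y => - r2 x y) B (fun k => k`!%:R^-1) expR) => //.
- by apply: measurable_funN; exact: measurable_r2.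
- move=> y wy; rewrite normrN ger0_norm ?r2_ge0//; by have /andP[] := hr cx wy.
- by move=> k; rewrite ger0_norm// invr_ge0.
- exact: expR_series.
(* With [a = k%:R - b] the factor [r2 ^ b] is cancelled and [r2 ^+ k] remains; [b < 0] keeps [a]
   positive even for [k = 0]. *)
move=> k; have a0 : 0 < k%:R - b by have := ler0n R k; lra.
have h := vanish_gamma b0 nb H cx a0.
rewrite -[RHS](mulr0 ((- 1) ^+ k)) -h -I_Z; last first.
  apply: (L1_wM (C := Cp b * Cp (k%:R - b))).
    by apply: measurable_funM; exact: measurable_r2pow.
  by move=> y wy; rewrite normrM; apply: ler_pM => //; exact: r2pow_bound.
congr I; apply/funext => y; have [->|wy] := eqVneq (w y) 0; first by rewrite !mul0r mulr0.
have p0 := r2_pos cx wy.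
by rewrite -powRD ?(gt_eqF p0) ?implybT// addrC subrK powR_mulrn ?(ltW p0)// -[in LHS]mulN1r exprMn; ring.
Qed.

End ucp.

(** * From vanishing moments to a vanishing function *)

Section moments.
Context {R : realType} {n : nat}.
Local Notation V := 'rV[R]_n.
Local Notation mu := (@leb R n).

(** Each derivative in [t] brings down one factor [sg y]. The claim is kept for all small [t] so
    that the induction can differentiate at an arbitrary base point, on the interval that remains
    around it. *)
Lemma exp_moments (v sg : V -> R) (dl S : R) : 0 < dl -> L1 mu v -> measurable_fun [set: V] sg ->
  (forall y, v y != 0 -> `|sg y| <= S) ->
  (forall t, `|t| < dl -> I mu (fun y => v y * expR (t * sg y)) = 0) ->
  forall m t, `|t| < dl -> I mu (fun y => v y * sg y ^+ m * expR (t * sg y)) = 0.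
Proof.
move=> dl0 lv ms sS H; elim=> [|m IH] t ht.
  by rewrite -[RHS](H t ht); congr I; apply/funext => y; rewrite expr0 mulr1.
have mexp (u : R) : measurable_fun [set: V] (fun y => expR (u * sg y)).
  apply: (measurableT_comp (continuous_measurable_fun (@continuous_expR R))).
  exact: measurable_funM.
have mv := L1_measurable lv.
have lm : L1 mu (fun y => v y * sg y ^+ m).
  apply: (L1_le _ (L1Z (S ^+ m) (L1_norm lv))).
    by apply: measurable_funM => //; exact: measurable_funX.
  move=> y; have [->|vy] := eqVneq (v y) 0; first by rewrite mul0r normr0 mulr0.
  rewrite normrM mulrC ler_wpM2r// normrX lerXn2r ?nnegrE ?sS//.
  by rewrite (le_trans _ (sS y vy)).
have b1 (u : R) y : v y != 0 -> `|u| < dl -> expR (u * sg y) <= expR (dl * S).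
  move=> vy hu; rewrite ler_expR (le_trans (ler_norm _))// normrM; apply: ler_pM => //.
    exact: ltW.
  exact: sS.
have d0 : 0 < dl - `|t| by rewrite subr_gt0.
have tu u : `|u| < dl - `|t| -> `|t + u| < dl.
  by rewrite ltrBrDl; apply: le_lt_trans; exact: ler_normD.
have := @deriv0_under R _ _ mu (fun y => v y * sg y ^+ m) (fun u y => expR ((t + u) * sg y))
  (fun u y => sg y * expR ((t + u) * sg y)) (dl - `|t|) (S * expR (dl * S)) d0 lm.
rewrite addr0 => h; rewrite -[RHS]h.
- by congr I; apply/funext => y; rewrite exprSr; ring.
- by move=> u hu; exact: mexp.
- exact: measurable_funM.
- move=> y u _ hu.
  have d1 : is_derive u (1 : R) (fun u => (t + u) * sg y) (sg y).
    rewrite (_ : (fun u => _) = (fun u => t * sg y + 2 * u * (2^-1 * sg y) + u ^+ 2 * 0)).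
      by apply: (is_derive_eq (is_derive_quad _ _ _ _)); field.
    by apply/funext => q; field.
  have de : is_derive ((t + u) * sg y) (1 : R) (@expR R) (expR ((t + u) * sg y)) by exact: is_derive_expR.
  have dc := is_derive1_comp (f := @expR R) (g := fun u => (t + u) * sg y) de d1.
  by apply: (is_derive_eq dc); rewrite mulrC.
- move=> y u; rewrite mulf_eq0 negb_or => /andP[vy _] hu; rewrite normrM; apply: ler_pM => //.
    exact: sS.
  by rewrite ger0_norm ?expR_ge0// b1// tu.
- move=> u hu; apply: (L1_le _ (L1Z (expR (dl * S)) (L1_norm lm))).
    by apply: measurable_funM => //; exact: L1_measurable lm.
  move=> y; have [->|vy] := eqVneq (v y) 0; first by rewrite !mul0r normr0 mulr0.
  by rewrite normrM mulrC ler_wpM2r// ger0_norm ?expR_ge0// b1// tu.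
by move=> u hu; apply: IH; exact: tu.
Qed.

Lemma moments_hart (v : V -> R) (x0 : V) : L1 mu v -> L2 mu v ->
  (forall e : V, exists S, forall y, v y != 0 -> `|edot e (y - x0)| <= S) ->
  (forall (e : V) m, I mu (fun y => v y * edot e (y - x0) ^+ m) = 0) ->
  {ae mu, forall y, v y = 0}.
Proof.
move=> lv l2 bS H.
have ms (e : V) : measurable_fun [set: V] (fun y => edot e (y - x0)).
  by apply: measurable_edot => //; exact: measurable_rVB.
have mv := L1_measurable lv.
have key (e : V) : I mu (fun y => v y * cos (edot e (y - x0))) = 0 /\
    I mu (fun y => v y * sin (edot e (y - x0))) = 0.
  have [S hS] := bS e; split.
    apply: (@power_series_under R _ _ mu v (fun y => edot e (y - x0)) S
      (fun k => (~~ odd k)%:R * (-1) ^+ k./2 / k`!%:R) (@cos R)) => //.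
    - move=> k; rewrite !normrM normrX normrN normr1 expr1n mulr1 ger0_norm// ger0_norm ?invr_ge0//.
      by rewrite ler_piMl ?invr_ge0//; case: odd.
    - exact: continuous_measurable_fun (@continuous_cos R).
    - exact: cos_series.
  apply: (@power_series_under R _ _ mu v (fun y => edot e (y - x0)) S
      (fun k => (odd k)%:R * (-1) ^+ k.-1./2 / k`!%:R) (@sin R)) => //.
  - move=> k; rewrite !normrM normrX normrN normr1 expr1n mulr1 ger0_norm// ger0_norm ?invr_ge0//.
    by rewrite ler_piMl ?invr_ge0//; case: odd.
  - exact: continuous_measurable_fun (@continuous_sin R).
  - exact: sin_series.
have lb (g : V -> R) : measurable_fun [set: V] g -> (forall y, `|g y| <= 1) -> L1 mu (fun y => v y * g y).
  move=> mg g1; apply: (L1_le _ (L1_norm lv)); first exact: measurable_funM.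
  by move=> y; rewrite normrM ler_piMr.
have lc e : L1 mu (fun y => v y * cos (edot e (y - x0))).
  apply: lb => [|y]; last exact: cos_max.
  by apply: (measurableT_comp (continuous_measurable_fun (@continuous_cos R))).
have ls e : L1 mu (fun y => v y * sin (edot e (y - x0))).
  apply: lb => [|y]; last exact: sin_max.
  by apply: (measurableT_comp (continuous_measurable_fun (@continuous_sin R))).
have h0 : hart v = fun=> 0.
  apply/funext => xi; rewrite /hart.
  have [k1 k2] := key xi; pose c := edot xi x0.
  (* The moments are centred at [x0]; the addition formulas move the centre back to the origin. *)
  have -> : (fun y => cas (edot y xi) * v y) =
      (fun y => (cos c + sin c) * (v y * cos (edot xi (y - x0))) +
                (cos c - sin c) * (v y * sin (edot xi (y - x0)))).
    apply/funext => y; have -> : edot y xi = edot xi (y - x0) + c by rewrite edotBr subrK edotC.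
    by rewrite /cas cosD sinD; ring.
  by rewrite I_D ?I_Z// ?k1 ?k2 ?mulr0 ?addr0//; exact: L1Z.
have := HT_sqI l2 (HT_hart lv l2); rewrite h0 {1}/sqI.
have -> : I mu (fun=> (0 : R) ^+ 2) = 0.
  by rewrite -[RHS](I_0 mu); congr I; apply/funext => y; rewrite expr0n.
move/esym/eqP; rewrite mulf_eq0 (gt_eqF (cG_gt0 _))/= => /eqP h.
have := ge0_I0_ae l2.2 (fun y => sqr_ge0 (v y)) h; apply: filterS => y /eqP.
by rewrite sqrf_eq0 => /eqP.
Qed.

Lemma ucp_pow (w : V -> R) (x0 : V) (r d0 B b : R) : L1 mu w -> L2 mu w -> 0 < r -> 0 < d0 ->
  (forall x y, cube x0 r x -> w y != 0 -> d0 <= r2 x y <= B) ->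
  b < 0 -> n%:R + 2 * (b - 1) < 0 ->
  (forall x, cube x0 r x -> I mu (fun y => w y * r2 x y `^ b) = 0) ->
  {ae mu, forall y, w y = 0}.
Proof.
move=> lw l2 r0 d00 hr b0 nb H.
have H' := vanish_gauss lw r0 d00 hr b0 nb H.
have cx0 : cube x0 r x0 by apply/(cube_norm _ _ r0); rewrite subrr normr0.
pose v y := w y * expR (- r2 x0 y).
have mr := @measurable_r2 R n x0.
have me : measurable_fun [set: V] (fun y => expR (- r2 x0 y)).
  apply: (measurableT_comp (continuous_measurable_fun (@continuous_expR R))).
  exact: measurable_funN.
have mw := L1_measurable lw.
have mv : measurable_fun [set: V] v by exact: measurable_funM.
have e1 y : 0 <= expR (- r2 x0 y) <= 1 by rewrite expR_ge0 expR_le1 oppr_le0 r2_ge0.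
have vw y : `|v y| <= `|w y|.
  by have /andP[a1 a2] := e1 y; rewrite normrM (ger0_norm a1) ler_piMr.
have lv : L1 mu v by exact: (L1_le mv (L1_norm lw)).
have l2v : L2 mu v.
  split=> //; apply: (L1_le _ l2.2); first exact: measurable_funX.
  by move=> y; rewrite normrX -[leRHS]real_normK ?num_real// lerXn2r ?nnegrE.
suff : {ae mu, forall y, v y = 0}.
  by apply: filterS => y /eqP; rewrite mulf_eq0 (gt_eqF (expR_gt0 _)) orbF => /eqP.
have bS (e : V) y : v y != 0 -> `|edot e (y - x0)| <= 1 + edot e e * B.
  rewrite mulf_eq0 negb_or => /andP[wy _].
  by have := edot_bound hr e cx0 wy; rewrite -opprB edotNr normrN.
apply: (moments_hart (x0 := x0)) => //; first by move=> e; exists (1 + edot e e * B) => y; exact: bS.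
move=> e m; have [dl dl0 hdl] := cube_line r0 e cx0.
have d20 : 0 < 2 * dl by rewrite mulr_gt0.
have ms : measurable_fun [set: V] (fun y => edot e (y - x0)).
  by apply: measurable_edot => //; exact: measurable_rVB.
have := exp_moments (v := v) (sg := fun y => edot e (y - x0)) d20 lv ms (bS e).
have hz : `|(0 : R)| < 2 * dl by rewrite normr0.
move=> /(_ _ m 0 hz) h; rewrite -[RHS]h.
  by congr I; apply/funext => y; rewrite mul0r expR0 mulr1.
(* Moving [x0] by [(t / 2) *: e] changes [- r2] by the linear term [t * edot e (y - x0)] and a
   constant, since the cross term of the square is doubled. *)
move=> t ht; have ht2 : `|t / 2| < dl by rewrite normrM (@ger0_norm _ 2^-1)// ltr_pdivrMr// mulrC.
have := H' _ (hdl _ ht2); rewrite (_ : (fun y => _) = (fun y => expR (- ((t / 2) ^+ 2 * edot e e)) *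
    (v y * expR (t * edot e (y - x0))))).
  rewrite I_Z; first by move/eqP; rewrite mulf_eq0 (gt_eqF (expR_gt0 _))/= => /eqP.
  apply: (L1_le _ (L1Z (expR (2 * dl * (1 + edot e e * B))) (L1_norm lv))).
    apply: measurable_funM => //.
    by apply: (measurableT_comp (continuous_measurable_fun (@continuous_expR R))); exact: measurable_funM.
  move=> y; have [->|vy] := eqVneq (v y) 0; first by rewrite !mul0r normr0 mulr0.
  rewrite normrM mulrC ler_wpM2r// ger0_norm ?expR_ge0// ler_expR (le_trans (ler_norm _))// normrM.
  by apply: ler_pM => //; [exact: ltW|exact: bS].
apply/funext => y; rewrite /v r2_line -[in RHS](opprB x0 y) edotNr.
rewrite (_ : - (r2 x0 y + _ + _) =
  - ((t / 2) ^+ 2 * edot e e) + (- r2 x0 y + t * - edot e (x0 - y))); last by field.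
by rewrite !expRD; ring.
Qed.

End moments.

(** * Unique continuation for kernels that are powers near an exterior cube *)

Section ucp_kernel.
Context {R : realType} {n : nat} (s : R).
Local Notation V := 'rV[R]_n.
Local Notation mu := (@leb R n).
Local Notation mm := (leb n \x leb n)%E.
Local Notation p_ := (@pexp R n s).

Lemma kap_pow (x y : V) : 0 < r2 x y -> kap s (x - y) = r2 x y `^ (1 - p_).
Proof.
rewrite /r2 /kap => h; have e0 : 0 <= edot (x - y) (x - y) by rewrite ltW.
have -> : (enorm (x - y) `^ p_) ^+ 2 = edot (x - y) (x - y) `^ p_.
  rewrite /enorm -powR12_sqrt// -powR_mulrn ?powR_ge0// -!powRrM; congr (_ `^ _); by field.
by rewrite powRB ?(gt_eqF h) ?implybT// powRr1.
Qed.

Lemma r2_upper (c x y : V) r M : 0 < r -> cube c r x -> cube 0 M y ->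
  r2 x y <= n%:R * (`|c| + r + M) ^+ 2.
Proof.
move=> r0 cx My; have hx := (cube_norm c x r0).1 cx.
have M0 : `|y| <= M \/ n = 0%N.
  case: (posnP n) => [|n0]; [by right|left].
  apply: ltW; rewrite -[y]subr0; apply/cube_norm => //.
  by have := My (Ordinal n0); apply: le_lt_trans.
apply: (le_trans (edot_le_norm _)); case: M0 => [M0|nz]; last by rewrite (_ : n%:R = 0 :> R) ?mul0r// nz.
have hx' : `|x| <= `|c| + r by have := ler_normD (x - c) c; rewrite subrK; lra.
rewrite ler_wpM2l// lerXn2r ?nnegrE//; first by have := normr_ge0 y; have := normr_ge0 c; lra.
by rewrite (le_trans (ler_normB _ _))// lerD.
Qed.

Lemma r2_sep (c x y : V) r M : 0 < r -> cube c r x -> cube 0 M y -> ~ cube c (2 * r) y ->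
  r ^+ 2 <= r2 x y <= n%:R * (`|c| + r + M) ^+ 2.
Proof.
move=> r0 cx My ncy; have r20 : 0 < 2 * r by rewrite mulr_gt0.
have hx := (cube_norm c x r0).1 cx.
have hy : 2 * r <= `|y - c| by rewrite leNgt; apply/negP => /(cube_norm _ _ r20).
have d1 : r <= `|x - y|.
  have := ler_normD (x - c) (y - x); have -> : x - c + (y - x) = y - c by rewrite addrC subrKA.
  by rewrite (distrC y x); lra.
apply/andP; split; last exact: r2_upper.
by apply: le_trans (norm_sqr_le_edot _); rewrite lerXn2r ?nnegrE// ltW.
Qed.

Lemma cvg_r2 (x_ : nat -> V) x y : x_ m @[m --> \oo] --> x -> r2 (x_ m) y @[m --> \oo] --> r2 x y.
Proof.
move=> cx; rewrite /r2 /edot; elim: (index_enum _) => [|i l IH].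
  by under eq_fun do rewrite big_nil; rewrite big_nil; exact: cvg_cst.
under eq_fun do rewrite big_cons; rewrite big_cons; apply: cvgD => //.
have ci : (x_ m - y) ord0 i @[m --> \oo] --> (x - y) ord0 i.
  rewrite !mxE; under eq_fun do rewrite !mxE; apply: cvgB; last exact: cvg_cst.
  exact: (cts_seq (@coord_continuous R 1 n ord0 i) cx).
exact: cvgM.
Qed.

Lemma cvg_powR (t_ : nat -> R) (t c : R) : 0 < t -> t_ m @[m --> \oo] --> t -> t_ m `^ c @[m --> \oo] --> t `^ c.
Proof.
move=> t0 ct; have [dt _] := is_derive1_powR c t0.
have ctn : {for t, continuous (fun u : R => u `^ c)}.
  by apply: differentiable_continuous; apply/derivable1_diffP.
exact: (@cvg_comp _ _ _ t_ (fun u : R => u `^ c) \oo (nbhs t) _ ct ctn).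
Qed.

(** The hypothesis holds only for almost every [x]. As [x] stays away from the support of [w], the
    integral is continuous in [x], so approximation by good points gives it everywhere in the
    cube. *)
Lemma ucp_kap (w : V -> R) (c : V) (r M : R) : 0 < s -> 0 < r -> L1 mu w -> L2 mu w ->
  (forall y, w y != 0 -> cube 0 M y /\ ~ cube c (2 * r) y) ->
  {ae mu, forall x, cube c r x -> I mu (fun y => w y * kap s (x - y)) = 0} ->
  {ae mu, forall y, w y = 0}.
Proof.
move=> s0 r0 lw l2 hw H; pose b : R := 1 - p_; have nn := ler0n R n.
have b0 : b < 0 by rewrite /b /pexp; lra.
have nb : n%:R + 2 * (b - 1) < 0 by rewrite /b /pexp; lra.
pose d0 := r ^+ 2; pose B := n%:R * (`|c| + r + M) ^+ 2.
have d00 : 0 < d0 by rewrite exprn_gt0.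
have hr x y : cube c r x -> w y != 0 -> d0 <= r2 x y <= B.
  by move=> cx wy; have [h1 h2] := hw y wy; exact: r2_sep.
have E x : cube c r x -> (fun y => w y * kap s (x - y)) = (fun y => w y * r2 x y `^ b).
  move=> cx; apply/funext => y; have [->|wy] := eqVneq (w y) 0; first by rewrite !mul0r.
  by rewrite kap_pow// (lt_le_trans d00)//; have /andP[] := hr x y cx wy.
apply: (ucp_pow lw l2 r0 d00 hr b0 nb) => x cx.
have oc : open (cube c r) by rewrite cube_ball//; exact: ball_open.
have /choice[x_ hx] (m : nat) : exists y, [/\ cube c r y, `|y - x| < m.+1%:R^-1 &
    I mu (fun z => w z * r2 y z `^ b) = 0].
  have m0 : 0 < m.+1%:R^-1 :> R by rewrite invr_gt0.
  have o2 : open (cube c r `&` cube x m.+1%:R^-1).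
    by apply: openI => //; rewrite cube_ball//; exact: ball_open.
  have ne : (cube c r `&` cube x m.+1%:R^-1) !=set0.
    by exists x; split => // i; rewrite subrr normr0.
  have [y [cy1 cy2] hy] := ae_open_ex o2 ne H; exists y; split => //; first exact/cube_norm.
  by rewrite -E// hy.
have cx_ : x_ m @[m --> \oo] --> x.
  apply/cvgrPdist_lt => e e0; have /cvgrPdist_lt/(_ e e0) := @cvg_harmonic R.
  apply: filterS => m; rewrite sub0r normrN /= ger0_norm ?invr_ge0// => h.
  by rewrite distrC; apply: lt_trans h; have [] := hx m.
have mw := L1_measurable lw.
have [] := @dct _ _ _ mu (fun m y => w y * r2 (x_ m) y `^ b) (fun y => w y * r2 x y `^ b)
  (fun y => (d0 `^ b + B `^ b) * `|w y|) _ _ _ (L1Z _ (L1_norm lw)) _.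
- by move=> m; apply: measurable_funM => //; exact: measurable_r2pow.
- by apply: measurable_funM => //; exact: measurable_r2pow.
- apply: aeW => y; have [->|wy] := eqVneq (w y) 0.
    by rewrite mul0r; under eq_fun do rewrite mul0r; exact: cvg_cst.
  apply: cvgM; first exact: cvg_cst.
  apply: cvg_powR; last exact: cvg_r2.
  by have /andP[h _] := hr x y cx wy; exact: lt_le_trans h.
- move=> m; apply: aeW => y; have [->|wy] := eqVneq (w y) 0; first by rewrite mul0r normr0 mulr0.
  have [cm _ _] := hx m; have /andP[h1 h2] := powR_between d00 b (hr _ _ cm wy).
  by rewrite normrM mulrC ler_wpM2r// ger0_norm.
move=> _ cv; apply: (cvg_unique _ cv) => //.
rewrite (_ : (fun m => _) = (fun=> 0)); first exact: cvg_cst.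
by apply/funext => m; have [] := hx m.
Qed.

(* on [cube c (2 * r)] the kernel is, up to the weight [B y], the power kernel *)
Lemma ucp_test (K : V * V -> R) (B h : V -> R) (k nu M : R) (c : V) (r : R) :
  0 < s -> 0 < r -> k != 0 -> 0 < nu -> measurable_fun [set: V] B -> (forall y, nu <= B y) ->
  {ae mu, forall y, B y <= M} -> {ae mm, forall z, cube c (2 * r) z.1 -> K z = k * B z.2 * kap s (z.1 - z.2)} ->
  measurable_fun [set: V * V] K ->
  L2 mu h -> (exists M', forall y, h y != 0 -> cube 0 M' y) -> (forall y, h y != 0 -> ~ cube c (2 * r) y) ->
  (forall g, Ccr (cube c r) g -> I mm (fun z => K z * (g z.1 * h z.2)) = 0) ->
  {ae mu, forall y, h y = 0}.
Proof.
move=> s0 r0 k0 nu0 mB Bnu BM KB mK lh [M' hM'] hc H.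
have mh := lh.1.
have l1h : L1 mu h.
  pose M1 := `|M'| + 1; have M10 : 0 < M1 by rewrite ltr_wpDl.
  have := L2_L1cube lh M10; rewrite (_ : (fun x => _) = h)//; apply/funext => x.
  have [->|hx] := eqVneq (h x) 0; first by rewrite mulr0.
  rewrite indicE mem_set ?mul1r// => i; apply: lt_le_trans (hM' x hx i) _.
  by rewrite /M1 (le_trans (ler_norm _))// lerDl.
pose w y := B y * h y.
have mw : measurable_fun [set: V] w by exact: measurable_funM.
have B0 y : 0 < B y by exact: lt_le_trans (Bnu y).
have aw : {ae mu, forall y, `|w y| <= M * `|h y|}.
  by apply: filterS BM => y hy; rewrite normrM (ger0_norm (ltW (B0 y))) ler_wpM2r.
have lw : L1 mu w by exact: (L1_le_ae mw (L1Z M (L1_norm l1h)) aw).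
have l2w : L2 mu w.
  split => //; apply: (L1_le_ae _ (L1Z (M ^+ 2) lh.2)); first exact: measurable_funX.
  apply: filterS BM => y hy; rewrite normrX normrM (ger0_norm (ltW (B0 y))) exprMn real_normK ?num_real//.
  by rewrite ler_wpM2r ?sqr_ge0// lerXn2r ?nnegrE ?(ltW (B0 y))// (le_trans (ltW (B0 y))).
have wh y : w y != 0 -> h y != 0 by rewrite mulf_eq0 negb_or => /andP[].
suff : {ae mu, forall y, w y = 0}.
  by apply: filterS => y /eqP; rewrite mulf_eq0 (gt_eqF (B0 y))/= => /eqP.
apply: (ucp_kap (c := c) (r := r) (M := M')) => //.
  by move=> y /wh hy; split; [exact: hM'|exact: hc].
(* The indicator confines [x] to the small cube, at distance at least [r] from the support of [h];
   hence [q] avoids the singularity and is integrable. *)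
pose q (z : V * V) := \1_(cube c r) z.1 * (w z.2 * kap s (z.1 - z.2)).
have mi : measurable_fun [set: V] (\1_(cube c r) : V -> R) by apply: measurable_indic; exact: measurable_cube.
have mq : measurable_fun [set: V * V] q.
  apply: measurable_funM; first exact: (measurableT_comp mi measurable_fst).
  by apply: measurable_funM; [exact: (measurableT_comp mw measurable_snd)|exact: measurable_kap2].
pose b : R := 1 - p_; pose d0 := r ^+ 2; pose B1 := n%:R * (`|c| + r + M') ^+ 2.
have d00 : 0 < d0 by rewrite exprn_gt0.
have qb z : `|q z| <= (d0 `^ b + B1 `^ b) * (\1_(cube c r) z.1 * `|w z.2|).
  have c0 : 0 <= d0 `^ b + B1 `^ b by rewrite addr_ge0 ?powR_ge0.
  rewrite /q indicE; have [cz|_] := boolP (_ \in _); last by rewrite !mul0r normr0 mulr0.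
  rewrite !mul1r; have [->|wy] := eqVneq (w z.2) 0; first by rewrite mul0r normr0 mulr0.
  have hb := r2_sep r0 (set_mem cz) (hM' _ (wh _ wy)) (hc _ (wh _ wy)).
  have p0 : 0 < r2 z.1 z.2 by apply: (lt_le_trans d00); have /andP[] := hb.
  rewrite normrM mulrC ler_wpM2r// kap_pow// ger0_norm ?powR_ge0//.
  by have /andP[] := powR_between d00 b hb.
have li : L1 mu (\1_(cube c r) : V -> R) by apply: L1_indic_cube; exact: ltW.
have lq : L1 mm q.
  by apply: (L1_le mq (L1Z _ (L1_tensor li (L1_norm lw)).1)).
pose F x := I mu (fun y => q (x, y)).
have lF : L1 mu F := (fubini1 lq).1.
have oc : open (cube c r) by rewrite cube_ball//; exact: ball_open.
have : {ae mu, forall x, cube c r x -> F x = 0}.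
  apply: (ae0_test_open oc (L1_measurable lF)) => g cg.
  have mg := Ccr_measurable cg; have [G G0 hG] := Ccr_bounded cg.
  have lqg : L1 mm (fun z => q z * g z.1).
    apply: (L1_le _ (L1Z G (L1_norm lq))).
      by apply: measurable_funM => //; exact: (measurableT_comp mg measurable_fst).
    by move=> z; rewrite normrM mulrC ler_wpM2r.
  have E x : F x * g x = I mu (fun y => q (x, y) * g x).
    have [gx|gx] := eqVneq (g x) 0.
      rewrite gx mulr0 -[LHS](I_0 mu); congr I; apply/funext => y; rewrite mulr0//.
    rewrite mulrC /F -I_Z; first by congr I; apply/funext => y; rewrite mulrC.
    apply: (L1_le (g := fun y => (d0 `^ b + B1 `^ b) * (\1_(cube c r) x * `|w y|))).
    - have mqx := measurableT_comp mq (measurable_pair1 x); exact: mqx.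
    - by apply: L1Z; apply: L1Z; exact: L1_norm.
    - by move=> y; exact: (qb (x, y)).
  have [f1 f2] := fubini1 lqg; rewrite (_ : (fun x => F x * g x) = (fun x => I mu (fun y => q (x, y) * g x))).
    split=> //; rewrite -f2.
    have := H g cg; rewrite (_ : I mm _ = k * I mm (fun z => q z * g z.1)).
      by move/eqP; rewrite mulf_eq0 (negbTE k0)/= => /eqP.
    rewrite -I_Z//; apply: I_ae_eq.
    - apply: measurable_funM => //; apply: measurable_funM.
        exact: (measurableT_comp mg measurable_fst).
      exact: (measurableT_comp mh measurable_snd).
    - by apply: measurable_funM => //; exact: L1_measurable lqg.
    apply: filterS KB => z hz; have [gz|gz] := eqVneq (g z.1) 0; first by rewrite gz mul0r !mulr0.
    have cz : cube c r z.1.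
      apply: contrapT => ncz; move/eqP: gz; apply; have [_ [L [_ LU]]] := cg.
      by apply => /LU.
    have cz2 : cube c (2 * r) z.1 by move=> i; apply: lt_trans (cz i) _; lra.
    by rewrite hz// /q /w indicE mem_set// mul1r; ring.
  by apply/funext => x; exact: E.
apply: filterS => x hx cx; have := hx cx; rewrite /F /q => <-.
by congr I; apply/funext => y; rewrite /= indicE mem_set// mul1r.
Qed.

End ucp_kernel.

(** * The Dirichlet problem *)

Section existence.
Context {R : realType} {n : nat} {s : R}.
Hypotheses (s01 : 0 < s < 1) (n0 : (0 < n)%N).
Local Notation V := 'rV[R]_n.
Local Notation mu := (@leb R n).
Local Notation mm := (leb n \x leb n)%E.
Local Notation p_ := (@pexp R n s).

(** [psi] vanishes on the exterior cube, so the pairs with first point in that cube already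
    contribute [psi y ^+ 2] times a kernel bounded below. *)
Lemma poincare (Om : set V) (c : V) (r : R) : bounded_set Om -> 0 < r ->
  (forall x, cube c r x -> ~ Om x) ->
  exists2 C, 0 <= C & forall psi, Ccr Om psi -> sqI mu psi <= C * sqI mm (dq s psi).
Proof.
move=> bO r0 cO; have [M M0 hM] := bounded_sub_cube bO; have nn := ler0n R n.
have [s0 _] := andP s01.
(* [B] bounds the squared distances between the cube and [Om]; the exponent [1 - p_] is negative, so
   [k0] bounds [kap] from below there. *)
pose B := n%:R * (`|c| + r + M) ^+ 2; pose k0 := B `^ (1 - p_).
have B0 : 0 < B by rewrite mulr_gt0 ?ltr0n// exprn_gt0// ltr_wpDl// addr_ge0// ltW.
have k00 : 0 < k0 by rewrite powR_gt0.
have li : L1 mu (\1_(cube c r) : V -> R) by apply: L1_indic_cube; exact: ltW.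
have m0 : 0 < I mu (\1_(cube c r) : V -> R).
  rewrite lt_neqAle I_ge0 ?andbT; last by move=> x; rewrite indicE.
  apply/eqP => /esym h; have := ge0_I0_ae li (fun x => _) h => /(_ _)/=.
  have i0 (x : V) : 0 <= (\1_(cube c r) x : R) by rewrite indicE.
  move=> /(_ i0) => H.
  have oc : open (cube c r) by rewrite cube_ball//; exact: ball_open.
  have ne : cube c r !=set0 by exists c => i; rewrite subrr normr0.
  have [x cx] := ae_open_ex oc ne H; rewrite indicE mem_set// => /eqP.
  by rewrite oner_eq0.
exists ((I mu (\1_(cube c r) : V -> R) * k0)^-1) => [|psi cp]; first by rewrite invr_ge0 mulr_ge0// ltW.
have cT := Ccr_sub (@subsetT _ Om) cp.
rewrite -ler_pdivrMl ?invr_gt0 ?mulr_gt0// invrK.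
have [lt et] := L1_tensor (m1 := mu) (m2 := mu) li (Ccr_L2 cp).2.
have ld := (dq_Ccr s01 cT).2.
rewrite mulrAC mulrC -et -I_Z//; apply: I_le; [exact: L1Z|exact: ld|] => z.
rewrite indicE; have [cz|_] := boolP (_ \in _); last by rewrite mul0r mulr0 sqr_ge0.
have {}cz := set_mem cz.
have supp y : psi y != 0 -> Om y.
  by move=> py; apply: contrapT => nO; move/eqP: py; apply; have [_ [L [_ LU]]] := cp; apply => /LU.
have px : psi z.1 = 0.
  by apply/eqP; apply: contrapT => /negP /supp; exact: cO.
rewrite mul1r dq_sqr px subr0 mulrC; have [->|py] := eqVneq (psi z.2) 0; first by rewrite expr0n !mul0r.
rewrite ler_wpM2l ?sqr_ge0//.
have p0 : 0 < r2 z.1 z.2.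
  rewrite lt_neqAle r2_ge0 andbT; apply/eqP => /esym/edot_eq0/eqP; rewrite subr_eq0 => /eqP e.
  by apply: (cO _ cz); rewrite e; exact: supp.
have up : r2 z.1 z.2 <= B by apply: r2_upper => //; apply: hM; exact: supp.
rewrite kap_pow// /k0 -(opprB p_ 1) !(powRN _ (p_ - 1)) lef_pV2 ?posrE ?powR_gt0//.
by rewrite ge0_ler_powR ?nnegrE ?(ltW p0) ?(ltW B0)// /pexp; lra.
Qed.

Variables (K : V * V -> R) (nu M : R).
Hypothesis kK : kernel s K nu M.

Definition fin_energy (a : V -> R) := measurable_fun [set: V] a /\ L2 mm (dq s a).

Lemma fin_energy_HU U a : HU s U a -> fin_energy a.
Proof. by move=> [[]]. Qed.

Lemma fin_energyD a b (t : R) : fin_energy a -> fin_energy b -> fin_energy (fun x => a x + t * b x).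
Proof.
move=> [ma la] [mb lb]; split.
  by apply: measurable_funD => //; apply: measurable_funM => //; exact: measurable_cst.
have -> : dq s (fun x => a x + t * b x) = (fun z => dq s a z + t * dq s b z).
  by apply/funext => z; rewrite dqD dqZ.
by apply: L2D => //; exact: L2Z.
Qed.

Lemma BR_lin a b c (t : R) : fin_energy a -> fin_energy b -> fin_energy c ->
  BR K (fun x => a x + t * b x) c = BR K a c + t * BR K b c.
Proof.
move=> [ma la] [mb lb] [mc lc].
have [mtb ltb] : fin_energy (fun x => 0 + t * b x).
  apply: (@fin_energyD (fun=> 0) b t) => //; exact: (fin_energy_HU (HU0 s01 setT)).
rewrite -(BR_Zl kK)// -(BR_Dl kK)//.
  by apply: (measurable_funM _ mb); exact: measurable_cst.
by move: ltb; under eq_fun do rewrite add0r.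
Qed.

Lemma BR_quad a b (t : R) : fin_energy a -> fin_energy b ->
  BR K (fun x => a x + t * b x) (fun x => a x + t * b x) =
  BR K a a + 2 * t * BR K a b + t ^+ 2 * BR K b b.
Proof.
move=> ea eb; have eab := fin_energyD t ea eb.
rewrite BR_lin// (BR_C K a) (BR_C K b (fun x => _)) !BR_lin// (BR_C K b a); ring.
Qed.

Lemma L2cvg_dq_add f (phi_ : nat -> V -> R) g :
  L2cvg mm (fun k => dq s (phi_ k)) (dq s g) ->
  L2cvg mm (fun k => dq s (fun x => f x + phi_ k x)) (dq s (fun x => f x + g x)).
Proof.
rewrite /L2cvg => h; rewrite (_ : (fun k => _) = (fun k => sqI mm (fun z => dq s (phi_ k) z - dq s g z)))//.
by apply/funext => k; congr (sqI mm _); apply/funext => z; rewrite !dqD; ring.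
Qed.

Lemma vertex0 (b q : R) : 0 <= q -> (forall t, 0 <= 2 * t * b + t ^+ 2 * q) -> b = 0.
Proof.
(* The vertex would be [- b / q]; with [q + 1] the choice also covers [q = 0] and still gives a
   negative value unless [b = 0]. *)
move=> q0 /(_ (- b / (q + 1))); have q1 : 0 < q + 1 by rewrite ltr_wpDl.
have -> : 2 * (- b / (q + 1)) * b + (- b / (q + 1)) ^+ 2 * q = - (b ^+ 2 * (q + 2) / (q + 1) ^+ 2).
  by field; rewrite gt_eqF.
rewrite oppr_ge0 pmulr_lle0 ?invr_gt0 ?exprn_gt0// => h.
have q2 : 0 < q + 2 by rewrite ltr_wpDl.
have : b ^+ 2 <= 0 by rewrite -(pmulr_lle0 _ q2).
by rewrite le_eqVlt ltNge sqr_ge0 orbF sqrf_eq0 => /eqP.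
Qed.

(* the Dirichlet principle *)
Lemma exist_min (Om : set V) (C : R) (f : V -> R) :
  0 <= C -> (forall psi, Ccr Om psi -> sqI mu psi <= C * sqI mm (dq s psi)) ->
  HU s setT f -> exists g, HU s Om g /\ forall v, HU s Om v -> BR K (fun x => f x + g x) v = 0.
Proof.
move=> C0 hC Hf; have ef := fin_energy_HU Hf.
have nu0 := kern_nu kK.
pose J phi := BR K (fun x => f x + phi x) (fun x => f x + phi x).
have ec phi : Ccr Om phi -> fin_energy phi by move=> c; exact: fin_energy_HU (HU_Ccr s01 c).
have efc phi : Ccr Om phi -> fin_energy (fun x => f x + phi x).
  by move=> c; have := fin_energyD 1 ef (ec _ c); under eq_fun do rewrite mul1r.
have Q0 a : fin_energy a -> nu * sqI mm (dq s a) <= BR K a a.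
  by move=> [ma la]; exact: (BR_lower kK).
have Q1 a : fin_energy a -> 0 <= BR K a a.
  by move=> ea; apply: le_trans (Q0 a ea); rewrite mulr_ge0 ?sqI_ge0// ltW.
pose S := [set y | exists2 phi, Ccr Om phi & y = J phi].
have S0 : nonempty S by exists (J (fun=> 0)); exists (fun=> 0) => //; exact: Ccr0.
have lS : has_lbound S by exists 0 => _ [phi c ->]; apply: Q1; exact: efc.
pose m := inf S.
have Jm phi : Ccr Om phi -> m <= J phi by move=> c; apply: ge_inf => //; exists phi.
have /choice[phi_ hphi] (k : nat) : exists phi, Ccr Om phi /\ J phi < m + k.+1%:R^-1.
  have k0 : 0 < k.+1%:R^-1 :> R by rewrite invr_gt0.
  by have [_ [phi c ->] h] := inf_adherent k0 (conj S0 lS); exists phi.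
have cphi k : Ccr Om (phi_ k) := (hphi k).1.
have cT k : Ccr setT (phi_ k) := Ccr_sub (@subsetT _ Om) (cphi k).
have cau k l : nu * sqI mm (dq s (fun x => phi_ k x - phi_ l x)) <= 2 * (k.+1%:R^-1 + l.+1%:R^-1).
  pose D x := phi_ k x - phi_ l x; have cD : Ccr Om D by exact: CcrB.
  have eD := ec _ cD; have el := efc _ (cphi l).
  apply: (le_trans (Q0 _ eD)).
  have e1 : J (phi_ k) = J (phi_ l) + 2 * 1 * BR K (fun x => f x + phi_ l x) D + 1 ^+ 2 * BR K D D.
    rewrite -BR_quad// /J; congr BR; apply/funext => x; rewrite /D; ring.
  (* The midpoint of [phi_ k] and [phi_ l]: its energy is at least the infimum, which by the
     parallelogram law bounds the energy of the difference. *)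
  have cm : Ccr Om (fun x => phi_ l x + 2^-1 * D x) by apply: CcrD => //; exact: CcrZ.
  have e2 : J (fun x => phi_ l x + 2^-1 * D x) =
      J (phi_ l) + 2 * 2^-1 * BR K (fun x => f x + phi_ l x) D + 2^-1 ^+ 2 * BR K D D.
    by rewrite -BR_quad// /J; congr BR; apply/funext => x; rewrite addrA.
  have := Jm _ cm; rewrite e2; have := (hphi k).2; rewrite e1; have := (hphi l).2.
  move: (J (phi_ l)) (BR K _ D) (BR K D D) (k.+1%:R^-1) (l.+1%:R^-1) => a b q u v.
  by rewrite (_ : 2^-1 ^+ 2 = 4^-1 :> R); [lra|field].
have hN e : 0 < e -> exists N, forall k l, (N <= k)%N -> (N <= l)%N ->
    sqI mm (dq s (fun x => phi_ k x - phi_ l x)) <= e.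
  move=> e0; have e4 : 0 < nu * e / 4 by rewrite divr_gt0 ?mulr_gt0.
  have /cvgrPdist_lt/(_ _ e4)[N _ HN] := @cvg_harmonic R; exists N => k l Nk Nl.
  have /= := HN k Nk; have /= := HN l Nl; rewrite !sub0r !normrN !ger0_norm ?invr_ge0// => hl hk.
  rewrite -(ler_pM2l nu0); apply: (le_trans (cau k l)).
  by move: hk hl; move: (k.+1%:R^-1) (l.+1%:R^-1) (nu * e) => a b q; lra.
have [g [lg cg]] : exists g, L2 mu g /\ L2cvg mu phi_ g.
  apply: L2_complete => [k|e e0]; first exact: Ccr_L2 (cphi k).
  have C1 : 0 < C + 1 by rewrite ltr_wpDl.
  have [N HN] := hN (e / (C + 1)) (divr_gt0 e0 C1); exists N => k l Nk Nl.
  apply: (le_trans (hC _ (CcrB (cphi k) (cphi l)))).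
  apply: (le_trans (ler_wpM2l C0 (HN k l Nk Nl))).
  by rewrite mulrCA ler_piMr ?(ltW e0)// ler_pdivrMr// mul1r lerDl.
have [ldg cdg] := dq_lim s01 cT lg cg hN.
have Hg : HU s Om g by split => //; exists phi_.
have eg := fin_energy_HU Hg.
have efg : fin_energy (fun x => f x + g x).
  by have := fin_energyD 1 ef eg; under eq_fun do rewrite mul1r.
have cfg := L2cvg_dq_add f cdg.
exists g; split => //.
have key v : Ccr Om v -> BR K (fun x => f x + g x) v = 0.
  move=> cv; have ev := ec _ cv.
  have cb := BR_cvg kK (fun k => (efc _ (cphi k)).1) (fun k => (efc _ (cphi k)).2) efg.1 efg.2 ev.1 ev.2 cfg.
  apply: (vertex0 (Q1 _ ev)) => t.
  (* [phi_ k] minimises only up to [k.+1%:R^-1]; for fixed [t] this error disappears in the limit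
     and leaves a nonnegative quadratic without constant term. *)
  have ct : k.+1%:R^-1 + 2 * t * BR K (fun x => f x + phi_ k x) v + t ^+ 2 * BR K v v @[k --> \oo] -->
      0 + 2 * t * BR K (fun x => f x + g x) v + t ^+ 2 * BR K v v.
    apply: cvgD; last exact: cvg_cst.
    apply: cvgD; first exact: cvg_harmonic.
    by apply: cvgM => //; exact: cvg_cst.
  rewrite -[X in 0 <= X]/(_ + _) -[X in 0 <= X + _]add0r; apply: (ler_cvg_to (cvg_cst 0) ct).
  apply: nearW => k; have cphit : Ccr Om (fun x => phi_ k x + t * v x) by apply: CcrD => //; exact: CcrZ.
  have := Jm _ cphit; have -> : J (fun x => phi_ k x + t * v x) = 
      J (phi_ k) + 2 * t * BR K (fun x => f x + phi_ k x) v + t ^+ 2 * BR K v v.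
    by rewrite -BR_quad// /J; [congr BR; apply/funext => x; rewrite addrA|exact: efc].
  have := (hphi k).2; move: (J (phi_ k)) (_ * BR K _ v) (_ * BR K v v) (k.+1%:R^-1) => a b c d; lra.
move=> v Hv; have [_ _ [psi [cpsi _ dpsi]]] := Hv; have ev := fin_energy_HU Hv.
have := BR_cvg kK (fun k => (ec _ (cpsi k)).1) (fun k => (ec _ (cpsi k)).2) ev.1 ev.2 efg.1 efg.2 dpsi.
rewrite (_ : (fun k => _) = (fun=> 0)); last by apply/funext => k; rewrite BR_C key.
move=> h; rewrite BR_C; apply: (cvg_unique _ h) => //; exact: cvg_cst.
Qed.

End existence.

(** * Rigidity of the gauge *)

Section pairing.
Context {R : realType} {n : nat}.
Local Notation V := 'rV[R]_n.
Local Notation mu := (@leb R n).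
Local Notation mm := (leb n \x leb n)%E.

Lemma csupp0 (U : set V) (f : V -> R) x : csupp U f -> ~ U x -> f x = 0.
Proof. by move=> [L [_ LU h]] nU; apply: h => /LU. Qed.

Lemma HU_off (s : R) (U : set V) (a : V -> R) : HU s U a -> {ae mu, forall x, ~ U x -> a x = 0}.
Proof.
move=> [la _ [phi [cphi ca _]]].
have [sg [_ ae]] := L2cvg_subseq (fun k => Ccr_L2 (cphi k)) la ca.
apply: filterS ae => x hx nU; apply: (cvg_unique _ hx) => //.
rewrite (_ : (fun k => _) = (fun=> 0)); first exact: cvg_cst.
by apply/funext => k; exact: csupp0 (cphi _).2 nU.
Qed.

(* the two terms of the integrand never interact, as [p] and [q] have disjoint supports *)
Lemma split_pair (K : V * V -> R) (p q : V -> R) : measurable_fun [set: V * V] K ->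
  (forall z, K (z.2, z.1) = K z) -> measurable_fun [set: V] p -> measurable_fun [set: V] q ->
  {ae mu, forall x, p x * q x = 0} ->
  L1 mm (fun z => K z * (q z.1 * p z.2 + q z.2 * p z.1)) ->
  I mm (fun z => K z * (q z.1 * p z.2 + q z.2 * p z.1)) = 0 ->
  L1 mm (fun z => K z * (q z.1 * p z.2)) /\ I mm (fun z => K z * (q z.1 * p z.2)) = 0.
Proof.
move=> mK sK mp mq pq l i.
have mf : measurable_fun [set: V * V] (fun z => K z * (q z.1 * p z.2)).
  apply: measurable_funM => //; apply: measurable_funM.
    exact: (measurableT_comp mq measurable_fst).
  exact: (measurableT_comp mp measurable_snd).
have l1 : L1 mm (fun z => K z * (q z.1 * p z.2)).
  apply: (L1_le_ae mf (L1_norm l)); apply: filterS2 (ae_fst mu pq) (ae_snd mu pq) => z a b.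
  have [e|e] := eqVneq (q z.1 * p z.2) 0; first by rewrite e mulr0 normr0.
  suff -> : q z.2 * p z.1 = 0 by rewrite addr0.
  move: e; rewrite mulf_eq0 negb_or => /andP[q1 p2].
  by move/eqP: a; rewrite mulf_eq0 (negbTE q1) orbF => /eqP ->; rewrite mulr0.
split => //; have l2 := L1_swap l1; have e2 := I_swap l1.
have sw : (fun z : V * V => K (z.2, z.1) * (q (z.2, z.1).1 * p (z.2, z.1).2)) =
    (fun z => K z * (q z.2 * p z.1)) by apply/funext => z; rewrite sK.
rewrite sw in l2 e2; have : I mm (fun z => K z * (q z.1 * p z.2)) + I mm (fun z => K z * (q z.1 * p z.2)) = 0.
  by rewrite -{2}e2 -I_D// -[RHS]i; congr I; apply/funext => z; rewrite mulrDr.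
by move/eqP; rewrite -mulr2n mulrn_eq0/= => /eqP.
Qed.

Lemma Ccr_exhaust (Om : set V) : open Om -> exists eta : nat -> V -> R,
  [/\ forall k, Ccr Om (eta k), forall k x, 0 <= eta k x <= 1 &
      forall x, Om x -> \forall k \near \oo, eta k x = 1].
Proof.
move=> oO; have [P PO OE] := open_cubes oO.
pose b (m : nat) : V -> R := if unpickle m is Some p then
  (if `[< P p >] then bump (map_mx ratr p.1) (p.2.+1%:R^-1) else fun=> 0) else fun=> 0.
have r0 (p : 'rV[rat]_n * nat) : 0 < p.2.+1%:R^-1 :> R by rewrite invr_gt0.
have cb m : Ccr Om (b m).
  rewrite /b; case: unpickle => [p|]; last exact: Ccr0.
  by case: asboolP => [Pp|_]; [apply: Ccr_bump => //; exact: PO|exact: Ccr0].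
have b01 m x : 0 <= b m x <= 1.
  rewrite /b; case: unpickle => [p|]; last by rewrite lexx ler01.
  by case: asboolP => _; rewrite ?lexx ?ler01// bump_ge0 bump_le1.
(* The recursion reads 1 - eta (k+1) = (1 - eta k) (1 - b k), the middle summand being 0; [eta]
   stays at 1 once some [b k] has been 1 at the point. *)
pose fix eta k : V -> R := if k is k'.+1 then (fun x => eta k' x + (1 - b k' x) * 0 + b k' x * (1 - eta k' x)) else fun=> 0.
have etaS k x : eta k.+1 x = eta k x + b k x * (1 - eta k x) by rewrite /= mulr0 addr0.
have ceta k : Ccr Om (eta k).
  elim: k => [|k IH]; first exact: Ccr0.
  rewrite (_ : eta k.+1 = (fun x => eta k x + (b k x - eta k x * b k x))).
    by apply: CcrD => //; apply: CcrB => //; apply: CcrM => //; exact: IH.1.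
  by apply/funext => x; rewrite etaS; ring.
exists eta; split => // [k x|x].
  elim: k => [|k /andP[h1 h2]]; first by rewrite /= lexx ler01.
  have /andP[b0 b1] := b01 k x; rewrite etaS; nra.
rewrite OE => -[p Pp cp]; exists (pickle p).+1 => // k /= hk.
elim: k hk => // k IH; rewrite ltnS leq_eqVlt => /orP[/eqP <-|/IH e]; rewrite etaS; last first.
  by rewrite e subrr mulr0 addr0.
have -> : b (pickle p) x = 1.
  rewrite /b pickleK; case: asboolP => // _; apply: bump1 => // i.
  exact: ltW (cp i).
by rewrite mul1r addrC subrK.
Qed.

End pairing.

(** * What the assumptions on the coefficients provide *)

Section coefficient_facts.
Context {R : realType} {n : nat} {s : R}.
Hypotheses (s01 : 0 < s < 1) (n0 : (0 < n)%N).
Local Notation V := 'rV[R]_n.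
Local Notation C := R[i].
Local Notation mu := (@leb R n).
Local Notation mm := (leb n \x leb n)%E.
Local Notation cz := (@cz R n s).
Let i0 : 'I_n := Ordinal n0.

Lemma sympart_diag (A : V -> V -> 'M[R]_n) (nu : R) x y :
  (forall x y xi : V, nu * enorm xi ^+ 2 <= contraction (sympart A x y) (tensor xi xi)) ->
  nu <= sympart A x y i0 i0.
Proof.
move=> /(_ x y (delta_mx ord0 i0)); rewrite enorm_sqr edot_delta mulr1 => /le_trans; apply.
rewrite le_eqVlt; apply/orP; left; apply/eqP.
rewrite /contraction (bigD1 i0)//= [X in _ + X]big1 => [|i ii].
  rewrite addr0 (bigD1 i0)//= [X in _ + X]big1 => [|j ji].
    by rewrite addr0 tensorE !mxE !eqxx !mulr1.
  by rewrite tensorE !mxE !eqxx (negbTE ji) !mulr0.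
by rewrite big1// => j _; rewrite tensorE !mxE (negbTE ii) /= mul0r mulr0.
Qed.

Lemma KA_scalar (A : V -> V -> 'M[R]_n) z a : A z.1 z.2 = a%:M -> KA s A z = a * (cz * kap s (z.1 - z.2)).
Proof.
move=> E; rewrite /KA -zeta_sq mulr_sumr E; apply: eq_bigr => i _.
rewrite (bigD1 i)//= big1 => [|j ji]; first by rewrite !mxE eqxx mulr1n addr0 expr2 mulrA.
by rewrite !mxE eq_sym (negbTE ji) mulr0n !mul0r.
Qed.

(* by (A1) and (A4) the coefficient is scalar, and independent of x, for x outside Omega *)
Lemma ext_kernel (Om : set V) (A : V -> V -> 'M[R]_n) : mxLinfty mm (fun z => A z.1 z.2) ->
  admissible s Om A -> exterior Om !=set0 ->
  exists (B : V -> R) (nu M : R), [/\ 0 < nu, measurable_fun [set: V] B, forall y, nu <= B y,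
    {ae mu, forall y, B y <= M} &
    {ae mm, forall z, exterior Om z.1 -> KA s (sympart A) z = cz * B z.2 * kap s (z.1 - z.2)}].
Proof.
move=> LA [[nu nu0 hA2] [beta [phi [[hb _ [a ha]] _ hA4]]]] ne.
have oe : open (exterior Om) by rewrite /exterior openC; exact: closed_closure.
have eO x : exterior Om x -> ~ Om x by move=> h Ox; apply: h; exact: subset_closure.
pose S := sympart A.
pose m k := xget 0 [set M : 'M[R]_n | forall x, exterior Om x -> beta k x = M].
have hm k x : exterior Om x -> beta k x = m k.
  move=> ex; have [_ _ [M hM]] := hb k.
  exact: (xgetPex (0 : 'M[R]_n) (ex_intro (fun M => forall x, exterior Om x -> beta k x = M) M hM)).
have H1 : {ae mm, forall z, exterior Om z.1 -> S z.1 z.2 = (S z.1 z.2 i0 i0)%:M /\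
    series (fun k => m k i0 i0 * beta k z.2 i0 i0) @ \oo --> S z.1 z.2 i0 i0}.
  apply: filterS ha => z [h1 _ h2] ez.
  have ea : a z.1 z.2 = S z.1 z.2 by apply: h2 => -[/(eO _ ez)].
  rewrite ea in h1.
  have h i j : series (fun k => beta k z.1 i j * beta k z.2 i j) @ \oo --> S z.1 z.2 i j.
    have [c _] := h1 i j; move: c; rewrite /cmx mxE /=.
    by under eq_fun do rewrite !mxE /=.
  have d k x i : beta k x i i = beta k x i0 i0.
    by have [bk hk] := hA4 k; rewrite hk !mxE !eqxx.
  split; last by have := h i0 i0; under eq_fun do rewrite (hm _ _ ez).
  apply/matrixP => i j; rewrite [RHS]mxE; case: eqVneq => [<-|ij].
    rewrite mulr1n; apply: (cvg_unique _ (h i i)) => //.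
    have -> : (fun k => beta k z.1 i i * beta k z.2 i i) = (fun k => beta k z.1 i0 i0 * beta k z.2 i0 i0).
      by apply/funext => k; rewrite !(d k _ i).
    exact: h.
  rewrite mulr0n; apply: (cvg_unique _ (h i j)) => //.
  have e0 : (fun k => beta k z.1 i j * beta k z.2 i j) = fun=> 0.
    by apply/funext => k; have [bk hk] := hA4 k; rewrite hk mxE (negbTE ij) mulr0n mul0r.
  rewrite e0 (_ : series _ = fun=> 0); first exact: cvg_cst.
  by apply/funext => N; rewrite /series/= big1.
have mS : measurable_fun [set: V * V] (fun z => S z.1 z.2 i0 i0).
  have mA := (LA i0 i0).1.
  have ms : measurable_fun [set: V * V] (fun z : V * V => (z.2, z.1)) by exact: measurable_fun_pair.
  have mA' := measurableT_comp mA ms.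
  apply: (eq_measurable_fun (fun z : V * V => 4^-1 * (A z.1 z.2 i0 i0 + A z.2 z.1 i0 i0 + A z.1 z.2 i0 i0 + A z.2 z.1 i0 i0))).
    by move=> z _; rewrite /S sympartE.
  by apply: measurable_funM => //; do 3! apply: measurable_funD => //.
have [M M0 hM] := Linfty_ae (LA i0 i0).
have H2 : {ae mm, forall z, S z.1 z.2 i0 i0 <= M}.
  apply: filterS2 hM (ae_swap hM) => z /= h1 h2; rewrite /S sympartE.
  move: h1 h2; rewrite !ler_norml => /andP[_ h1] /andP[_ h2]; lra.
(* The section at one good exterior point [x1] defines [B]. At another exterior point the series has
   the same terms, because every [beta k] takes the constant value [m k] there. *)
have [x1 ex1 [h1 h2]] := ae_open_ex oe ne (filterI (ae_section1 H1) (ae_section1 H2)).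
exists (fun y => S x1 y i0 i0), nu, M; split => //.
- exact: (measurableT_comp mS (measurable_pair1 x1)).
- by move=> y; exact: sympart_diag.
have h3 : {ae mu, forall y, series (fun k => m k i0 i0 * beta k y i0 i0) @ \oo --> S x1 y i0 i0}.
  by apply: filterS h1 => y /(_ ex1)[].
apply: filterS2 H1 (ae_snd mu h3) => z a1 a2 ez; have [e1 e2] := a1 ez.
rewrite (KA_scalar e1) (cvg_unique _ e2 a2)//; ring.
Qed.

(** At an exterior point [rho] vanishes, so pairing [x] with it exhibits [1 + rho x] as a quotient
    of diagonal entries, which are positive reals by ellipticity. *)
Lemma gauge_real (Om : set V) (A1 A2 : V -> V -> 'M[R]_n) : assumption_A2 A1 -> assumption_A2 A2 ->
  exterior Om !=set0 -> gauge Om A1 A2 -> exists rho, [/\ Ccr Om rho, forall x, 0 < 1 + rho x &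
    forall x y, sympart A2 x y = ((1 + rho x) * (1 + rho y)) *: sympart A1 x y].
Proof.
move=> [nu1 p1 h1] [nu2 p2 h2] [y0 ey0] [rho /CcrP[cr ci] G].
have nO : ~ Om y0 by move=> Oy; apply: ey0; exact: subset_closure.
have s1 x y : 0 < sympart A1 x y i0 i0 by exact: lt_le_trans p1 (sympart_diag x y h1).
have s2 x y : 0 < sympart A2 x y i0 i0 by exact: lt_le_trans p2 (sympart_diag x y h2).
have r0 : rho y0 = 0.
  by move: (csupp0 cr.2 nO) (csupp0 ci.2 nO) => /=; case: (rho y0) => a b /= -> ->.
have ent x y i j : (sympart A2 x y i j)%:C%C = (1 + rho x) * (1 + rho y) * (sympart A1 x y i j)%:C%C.
  by have /matrixP/(_ i j) := G x y; rewrite !mxE.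
have im x : complex.Im (rho x) = 0.
  have := ent x y0 i0 i0; rewrite r0; have := s1 x y0; move: (sympart A1 _ _ _ _) (sympart A2 _ _ _ _) => a b a0.
  case: (rho x) => c d /= [_]; rewrite !(mulr0, mul0r, addr0, add0r, mulr1, subr0) => /esym/eqP.
  by rewrite mulf_eq0 (gt_eqF a0) orbF => /eqP.
exists (fun x => complex.Re (rho x)); split => // [x|x y].
  have := ent x y0 i0 i0; rewrite r0; have := s1 x y0; have := s2 x y0.
  move: (sympart A1 _ _ _ _) (sympart A2 _ _ _ _) => a b b0 a0.
  move: (im x); case: (rho x) => c d /= -> [+ _].
  rewrite !(mulr0, mul0r, addr0, add0r, mulr1, subr0) => e.
  by rewrite -(pmulr_lgt0 _ a0) -e.
apply/matrixP => i j; rewrite [RHS]mxE; have := ent x y i j; move: (im x) (im y).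
move: (sympart A1 _ _ _ _) (sympart A2 _ _ _ _) => a b.
case: (rho x) => c d; case: (rho y) => c' d' /= -> -> [-> _]; ring.
Qed.

Lemma KA_gauge (A1 A2 : V -> V -> 'M[R]_n) (g : V -> R) z :
  (forall x y, sympart A2 x y = (g x * g y) *: sympart A1 x y) ->
  KA s (sympart A2) z = g z.1 * g z.2 * KA s (sympart A1) z.
Proof.
move=> h; rewrite /KA h mulr_sumr; apply: eq_bigr => i _; rewrite mulr_sumr; apply: eq_bigr => j _.
by rewrite mxE; ring.
Qed.

Definition rc (f : V -> R) (x : V) : C := (f x)%:C%C.

Lemma tildeHs_rc U f : HU s U f -> tildeHs s U (rc f).
Proof. by move=> h; apply/(tildeHsP s01 n0); split => //=; exact: HU0. Qed.

Lemma BR0l (K : V * V -> R) c : BR K (fun=> 0) c = 0.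
Proof. by rewrite -[RHS](I_0 mm); congr I; apply/funext => z; rewrite subrr !mul0r. Qed.

Lemma B_form_real (A : V -> V -> 'M[R]_n) u v : mxLinfty mm (fun z => A z.1 z.2) ->
  tildeHs s setT u -> tildeHs s setT v ->
  let K := KA s (sympart A) in
  let a x := complex.Re (u x) in let b x := complex.Im (u x) in
  let c x := complex.Re (v x) in let d x := complex.Im (v x) in
  B_form s A u v = Complex (BR K a c - BR K b d) (BR K a d + BR K b c).
Proof.
move=> LA tu tv K a b c d; have mA i j := (LA i j).1.
have /(tildeHsP s01 n0)[ha hb] := tu; have /(tildeHsP s01 n0)[hc hd] := tv.
rewrite (B_formE s01 n0 mA tu tv) => [|e f he hf]; last by have [] := BR_sympart LA he hf.
by rewrite (BR_sympart LA ha hc).2 (BR_sympart LA hb hd).2 (BR_sympart LA ha hd).2 (BR_sympart LA hb hc).2.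
Qed.

(** Existence ensures that [u_sol] is a solution and not the default value. Real data and a real
    kernel let its real part solve the real problem and carry the real part of the DN pairing. *)
Lemma real_solution (Om : set V) (A : V -> V -> 'M[R]_n) (f : V -> R) (c : V) (r : R) :
  mxLinfty mm (fun z => A z.1 z.2) -> assumption_A2 A -> bounded_set Om -> 0 < r ->
  (forall x, cube c r x -> ~ Om x) -> HU s setT f ->
  let K := KA s (sympart A) in
  exists a, [/\ HU s setT a, HU s Om (fun x => a x - f x),
    forall v, HU s Om v -> BR K a v = 0 &
    forall g, HU s setT g -> complex.Re (DN s Om A (rc f) (rc g)) = BR K a g].
Proof.
move=> LA hA2 bO r0 cO hf K.
have [nu [M kK]] := KA_kernel (cz_gt0 n s01) LA hA2.
have [P P0 hP] := poincare s01 n0 bO r0 cO.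
have [g [Hg hg]] := exist_min s01 kK P0 hP hf.
have HgT := HU_sub (@subsetT _ Om) Hg.
have Hfg := HU_D s01 hf HgT.
pose Sol := [set u | solution s Om A (rc f) u].
have sol : Sol (rc (fun x => f x + g x)).
  split.
  - by have [] := tildeHs_rc Hfg.
  - have -> : (fun x => rc (fun x => f x + g x) x - rc f x) = rc g.
      by apply/funext => x; rewrite /rc rmorphD/= addrC addKr.
    exact: tildeHs_rc.
  - move=> v tv; have /(tildeHsP s01 n0)[hc hd] := tv.
    have tvT : tildeHs s setT v.
      by apply/(tildeHsP s01 n0); split; [exact: HU_sub (@subsetT _ Om) hc|exact: HU_sub (@subsetT _ Om) hd].
    rewrite (B_form_real LA (tildeHs_rc Hfg) tvT) /=.
    by rewrite !BR0l !hg// subr0 addr0.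
have := xgetPex (fun=> 0 : C) (ex_intro Sol _ sol); rewrite -/(u_sol s Om A (rc f)).
rewrite /DN; set u := u_sol _ _ _ _ => -[_ tu bu].
have /(tildeHsP s01 n0)[hr hi] := tu.
pose a x := complex.Re (u x); pose b x := complex.Im (u x).
have Er : (fun x => complex.Re (u x - rc f x)) = (fun x => a x - f x).
  by apply/funext => x; rewrite /a /rc; case: (u x).
have Ei : (fun x => complex.Im (u x - rc f x)) = b.
  by apply/funext => x; rewrite /b /rc; case: (u x) => ? ? /=; rewrite subr0.
rewrite Er in hr; rewrite Ei in hi.
have haT : HU s setT a.
  have := HU_D s01 (HU_sub (@subsetT _ Om) hr) hf.
  by under eq_fun do rewrite subrK.
have hbT := HU_sub (@subsetT _ Om) hi.
have tuT : tildeHs s setT u by apply/(tildeHsP s01 n0).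
have re v : HU s setT v -> complex.Re (B_form s A u (rc v)) = BR K a v.
  move=> hv; rewrite (B_form_real LA tuT (tildeHs_rc hv)) /=.
  by rewrite (BR_C _ _ (fun=> 0)) BR0l subr0.
exists a; split => // v hv.
by rewrite -(re v (HU_sub (@subsetT _ Om) hv)) (bu _ (tildeHs_rc hv)).
Qed.

Lemma B_form_sympart (A1 A2 : V -> V -> 'M[R]_n) u v : mxLinfty mm (fun z => A1 z.1 z.2) ->
  mxLinfty mm (fun z => A2 z.1 z.2) -> (forall x y, sympart A1 x y = sympart A2 x y) ->
  tildeHs s setT u -> tildeHs s setT v -> B_form s A1 u v = B_form s A2 u v.
Proof.
move=> L1 L2 E tu tv.
rewrite (B_form_real L1 tu tv) (B_form_real L2 tu tv).
by have -> : sympart A1 = sympart A2 by apply/funext => x; apply/funext => y.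
Qed.

End coefficient_facts.

(** * The gauge function vanishes *)

Section gauge_rigidity.
Context {R : realType} {n : nat} {s : R}.
Hypothesis s01 : 0 < s < 1.
Local Notation V := 'rV[R]_n.
Local Notation mu := (@leb R n).
Local Notation mm := (leb n \x leb n)%E.

Variables (Om : set V) (K1 K2 : V * V -> R) (nu1 M1 nu2 M2 : R) (rho : V -> R).
Hypotheses (oO : open Om) (bO : bounded_set Om).
Hypotheses (kK1 : kernel s K1 nu1 M1) (kK2 : kernel s K2 nu2 M2).
Hypotheses (crho : Ccr Om rho) (rho_gt : forall x, 0 < 1 + rho x).
Hypothesis K12 : forall z, K2 z = (1 + rho z.1) * (1 + rho z.2) * K1 z.
Variables (c1 c2 : V) (r1 r2 : R).
Hypotheses (r10 : 0 < r1) (r20 : 0 < r2).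
Hypothesis c1O : forall x, cube c1 (2 * r1) x -> ~ Om x.
Hypothesis c2O : forall x, cube c2 (2 * r2) x -> ~ Om x.
Hypothesis c12 : forall x, cube c1 r1 x -> ~ cube c2 r2 x.

(* the form in which [ext_kernel] describes the kernel near an exterior cube *)
Definition ext_form (c : V) (r : R) (K : V * V -> R) := exists (k : R) (B : V -> R) (nu M : R),
  [/\ k != 0, 0 < nu, measurable_fun [set: V] B & [/\ forall y, nu <= B y, {ae mu, forall y, B y <= M} &
    {ae mm, forall z, cube c (2 * r) z.1 -> K z = k * B z.2 * kap s (z.1 - z.2)}]].

Hypotheses (e1 : ext_form c1 r1 K1) (e2 : ext_form c2 r2 K1).
Let s0 : 0 < s. Proof. by have /andP[] := s01. Qed.

Lemma ucp_ext c r (h : V -> R) : 0 < r -> ext_form c r K1 -> (forall x, cube c (2 * r) x -> ~ Om x) ->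
  L2 mu h -> (forall x, ~ Om x -> h x = 0) ->
  (forall g, Ccr (cube c r) g -> I mm (fun z => K1 z * (g z.1 * h z.2)) = 0) ->
  {ae mu, forall x, h x = 0}.
Proof.
move=> r0 [k [B [nu [M [k0 nu0 mB [Bnu BM KB]]]]]] cO lh hO H.
have [M' _ OM] := bounded_sub_cube bO.
have hOm y : h y != 0 -> Om y by move=> hy; apply: contrapT => /hO/eqP; apply/negP.
apply: (ucp_test s0 r0 k0 nu0 mB Bnu BM KB (kern_meas kK1) lh) => //.
  by exists M' => y /hOm /OM.
by move=> y /hOm Oy cy; exact: (cO y cy).
Qed.

Lemma cube_double (c x : V) (r : R) : 0 < r -> cube c r x -> cube c (2 * r) x.
Proof. by move=> r0 cx i; apply: lt_trans (cx i) _; lra. Qed.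

Section one_datum.
Variables (f u1 u2 : V -> R).
Hypotheses (cf : Ccr (cube c1 r1) f).
Hypotheses (h1 : HU s setT u1) (h2 : HU s setT u2).
Hypotheses (f1 : HU s Om (fun x => u1 x - f x)) (f2 : HU s Om (fun x => u2 x - f x)).
Hypotheses (sol1 : forall v, HU s Om v -> BR K1 u1 v = 0) (sol2 : forall v, HU s Om v -> BR K2 u2 v = 0).
Hypothesis DNeq : forall g, Ccr (cube c2 r2) g -> BR K1 u1 g = BR K2 u2 g.

Let mK1 := kern_meas kK1.
Let mu1 : measurable_fun [set: V] u1. Proof. by have [[]] := h1. Qed.
Let mu2 : measurable_fun [set: V] u2. Proof. by have [[]] := h2. Qed.
Let mrho := Ccr_measurable crho.
Let energy a : HU s setT a -> measurable_fun [set: V] a /\ L2 mm (dq s a).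
Proof. by move=> [[]]. Qed.

Let L1BR1 a c : HU s setT a -> HU s setT c -> L1 mm (fun z => (a z.2 - a z.1) * (c z.2 - c z.1) * K1 z).
Proof. by move=> /energy[ma la] /energy[mc lc]; exact: (BR_L1 kK1). Qed.
Let L1BR2 a c : HU s setT a -> HU s setT c -> L1 mm (fun z => (a z.2 - a z.1) * (c z.2 - c z.1) * K2 z).
Proof. by move=> /energy[ma la] /energy[mc lc]; exact: (BR_L1 kK2). Qed.

Let mfst (a : V -> R) : measurable_fun [set: V] a -> measurable_fun [set: V * V] (fun z => a z.1).
Proof. by move=> ma; exact: (measurableT_comp ma measurable_fst). Qed.
Let msnd (a : V -> R) : measurable_fun [set: V] a -> measurable_fun [set: V * V] (fun z => a z.2).
Proof. by move=> ma; exact: (measurableT_comp ma measurable_snd). Qed.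

Let off1 : {ae mu, forall x, ~ Om x -> u1 x = f x}.
Proof. by apply: filterS (HU_off f1) => x h nO; apply/eqP; rewrite -subr_eq0; apply/eqP; exact: h. Qed.
Let off2 : {ae mu, forall x, ~ Om x -> u2 x = f x}.
Proof. by apply: filterS (HU_off f2) => x h nO; apply/eqP; rewrite -subr_eq0; apply/eqP; exact: h. Qed.

Let rho0 x : ~ Om x -> rho x = 0. Proof. exact: csupp0 crho.2. Qed.

(* unique continuation from W2 *)
Lemma solutions_gauge : {ae mu, forall x, u1 x = (1 + rho x) * u2 x}.
Proof.
pose h x := u1 x - (1 + rho x) * u2 x.
have [P P0 hP] := Ccr_bounded crho.
have mg : measurable_fun [set: V] (fun x => 1 + rho x) by exact: measurable_funD.
have l2h : L2 mu h.
  have [l1 _ _] := h1; have [l2 _ _] := h2; apply: L2B => //; split; first exact: measurable_funM.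
  apply: (L1_le _ (L1Z ((1 + P) ^+ 2) l2.2)); first by apply: measurable_funX; exact: measurable_funM.
  move=> x; rewrite exprMn normrM !ger0_norm ?sqr_ge0// ler_wpM2r ?sqr_ge0//.
  rewrite lerXn2r ?nnegrE ?(ltW (rho_gt x)) ?addr_ge0// lerD2l.
  exact: le_trans (ler_norm _) (hP x).
have mO : measurable Om by exact: open_rV_measurable.
(* [h] vanishes off [Om] only almost everywhere; its cut-off does so at every point, as [ucp_ext]
   requires. *)
pose h' x := \1_Om x * h x.
have l2h' : L2 mu h'.
  split; first by apply: measurable_funM; [exact: measurable_indic|exact: l2h.1].
  apply: (L1_le _ l2h.2).
    by apply: measurable_funX; apply: measurable_funM; [exact: measurable_indic|exact: l2h.1].
  move=> x; rewrite /h' indicE; case: (_ \in _); rewrite ?mul1r ?mul0r ?expr0n ?normr0 ?sqr_ge0//.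
  by rewrite ger0_norm ?sqr_ge0.
have hh' : {ae mu, forall x, h x = h' x}.
  apply: filterS2 off1 off2 => x a b; rewrite /h' indicE; case: (boolP (x \in Om)) => [_|]; first by rewrite mul1r.
  by rewrite notin_setE => nO; rewrite mul0r /h a// b// rho0// addr0 mul1r subrr.
suff : {ae mu, forall x, h' x = 0}.
  by apply: filterS2 hh' => x a b; apply/eqP; rewrite -subr_eq0 -/(h x) a b.
apply: (ucp_ext r20 e2 c2O l2h') => [x nO|g cg].
  by rewrite /h' indicE memNset// mul0r.
have cgT := Ccr_sub (@subsetT _ _) cg; have hg := HU_Ccr s01 cgT.
have mg' := Ccr_measurable cg.
have supp x : g x != 0 -> [/\ ~ Om x, f x = 0 & rho x = 0].
  move=> gx; have cx : cube c2 r2 x by apply: contrapT => /(csupp0 cg.2)/eqP; apply/negP.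
  have nO := c2O (cube_double r20 cx); split; [by []| |exact: rho0].
  by apply: (csupp0 cf.2) => /c12.
(* Where [g] is nonzero, [u1], [u2] and [rho] vanish, because the cube of [g] lies outside [Om] and
   misses the support of [f]. The difference of the two forms is then made of cross terms alone, and
   there [u1 - (1 + rho) * u2] appears as a factor. *)
have vg : {ae mu, forall x, g x = 0 \/ [/\ u1 x = 0, u2 x = 0 & rho x = 0]}.
  apply: filterS2 off1 off2 => x a b; have [gx|gx] := eqVneq (g x) 0; [by left|right].
  by have [nO fx rx] := supp x gx; rewrite a// b// fx.
have gh : {ae mu, forall x, h x * g x = 0}.
  apply: filterS vg => x [->|[a b c]]; first by rewrite mulr0.
  by rewrite /h a b c mulr0 subrr mul0r.
have l1 := L1BR1 h1 hg; have l2 := L1BR2 h2 hg.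
pose D z := (u1 z.2 - u1 z.1) * (g z.2 - g z.1) * K1 z - (u2 z.2 - u2 z.1) * (g z.2 - g z.1) * K2 z.
have lD : L1 mm D by exact: L1B.
have iD : I mm D = 0 by rewrite /D I_B// -/(BR K1 u1 g) -/(BR K2 u2 g) DNeq// subrr.
have mS : measurable_fun [set: V * V] (fun z => K1 z * (g z.1 * h z.2 + g z.2 * h z.1)).
  apply: measurable_funM => //; apply: measurable_funD; apply: measurable_funM.
  - exact: mfst.
  - exact: (msnd l2h.1).
  - exact: msnd.
  - exact: (mfst l2h.1).
have DE : {ae mm, forall z, - D z = K1 z * (g z.1 * h z.2 + g z.2 * h z.1)}.
  apply: filterS2 (ae_fst mu vg) (ae_snd mu vg) => z a b; rewrite /D K12 /h.
  case: a => [->|[-> -> ->]]; case: b => [->|[-> -> ->]]; ring.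
have lS := L1_ae_eq mS DE (L1N lD).
have iS : I mm (fun z => K1 z * (g z.1 * h z.2 + g z.2 * h z.1)) = 0.
  by rewrite -(I_ae_eq _ mS DE) ?I_N// ?iD ?oppr0//; exact: L1_measurable (L1N lD).
have [l0 <-] := split_pair mK1 (kern_sym kK1) l2h.1 mg' gh lS iS.
apply: I_ae_eq.
- by apply: measurable_funM => //; apply: measurable_funM; [exact: mfst|exact: (msnd l2h'.1)].
- exact: L1_measurable l0.
- by apply: filterS (ae_snd mu hh') => z ->.
Qed.

Let tested (phi : V -> R) : Ccr Om phi ->
  L1 mm (fun z => K1 z * ((rho z.2 - rho z.1) * (u1 z.2 * phi z.2 - u1 z.1 * phi z.1))) /\
  I mm (fun z => K1 z * ((rho z.2 - rho z.1) * (u1 z.2 * phi z.2 - u1 z.1 * phi z.1))) = 0.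
Proof.
(* The equation of [u1] is tested with [(1 + rho) * phi] and that of [u2] with [phi]; both are in
   [Ccr Om]. *)
move=> cp; have mp := Ccr_measurable cp.
have cgp : Ccr Om (fun x => phi x + rho x * phi x) by apply: CcrD => //; apply: CcrM => //; exact: crho.1.
have hgp := HU_Ccr s01 cgp; have hp := HU_Ccr s01 cp.
have l1 := L1BR1 h1 (HU_sub (@subsetT _ _) hgp); have l2 := L1BR2 h2 (HU_sub (@subsetT _ _) hp).
have i1 := sol1 hgp; have i2 := sol2 hp.
pose D z := (u1 z.2 - u1 z.1) * ((phi z.2 + rho z.2 * phi z.2) - (phi z.1 + rho z.1 * phi z.1)) * K1 z
  - (u2 z.2 - u2 z.1) * (phi z.2 - phi z.1) * K2 z.
have lD : L1 mm D by exact: L1B.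
have iD : I mm D = 0.
  by rewrite /D I_B// -/(BR K2 u2 phi) i2 subr0; exact: i1.
have mS : measurable_fun [set: V * V]
    (fun z => K1 z * ((rho z.2 - rho z.1) * (u1 z.2 * phi z.2 - u1 z.1 * phi z.1))).
  apply: measurable_funM => //; apply: measurable_funM; apply: measurable_funB.
  - exact: msnd.
  - exact: mfst.
  - by apply: measurable_funM; exact: msnd.
  - by apply: measurable_funM; exact: mfst.
have ae := solutions_gauge.
have DE : {ae mm, forall z, D z = K1 z * ((rho z.2 - rho z.1) * (u1 z.2 * phi z.2 - u1 z.1 * phi z.1))}.
  by apply: filterS2 (ae_fst mu ae) (ae_snd mu ae) => z a b; rewrite /D K12 a b; ring.
split; first exact: L1_ae_eq mS DE lD.
by rewrite -(I_ae_eq (L1_measurable lD) mS DE).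
Qed.

(** The hypothesis says that [phi] is 1 wherever [rho] is not 0. It cancels the terms in which [rho]
    and [u1 * (1 - phi)] meet at one point, and [split_pair] separates the two cross terms. *)
Let tested_complement (phi : V -> R) : Ccr Om phi -> (forall x, rho x * (1 - phi x) = 0) ->
  L1 mm (fun z => K1 z * ((u1 z.1 * (1 - phi z.1)) * rho z.2)) /\
  I mm (fun z => K1 z * ((u1 z.1 * (1 - phi z.1)) * rho z.2)) = 0.
Proof.
move=> cp rp; have [lt it] := tested cp; have mp := Ccr_measurable cp.
have hr := HU_Ccr s01 crho.
have l1 := L1BR1 h1 (HU_sub (@subsetT _ _) hr); have i1 := sol1 hr.
have E : (fun z : V * V => K1 z * ((u1 z.1 * (1 - phi z.1)) * rho z.2 + (u1 z.2 * (1 - phi z.2)) * rho z.1)) =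
    (fun z => K1 z * ((rho z.2 - rho z.1) * (u1 z.2 * phi z.2 - u1 z.1 * phi z.1)) -
      (u1 z.2 - u1 z.1) * (rho z.2 - rho z.1) * K1 z).
  apply/funext => z; have a := rp z.1; have b := rp z.2.
  transitivity (K1 z * ((u1 z.1 * (1 - phi z.1)) * rho z.2 + (u1 z.2 * (1 - phi z.2)) * rho z.1
    - u1 z.1 * (rho z.1 * (1 - phi z.1)) - u1 z.2 * (rho z.2 * (1 - phi z.2)))).
    by rewrite a b !mulr0 !subr0.
  ring.
apply: (split_pair (p := rho) (q := fun x => u1 x * (1 - phi x)) mK1 (kern_sym kK1) mrho).
- by apply: measurable_funM => //; exact: measurable_funB.
- by apply: aeW => x; rewrite mulrCA rp mulr0.
- by rewrite E; exact: L1B.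
- by rewrite E I_B// it sub0r; apply/eqP; rewrite oppr_eq0; apply/eqP.
Qed.

Lemma datum_orthogonal : I mm (fun z => K1 z * (f z.1 * rho z.2)) = 0.
Proof.
have [L [cL LO Lr]] := crho.2.
have [chi cchi chi1] := cutoff oO cL LO.
have [eta [ceta eta01 eta1]] := Ccr_exhaust oO.
have rchi x : rho x * (1 - chi x) = 0.
  have [Lx|nLx] := pselect (L x); first by rewrite chi1// subrr mulr0.
  by rewrite Lr// mul0r.
(* That is, 1 - phi = (1 - chi) (1 - eta): [chi] fixes [phi] to 1 on the support of [rho], [eta]
   drives it to 1 at every point of [Om], and the integrand with [chi] alone dominates. *)
pose phi k x := chi x + (eta k x - chi x * eta k x).
have cphi k : Ccr Om (phi k) by apply: CcrD => //; apply: CcrB => //; apply: CcrM => //; exact: cchi.1.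
have phiE k x : 1 - phi k x = (1 - chi x) * (1 - eta k x) by rewrite /phi; ring.
have rphi k x : rho x * (1 - phi k x) = 0 by rewrite phiE mulrA rchi mul0r.
have [l0 _] := tested_complement cchi rchi.
have mf := Ccr_measurable cf.
have [] := @dct _ _ _ mm (fun k z => K1 z * ((u1 z.1 * (1 - phi k z.1)) * rho z.2))
  (fun z => K1 z * (f z.1 * rho z.2)) (fun z => `|K1 z * ((u1 z.1 * (1 - chi z.1)) * rho z.2)|) _ _ _ (L1_norm l0) _.
- by move=> k; exact: L1_measurable (tested_complement (cphi k) (rphi k)).1.
- by apply: measurable_funM => //; apply: measurable_funM; [exact: mfst|exact: msnd].
- apply: filterS (ae_fst mu off1) => z hz; apply: cvgM; first exact: cvg_cst.
  apply: cvgM; last exact: cvg_cst.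
  have [Oz|nOz] := pselect (Om z.1).
    have fz : f z.1 = 0.
      by apply: (csupp0 cf.2) => /(cube_double r10)/c1O.
    rewrite fz; have [N _ HN] := eta1 z.1 Oz; apply/cvgrPdist_le => e e0.
    by exists N => // k /HN hk; rewrite /= phiE hk subrr !mulr0 subrr normr0 ltW.
  rewrite -hz// (_ : (fun k => _) = (fun=> u1 z.1)); first exact: cvg_cst.
  by apply/funext => k; rewrite (csupp0 (cphi k).2 nOz) subr0 mulr1.
- move=> k; apply: aeW => z; rewrite phiE.
  have /andP[a b] := eta01 k z.1.
  rewrite (_ : K1 z * _ = (1 - eta k z.1) * (K1 z * (u1 z.1 * (1 - chi z.1) * rho z.2))); last by ring.
  by rewrite normrM ler_piMl// ger0_norm; lra.
move=> _ cv; apply/esym; apply: (cvg_unique _ _ cv) => //.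
rewrite (_ : (fun k => _) = (fun=> 0)); first exact: cvg_cst.
by apply/funext => k; exact: (tested_complement (cphi k) (rphi k)).2.
Qed.

End one_datum.

Lemma gauge_trivial :
  (forall f, Ccr (cube c1 r1) f -> exists u1 u2, [/\ HU s setT u1, HU s setT u2,
     HU s Om (fun x => u1 x - f x), HU s Om (fun x => u2 x - f x) &
     [/\ forall v, HU s Om v -> BR K1 u1 v = 0, forall v, HU s Om v -> BR K2 u2 v = 0 &
     forall g, Ccr (cube c2 r2) g -> BR K1 u1 g = BR K2 u2 g]]) -> forall x, rho x = 0.
Proof.
move=> H; have lr := Ccr_L2 crho.
have ae : {ae mu, forall x, rho x = 0}.
  apply: (ucp_ext r10 e1 c1O lr) => [x|f cf]; first exact: csupp0 crho.2.
  have [u1 [u2 [h1 h2 f1 f2 [s1 s2 d]]]] := H f cf.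
  exact: (datum_orthogonal cf h1 h2 f1 f2 s1 s2 d).
(* By continuity the set where [rho] is nonzero is open, so it cannot be null without being
   empty. *)
move=> x; apply: contrapT => /eqP rx.
have oU : open [set y | rho y != 0].
  rewrite (_ : [set y | _] = rho @^-1` [set t | t != 0]); last by [].
  apply: open_comp; last exact: open_neq.
  by move=> y _; exact: (smoothV_continuous crho.1).
by have [y /= + e] := ae_open_ex oU (ex_intro _ x rx) ae; rewrite e eqxx.
Qed.

End gauge_rigidity.

(** * Separated cubes in the measurement sets *)

Section cubes.
Context {R : realType} {n : nat}.
Local Notation V := 'rV[R]_n.

Lemma open_cube_sub (U : set V) x : open U -> U x -> exists2 r, 0 < r & cube x r `<=` U.
Proof.
move=> oU Ux; have [e /= e0 he] : nbhs_ball x U by rewrite nbhs_ballE; apply: open_nbhs_nbhs.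
by exists e => //; rewrite cube_ball.
Qed.

Lemma open_two_points (U : set V) x : (0 < n)%N -> open U -> U x -> exists2 y, U y & y != x.
Proof.
move=> n0 oU Ux; have [r r0 rU] := open_cube_sub oU Ux.
exists (x + const_mx (r / 2)).
  apply: rU => i; rewrite !mxE addrAC subrr add0r ger0_norm ?divr_ge0 ?ltW//; lra.
apply/eqP => /rowP/(_ (Ordinal n0)); rewrite !mxE => /eqP.
by rewrite -subr_eq0 addrAC subrr add0r gt_eqF// divr_gt0.
Qed.

(** The two sets may overlap or coincide, so distinct centres are chosen and the radii kept to at
    most half their distance. The doubled cubes leave the margin that unique continuation needs. *)
Lemma disjoint_cubes (U1 U2 : set V) : (0 < n)%N -> open U1 -> U1 !=set0 -> open U2 -> U2 !=set0 ->
  exists c1 c2 r1 r2, [/\ 0 < r1, 0 < r2, cube c1 (2 * r1) `<=` U1, cube c2 (2 * r2) `<=` U2 &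
    forall x, cube c1 r1 x -> ~ cube c2 r2 x].
Proof.
move=> n0 o1 [c1 Uc1] o2 [x2 Ux2].
have [c2 Uc2 c12] : exists2 c2, U2 c2 & c2 != c1.
  by have [e|e] := eqVneq x2 c1; [rewrite -e; exact: open_two_points|exists x2].
have [e1 p1 s1] := open_cube_sub o1 Uc1; have [e2 p2 s2] := open_cube_sub o2 Uc2.
have d0 : 0 < `|c2 - c1| by rewrite normr_gt0 subr_eq0.
pose q := `|c2 - c1| / 2; have q0 : 0 < q by rewrite divr_gt0.
exists c1, c2, (minr (e1 / 2) q), (minr (e2 / 2) q).
have m1 : 0 < minr (e1 / 2) q by rewrite lt_min q0 divr_gt0.
have m2 : 0 < minr (e2 / 2) q by rewrite lt_min q0 divr_gt0.
have sub e c (W : set V) : cube c e `<=` W -> cube c (2 * minr (e / 2) q) `<=` W.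
  move=> h x hx; apply: h => i; apply: (lt_le_trans (hx i)).
  have : minr (e / 2) q <= e / 2 by rewrite ge_min lexx.
  lra.
split; [by []|by []|exact: sub|exact: sub|] => x /(cube_norm _ _ m1) a /(cube_norm _ _ m2) b.
have := ler_normD (x - c1) (c2 - x); have -> : x - c1 + (c2 - x) = c2 - c1 by rewrite addrC subrKA.
rewrite (distrC c2 x); move: a b; rewrite !lt_min => /andP[_ a] /andP[_ b].
by rewrite leNgt => /negP; apply; rewrite /q in a b; lra.
Qed.

End cubes.

(** * The two directions of the equivalence *)

Theorem theorem1p2 (R : realType) (n : nat) (s : R)
    (Omega W1 W2 : set 'rV[R]_n) (A1 A2 : 'rV[R]_n -> 'rV[R]_n -> 'M[R]_n) :
  (0 < n)%N -> 0 < s < 1 ->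
  open Omega -> bounded_set Omega ->
  open W1 -> bounded_set W1 -> W1 !=set0 -> W1 `<=` exterior Omega ->
  open W2 -> bounded_set W2 -> W2 !=set0 -> W2 `<=` exterior Omega ->
  mxLinfty (leb n \x leb n)%E (fun z => A1 z.1 z.2) ->
  mxLinfty (leb n \x leb n)%E (fun z => A2 z.1 z.2) ->
  admissible s Omega A1 -> admissible s Omega A2 ->
  (gauge Omega A1 A2 /\
   (forall f, Cc_infty W1 f -> forall g, Cc_infty W2 g ->
      DN s Omega A1 f g = DN s Omega A2 f g)) <->
  (forall x y, sympart A1 x y = sympart A2 x y).
Proof.
move=> n0 s01 oO bO oW1 _ W10 W1e oW2 _ W20 W2e LA1 LA2 ad1 ad2.
have ccT (U : set 'rV[R]_n) f : Cc_infty U f -> tildeHs s setT f.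
  by move=> /CcrP[cr ci]; apply/(tildeHsP s01 n0); split;
    apply: HU_Ccr => //; exact: Ccr_sub (@subsetT _ U) _.
split=> [[G DNe]|E]; last first.
  have E' : sympart A1 = sympart A2 by apply/funext => x; apply/funext => y; exact: E.
  split.
    exists (fun=> 0) => [|x y]; last by rewrite E addr0 mul1r scale1r.
    by apply/CcrP; split; exact: Ccr0.
  move=> f cf g cg; have tf := ccT _ _ cf; have tg := ccT _ _ cg.
  have tu (u : 'rV[R]_n -> R[i]) : tildeHs s Omega (fun x => u x - f x) -> tildeHs s setT u.
    move=> /(tildeHsP s01 n0)[hr hi]; have /(tildeHsP s01 n0)[fr fi] := tf.
    apply/(tildeHsP s01 n0); split.
      have := HU_D s01 (HU_sub (@subsetT _ Omega) hr) fr; congr HU; apply/funext => x.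
      by case: (u x) (f x) => ? ? [? ?] /=; rewrite subrK.
    have := HU_D s01 (HU_sub (@subsetT _ Omega) hi) fi; congr HU; apply/funext => x.
    by case: (u x) (f x) => ? ? [? ?] /=; rewrite subrK.
  have tv v : tildeHs s Omega v -> tildeHs s setT v.
    by move=> /(tildeHsP s01 n0)[a b]; apply/(tildeHsP s01 n0); split; exact: HU_sub (@subsetT _ Omega) _.
  (* Equal forms give equal sets of solutions, hence the same choice by [xget], whether or not the
     solution is unique. *)
  have sE : [set u | solution s Omega A1 f u] = [set u | solution s Omega A2 f u].
    apply/seteqP; split => u [hs tO hB]; split; [exact: hs|exact: tO|move=> v hv|exact: hs|exact: tO|move=> v hv].
      by rewrite -(B_form_sympart s01 n0 LA1 LA2 E (tu _ tO) (tv _ hv)); exact: hB.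
    by rewrite (B_form_sympart s01 n0 LA1 LA2 E (tu _ tO) (tv _ hv)); exact: hB.
  have uE : u_sol s Omega A1 f = u_sol s Omega A2 f by exact: (congr1 (xget (fun=> 0)) sE).
  (* Either the chosen function solves the problem or it is the default 0; it lies in the space in
     both cases. *)
  have tU : tildeHs s setT (u_sol s Omega A2 f).
    pose P u := solution s Omega A2 f u.
    have [[u su]|nS] := pselect (exists u, P u).
      have [_ h _] : P (u_sol s Omega A2 f) := xgetPex (fun=> 0) (ex_intro P u su).
      exact: tu h.
    have -> : u_sol s Omega A2 f = (fun=> 0) by apply: xgetPN => u su; apply: nS; exists u.
    by apply/(tildeHsP s01 n0); split; exact: HU0.
  rewrite /DN uE; exact: (B_form_sympart s01 n0 LA1 LA2 E tU tg).
have eO x : exterior Omega x -> ~ Omega x by move=> h Ox; apply: h; exact: subset_closure.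
have eN : exterior Omega !=set0 by have [x hx] := W10; exists x; exact: W1e.
have [A21 _] := ad1; have [A22 _] := ad2.
have [rho [crho rgt Gr]] := gauge_real n0 A21 A22 eN G.
have [c1 [c2 [r1 [r2 [r10 r20 s1 s2 c12]]]]] := disjoint_cubes n0 oW1 W10 oW2 W20.
have cz0 := cz_gt0 n s01.
have [nu1 [M1 k1]] := KA_kernel cz0 LA1 A21.
have [nu2 [M2 k2]] := KA_kernel cz0 LA2 A22.
have [B [nu [M [nu0 mB Bnu BM KB]]]] := ext_kernel n0 LA1 ad1 eN.
have e1 x : cube c1 (2 * r1) x -> exterior Omega x by move=> /s1/W1e.
have e2 x : cube c2 (2 * r2) x -> exterior Omega x by move=> /s2/W2e.
have c1O x : cube c1 (2 * r1) x -> ~ Omega x by move=> /e1/eO.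
have c2O x : cube c2 (2 * r2) x -> ~ Omega x by move=> /e2/eO.
have form c r : (forall x, cube c (2 * r) x -> exterior Omega x) -> ext_form (s := s) c r (KA s (sympart A1)).
  move=> h; exists (@cz R n s), B, nu, M; split => //; first by rewrite gt_eqF.
  by split => //; apply: filterS KB => z hz /h /hz.
have r0 : forall x, rho x = 0.
  apply: (gauge_trivial s01 oO bO k1 k2 crho rgt _ r10 r20 c1O c2O c12 (form _ _ e1) (form _ _ e2)).
    move=> z; exact: (KA_gauge (g := fun x => 1 + rho x)).
  move=> f cf; have cfT := Ccr_sub (@subsetT _ _) cf; have hf := HU_Ccr s01 cfT.
  have d1 x : cube c1 r1 x -> ~ Omega x by move=> /(cube_double r10)/c1O.
  have [u1 [h1 f1 sol1 D1]] := real_solution s01 n0 LA1 A21 bO r10 d1 hf.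
  have [u2 [h2 f2 sol2 D2]] := real_solution s01 n0 LA2 A22 bO r10 d1 hf.
  exists u1, u2; split; [exact: h1|exact: h2|exact: f1|exact: f2|split; [exact: sol1|exact: sol2|move=> g cg]].
  have cc (W : set 'rV[R]_n) (c : 'rV[R]_n) r h : 0 < r -> cube c (2 * r) `<=` W -> Ccr (cube c r) h -> Cc_infty W (rc h).
    move=> r00 sW ch; apply/CcrP; split; last exact: Ccr0.
    by apply: Ccr_sub ch => x /(cube_double r00)/sW.
  have hg : HU s setT g by apply: HU_Ccr => //; exact: Ccr_sub (@subsetT _ _) cg.
  (* Real data and real tests are enough, so only real parts of the DN pairings are compared. *)
  have e := congr1 (@complex.Re R) (DNe _ (cc W1 _ _ _ r10 s1 cf) _ (cc W2 _ _ _ r20 s2 cg)).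
  exact: (eq_trans (esym (D1 g hg)) (eq_trans e (D2 g hg))).
by move=> x y; rewrite Gr !r0 addr0 mul1r scale1r.
Qed.
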